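(* Let $\alpha,\beta>0$, $1\le p,q\le\infty$, let $w$ be a submultiplicative weight and $v$ a $w$-moderate weight on $\mathbb{R}^d$, and let $g,\gamma\in W_{\mathbb{H}}(L^\infty,L^1_w)$. For $n\in\mathbb{Z}^d$ put $G_n(x)=\sum_{k\in\mathbb{Z}^d}T_{\alpha k}\gamma(x)\odot T_{\alpha k+\frac n\beta}g(x)\in B(\mathbb{H})$, and for $l,n\in\mathbb{Z}^d$ put $$[\gamma,M_{\frac l\alpha}T_{\frac n\beta}g]:=\int_{\mathbb{R}^d}\gamma(x)\odot M_{\frac l\alpha}T_{\frac n\beta}g(x)\,dx\in B(\mathbb{H}).$$ Then for each $n$ the $l$-th Fourier coefficient $\alpha^{-d}\int_{Q_\alpha}G_n(x)e^{-2\pi i\langle l,x/\alpha\rangle}dx$ of $G_n$ equals $\alpha^{-d}[\gamma,M_{\frac l\alpha}T_{\frac n\beta}g]$, and the Fourier series $$G_n(x)=\alpha^{-d}\sum_{l\in\mathbb{Z}^d}[\gamma,M_{\frac l\alpha}T_{\frac n\beta}g]\,e^{2\pi i\langle l,x/\alpha\rangle}$$ converges in $L^2(Q_\alpha,B(\mathbb{H}))$. Consequently (Janssen's representation), for $f\in W_{\mathbb{H}}(L^p,L^q_v)$ the frame operator $S_{g,\gamma}$ satisfies $$S_{g,\gamma}f=\beta^{-d}\sum_{n\in\mathbb{Z}^d}G_n\bigl(T_{\frac n\beta}f\bigr)=(\alpha\beta)^{-d}\sum_{n\in\mathbb{Z}^d}\sum_{l\in\mathbb{Z}^d}[\gamma,M_{\frac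 l\alpha}T_{\frac n\beta}g]\bigl(M_{\frac l\alpha}T_{\frac n\beta}f\bigr),$$ where for each $n$ the inner sum over $l$ is understood as the function $x\mapsto\bigl(\sum_l[\gamma,M_{\frac l\alpha}T_{\frac n\beta}g]e^{2\pi i\langle l,x/\alpha\rangle}\bigr)\bigl(f(x-\tfrac n\beta)\bigr)$, the operator-valued Fourier series being taken in the sense of convergence in $L^2(Q_\alpha,B(\mathbb{H}))$ and extended periodically.
   Context: $\mathbb{H}$ is a separable complex Hilbert space and $B(\mathbb{H})$ its bounded linear operators. For $x,y\in\mathbb{H}$, $(x\odot y)(z)=\langle z,y\rangle x$. $T_af(x)=f(x-a)$, $M_bf(x)=e^{2\pi i\langle b,x\rangle}f(x)$. $Q_\alpha=[0,\alpha)^d$. $(G_n(T_{n/\beta}f))(x)=G_n(x)(f(x-n/\beta))$. Weights: a weight is a continuous function $w:\mathbb{R}^d\to(0,\infty)$ with $w(x)=w(-x)$; submultiplicative means $w(x+y)\le w(x)w(y)$; $v$ is $w$-moderate if $v(x+y)\le C_vw(x)v(y)$ for some $C_v>0$ and all $x,y$. $W_{\mathbb{H}}(L^p,L^q_v)$ is the Banach space of measurable $f:\mathbb{R}^d\to\mathbb{H}$ with $\|f\|=\bigl(\sum_{k\in\mathbb{Z}^d}\|f\cdot T_{\alpha k}\chi_{Q_\alpha}\|_{L^p(\mathbb{R}^d,\mathbb{H})}^qv(\alpha k)^q\bigr)^{1/q}<\infty$ (usual modification for $q=\infty$). The pairing is $\langle f,g\rangle=\int_{\mathbb{R}^d}\langle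 f(x),g(x)\rangle_{\mathbb{H}}dx$. Frame operator: formally $S_{g,\gamma}f=\sum_{k,n\in\mathbb{Z}^d}\langle f,M_{\beta n}T_{\alpha k}g\rangle M_{\beta n}T_{\alpha k}\gamma$. On $W_{\mathbb{H}}(L^p,L^q_v)$ it is defined as $S_{g,\gamma}=R_{\gamma,h}C_{g,h}$ for any unit vector $h\in\mathbb{H}$, where: $C_{g,h}f=(\langle f,M_{\beta n}T_{\alpha k}g\rangle h)_{k,n}$; there are unique $m_k\in L^p(Q_{1/\beta},\mathbb{H})$, extended $1/\beta$-periodically, whose Fourier coefficients $\beta^d\int_{Q_{1/\beta}}e^{-2\pi i\beta\langle n,t\rangle}m_k(t)dt$ equal $\langle f,M_{\beta n}T_{\alpha k}g\rangle h$; and $R_{\gamma,h}C_{g,h}f=\sum_k\langle m_k(\cdot),h\rangle_{\mathbb{H}}T_{\alpha k}\gamma$ (unconditionally convergent in norm, or in $\sigma(W_{\mathbb{H}}(L^p,L^q_v),W_{\mathbb{H}}(L^{p'},L^{q'}_{1/v}))$ if $p=\infty$ or $q=\infty$). *)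

(* Defs.v *)
From HB Require Import structures.
From mathcomp Require Import all_boot all_order all_algebra finmap.
From mathcomp Require Import all_classical all_reals all_analysis.
From mathcomp Require Import complex.
From mathcomp.analysis.showcase Require summability.

Set Implicit Arguments.
Unset Strict Implicit.
Unset Printing Implicit Defensive.

Import Order.TTheory GRing.Theory Num.Def Num.Theory.
Import numFieldNormedType.Exports.

Local Open Scope classical_set_scope.
Local Open Scope complex_scope.
Local Open Scope ring_scope.

HB.mixin Record isHilbert (R : realType) H & CompleteNormedModule R[i] H := {
  inner : {dot H for @Num.conj R[i]} ;
  inner_norm : forall x : H, inner x x = `|x| ^+ 2 }.

#[short(type="hilbertType")]
HB.structure Definition Hilbert (R : realType) :=
  {H of CompleteNormedModule R[i] H & isHilbert R H}.

(* The norm of a normedModType R[i] takes its values in R[i]. *)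
Definition rnorm {R : realType} {E : normedModType R[i]} (x : E) : R :=
  complex.Re `|x|.

Section rnorm_lemmas.
Context {R : realType} {E : normedModType R[i]}.
Implicit Types x y : E.

Lemma rnormE x : (rnorm x)%:C = `|x|.
Proof. by rewrite RRe_real// normr_real. Qed.

Lemma rnorm_ge0 x : 0 <= rnorm x.
Proof. by rewrite -ler0c rnormE. Qed.

Lemma ler_rnormD x y : rnorm (x + y) <= rnorm x + rnorm y.
Proof. by rewrite -lecR rmorphD/= !rnormE ler_normD. Qed.

Lemma rnorm_le1 x : (rnorm x <= 1) = (`|x| <= 1).
Proof. by rewrite -rnormE -lecR. Qed.

End rnorm_lemmas.

Section bounded_operators.
Context {R : realType} {E : normedModType R[i]}.

Definition is_bounded_op : {pred E -> E} :=
  [pred A | `[< linear A /\ continuous A >]].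

Record bounded_op := BoundedOp {
  bounded_op_fun :> E -> E ;
  _ : bounded_op_fun \in is_bounded_op }.

HB.instance Definition _ := [isSub for bounded_op_fun].
HB.instance Definition _ := [Choice of bounded_op by <:].

Lemma is_bounded_op_submod_closed : submod_closed is_bounded_op.
Proof.
split=> [|a A B /asboolP[lA cA] /asboolP[lB cB]]; apply/asboolP; split.
- by move=> b x y; rewrite /= scaler0 addr0.
- exact: cst_continuous.
- move=> b x y /=.
  have -> : (a *: A + B) (b *: x + y) = a *: A (b *: x + y) + B (b *: x + y) by [].
  rewrite lA lB scalerDr addrACA; congr +%R.
  by rewrite [RHS]scalerDr !scalerA mulrC.
- move=> x; apply: cvgD; last exact: cB.
  by apply: cvgZr; exact: cA.
Qed.

HB.instance Definition _ := GRing.isSubmodClosed.Build _ _ is_bounded_op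
  is_bounded_op_submod_closed.
HB.instance Definition _ := [SubChoice_isSubLmodule of bounded_op by <:].

Definition op_norm (A : bounded_op) : R :=
  sup [set rnorm (A x) | x in [set x : E | rnorm x <= 1]].


Implicit Types (A B : bounded_op) (x : E).

Lemma bounded_op_linear A : linear A.
Proof. by case: A => A /= /asboolP[]. Qed.

Lemma bounded_op_continuous A : continuous A.
Proof. by case: A => A /= /asboolP[]. Qed.

HB.instance Definition _ A := GRing.isLinear.Build _ _ _ _
  (bounded_op_fun A) (bounded_op_linear A).

Lemma bounded_opP A B : A =1 B -> A = B.
Proof. by move=> AB; apply/val_inj/funext. Qed.

Lemma has_sup_op_norm A :
  has_sup [set rnorm (A x) | x in [set x : E | rnorm x <= 1]].
Proof.
split; first by exists (rnorm (A 0)), 0 => //=; rewrite rnorm_le1 normr0.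
have /linear_boundedP : bounded_near A (nbhs (0 : E)).
  exact/linear_bounded_continuous/bounded_op_continuous.
move=> /pinfty_ex_gt0[M M0 AM]; exists (complex.Re M) => _ [x x1 <-].
rewrite /= rnorm_le1 in x1.
have MR : (complex.Re M)%:C = M by rewrite RRe_real// gtr0_real.
rewrite -lecR rnormE MR (le_trans (AM x))//.
by rewrite -[leRHS]mulr1 ler_wpM2l// ltW.
Qed.

Lemma le_op_norm A x : rnorm x <= 1 -> rnorm (A x) <= op_norm A.
Proof.
by move=> x1; apply: sup_ubound; [have [] := has_sup_op_norm A|exists x].
Qed.

Lemma op_norm_ge0 A : 0 <= op_norm A.
Proof.
apply: (le_trans (rnorm_ge0 (A 0))); apply: le_op_norm.
by rewrite rnorm_le1 normr0.
Qed.

Lemma op_norm_le A M : (forall x, rnorm x <= 1 -> rnorm (A x) <= M) ->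
  op_norm A <= M.
Proof.
move=> AM; apply: ge_sup; first by have [] := has_sup_op_norm A.
by move=> _ [x x1 <-]; exact: AM.
Qed.

Lemma op_normZ_le (a : R[i]) A : op_norm (a *: A) <= rnorm (a : R[i]^o) * op_norm A.
Proof.
apply: op_norm_le => x x1; rewrite [(a *: A) x]/(a *: A x).
rewrite -lecR rmorphM/= !rnormE normrZ ler_wpM2l//.
by rewrite -rnormE lecR le_op_norm.
Qed.

Let normC A : R[i] := (op_norm A)%:C.

Let normC_ler_normD A B : normC (A + B) <= normC A + normC B.
Proof.
rewrite /normC -rmorphD/= lecR; apply: op_norm_le => x x1.
rewrite [(A + B) x]/(A x + B x) (le_trans (ler_rnormD _ _))//.
by rewrite lerD// le_op_norm.
Qed.

Let normC_normrZ (a : R[i]) A : normC (a *: A) = `|a| * normC A.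
Proof.
rewrite /normC -(@rnormE _ R[i]^o) -rmorphM/=; congr _%:C.
apply/eqP; rewrite eq_le op_normZ_le/=.
have [->|a0] := eqVneq a 0.
  by rewrite /rnorm normr0 mul0r op_norm_ge0.
have na0 : 0 < rnorm (a : R[i]^o) by rewrite -ltcR rnormE normr_gt0.
rewrite -ler_pdivlMl//.
have := op_normZ_le a^-1 (a *: A); rewrite scalerA mulVf// scale1r.
suff -> : rnorm (a^-1 : R[i]^o) = (rnorm (a : R[i]^o))^-1 by [].
apply: (@complexI R); rewrite fmorphV/= !rnormE; exact: normfV.
Qed.

Let normC_eq0 A : normC A = 0 -> A = 0.
Proof.
move=> /(congr1 (@complex.Re R))/= A0; apply: bounded_opP => x.
have [->|x0] := eqVneq x 0; first by rewrite !linear0.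
have nx0 : `|x| != 0 by rewrite normr_eq0.
have Ax : A (`|x|^-1 *: x) = 0.
  apply/normr0_eq0/eqP; rewrite eq_le normr_ge0 andbT -(rnormE (A _)).
  rewrite -[leRHS]/((0 : R)%:C) lecR -A0 le_op_norm//.
  by rewrite rnorm_le1 normrZ normfV normr_id mulVf.
apply: (@scalerI _ _ `|x|^-1); first by rewrite invr_neq0.
by rewrite scaler0 -[RHS]Ax [RHS]linearZ.
Qed.

HB.instance Definition _ := Lmodule_isNormed.Build R[i] bounded_op
  normC_ler_normD normC_normrZ normC_eq0.

End bounded_operators.
Arguments bounded_op {R} E.

Section rank_one.
Context {R : realType} {H : hilbertType R}.
Implicit Types x y z : H.

Lemma inner_CauchySchwarz x y : `|inner x y| <= `|x| * `|y|.
Proof.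
have [->|y0] := eqVneq y 0; first by rewrite linear0r normr0 mulr_ge0.
have yy0 : 0 < `|y| ^+ 2 by rewrite exprn_gt0// normr_gt0.
pose c := inner x y / `|y| ^+ 2.
have : 0 <= inner (x - c *: y) (x - c *: y) by exact: dnorm_ge0.
have nR : (`|y| ^+ 2)^*%R = `|y| ^+ 2 by rewrite conj_Creal// rpredX// normr_real.
have dE : inner x (c *: y) = `|inner x y| ^+ 2 / `|y| ^+ 2.
  by rewrite linearZr_LR/= /c rmorphM/= fmorphV/= nR normCK mulrAC [X in X / _]mulrC.
have dJ : (inner x (c *: y))^*%R = inner x (c *: y).
  by rewrite dE rmorphM/= fmorphV/= nR rmorphXn/= conj_normC.
have cE : `|c| ^+ 2 * `|y| ^+ 2 = `|inner x y| ^+ 2 / `|y| ^+ 2.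
  rewrite /c normrM normfV (ger0_norm (ltW yy0)) exprMn exprVn -mulrA.
  by congr (_ * _); rewrite expr2 invfM mulfVK// gt_eqF.
rewrite dnormB dnormZ/= dJ !inner_norm cE dE opprD addrA addrK subr_ge0.
rewrite ler_pdivrMr// -exprMn.
by rewrite ler_pXn2r// nnegrE ?mulr_ge0.
Qed.

Lemma rank_one_bounded x y : (fun z => inner z y *: x) \in is_bounded_op.
Proof.
apply/asboolP.
have lin : linear (fun z => inner z y *: x).
  by move=> a u v; rewrite linearPl/= scalerDl scalerA.
split=> //.
pose f : {linear H -> H} := HB.pack (fun z => inner z y *: x)
  (GRing.isLinear.Build _ _ _ _ _ lin).
apply: (@bounded_linear_continuous _ _ _ f); apply/linear_boundedP.
near=> r => z; rewrite /= normrZ.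
apply: (@le_trans _ _ (`|z| * `|y| * `|x|)).
  by apply: ler_wpM2r => //; exact: inner_CauchySchwarz.
rewrite -mulrA mulrC; apply: ler_wpM2r => //.
Unshelve. all: by end_near. Qed.

(* x \odot y *)
Definition rank_one x y : bounded_op H := BoundedOp (rank_one_bounded x y).

End rank_one.

(* Row vectors carry the product sigma-algebra generated by the coordinates, as
   tuples do; on 'rV[R]_n this is the Borel sigma-algebra of R^n. *)
Definition measure_rV_display : measure_display -> measure_display.
Proof. exact. Qed.

Section measurable_rV.
Context {disp} {T : sigmaRingType disp}.
Variable n : nat.

Let coors : 'I_n -> 'rV[T]_n -> T := fun i x => x ord0 i.

Let rV_set0 : g_sigma_preimage coors set0.
Proof. exact: sigma_algebra0. Qed.

Let rV_setC A : g_sigma_preimage coors A -> g_sigma_preimage coors (~` A).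
Proof. exact: sigma_algebraC. Qed.

Let rV_bigcup (F : _^nat) : (forall i, g_sigma_preimage coors (F i)) ->
  g_sigma_preimage coors (\bigcup_i (F i)).
Proof. exact: sigma_algebra_bigcup. Qed.

HB.instance Definition _ := @isMeasurable.Build (measure_rV_display disp)
  'rV[T]_n (g_sigma_preimage coors) rV_set0 rV_setC rV_bigcup.

Lemma measurable_coord_rV (i : 'I_n) :
  measurable_fun [set: 'rV[T]_n] (fun x : 'rV[T]_n => x ord0 i).
Proof.
move=> _ Y mY; rewrite setTI; apply: sub_sigma_algebra => /=.
rewrite -bigcup_seq/=; exists i => /=; first by rewrite mem_index_enum.
by exists Y => //; rewrite setTI.
Qed.

End measurable_rV.

Section measurable_fun_rV.
Context d1 d2 (T1 : measurableType d1) (T2 : measurableType d2).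

Lemma measurable_fun_coord_rV n (f : T1 -> 'rV[T2]_n) :
  (forall i, measurable_fun [set: T1] (fun x => f x ord0 i)) ->
  measurable_fun [set: T1] f.
Proof.
move=> mf _ A mA; rewrite setTI.
have : <<s preimage_set_system setT f
    (\big[setU/set0]_(i < n) preimage_set_system setT
       (fun x : 'rV[T2]_n => x ord0 i) measurable) >> (f @^-1` A).
  rewrite g_sigma_preimageE; exists A => //; by rewrite setTI.
apply: smallest_sub; first exact: sigma_algebra_measurable.
move=> _ [B + <-]; rewrite setTI -bigcup_seq => -[i _ [C mC <-]].
by rewrite setTI; have := mf i measurableT C mC; rewrite setTI.
Qed.

End measurable_fun_rV.

Section lebesgue_rV.
Context {R : realType}.

Section cons_measure.
Variables (n : nat) (mu : {sigma_finite_measure set 'rV[R]_n -> \bar R}).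

Let cons (u : R * 'rV[R]_n) : 'rV[R]_n.+1 := row_mx u.1%:M u.2.

Let measurable_cons : measurable_fun [set: R * 'rV[R]_n] cons.
Proof.
apply: measurable_fun_coord_rV => i.
have [j ->|j ->] := split_ordP (i : 'I_(1 + n)).
  rewrite (_ : (fun _ => _) = fst)//; apply/funext => u /=.
  by rewrite /cons [LHS]row_mxEl !ord1 mxE eqxx mulr1n.
rewrite (_ : (fun _ => _) = (fun x : 'rV[R]_n => x ord0 j) \o snd).
  by apply: measurableT_comp => //; exact: measurable_coord_rV.
by apply/funext => u /=; rewrite /cons [LHS]row_mxEr.
Qed.

Definition rV_cons_measure := pushforward (lebesgue_measure \x mu)%E cons.


Let rV_cons_measure0 : rV_cons_measure set0 = 0%E.
Proof. by rewrite /rV_cons_measure /pushforward preimage_set0 measure0. Qed.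

Let rV_cons_measure_ge0 A : (0 <= rV_cons_measure A)%E.
Proof. exact: measure_ge0. Qed.

Let rV_cons_measure_sigma_additive : semi_sigma_additive rV_cons_measure.
Proof.
move=> F mF tF mUF; rewrite /rV_cons_measure /pushforward preimage_bigcup.
apply: measure_semi_sigma_additive.
- by move=> i; rewrite -[X in measurable X]setTI; exact: measurable_cons.
- apply/trivIsetP => /= i j _ _ ij; rewrite -preimage_setI.
  by move/trivIsetP : tF => /(_ _ _ _ _ ij) ->//; rewrite preimage_set0.
- rewrite -preimage_bigcup -[X in measurable X]setTI.
  exact: measurable_cons.
Qed.

HB.instance Definition _ := isMeasure.Build _ _ _ rV_cons_measure
  rV_cons_measure0 rV_cons_measure_ge0 rV_cons_measure_sigma_additive.

Let uncons (x : 'rV[R]_n.+1) : R * 'rV[R]_n :=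
  (x ord0 ord0, rsubmx (x : 'rV[R]_(1 + n))).

Let consK : cancel cons uncons.
Proof.
move=> [a y]; rewrite /uncons /cons row_mxKr; congr pair.
have -> : (ord0 : 'I_n.+1) = lshift n (ord0 : 'I_1) by exact/val_inj.
by rewrite [LHS]row_mxEl mxE eqxx mulr1n.
Qed.

Let measurable_uncons : measurable_fun [set: 'rV[R]_n.+1] uncons.
Proof.
apply/measurable_fun_pair; first exact: measurable_coord_rV.
apply: measurable_fun_coord_rV => i.
rewrite (_ : (fun _ => _) = fun x : 'rV[R]_n.+1 => x ord0 (rshift 1 i)).
  exact: measurable_coord_rV.
by apply/funext => x; rewrite mxE.
Qed.

Let rV_cons_measure_sigma_finite : sigma_finite setT rV_cons_measure.
Proof.
have /sigma_finiteP[F [FT ndF Foo]] := sigma_finiteT (@lebesgue_measure R).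
have /sigma_finiteP[G [GT ndG Goo]] := sigma_finiteT mu.
exists (fun i => uncons @^-1` (F i `*` G i)) => [|i].
  rewrite -preimage_bigcup (_ : \bigcup_i _ = setT) ?preimage_setT//.
  apply/seteqP; split => // -[x y] _.
  have [n0 _ Fx] : (\bigcup_i F i) x by rewrite -FT.
  have [n1 _ Gy] : (\bigcup_i G i) y by rewrite -GT.
  exists (maxn n0 n1) => //; split => /=.
    by move: x Fx; exact/subsetPset/ndF/leq_maxl.
  by move: y Gy; exact/subsetPset/ndG/leq_maxr.
have [mFi Fioo] := Foo i; have [mGi Gioo] := Goo i; split.
  rewrite -[X in measurable X]setTI; apply: measurable_uncons => //.
  exact: measurableX.
rewrite /rV_cons_measure /pushforward -comp_preimage.
rewrite (_ : uncons \o cons = id); last by apply/funext => u /=; rewrite consK.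
by rewrite preimage_id product_measure1E// lte_mul_pinfty// ge0_fin_numE.
Qed.

HB.instance Definition _ := Measure_isSigmaFinite.Build _ _ _ rV_cons_measure
  rV_cons_measure_sigma_finite.

End cons_measure.

Fixpoint lebesgue_rV (n : nat) : {sigma_finite_measure set 'rV[R]_n -> \bar R} :=
  match n with
  | 0 => \d_(0 : 'rV[R]_0)
  | m.+1 => rV_cons_measure (lebesgue_rV m)
  end.

End lebesgue_rV.

Section Bochner.
Context {disp} {T : measurableType disp} {R : realType} {E : normedModType R[i]}.
Variable mu : {measure set T -> \bar R}.
Implicit Types (D : set T) (f s : T -> E) (p : \bar R).

(* for separable E this coincides with strong measurability *)
Definition borel_fun f := forall U : set E, open U -> measurable (f @^-1` U).

Definition bochner_simple s :=
  [/\ finite_set (range s),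
      forall y, measurable (s @^-1` [set y]) &
      forall y, y != 0 -> (mu (s @^-1` [set y]) < +oo)%E].

(* the value y = 0 contributes 0 even when its fibre has infinite measure *)
Definition simple_integral s : E :=
  \sum_(y \in range s) (fine (mu (s @^-1` [set y])))%:C *: y.

Definition strongly_measurable f := exists s : nat -> T -> E,
  (forall n, bochner_simple (s n)) /\
  {ae mu, forall x, s n x @[n --> \oo] --> f x}.

Definition has_bochner_integral f (I : E) := exists s : nat -> T -> E,
  [/\ forall n, bochner_simple (s n),
      {ae mu, forall x, s n x @[n --> \oo] --> f x},
      (\int[mu]_x (rnorm (f x - s n x))%:E)%E @[n --> \oo] --> 0%E &
      simple_integral (s n) @[n --> \oo] --> I].

Definition cutoff D f : T -> E := fun x => (\1_D x : R)%:C *: f x.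

Definition bochner D f : E :=
  xget 0 [set I | has_bochner_integral (cutoff D f) I].

Definition Lp_norm D p f : \bar R :=
  Lnorm mu p (fun x => (rnorm (cutoff D f x))%:E).

Definition in_Lp D p f :=
  strongly_measurable (cutoff D f) /\ (Lp_norm D p f < +oo)%E.

(* Sums over an infinite index set I have no preferred order: they are limits
   of the net of partial sums over the finite subsets of I. *)
Definition Lp_cvg {I : choiceType} D p (u : {fset I} -> T -> E) f :=
  in_Lp D p f /\
  Lp_norm D p (fun x => u A x - f x) @[A --> summability.totally] --> 0%E.

End Bochner.

Definition lq_norm {R : realType} {I : choiceType} (q : \bar R)
    (a : I -> \bar R) : \bar R :=
  match q with
  | r%:E => ((\esum_(k in [set: I]) (a k `^ r)) `^ r^-1)%E
  | +oo%E => ereal_sup (range a)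
  | -oo%E => 0%E
  end.

Section time_frequency.
Context {R : realType} {d : nat}.
Local Notation Rd := 'rV[R]_d.
Local Notation Zd := 'rV[int]_d.

Definition rV_of_int (k : Zd) : Rd := map_mx intr k.

Definition dotp (x y : Rd) : R := \sum_i x ord0 i * y ord0 i.

Definition cis2pi (t : R) : R[i] := cos (2 * pi * t) +i* sin (2 * pi * t).

Definition translate {V : Type} (a : Rd) (f : Rd -> V) : Rd -> V :=
  fun x => f (x - a).

Definition modulate {V : lmodType R[i]} (b : Rd) (f : Rd -> V) : Rd -> V :=
  fun x => cis2pi (dotp b x) *: f x.

Definition cube (a : R) : set Rd := [set x | forall i, 0 <= x ord0 i < a].

Definition periodic {V : Type} (a : R) (f : Rd -> V) :=
  forall (x : Rd) (k : Zd), f (x + a *: rV_of_int k) = f x.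

Definition weight (w : Rd -> R) :=
  [/\ continuous w, forall x, 0 < w x & forall x, w (- x) = w x].

Definition submultiplicative (w : Rd -> R) :=
  forall x y, w (x + y) <= w x * w y.

Definition moderate (w v : Rd -> R) :=
  exists2 C : R, 0 < C & forall x y, v (x + y) <= C * w x * v y.

Section Fourier.
Context {E : normedModType R[i]}.

Definition fourier_coef (a : R) (F : Rd -> E) (l : Zd) : E :=
  (a ^- d)%:C *: bochner (lebesgue_rV d) (cube a)
    (fun x => cis2pi (- dotp (rV_of_int l) (a^-1 *: x)) *: F x).

Definition fourier_sum (a : R) (c : Zd -> E) (A : {fset Zd}) : Rd -> E :=
  fun x => summability.partial_sum
    (fun l => cis2pi (dotp (rV_of_int l) (a^-1 *: x)) *: c l) A.

Definition fourier_series_L2 (a : R) (c : Zd -> E) (F : Rd -> E) :=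
  Lp_cvg (lebesgue_rV d) (cube a) 2%:E (fourier_sum a c) F.

(* the L^2(cube a, E)-sum, extended periodically; it is unique up to null sets *)
Definition fourier_L2_sum (a : R) (c : Zd -> E) : Rd -> E :=
  xget (fun=> 0) [set F | periodic a F /\ fourier_series_L2 a c F].

(* the function m_k behind synthesis_op; it is unique up to null sets *)
Definition fourier_fun (a : R) (p : \bar R) (c : Zd -> E) : Rd -> E :=
  xget (fun=> 0) [set m | [/\ periodic a m,
    in_Lp (lebesgue_rV d) (cube a) p m &
    forall n, fourier_coef a m n = c n]].

End Fourier.
End time_frequency.

Section gabor.
Context {R : realType} {d : nat} {H : hilbertType R}.
Local Notation Rd := 'rV[R]_d.
Local Notation Zd := 'rV[int]_d.
Implicit Types (a : R) (p q : \bar R) (v : Rd -> R) (f g : Rd -> H).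

(* W_H(L^p, L^q_v) *)
Definition amalgam_norm a p q v f : \bar R :=
  lq_norm q (fun k : Zd =>
    (Lnorm (lebesgue_rV d) p (fun x =>
       (rnorm (f x) * translate (a *: rV_of_int k) \1_(cube a) x)%:E)
     * (v (a *: rV_of_int k))%:E)%E).

Definition amalgam a p q v f :=
  borel_fun f /\ (amalgam_norm a p q v f < +oo)%E.

Definition pairing f g : R[i] :=
  bochner (lebesgue_rV d) setT (fun x => inner (f x) (g x) : R[i]^o).

Definition amalgam_cvg {I : choiceType} a p q v (u : {fset I} -> Rd -> H) f :=
  amalgam a p q v f /\
  amalgam_norm a p q v (fun x => u A x - f x)
    @[A --> summability.totally] --> 0%E.

(* convergence in sigma(W_H(L^p, L^q_v), W_H(L^p', L^q'_(1/v))) *)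
Definition amalgam_weak_cvg {I : choiceType} a p q v
    (u : {fset I} -> Rd -> H) f :=
  amalgam a p q v f /\
  forall phi, amalgam a (hoelder_conjugate p) (hoelder_conjugate q)
                (fun x => (v x)^-1) phi ->
    (pairing (u A) phi : R[i]^o) @[A --> summability.totally] -->
    (pairing f phi : R[i]^o).

Definition gabor_atom a (b : R) g (k n : Zd) : Rd -> H :=
  modulate (b *: rV_of_int n) (translate (a *: rV_of_int k) g).

Definition analysis_op a (b : R) g (h : H) f (k n : Zd) : H :=
  pairing f (gabor_atom a b g k n) *: h.

(* R_(gamma, h) c = \sum_k <m_k(.), h> T_(a k) gamma, where the 1/b-periodic m_k
   has Fourier coefficients c k; the limit is chosen in the topology in which
   the series is defined, and is unique up to null sets *)
Definition synthesis_op a (b : R) p q v gamma (h : H) (c : Zd -> Zd -> H) :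
    Rd -> H :=
  let m k := fourier_fun b^-1 p (c k) in
  let series (A : {fset Zd}) (x : Rd) := summability.partial_sum
    (fun k => inner (m k x) h *: translate (a *: rV_of_int k) gamma x) A in
  xget (fun=> 0) [set F | if (p == +oo%E) || (q == +oo%E)
    then amalgam_weak_cvg a p q v series F
    else amalgam_cvg a p q v series F].

Definition frame_op a (b : R) p q v g gamma (h : H) f : Rd -> H :=
  synthesis_op a b p q v gamma h (analysis_op a b g h f).

(* G_n; the series is taken in operator norm *)
Definition walnut_coef a (b : R) g gamma (n : Zd) : Rd -> bounded_op H :=
  fun x => summability.sum (fun k : Zd =>
    rank_one (translate (a *: rV_of_int k) gamma x)
      (translate (a *: rV_of_int k + b^-1 *: rV_of_int n) g x)).

(* [f, g] = \int f(x) \odot g(x) dx *)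
Definition op_bracket f g : bounded_op H :=
  bochner (lebesgue_rV d) setT (fun x => rank_one (f x) (g x)).

Definition apply_op (G : Rd -> bounded_op H) f : Rd -> H := fun x => G x (f x).

End gabor.

(* Main.v *)
Require Import Defs.
From HB Require Import structures.
From mathcomp Require Import all_boot all_order all_algebra finmap.
From mathcomp Require Import all_classical all_reals all_analysis measurable_realfun ess_sup_inf.
From mathcomp Require Import complex ring lra.
From mathcomp.analysis.showcase Require summability.
Set Implicit Arguments.
Unset Strict Implicit.
Unset Printing Implicit Defensive.
Import Order.TTheory GRing.Theory Num.Def Num.Theory.
Import numFieldNormedType.Exports.
Local Open Scope classical_set_scope.
Local Open Scope complex_scope.
Local Open Scope ring_scope.

(** Let [u = |g|] and [t = |gamma|]. Submultiplicativity of [w] gives Walnut's estimate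
    [sum_n w(n/beta) sup_x sum_k t(x - alpha k) u(x - alpha k - n/beta) < oo], so for [f] in the
    amalgam space the double series
    [sum_(k,n) <f(x - n/beta), g(x - alpha k - n/beta)> gamma(x - alpha k)]
    converges absolutely almost everywhere, with a majorant in the amalgam space.
    Summed over [k] first it is the Walnut series [sum_n G_n(x) f(x - n/beta)]. Summed over [n]
    first, it involves the periodizations [sum_n psi_k(x - n/beta)] of
    [psi_k = <f, T_(alpha k) g>], whose Fourier coefficients are
    [beta^d <f, M_(beta n) T_(alpha k) g>]; by uniqueness of Fourier coefficients this is
    [beta^d] times the series defining the frame operator. Norm convergence follows by dominated
    convergence, weak convergence from the pairing of the majorant with a test function.

    [G_n] is the [alpha]-periodization of [gamma(x) \odot g(x - n/beta)], which gives its
    Fourier coefficients. It is bounded in Hilbert-Schmidt norm, because a rank-one operator has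
    equal operator and Hilbert-Schmidt norms; so its Fourier series converges in L^2 by Parseval
    in each matrix entry and domination over the entries. Completeness of the characters is
    reduced to half-spaces, whose indicators are limits of [(1 - P^n)^(n 2^n)] for a trigonometric
    polynomial [P] with values in [[0, 1]]. *)

(** * Integrals and p-norms of extended-real functions, unordered sums *)

(** Two obstacles shape the proof. First, Bochner integrals, the multipliers [m_k], operator-valued
    Fourier sums and the frame operator are all obtained by choice among the objects with a defining
    property. Each of them needs an explicit candidate and a proof that the property fixes it,
    almost everywhere if it is a function. Identities between vector integrals are tested on bounded
    real-linear functionals, where Lebesgue theory applies; real and imaginary parts of inner
    products supply enough of these for scalars, vectors and operators. Second, [B(H)] is in general
    neither separable nor a Hilbert space. Measurability of [G_n] is therefore inherited from simple
    approximations of [gamma] and [g], and Parseval is recovered through matrix entries. Sums over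
    lattices are unordered while dominated convergence is sequential, so every sum is carried with a
    majorant whose tails bound the error for all finite index sets at once. Half-spaces suffice for
    completeness because coordinate rays generate the sigma-algebra of [R^d]. *)

Section ae_integral.
Local Open Scope ereal_scope.
Context d (T : measurableType d) (R : realType).
Variable mu : {measure set T -> \bar R}.
Import HBNNSimple.

(** Covers non-measurable integrands too: the integral is a supremum over simple functions, and
    cutting one below [f] by the complement of the null set puts it below [g] without changing its
    integral. *)
Lemma ge0_ae_le_integral (f g : T -> \bar R) : (forall x, 0 <= f x) ->
  (forall x, 0 <= g x) -> {ae mu, forall x, f x <= g x} ->
  \int[mu]_x f x <= \int[mu]_x g x.
Proof.
move=> f0 g0 [N [mN N0 fgN]].
rewrite !ge0_integralTE//; apply: ge_ereal_sup => _ [h /= hf <-].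
apply: ereal_sup_ubound; exists (proj_nnsfun h (measurableC mN)).
  move=> x /=; rewrite mindicE.
  case: (boolP (x \in ~` N)); last by rewrite mulr0.
  rewrite inE mulr1 => /= Nx; apply: (le_trans (hf x)).
  by apply: contrapT => fg; apply: Nx; exact: fgN.
rewrite -!integralT_nnsfun; apply: ae_eq_integral => //.
- by apply/measurable_EFinP.
- by apply/measurable_EFinP.
exists N; split=> // x /= /not_implyP[_] /=; rewrite mindicE.
case: (boolP (x \in ~` N)); last by rewrite notin_setE /= => /contrapT.
by rewrite mulr1.
Qed.

Lemma ge0_ae_eq_integralT (f g : T -> \bar R) : (forall x, 0 <= f x) ->
  (forall x, 0 <= g x) -> {ae mu, forall x, f x = g x} ->
  \int[mu]_x f x = \int[mu]_x g x.
Proof.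
move=> f0 g0 fg; apply/eqP; rewrite eq_le; apply/andP; split;
  apply: ge0_ae_le_integral => //; apply: filterS fg => x -> //.
Qed.

Lemma ae_eq_integralT (f g : T -> \bar R) : {ae mu, forall x, f x = g x} ->
  \int[mu]_x f x = \int[mu]_x g x.
Proof.
move=> fg; rewrite integralE [RHS]integralE; congr (_ - _);
  apply: ge0_ae_eq_integralT => //; by apply: filterS fg => x; rewrite ?funeposE ?funenegE => ->.
Qed.

End ae_integral.

Section Lnorm_nonneg.
Local Open Scope ereal_scope.
Context d (T : measurableType d) (R : realType).
Variable mu : {measure set T -> \bar R}.
Implicit Types (f g : T -> \bar R) (p : \bar R).

Lemma le_poweR (r : R) (x y : \bar R) : (0 <= r)%R -> 0 <= x -> x <= y ->
  x `^ r <= y `^ r.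
Proof.
move=> r0 x0 xy; apply: gt0_ler_poweR => //; rewrite in_itv/= ?leey ?andbT//.
exact: le_trans xy.
Qed.

Lemma ge1_real p : 1 <= p -> p = +oo \/ exists2 r : R, (1 <= r)%R & p = r%:E.
Proof. by case: p => [r||]//; [right; exists r|left]. Qed.

Lemma Lnorm_ae_le p f g : 1 <= p ->
  {ae mu, forall x, `|f x| <= `|g x|} -> 'N[mu]_p[f] <= 'N[mu]_p[g].
Proof.
move=> /ge1_real[->|[r r1 ->]] fg; rewrite unlock.
  by case: ifPn => // _; exact: le_ess_sup.
have r0 : (0 <= r)%R by apply: le_trans r1.
apply: le_poweR; rewrite ?invr_ge0//; first by apply: integral_ge0 => x _; exact: poweR_ge0.
apply: ge0_ae_le_integral => [x|x|]; [exact: poweR_ge0..|].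
by apply: filterS fg => x; apply: le_poweR.
Qed.

Lemma Lnorm_ae_eq p f g : 1 <= p ->
  {ae mu, forall x, f x = g x} -> 'N[mu]_p[f] = 'N[mu]_p[g].
Proof.
move=> p1 fg; apply/eqP; rewrite eq_le; apply/andP; split; apply: Lnorm_ae_le => //;
  by apply: filterS fg => x ->.
Qed.

Lemma Lnorm_le p f g : 1 <= p ->
  (forall x, `|f x| <= `|g x|) -> 'N[mu]_p[f] <= 'N[mu]_p[g].
Proof. by move=> p1 fg; apply: Lnorm_ae_le => //; exact: aeW. Qed.

Lemma Lnorm_ge0_le p f g : 1 <= p -> (forall x, 0 <= f x) ->
  (forall x, f x <= g x) -> 'N[mu]_p[f] <= 'N[mu]_p[g].
Proof.
move=> p1 f0 fg; apply: Lnorm_le => // x; rewrite !gee0_abs//.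
exact: le_trans (fg x).
Qed.

Lemma Lnorm_lty_ae p f : 1 <= p -> measurable_fun setT f -> 'N[mu]_p[f] < +oo ->
  {ae mu, forall x, `|f x| < +oo}.
Proof.
move=> /ge1_real[->|[r r1 ->]] mf; rewrite unlock.
  case: ifPn => [m0|]; last first.
    rewrite -leNgt => m0 _; apply: measure0_ae; apply/eqP; rewrite eq_le m0/=.
    exact: measure_ge0.
  by move=> foo; apply: filterS (ess_sup_ge mu (abse \o f)) => x /= /le_lt_trans; apply.
have r0 : (0 < r)%R by apply: lt_le_trans r1.
move=> h.
have hi : \int[mu]_x `|f x| `^ r < +oo.
  rewrite ltey; apply/eqP => hoo; move: h; rewrite hoo poweRyr ?ltxx//.
  by rewrite invr_eq0 gt_eqF.
have : mu.-integrable setT (fun x => `|f x| `^ r).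
  apply/integrableP; split.
    by apply: (measurableT_comp (measurable_poweR _)); exact: measurableT_comp.
  by under eq_integral do rewrite (gee0_abs (poweR_ge0 _ _)).
move=> /integrable_ae => /(_ measurableT); apply: filterS => x /(_ Logic.I).
case: (`|f x|) (abse_ge0 (f x)) => //=; first by move=> *; rewrite ltry.
by rewrite gt_eqF.
Qed.

(** Values may be infinite. If both norms are finite, the functions are finite almost everywhere and
    real Minkowski applies to their finite parts; otherwise the right-hand side is infinite. *)
Lemma LnormD p f g : 1 <= p -> (forall x, 0 <= f x) -> (forall x, 0 <= g x) ->
  measurable_fun setT f -> measurable_fun setT g ->
  'N[mu]_p[(fun x => f x + g x)] <= 'N[mu]_p[f] + 'N[mu]_p[g].
Proof.
move=> p1 f0 g0 mf mg.
have [->|foo] := eqVneq 'N[mu]_p[f] +oo.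
  by rewrite addye ?leey// -ltNye (lt_le_trans _ (Lnorm_ge0 _ _ _)).
have [->|goo] := eqVneq 'N[mu]_p[g] +oo.
  by rewrite addey ?leey// -ltNye (lt_le_trans _ (Lnorm_ge0 _ _ _)).
have ff := Lnorm_lty_ae p1 mf; rewrite ltey in ff; have {}ff := ff foo.
have gg := Lnorm_lty_ae p1 mg; rewrite ltey in gg; have {}gg := gg goo.
have fE : {ae mu, forall x, f x = (EFin \o (fine \o f)) x}.
  apply: filterS ff => x; rewrite gee0_abs// => fx /=; rewrite fineK//.
  by rewrite ge0_fin_numE.
have gE : {ae mu, forall x, g x = (EFin \o (fine \o g)) x}.
  apply: filterS gg => x; rewrite gee0_abs// => fx /=; rewrite fineK//.
  by rewrite ge0_fin_numE.
rewrite (Lnorm_ae_eq p1 fE) (Lnorm_ae_eq p1 gE).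
rewrite [leLHS](_ : _ = 'N[mu]_p[EFin \o ((fine \o f) \+ (fine \o g))%R]).
  by apply: eminkowski => //; exact: measurableT_comp.
apply: Lnorm_ae_eq => //; apply: filterS2 fE gE => x fx gx.
by rewrite [in LHS]fx [in LHS]gx.
Qed.

Lemma Lnorm_sum p (F : nat -> T -> \bar R) n : 1 <= p -> (forall i x, 0 <= F i x) ->
  (forall i, measurable_fun setT (F i)) ->
  'N[mu]_p[(fun x => \sum_(i < n) F i x)] <= \sum_(i < n) 'N[mu]_p[F i].
Proof.
move=> p1 F0 mF; elim: n => [|n ih].
  rewrite big_ord0 (_ : (fun _ => _) = cst 0) ?Lnorm0//; last first.
    by apply/funext => x; rewrite big_ord0.
  by apply/eqP => p0; rewrite p0 in p1; move: p1; rewrite lee_fin ler10.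
rewrite big_ord_recr/= (_ : (fun _ => _) = (fun x => \sum_(i < n) F i x + F n x)).
  apply: le_trans (leeD2r _ ih); apply: LnormD => //.
    by move=> x; apply: sume_ge0.
  exact: emeasurable_sum.
by apply/funext => x; rewrite big_ord_recr.
Qed.

(** The Fatou property of the norm: monotone convergence of the powers for a finite exponent, a
    countable union of null sets for [p = +oo]. *)
Lemma Lnorm_nd_lim p (F : nat -> T -> \bar R) (c : \bar R) : 1 <= p ->
  (forall i x, 0 <= F i x) -> (forall i, measurable_fun setT (F i)) ->
  (forall x, {homo F ^~ x : n m / (n <= m)%N >-> n <= m}) ->
  (forall n, 'N[mu]_p[F n] <= c) -> 'N[mu]_p[(fun x => limn (F ^~ x))] <= c.
Proof.
move=> p1 F0 mF ndF Fc.
have cF x : cvgn (F ^~ x) by apply: ereal_nondecreasing_is_cvgn => n m; exact: ndF.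
have l0 x : 0 <= limn (F ^~ x) by apply: lime_ge => //; near=> n.
move: p1 Fc => /ge1_real[->|[r r1 ->]] Fc; move: Fc; rewrite unlock.
  case: ifPn => // m0 Fc; last exact: (Fc 0%N).
  apply/ess_supP.
  have : {ae mu, forall x, forall n, `|F n x| <= c}.
    by apply: ae_foralln => n; exact/ess_supP/Fc.
  apply: filterS => x Fx /=; rewrite gee0_abs//; apply: lime_le => //.
  by near=> n; rewrite -[leLHS]gee0_abs.
move=> Fc; have r0 : (0 < r)%R by apply: lt_le_trans r1.
have c0 : 0 <= c by apply: le_trans (Fc 0%N); exact: poweR_ge0.
have [->|coo] := eqVneq c +oo; first by rewrite leey.
have Fc' n : \int[mu]_x `|F n x| `^ r <= c `^ r.
  have := le_poweR (ltW r0) (poweR_ge0 _ _) (Fc n).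
  rewrite -poweRrM mulVf ?gt_eqF// poweRe1//.
  by apply: integral_ge0 => x _; exact: poweR_ge0.
have powK (y : \bar R) : 0 <= y -> (y `^ r) `^ r^-1 = y.
  by move=> y0; rewrite -poweRrM mulfV ?poweRe1// gt_eqF.
have powVK (y : \bar R) : 0 <= y -> (y `^ r^-1) `^ r = y.
  by move=> y0; rewrite -poweRrM mulVf ?poweRe1// gt_eqF.
have ri : (0 <= r^-1)%R by rewrite invr_ge0 ltW.
suff : \int[mu]_x `|limn (F ^~ x)| `^ r <= c `^ r.
  move=> /(le_poweR ri); rewrite powK//; apply.
  by apply: integral_ge0 => x _; exact: poweR_ge0.
have mp n : measurable_fun setT (fun x => `|F n x| `^ r).
  by apply: (measurableT_comp (measurable_poweR _)); exact: measurableT_comp.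
have ndp x : {homo (fun n => `|F n x| `^ r) : n m / (n <= m)%N >-> n <= m}.
  by move=> n m nm; apply: le_poweR => //; [exact: ltW|rewrite !gee0_abs// ndF].
have cp x : cvgn (fun n => `|F n x| `^ r).
  by apply: ereal_nondecreasing_is_cvgn => n m; exact: ndp.
apply: (@le_trans _ _ (\int[mu]_x limn (fun n => `|F n x| `^ r))).
  apply: ge0_ae_le_integral => [x|x|]; first exact: poweR_ge0.
    by apply: lime_ge => //; near=> n; exact: poweR_ge0.
  apply: aeW => x; set L := limn (fun n => `|F n x| `^ r).
  have L0 : 0 <= L by apply: lime_ge; [exact: cp|near=> n; exact: poweR_ge0].
  rewrite -[leRHS]powVK//; apply: le_poweR => //; first exact: ltW.
  rewrite gee0_abs//; apply: lime_le => //; near=> n.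
  rewrite -[leLHS]powK//; apply: le_poweR => //; first exact: poweR_ge0.
  have := @nondecreasing_cvgn_le R.
  move=> _; rewrite /L (cvg_lim _ (ereal_nondecreasing_cvgn _))//.
  by apply: ereal_sup_ubound; exists n => //; rewrite gee0_abs.
rewrite monotone_convergence//.
  apply: lime_le; last by near=> n.
  apply: ereal_nondecreasing_is_cvgn => n m nm.
  apply: ge0_le_integral => // [x _|x _]; first exact: poweR_ge0.
  exact: ndp.
by move=> n x _; exact: poweR_ge0.
Unshelve. all: by end_near. Qed.

Lemma Lnorm_nneseries p (F : nat -> T -> \bar R) : 1 <= p -> (forall i x, 0 <= F i x) ->
  (forall i, measurable_fun setT (F i)) ->
  'N[mu]_p[(fun x => \sum_(i <oo) F i x)] <= \sum_(i <oo) 'N[mu]_p[F i].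
Proof.
move=> p1 F0 mF; apply: (@Lnorm_nd_lim p (fun n x => \sum_(0 <= i < n) F i x)) => //.
- by move=> i x; apply: sume_ge0.
- by move=> i; apply: emeasurable_sum.
- by move=> x n m nm; exact: lee_sum_nneg_natr.
move=> n; under eq_Lnorm do rewrite big_mkord; apply: le_trans (Lnorm_sum _ _ _ _) _ => //.
rewrite -(big_mkord xpredT (fun i => 'N[mu]_p[F i])).
by apply: nneseries_lim_ge => i _ _; exact: Lnorm_ge0.
Qed.

Lemma LnormZl p f (c : R) : 1 <= p -> (0 <= c)%R -> measurable_fun setT f ->
  'N[mu]_p[(fun x => c%:E * f x)] = c%:E * 'N[mu]_p[f].
Proof.
move=> /ge1_real[->|[r r1 ->]] c0 mf; rewrite unlock.
  case: ifPn => [m0|]; last by rewrite mule0.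
  rewrite -ess_supZl//; apply: eq_ess_sup; apply: aeW => x /=.
  by rewrite abseM gee0_abs.
have r0 : (0 < r)%R by apply: lt_le_trans r1.
under eq_integral do rewrite abseM gee0_abs ?lee_fin// poweRM ?lee_fin//.
rewrite ge0_integralZl//; last 3 first.
- by apply: (measurableT_comp (measurable_poweR _)); exact: measurableT_comp.
- by move=> x _; exact: poweR_ge0.
- exact: poweR_ge0.
rewrite poweRM; last 2 first.
- exact: poweR_ge0.
- by apply: integral_ge0 => x _; exact: poweR_ge0.
by rewrite -poweRrM mulfV ?poweRe1// gt_eqF.
Qed.

Lemma cvge_poweR0 (u : nat -> \bar R) (r : R) : (0 < r)%R -> (forall n, 0 <= u n) ->
  u @ \oo --> 0 -> (u n `^ r) @[n --> \oo] --> 0.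
Proof.
move=> r0 u0 uu; apply/fine_cvgP; split.
  move/fine_cvgP: uu => [+ _]; apply: filterS => n un; exact: fin_num_poweR.
move/fine_cvgP: uu => [uf uu]; apply/cvgrPdist_lt => e e0.
have e1 : (0 < e `^ r^-1)%R by rewrite powR_gt0.
move/cvgrPdist_lt: uu => /(_ _ e1) uu; near=> n.
have unf : u n \is a fin_num by near: n.
have : (`|0 - fine (u n)| < e `^ r^-1)%R by near: n.
rewrite !sub0r !normrN => h.
rewrite /= fine_poweR ger0_norm ?powR_ge0//.
have -> : e = ((e `^ r^-1) `^ r)%R by rewrite -powRrM mulVf ?powRr1 ?gt_eqF// ltW.
rewrite gt0_ltr_powR// ?nnegrE ?powR_ge0 ?fine_ge0//.
by rewrite ger0_norm ?fine_ge0 in h.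
Unshelve. all: by end_near. Qed.

Lemma Lnorm_dct (r : R) (F : nat -> T -> \bar R) (g : T -> \bar R) : (1 <= r)%R ->
  (forall n x, 0 <= F n x) -> (forall n, measurable_fun setT (F n)) ->
  measurable_fun setT g -> 'N[mu]_r%:E[g] < +oo ->
  (forall n x, F n x <= `|g x|) ->
  {ae mu, forall x, F ^~ x @ \oo --> 0} ->
  'N[mu]_r%:E[F n] @[n --> \oo] --> 0.
Proof.
move=> r1 F0 mF mg gfin Fg Fcvg.
have r0 : (0 < r)%R by apply: lt_le_trans r1.
rewrite unlock; apply: cvge_poweR0; first by rewrite invr_gt0.
  by move=> n; apply: integral_ge0 => x _; exact: poweR_ge0.
have mp f : measurable_fun setT f -> measurable_fun setT (fun x : T => `|f x| `^ r).
  by move=> mf; apply: (measurableT_comp (measurable_poweR _)); exact: measurableT_comp.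
have := @dominated_convergence _ T R mu setT measurableT
  (fun n x => `|F n x| `^ r) (cst 0) (fun x => `|g x| `^ r).
case=> //.
- by move=> n; exact: mp.
- apply: filterS Fcvg => x Fx _ /=; apply: cvge_poweR0 => //.
  by under eq_fun do rewrite gee0_abs//.
- apply/integrableP; split; first exact: mp.
  under eq_integral do rewrite (gee0_abs (poweR_ge0 _ _)).
  rewrite unlock in gfin; rewrite ltey; apply/eqP => hoo; move: gfin.
  by rewrite hoo poweRyr ?ltxx// invr_eq0 gt_eqF.
- apply: aeW => x n _; rewrite (gee0_abs (poweR_ge0 _ _)); apply: le_poweR => //.
    exact: ltW.
  by rewrite gee0_abs.
by move=> _ _; rewrite integral0.
Qed.

Lemma Lnorm_hoelder p f g : 1 <= p -> (forall x, 0 <= f x) -> (forall x, 0 <= g x) ->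
  measurable_fun setT f -> measurable_fun setT g ->
  'N[mu]_p[f] < +oo -> 'N[mu]_(hoelder_conjugate p)[g] < +oo ->
  \int[mu]_x (f x * g x) <= 'N[mu]_p[f] * 'N[mu]_(hoelder_conjugate p)[g].
Proof.
(* The endpoint pair [(+oo, 1)]; the case [p = 1] uses it with the two functions exchanged. *)
have hy f' g' : (forall x, 0 <= f' x) -> (forall x, 0 <= g' x) ->
   measurable_fun setT f' -> measurable_fun setT g' -> 'N[mu]_+oo[f'] < +oo ->
   \int[mu]_x (f' x * g' x) <= 'N[mu]_+oo[f'] * 'N[mu]_1[g'].
  move=> f0 g0 mf mg; rewrite Lnorm1 unlock.
  case: ifPn => [m0 _|]; last first.
    rewrite -leNgt => m0 _; rewrite mul0e.
    rewrite (@ge0_ae_eq_integralT _ _ _ _ _ (cst 0)) ?integral0// => [x|].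
      exact: mule_ge0.
    apply: measure0_ae; apply/eqP; rewrite eq_le m0/=; exact: measure_ge0.
  under [X in _ <= _ * X]eq_integral do rewrite gee0_abs//.
  rewrite -ge0_integralZl//; last first.
    by apply: ess_sup_gee => //; apply: aeW => x /=.
  apply: ge0_ae_le_integral => [x|x|].
  - exact: mule_ge0.
  - by apply: mule_ge0 => //; apply: ess_sup_gee => //; apply: aeW => y /=.
  apply: filterS (ess_sup_ge mu (abse \o f')) => x /= fx.
  by apply: lee_wpmul2r => //; rewrite -(gee0_abs (f0 x)).
move=> p1 f0 g0 mf mg foo goo; case/ge1_real: p1 foo goo => [->|[r r1 ->]].
  by rewrite hoelder_conjugatey => foo _; exact: hy.
have [->|rn1] := eqVneq r 1%R.
  rewrite hoelder_conjugate1 => foo goo; under eq_integral do rewrite muleC.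
  by rewrite muleC; exact: hy.
have rg1 : (1 < r)%R by rewrite lt_neqAle eq_sym rn1.
have r0 : (0 < r)%R by apply: lt_trans rg1.
have rE : hoelder_conjugate r%:E = (r / (r - 1))%:E.
  rewrite /hoelder_conjugate/= eqe gt_eqF// -EFinD inver subr_eq0 (negbTE rn1).
  by rewrite -EFinM.
rewrite rE => foo goo.
have q1 : (1 <= r / (r - 1))%R by rewrite ler_pdivlMr ?subr_gt0// mul1r gerBl.
have ff := Lnorm_lty_ae (r1 : 1 <= r%:E) mf foo.
have gg := Lnorm_lty_ae (q1 : 1 <= (r / (r - 1))%:E) mg goo.
have fE : {ae mu, forall x, f x = (EFin \o (fine \o f)) x}.
  apply: filterS ff => x; rewrite gee0_abs// => fx /=; rewrite fineK//.
  by rewrite ge0_fin_numE.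
have gE : {ae mu, forall x, g x = (EFin \o (fine \o g)) x}.
  apply: filterS gg => x; rewrite gee0_abs// => fx /=; rewrite fineK//.
  by rewrite ge0_fin_numE.
rewrite (Lnorm_ae_eq (r1 : 1 <= r%:E) fE) (Lnorm_ae_eq (q1 : 1 <= (r / (r - 1))%:E) gE).
have := @hoelder _ _ _ mu (fine \o f) (fine \o g) r (r / (r - 1))%R.
rewrite Lnorm1 => /(_ _ _ r0 _ _) h; apply: le_trans (h _ _ _ _).
- apply: ge0_ae_le_integral => [x|x//|]; first exact: mule_ge0.
  apply: filterS2 fE gE => x fx gx /=; rewrite [in leLHS]fx [in leLHS]gx.
  by rewrite -EFinM lee_abs.
- exact: measurableT_comp.
- exact: measurableT_comp.
- by apply: lt_le_trans q1.
- rewrite invf_div; field.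
  by rewrite gt_eqF// subr_eq0 rn1.
Qed.

End Lnorm_nonneg.

Section esum_countable.
Local Open Scope ereal_scope.
Context (R : realType) (I : countType).
Implicit Types a b : I -> \bar R.

(** Transports a countable family to [nat] along its encoding, padded with zeros, so that series and
    integrals against the counting measure become available. *)
Definition ext a (n : nat) : \bar R := oapp a 0 (pickle_inv n).

Lemma ext_pickle a i : ext a (choice.pickle i) = a i.
Proof. by rewrite /ext pickleK_inv. Qed.

Lemma ext_ge0 a n : (forall i, 0 <= a i) -> 0 <= ext a n.
Proof. by move=> a0; rewrite /ext; case: pickle_inv => /=. Qed.

Lemma esum_ext a : (forall i, 0 <= a i) ->
  \esum_(i in [set: I]) a i = \sum_(n <oo) ext a n.
Proof.
move=> a0; rewrite nneseries_esumT; last by move=> n; exact: ext_ge0.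
have := @reindex_esum R I nat setT (range (@choice.pickle I)) (@choice.pickle I) (ext a).
rewrite (eq_esum (fun i _ => ext_pickle a i)) => <-.
  rewrite esum_mkcond; apply: eq_esum => n _.
  case: ifPn => //; rewrite notin_setE /= => nn.
  rewrite /ext; case: (pickle_inv n) (@pickle_invK I n) => //= i ni.
  by exfalso; apply: nn; exists i.
by split => //; apply: in2W; exact: (pcan_inj pickleK_inv).
Qed.

Lemma esum_ge0T a : (forall i, 0 <= a i) -> 0 <= \esum_(i in [set: I]) a i.
Proof. by move=> a0; apply: esum_ge0 => i _. Qed.

Lemma le_esumT a b : (forall i, a i <= b i) ->
  \esum_(i in [set: I]) a i <= \esum_(i in [set: I]) b i.
Proof. by move=> ab; apply: le_esum => i _. Qed.

Lemma esum_term a i : (forall i, 0 <= a i) -> a i <= \esum_(i in [set: I]) a i.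
Proof.
move=> a0; apply: esum_ge; exists [set i]; last by rewrite fsbig_set1.
by split=> //; exact: finite_set1.
Qed.

Lemma esumZl (c : \bar R) a : 0 <= c -> (forall i, 0 <= a i) ->
  \esum_(i in [set: I]) (c * a i) = c * \esum_(i in [set: I]) a i.
Proof.
move=> c0 a0; rewrite !esum_ext//; last by move=> i; exact: mule_ge0.
rewrite -!ge0_integral_count; last 2 first.
- by move=> n; exact: ext_ge0.
- by move=> n; apply: ext_ge0 => i; exact: mule_ge0.
rewrite -ge0_integralZl//; last by move=> n _; exact: ext_ge0.
by apply: eq_integral => n _; rewrite /ext; case: pickle_inv => //=; rewrite mule0.
Qed.

Context d (T : measurableType d).
Variable mu : {measure set T -> \bar R}.

Lemma measurable_ext (F : I -> T -> \bar R) n :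
  (forall i, measurable_fun setT (F i)) ->
  measurable_fun setT (fun x => ext (F ^~ x) n).
Proof.
by move=> mF; rewrite /ext; case: pickle_inv => [i|] /=; [exact: mF|exact: measurable_cst].
Qed.

Lemma measurable_esum (F : I -> T -> \bar R) :
  (forall i x, 0 <= F i x) -> (forall i, measurable_fun setT (F i)) ->
  measurable_fun setT (fun x => \esum_(i in [set: I]) F i x).
Proof.
move=> F0 mF; rewrite (_ : (fun _ => _) = fun x => \sum_(n <oo) ext (F ^~ x) n).
  by apply: ge0_emeasurable_sum => [n x _ _|n _]; [exact: ext_ge0|exact: measurable_ext].
by apply/funext => x; exact: esum_ext.
Qed.

Lemma integral_esum (F : I -> T -> \bar R) :
  (forall i x, 0 <= F i x) -> (forall i, measurable_fun setT (F i)) ->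
  \int[mu]_x (\esum_(i in [set: I]) F i x) = \esum_(i in [set: I]) \int[mu]_x F i x.
Proof.
move=> F0 mF; under eq_integral do rewrite esum_ext//.
rewrite integral_nneseries//; last 2 first.
- by move=> n; exact: measurable_ext.
- by move=> n x _; exact: ext_ge0.
rewrite esum_ext; last by move=> i; apply: integral_ge0 => x _.
apply: eq_eseriesr => n _; rewrite /ext; case: pickle_inv => //=.
by rewrite integral0.
Qed.

Lemma Lnorm_esum p (F : I -> T -> \bar R) : 1 <= p ->
  (forall i x, 0 <= F i x) -> (forall i, measurable_fun setT (F i)) ->
  'N[mu]_p[(fun x => \esum_(i in [set: I]) F i x)] <= \esum_(i in [set: I]) 'N[mu]_p[F i].
Proof.
move=> p1 F0 mF; under eq_Lnorm do rewrite esum_ext//.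
apply: le_trans (Lnorm_nneseries _ _ _ _) _ => //.
- by move=> n x; exact: ext_ge0.
- by move=> n; exact: measurable_ext.
rewrite esum_ext; last by move=> i; exact: Lnorm_ge0.
apply: lee_nneseries => n _; first by move=> _; exact: Lnorm_ge0.
rewrite /ext; case: pickle_inv => //=.
by rewrite Lnorm0// gt_eqF// (lt_le_trans _ p1).
Qed.

End esum_countable.

Section lq.
Local Open Scope ereal_scope.
Context (R : realType) (I : countType).
Variable i0 : I.
Implicit Types (a b : I -> \bar R) (q : \bar R).

Lemma counting_ge1 (A : set nat) n : A n -> 1 <= (@counting nat R) A.
Proof.
move=> An; rewrite counting_dirac.
apply: (@le_trans _ _ (\sum_(0 <= k < n.+1) \d_k A)).
  by rewrite big_nat_recr//= diracE mem_set// leeDr// sume_ge0.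
by apply: nneseries_lim_ge => k _ _.
Qed.

Lemma ae_counting (P : nat -> Prop) : {ae (@counting nat R), forall n, P n} -> forall n, P n.
Proof.
move=> [A [mA A0 PA]] n; apply: contrapT => Pn.
have : A n by exact: PA.
by move=> /counting_ge1; rewrite A0 lee_fin ler10.
Qed.

(** Makes Minkowski, Hoelder and dominated convergence for [lq_norm] instances of those for [Lnorm].
    The point [i0] matters for [q = +oo]: the supremum over an empty family would be [-oo], not the
    value 0 of the padding. *)
Lemma lq_normE q a : 1 <= q -> (forall i, 0 <= a i) ->
  lq_norm q a = 'N[counting]_q[ext a].
Proof.
move=> /ge1_real[->|[r r1 ->]] a0.
  have cT : 0 < (@counting nat R) setT.
    by apply: lt_le_trans (@counting_ge1 setT 0%N _).
  rewrite unlock cT /=; apply/eqP; rewrite eq_le; apply/andP; split.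
    apply: ge_ereal_sup => _ [i _ <-]; rewrite -(ext_pickle a i).
    have := ae_counting (ess_sup_ge (@counting nat R) (abse \o ext a)).
    by move=> /(_ (choice.pickle i)) /=; rewrite gee0_abs// ext_ge0.
  apply/ess_supP; apply: aeW => n /=; rewrite gee0_abs ?ext_ge0//.
  rewrite /ext; case: pickle_inv => [i|] /=.
    by apply: ereal_sup_ubound; exists i.
  by apply: le_trans (a0 i0) _; apply: ereal_sup_ubound; exists i0.
have r0 : (0 < r)%R by apply: lt_le_trans r1.
rewrite Lnorm_counting//=; congr (_ `^ _).
rewrite esum_ext; last by move=> i; exact: poweR_ge0.
apply: eq_eseriesr => n _; rewrite /ext; case: pickle_inv => [i|] /=.
  by rewrite gee0_abs.
by rewrite normr0 powR0// gt_eqF.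
Qed.

Lemma lq_norm_ge0 q a : 1 <= q -> (forall i, 0 <= a i) -> 0 <= lq_norm q a.
Proof. by move=> q1 a0; rewrite lq_normE// Lnorm_ge0. Qed.

Lemma le_lq_norm q a b : 1 <= q -> (forall i, 0 <= a i) -> (forall i, a i <= b i) ->
  lq_norm q a <= lq_norm q b.
Proof.
move=> q1 a0 ab; have b0 i : 0 <= b i by apply: le_trans (ab i).
rewrite !lq_normE//; apply: Lnorm_ge0_le => // n; first exact: ext_ge0.
by rewrite /ext; case: pickle_inv => /=.
Qed.

Lemma lq_norm_term q a i : 1 <= q -> (forall i, 0 <= a i) -> a i <= lq_norm q a.
Proof.
move=> /ge1_real[->|[r r1 ->]] a0 /=; first by apply: ereal_sup_ubound; exists i.
have r0 : (0 < r)%R by apply: lt_le_trans r1.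
rewrite -[leLHS]poweRe1// -(mulfV (lt0r_neq0 r0)) poweRrM.
apply: le_poweR; [by rewrite invr_ge0 ltW|exact: poweR_ge0|].
by apply: (esum_term (a := fun i => a i `^ r)) => j; exact: poweR_ge0.
Qed.

Lemma lq_norm_esum (J : countType) q (F : J -> I -> \bar R) : 1 <= q ->
  (forall j i, 0 <= F j i) ->
  lq_norm q (fun i => \esum_(j in [set: J]) F j i) <= \esum_(j in [set: J]) lq_norm q (F j).
Proof.
move=> q1 F0; rewrite lq_normE//; last by move=> i; exact: esum_ge0T.
rewrite [leLHS](_ : _ = 'N[counting]_q[(fun n => \esum_(j in [set: J]) ext (F j) n)]).
  apply: le_trans (Lnorm_esum _ q1 _ _) _ => //; first by move=> j n; exact: ext_ge0.
  by apply: le_esumT => j; rewrite lq_normE.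
congr Lnorm; apply/funext => n; rewrite /ext; case: pickle_inv => //=.
by rewrite esum1.
Qed.

Lemma lq_normZl q (c : R) a : 1 <= q -> (0 <= c)%R -> (forall i, 0 <= a i) ->
  lq_norm q (fun i => c%:E * a i) = c%:E * lq_norm q a.
Proof.
move=> q1 c0 a0; rewrite !lq_normE//; last by move=> i; exact: mule_ge0.
rewrite -LnormZl//; congr Lnorm; apply/funext => n.
by rewrite /ext; case: pickle_inv => //=; rewrite mule0.
Qed.

Lemma lq_norm_dct (r : R) (F : nat -> I -> \bar R) (g : I -> \bar R) : (1 <= r)%R ->
  (forall n i, 0 <= F n i) -> (forall n i, F n i <= g i) -> lq_norm r%:E g < +oo ->
  (forall i, F ^~ i @ \oo --> 0) -> lq_norm r%:E (F n) @[n --> \oo] --> 0.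
Proof.
move=> r1 F0 Fg gfin Fc.
have g0 i : 0 <= g i by apply: le_trans (Fg 0%N i).
rewrite (_ : (fun n => _) = fun n => 'N[counting]_r%:E[ext (F n)]); last first.
  by apply/funext => n; rewrite lq_normE.
apply: (@Lnorm_dct _ _ _ _ _ _ (ext g)) => //.
- by move=> n k; exact: ext_ge0.
- by rewrite -lq_normE.
- move=> n k; rewrite gee0_abs ?ext_ge0//.
  by rewrite /ext; case: pickle_inv => /=.
apply: aeW => k; rewrite /ext; case: pickle_inv => [i|] /=; first exact: Fc.
exact: cvg_cst.
Qed.

Lemma lq_norm_hoelder q a b : 1 <= q -> (forall i, 0 <= a i) -> (forall i, 0 <= b i) ->
  lq_norm q a < +oo -> lq_norm (hoelder_conjugate q) b < +oo ->
  \esum_(i in [set: I]) (a i * b i) <= lq_norm q a * lq_norm (hoelder_conjugate q) b.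
Proof.
move=> q1 a0 b0 aoo boo; have q1' := hoelder_conj_ge1 q1.
rewrite !lq_normE// in aoo boo *; apply: le_trans (Lnorm_hoelder q1 _ _ _ _ _ _) => //.
- rewrite esum_ext; last by move=> i; exact: mule_ge0.
  rewrite ge0_integral_count; last first.
    by move=> n; apply: mule_ge0; exact: ext_ge0.
  apply: lee_nneseries => n _.
    by move=> _; apply: ext_ge0 => i; exact: mule_ge0.
  by rewrite /ext; case: pickle_inv => //=; rewrite mule0.
- by move=> n; exact: ext_ge0.
- by move=> n; exact: ext_ge0.
Qed.

Lemma lq_norm1 a : (forall i, 0 <= a i) -> lq_norm 1 a = \esum_(i in [set: I]) a i.
Proof.
move=> a0; rewrite /= invr1 poweRe1.
  by apply: eq_esum => i _; rewrite poweRe1.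
by apply: esum_ge0T => i; exact: poweR_ge0.
Qed.

Lemma esum_dct (F : nat -> I -> \bar R) (g : I -> \bar R) :
  (forall n i, 0 <= F n i) -> (forall n i, F n i <= g i) ->
  \esum_(i in [set: I]) g i < +oo -> (forall i, F ^~ i @ \oo --> 0) ->
  \esum_(i in [set: I]) F n i @[n --> \oo] --> 0.
Proof.
move=> F0 Fg gfin Fc.
have g0 i : 0 <= g i by apply: le_trans (Fg 0%N i).
under eq_fun do rewrite -lq_norm1//.
by apply: (@lq_norm_dct 1 F g) => //; rewrite lq_norm1.
Qed.

End lq.

Section cvg0.
Local Open Scope ereal_scope.
Context (R : realType).

Lemma ge0_cvge0P (S : Type) (F : set_system S) (FF : Filter F) (h : S -> \bar R) :
  (forall x, 0 <= h x) ->
  (h x @[x --> F] --> 0) <-> (forall e : R, (0 < e)%R -> \forall x \near F, h x <= e%:E).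
Proof.
move=> h0; split.
  move=> /fine_cvgP[hf /cvgrPdist_le hc] e e0; have := hc _ e0; move: hf.
  apply: filterS2 => x hx /=; rewrite sub0r normrN ger0_norm ?fine_ge0// => he.
  by rewrite -(fineK hx) lee_fin.
move=> H; apply/fine_cvgP; split.
  have := H 1%R ltr01; apply: filterS => x hx; rewrite ge0_fin_numE//.
  by apply: le_lt_trans hx _; rewrite ltry.
apply/cvgrPdist_le => e e0; have := H e e0; apply: filterS => x hx.
rewrite sub0r normrN /= ger0_norm ?fine_ge0// -lee_fin fineK//.
by rewrite ge0_fin_numE//; apply: le_lt_trans hx _; rewrite ltry.
Qed.

Context (I : countType).
Implicit Types A : {fset I}.

(** An exhausting sequence of finite sets: every finite set lies in some [seg n], which links
    sequences to the net of finite subsets. *)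
Definition seg n : {fset I} := [fset i | i in pmap pickle_inv (iota 0 n)]%fset.

Lemma in_seg n i : (i \in seg n) = (choice.pickle i < n)%N.
Proof.
rewrite /seg inE /= mem_pmap; apply/mapP/idP => [[k]|ik].
  rewrite mem_iota add0n /= => kn ki.
  by have := @pickle_invK I k; rewrite -ki /= => ->.
by exists (choice.pickle i); rewrite ?mem_iota ?pickleK_inv.
Qed.

(** Turns a sequential limit into a limit along the net, provided the bound at [n] holds for all
    supersets of [seg n]. Tails are monotone in the index set, so they meet this condition. *)
Lemma cvg_totally0 (h : {fset I} -> \bar R) (u : nat -> \bar R) :
  (forall A, 0 <= h A) -> (forall A n, fsubset (seg n) A -> h A <= u n) ->
  u @ \oo --> 0 -> h A @[A --> summability.totally] --> 0.
Proof.
move=> h0 hu uc; apply/(ge0_cvge0P (summability.totally_filter)) => // e e0.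
have u0 n : 0 <= u n by apply: le_trans (h0 (seg n)) (hu _ _ _).
have /(ge0_cvge0P _ u0)/(_ e e0)[n _ un] := uc.
exists (seg n) => // A /= nA; apply: le_trans (hu _ _ nA) _.
exact: (un n (leqnn n)).
Qed.

(** The tail outside [A], written as a full sum with masked terms so that comparison and dominated
    convergence work term by term. *)
Definition tl (a : I -> \bar R) A : \bar R :=
  \esum_(i in [set: I]) (if i \in A then 0 else a i).

Lemma tl_ge0 a A : (forall i, 0 <= a i) -> 0 <= tl a A.
Proof. by move=> a0; apply: esum_ge0T => i; case: ifP. Qed.

Lemma le_tl a A B : (forall i, 0 <= a i) -> fsubset A B -> tl a B <= tl a A.
Proof.
move=> a0 /fsubsetP AB; apply: le_esumT => i.
by case: ifPn => [iB|iB]; case: ifPn => // iA; rewrite (AB _ iA) in iB.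
Qed.

Lemma tl_le a A : (forall i, 0 <= a i) -> tl a A <= \esum_(i in [set: I]) a i.
Proof. by move=> a0; apply: le_esumT => i; case: ifP. Qed.

Lemma seg_ev i : \forall n \near \oo, i \in seg n.
Proof. by exists (choice.pickle i).+1 => // n /= ni; rewrite in_seg. Qed.

Lemma tl_seg_cvg a : (forall i, 0 <= a i) -> \esum_(i in [set: I]) a i < +oo ->
  tl a (seg n) @[n --> \oo] --> 0.
Proof.
move=> a0 afin.
have [I0|/set0P[i0 _]] := eqVneq [set: I] set0.
  by rewrite /tl I0; under eq_fun do rewrite esum_set0; exact: cvg_cst.
apply: (@esum_dct _ _ i0 _ a) => //.
- by move=> n i; case: ifP.
- by move=> n i; case: ifP.
move=> i; apply: cvg_near_cst; apply: filterS (seg_ev i) => n ->//.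
Qed.

Lemma tl_cvg a : (forall i, 0 <= a i) -> \esum_(i in [set: I]) a i < +oo ->
  tl a A @[A --> summability.totally] --> 0.
Proof.
move=> a0 afin; apply: (cvg_totally0 _ _ (tl_seg_cvg a0 afin)).
  by move=> A; exact: tl_ge0.
by move=> A n; exact: le_tl.
Qed.

Lemma esum_fset_tl a A : (forall i, 0 <= a i) ->
  \esum_(i in [set: I]) a i = \sum_(i <- A) a i + tl a A.
Proof.
move=> a0; rewrite (esumID [set` A])//; congr (_ + _).
  by rewrite setTI esum_fset// -fsbig_seq.
rewrite setTI /tl esum_mkcond; apply: eq_esum => i _.
by rewrite in_setC mem_setE; case: (i \in A).
Qed.

End cvg0.
Arguments seg {I} n.

(** * Lebesgue measure on R^d and its tiling by cubes *)

Section rV_measurability.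
Context {R : realType} {n : nat}.
Local Notation Rn := 'rV[R]_n.

Lemma measurable_addrV (y : Rn) : measurable_fun setT (fun x : Rn => x + y).
Proof.
apply: measurable_fun_coord_rV => i.
rewrite (_ : (fun _ => _) = (fun t => t + y ord0 i) \o (fun x : Rn => x ord0 i)).
  apply: measurableT_comp; last exact: measurable_coord_rV.
  by apply: measurable_funD => //; exact: measurable_cst.
by apply/funext => x /=; rewrite mxE.
Qed.

Lemma measurable_subrV (y : Rn) : measurable_fun setT (fun x : Rn => x - y).
Proof. exact: measurable_addrV. Qed.

Lemma measurable_cube (a : R) : measurable (@cube R n a).
Proof.
rewrite (_ : cube a = \bigcap_(i in [set: 'I_n]) [set x : Rn | 0 <= x ord0 i < a]).
  apply: fin_bigcap_measurable => // i _.
  have := @measurable_coord_rV _ R n i measurableT `[0, a[%classic (measurable_itv _).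
  rewrite setTI; congr measurable; apply/seteqP; split => x /=; by rewrite in_itv.
apply/seteqP; split => x /= h i; first by move=> _; exact: h.
exact: h.
Qed.

Lemma measurable_comp_addrV (y : Rn) (F : Rn -> \bar R) :
  measurable_fun setT F -> measurable_fun setT (fun x : Rn => F (x + y)).
Proof. by move=> mF; apply: (measurableT_comp mF); exact: measurable_addrV. Qed.

End rV_measurability.

Lemma measure_indic d (T : measurableType d) (R : realType)
  (mu : {measure set T -> \bar R}) (A : set T) : measurable A ->
  mu A = (\int[mu]_x (\1_A x)%:E)%E.
Proof. by move=> mA; rewrite integral_indic// setIT. Qed.

Lemma measurable_indicE d (T : measurableType d) (R : realType) (A : set T) :
  measurable A -> measurable_fun setT (fun x => (\1_A x : R)%:E).
Proof. by move=> mA; apply/measurable_EFinP; exact: measurable_indic. Qed.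

Section translation.
Context {R : realType}.
Local Open Scope ereal_scope.

Lemma measurable_add1 (y : R) :
  measurable_fun setT ((fun t => t + y)%R : measurableTypeR R -> measurableTypeR R).
Proof. by apply: measurable_funD => //; exact: measurable_cst. Qed.

Lemma lebesgue_measure_translate (y : R) (A : set R) : measurable A ->
  pushforward lebesgue_measure ((fun t => t + y)%R : measurableTypeR R -> measurableTypeR R) A
  = lebesgue_measure A.
Proof.
move=> mA; apply/esym.
have := @lebesgue_measure_unique R (pushforward lebesgue_measure
  ((fun t => t + y)%R : measurableTypeR R -> measurableTypeR R)).
move=> /(_ (measurable_add1 y)) h; apply: h => // X [[u v] /= _ <-].
rewrite /pushforward (_ : _ @^-1` _ = `]u - y, v - y]%classic)%R.
  rewrite !lebesgue_measure_itv/= !lte_fin ltrD2r.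
  by case: ifP => // _; rewrite -!EFinB; congr EFin; ring.
apply/seteqP; split => t /=; rewrite !in_itv/=; first by rewrite ltrBlDr lerBrDr.
by rewrite ltrBlDr lerBrDr.
Qed.

Lemma ge0_integral_translate1 (y : R) (F : R -> \bar R) :
  measurable_fun setT F -> (forall t, 0 <= F t) ->
  \int[lebesgue_measure]_t F (t + y)%R = \int[lebesgue_measure]_t F t.
Proof.
move=> mF F0.
have := @ge0_integral_pushforward _ _ (measurableTypeR R) (measurableTypeR R) R _
  (measurable_add1 y) lebesgue_measure setT F measurableT mF (fun t _ => F0 t).
rewrite preimage_setT => <-; apply: eq_measure_integral => [|m A mA _].
  exact: measurable_add1.
exact: lebesgue_measure_translate.
Qed.

Definition consrV n (u : R * 'rV[R]_n) : 'rV[R]_n.+1 := row_mx u.1%:M u.2.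

Lemma consrV0 n (u : R * 'rV[R]_n) : consrV u ord0 ord0 = u.1.
Proof.
rewrite /consrV (_ : (ord0 : 'I_n.+1) = lshift n (ord0 : 'I_1)); last exact/val_inj.
by rewrite [LHS]row_mxEl mxE eqxx mulr1n.
Qed.

Lemma consrVS n (u : R * 'rV[R]_n) (i : 'I_n) : consrV u ord0 (rshift 1 i) = u.2 ord0 i.
Proof. by rewrite [LHS]row_mxEr. Qed.

Lemma measurable_consrV n : measurable_fun [set: R * 'rV[R]_n] (@consrV n).
Proof.
apply: measurable_fun_coord_rV => i.
have [j ->|j ->] := split_ordP (i : 'I_(1 + n)).
  rewrite (_ : (fun _ => _) = fst)//; apply/funext => u /=.
  by rewrite /consrV [LHS]row_mxEl !ord1 mxE eqxx mulr1n.
rewrite (_ : (fun _ => _) = (fun x : 'rV[R]_n => x ord0 j) \o snd).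
  by apply: measurableT_comp => //; exact: measurable_coord_rV.
by apply/funext => u /=; rewrite /consrV [LHS]row_mxEr.
Qed.

(** Tonelli for the recursively defined measure, which is the push-forward of a product under
    [consrV]; it drives the inductions on the dimension. *)
Lemma ge0_integral_rVS n (F : 'rV[R]_n.+1 -> \bar R) :
  measurable_fun setT F -> (forall x, 0 <= F x) ->
  \int[lebesgue_rV n.+1]_x F x =
  \int[lebesgue_measure]_t \int[lebesgue_rV n]_u F (consrV (t, u)).
Proof.
move=> mF F0.
transitivity (\int[(lebesgue_measure \x lebesgue_rV n)]_z (F \o @consrV n) z).
  have h := @ge0_integral_pushforward _ _ (measurableTypeR R * 'rV[R]_n)%type _ R _
    (@measurable_consrV n)
    (lebesgue_measure \x lebesgue_rV n) setT F measurableT mF (fun t _ => F0 t).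
  etransitivity; last by move: h; rewrite preimage_setT; apply.
  by [].
rewrite fubini_tonelli1//; first by apply: (measurableT_comp mF); exact: measurable_consrV.
by move=> x; exact: F0.
Qed.

Lemma measurable_consrV2 n (F : 'rV[R]_n.+1 -> \bar R) (t : R) :
  measurable_fun setT F -> measurable_fun setT (fun u : 'rV[R]_n => F (consrV (t, u))).
Proof.
move=> mF; apply: (measurableT_comp mF).
apply: (measurableT_comp (@measurable_consrV n)); exact: measurable_pair1.
Qed.

Lemma measurable_consrV_int n (F : 'rV[R]_n.+1 -> \bar R) :
  measurable_fun setT F -> (forall x, 0 <= F x) ->
  measurable_fun setT (fun t : R => \int[lebesgue_rV n]_u F (consrV (t, u))).
Proof.
move=> mF F0.
have := @measurable_fun_fubini_tonelli_F _ _ _ _ R (lebesgue_rV n) (F \o @consrV n).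
apply; last by move=> x; exact: (F0 _).
by apply: (measurableT_comp mF); exact: measurable_consrV.
Qed.

Lemma ge0_integral_translate n (y : 'rV[R]_n) (F : 'rV[R]_n -> \bar R) :
  measurable_fun setT F -> (forall x, 0 <= F x) ->
  \int[lebesgue_rV n]_x F (x + y)%R = \int[lebesgue_rV n]_x F x.
Proof.
elim: n y F => [|n ih] y F mF F0.
  by apply: eq_integral => x _; congr F; apply/rowP => -[].
rewrite [LHS]ge0_integral_rVS//; last exact: measurable_comp_addrV.
rewrite [RHS](ge0_integral_rVS mF F0).
pose y0 := y ord0 ord0; pose y1 : 'rV_n := \row_i y ord0 (rshift 1 i).
have yE t u : (consrV (t, u) + y = consrV (t + y0, u + y1))%R.
  apply/rowP => i; have [j ->|j ->] := split_ordP (i : 'I_(1 + n)).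
    have -> : lshift n j = ord0 :> 'I_n.+1 by apply/val_inj; rewrite !ord1.
    by rewrite mxE !consrV0.
  by rewrite mxE !consrVS/= !mxE.
transitivity (\int[lebesgue_measure]_t \int[lebesgue_rV n]_u F (consrV (t + y0, u)%R)).
  apply: eq_integral => t _; under eq_integral do rewrite yE.
  by apply: (ih y1 (fun u => F (consrV ((t + y0)%R, u)))) => //; exact: measurable_consrV2.
apply: (@ge0_integral_translate1 y0 (fun t => \int[lebesgue_rV n]_u F (consrV (t, u)))).
  exact: measurable_consrV_int.
by move=> t; apply: integral_ge0.
Qed.

Lemma lebesgue_cube n (a : R) : (0 <= a)%R -> lebesgue_rV n (cube a) = (a ^+ n)%:E.
Proof.
move=> a0; elim: n => [|n ih].
  by rewrite /= diracE mem_set ?expr0// => -[].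
rewrite measure_indic; last exact: measurable_cube.
rewrite ge0_integral_rVS//; last first.
  apply: measurable_indicE; exact: measurable_cube.
transitivity (\int[lebesgue_measure]_t ((a ^+ n)%:E * (\1_(`[0%R, a[%classic) t)%:E)).
  apply: eq_integral => t _.
  rewrite -ih measure_indic; last exact: measurable_cube.
  rewrite muleC -ge0_integralZl//.
  - apply: eq_integral => u _; rewrite -EFinM; congr EFin.
    rewrite !indicE -natrM mulnb; congr (_ %:R); congr nat_of_bool.
    apply/idP/andP; rewrite !inE /= in_itv/=.
      move=> h; split; first by have := h ord0; rewrite consrV0.
      by move=> i; have := h (rshift 1 i); rewrite consrVS.
    move=> [ht hu] i; have [j ->|j ->] := split_ordP (i : 'I_(1 + n)).
      have -> : lshift n j = ord0 :> 'I_n.+1 by apply/val_inj; rewrite !ord1.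
      by rewrite consrV0.
    by rewrite consrVS.
  - apply: measurable_indicE; exact: measurable_cube.
have mi : measurable (`[0%R, a[%classic : set (measurableTypeR R)) by exact: measurable_itv.
rewrite ge0_integralZl//.
- rewrite integral_indic// setIT.
  transitivity ((a ^+ n)%:E * (if (0 < a)%R then a%:E else 0)).
    congr (_ * _); have := @lebesgue_measure_itv R `[0%R, a[.
    by rewrite /= lte_fin sube0; apply.
  case: ltgtP a0 => // [a0 _|<- _]; first by rewrite -EFinM exprSr.
  by rewrite exprS mul0r mule0.
- exact: measurable_indicE.
- by rewrite lee_fin exprn_ge0.
Qed.

Lemma lebesgue_translate n (y : 'rV[R]_n) (A : set 'rV[R]_n) : measurable A ->
  lebesgue_rV n [set x : 'rV[R]_n | A (x + y)%R] = lebesgue_rV n A.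
Proof.
move=> mA.
have mA' : measurable [set x : 'rV[R]_n | A (x + y)%R].
  by rewrite -[X in measurable X]setTI; apply: (measurable_addrV y).
rewrite !measure_indic//.
by rewrite -[RHS](ge0_integral_translate y)//; exact: measurable_indicE.

Qed.

Lemma ae_translate n (y : 'rV[R]_n) (P : 'rV[R]_n -> Prop) :
  {ae lebesgue_rV n, forall x, P x} -> {ae lebesgue_rV n, forall x, P (x + y)%R}.
Proof.
move=> [A [mA A0 PA]]; exists [set x : 'rV[R]_n | A (x + y)%R]; split.
- by rewrite -[X in measurable X]setTI; apply: (measurable_addrV y).
- by rewrite lebesgue_translate.
- by move=> x /= Px; apply: PA.
Qed.

End translation.

Section ae_countable.
Context d (T : measurableType d) (R : realType) (mu : {measure set T -> \bar R}).

Lemma ae_forall_count (I : countType) (P : I -> T -> Prop) :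
  (forall i, {ae mu, forall x, P i x}) -> {ae mu, forall x, forall i, P i x}.
Proof.
move=> h.
have : {ae mu, forall x, forall n, oapp (fun i => P i x) True (pickle_inv n)}.
  apply: ae_foralln => n; case: (pickle_inv n) => [i|] /=; first exact: h.
  exact: aeW.
by apply: filterS => x hx i; have := hx (choice.pickle i); rewrite pickleK_inv.
Qed.

End ae_countable.

Section tiling.
Context {R : realType} {d : nat}.
Local Notation Rd := 'rV[R]_d.
Local Notation Zd := 'rV[int]_d.
Local Notation mu := (lebesgue_rV d).
Variable a : R.
Hypothesis a0 : 0 < a.

Definition cell (x : Rd) : Zd := \row_i Num.floor (x ord0 i / a).

Lemma cellP (x : Rd) (k : Zd) : cube a (x - a *: rV_of_int k) <-> cell x = k.
Proof.
split=> [h|<- i].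
  apply/rowP => i; rewrite mxE; apply/eqP; rewrite floor_eq.
  have := h i; rewrite !mxE subr_ge0 ltrBlDr => /andP[h1 h2].
  rewrite ler_pdivlMr// mulrC h1/= ltr_pdivrMr// rmorphD/= mulrDl mul1r addrC mulrC.
  exact: h2.
rewrite !mxE subr_ge0 ltrBlDr.
have := floor_itv (x ord0 i / a) => /andP[].
rewrite ler_pdivlMr// ltr_pdivrMr// rmorphD/= mulrDl mul1r => h1 h2.
by rewrite mulrC h1 addrC h2.
Qed.

Lemma cube_cell0 (x : Rd) : cube a x <-> cell x = 0.
Proof.
rewrite -cellP (_ : x - _ = x)// (_ : rV_of_int 0 = 0) ?scaler0 ?subr0//.
by apply/rowP => i; rewrite !mxE.
Qed.

Lemma rV_of_intD (k l : Zd) : rV_of_int (k + l) = rV_of_int k + rV_of_int l :> Rd.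
Proof. by apply/rowP => i; rewrite !mxE rmorphD. Qed.

Lemma rV_of_intN (k : Zd) : rV_of_int (- k) = - rV_of_int k :> Rd.
Proof. by apply/rowP => i; rewrite !mxE rmorphN. Qed.

Lemma cellD (x : Rd) (k : Zd) : cell (x + a *: rV_of_int k) = cell x + k.
Proof.
apply/cellP; rewrite rV_of_intD scalerDr opprD addrACA addrN addr0.
exact/cellP.
Qed.

Lemma measurable_cell (k : Zd) : measurable [set x : Rd | cell x = k].
Proof.
rewrite (_ : mkset _ = (fun x => x - a *: rV_of_int k) @^-1` cube a).
  rewrite -[X in measurable X]setTI; apply: (measurable_subrV _) => //.
  exact: measurable_cube.
by apply/seteqP; split => x /= /cellP.
Qed.

Local Open Scope ereal_scope.
Definition onc (k : Zd) (F : Rd -> \bar R) (x : Rd) : \bar R :=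
  if cell x == k then F x else 0.

Lemma measurable_onc k F : measurable_fun setT F -> measurable_fun setT (onc k F).
Proof.
move=> mF; rewrite (_ : onc k F = F \_ [set x | cell x = k]).
  apply/(measurable_restrictT _ _).1; first exact: measurable_cell.
  exact: measurable_funTS.
apply/funext => x; rewrite /onc patchE; case: eqP => ck; first by rewrite mem_set.
by rewrite memNset.
Qed.

Lemma onc_ge0 k F x : (forall x, 0 <= F x) -> 0 <= onc k F x.
Proof. by move=> F0; rewrite /onc; case: ifP. Qed.

Lemma esum_onc F x : (forall x, 0 <= F x) -> \esum_(k in [set: Zd]) onc k F x = F x.
Proof.
move=> F0; rewrite -[RHS](@esum_set1 _ _ (cell x) (fun=> F x))//.
rewrite [RHS]esum_mkcond; apply: eq_esum => k _; rewrite /onc.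
case: eqP => [<-|ck]; first by rewrite mem_set.
by rewrite memNset// => /= /esym.
Qed.

Lemma integral_cube F : \int[mu]_(x in cube a) F x = \int[mu]_x onc 0 F x.
Proof.
rewrite integral_mkcond; apply: eq_integral => x _; rewrite patchE /onc.
case: eqP => [/cube_cell0 ck|ck]; first by rewrite mem_set.
by rewrite memNset// => /cube_cell0.
Qed.

Lemma onc_shift k F x : onc k F (x + a *: rV_of_int k)%R = onc 0 (fun x => F (x + a *: rV_of_int k)%R) x.
Proof. by rewrite /onc cellD -subr_eq0 addrK. Qed.

(** Cut the space into lattice cells and translate each one back onto the fundamental cube. *)
Lemma ge0_integral_unfold F : measurable_fun setT F -> (forall x, 0 <= F x) ->
  \int[mu]_x F x =
  \int[mu]_(x in cube a) \esum_(k in [set: Zd]) F (x + a *: rV_of_int k)%R.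
Proof.
move=> mF F0; rewrite integral_cube.
transitivity (\int[mu]_x \esum_(k in [set: Zd]) onc k F x).
  by apply: eq_integral => x _; rewrite esum_onc.
rewrite integral_esum//; last 2 first.
- by move=> k x; exact: onc_ge0.
- by move=> k; exact: measurable_onc.
transitivity (\esum_(k in [set: Zd])
    \int[mu]_x onc 0 (fun x => F (x + a *: rV_of_int k)%R) x).
  apply: eq_esum => k _; rewrite -[LHS](ge0_integral_translate (a *: rV_of_int k))//.
  - by apply: eq_integral => x _; rewrite onc_shift.
  - exact: measurable_onc.
  - by move=> x; exact: onc_ge0.
rewrite -integral_esum//; last 2 first.
- by move=> k x; exact: onc_ge0.
- by move=> k; apply: measurable_onc; exact: measurable_comp_addrV.
apply: eq_integral => x _; rewrite /onc; case: ifP => // _.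
by rewrite esum1.
Qed.

(** The shifted cube is another fundamental domain: unfolding its indicator counts the lattice
    translates of [x] that fall in it, and there is exactly one, indexed by [- cell (x - y)]. *)
Lemma ge0_integral_periodic_shift F (y : Rd) : measurable_fun setT F ->
  (forall x, 0 <= F x) -> Defs.periodic a F ->
  \int[mu]_(x in cube a) F (x + y)%R = \int[mu]_(x in cube a) F x.
Proof.
move=> mF F0 pF.
pose G x := F x * (\1_(cube a) (x - y)%R)%:E.
have mG : measurable_fun setT G.
  apply: emeasurable_funM => //; apply/measurable_EFinP.
  apply: (@measurableT_comp _ _ _ _ _ _ (\1_(cube a) : Rd -> R)).
    apply: measurable_indic; exact: measurable_cube.
  exact: measurable_subrV.
have G0 x : 0 <= G x by rewrite mule_ge0// lee_fin.
transitivity (\int[mu]_x G x).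
  rewrite -(ge0_integral_translate y)// integral_cube; apply: eq_integral => x _.
  rewrite /G /onc addrK indicE; case: eqP => [/cube_cell0 cx|cx].
    by rewrite mem_set// mule1.
  by rewrite memNset ?mule0// => /cube_cell0.
rewrite ge0_integral_unfold//; apply: eq_integral => x _.
transitivity (\esum_(k in [set: Zd]) (F x * (\1_(cube a) (x + a *: rV_of_int k - y)%R)%:E)).
  by apply: eq_esum => k _; rewrite /G pF.
rewrite esumZl//.
rewrite (_ : \esum_(k in _) _ = 1) ?mule1//.
rewrite -[RHS](@esum_set1 R Zd (- cell (x - y))%R (fun=> 1))//.
rewrite [RHS]esum_mkcond; apply: eq_esum => k _; rewrite indicE.
have -> : (x + a *: rV_of_int k - y = (x - y) + a *: rV_of_int k)%R by rewrite addrAC.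
have [->|kn] := eqVneq k (- cell (x - y))%R.
  by rewrite !mem_set//; apply/cube_cell0; rewrite cellD addrN.
rewrite !memNset//=; first by move/eqP: kn.
by move=> /cube_cell0 /eqP; rewrite cellD addrC addr_eq0 (negbTE kn).
Qed.

End tiling.

(** * The Bochner integral *)

Section rnorm_theory.
Context {R : realType} {E : normedModType R[i]}.
Implicit Types x y : E.

Lemma rnorm0 : rnorm (0 : E) = 0.
Proof. by rewrite /rnorm normr0. Qed.

Lemma rnormN x : rnorm (- x) = rnorm x.
Proof. by rewrite /rnorm normrN. Qed.

Lemma rnorm_distC x y : rnorm (x - y) = rnorm (y - x).
Proof. by rewrite -rnormN opprB. Qed.

Lemma rnormZ (c : R[i]) x : rnorm (c *: x) = rnorm (c : R[i]^o) * rnorm x.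
Proof. by apply: (@complexI R); rewrite rmorphM/= !rnormE normrZ. Qed.

Lemma rnormRZ (t : R) x : rnorm (t%:C *: x) = `|t| * rnorm x.
Proof.
rewrite rnormZ; congr (_ * _); apply: (@complexI R); rewrite rnormE.
by rewrite normc_def /= expr0n/= addr0 sqrtr_sqr.
Qed.

Lemma rnorm_eq0 x : rnorm x = 0 -> x = 0.
Proof. by move=> x0; apply/normr0_eq0; rewrite -rnormE x0. Qed.

Lemma ler_rnormB x y : rnorm (x - y) <= rnorm x + rnorm y.
Proof. by rewrite -(rnormN y) ler_rnormD. Qed.

Lemma ler_rnorm_dist x y : `|rnorm x - rnorm y| <= rnorm (x - y).
Proof.
rewrite ler_norml; apply/andP; split.
  rewrite lerNl opprB rnorm_distC lerBlDr.
  by rewrite -[X in rnorm X <= _](subrK x) ler_rnormD.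
by rewrite lerBlDr -[X in rnorm X <= _](subrK y) ler_rnormD.
Qed.

Lemma ler_rnorm_sum (I : Type) (r : seq I) (P : pred I) (F : I -> E) :
  rnorm (\sum_(i <- r | P i) F i) <= \sum_(i <- r | P i) rnorm (F i).
Proof.
elim/big_rec2: _ => [|i y x _ h]; first by rewrite rnorm0.
exact: le_trans (ler_rnormD _ _) (lerD (lexx _) h).
Qed.

Lemma cvg_rnormP (T : Type) (F : set_system T) (FF : Filter F) (u : T -> E) (l : E) :
  (u x @[x --> F] --> l) <-> (forall e : R, 0 < e -> \forall x \near F, rnorm (l - u x) < e).
Proof.
split.
  move=> /cvgrPdist_lt h e e0; have /h : 0 < e%:C by rewrite ltcR.
  by apply: filterS => x; rewrite -rnormE ltcR.
move=> h; apply/cvgrPdist_lt => e e0.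
have eE : (complex.Re e)%:C = e by rewrite RRe_real// gtr0_real.
have e0' : 0 < complex.Re e by rewrite -ltcR eE.
by apply: filterS (h _ e0') => x; rewrite -eE -rnormE ltcR.
Qed.

Lemma cvg_rnorm0P (T : Type) (F : set_system T) (FF : Filter F) (u : T -> E) (l : E) :
  (u x @[x --> F] --> l) <-> (rnorm (l - u x) @[x --> F] --> (0 : R)).
Proof.
rewrite cvg_rnormP; split => [h|/cvgrPdist_lt h e e0].
  apply/cvgrPdist_lt => e e0; apply: filterS (h e e0) => x.
  by rewrite sub0r normrN ger0_norm// rnorm_ge0.
by apply: filterS (h e e0) => x; rewrite sub0r normrN ger0_norm// rnorm_ge0.
Qed.

Lemma cvg_rnorm (T : Type) (F : set_system T) (FF : Filter F) (u : T -> E) (l : E) :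
  u x @[x --> F] --> l -> rnorm (u x) @[x --> F] --> rnorm l.
Proof.
move=> /cvg_rnormP h; apply/cvgrPdist_lt => e e0; apply: filterS (h e e0) => x.
exact: le_lt_trans (ler_rnorm_dist _ _).
Qed.

End rnorm_theory.

Section msimple.
Context d (T : measurableType d).

(** A notion free of any measure: fibres may have infinite mass, so the class is closed under
    arbitrary pointwise operations. With a finite range, measurable fibres make the preimage of
    every set measurable. *)
Definition msimple (V : Type) (s : T -> V) :=
  finite_set (range s) /\ forall Y : set V, measurable (s @^-1` Y).

Lemma msimple_fibres (V : Type) (s : T -> V) : finite_set (range s) ->
  (forall y, measurable (s @^-1` [set y])) -> msimple s.
Proof.
move=> fs ms; split=> // Y.
rewrite (_ : _ @^-1` _ = \bigcup_(y in range s `&` Y) s @^-1` [set y]).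
  by apply: fin_bigcup_measurable => // ; exact: finite_setIl.
apply/seteqP; split => [x /= Yx|x [y [_ Yy] /= ->]]//.
by exists (s x) => //; split => //; exists x.
Qed.

Lemma msimple_cst (V : Type) (v : V) : msimple (fun _ : T => v).
Proof.
apply: msimple_fibres; first by apply: (sub_finite_set _ (finite_set1 v)) => _ [x _ <-].
move=> y; case: (pselect (v = y)) => [vy|vy].
  by rewrite (_ : _ @^-1` _ = setT)//; apply/seteqP; split => x //=.
by rewrite (_ : _ @^-1` _ = set0)//; apply/seteqP; split => x //=.
Qed.

Lemma msimple2 (V1 V2 V3 : Type) (Phi : V1 -> V2 -> V3) s t :
  msimple s -> msimple t -> msimple (fun x => Phi (s x) (t x)).
Proof.
move=> [fs ms] [ft mt]; split.
  apply: (sub_finite_set (B := [set Phi u v | u in range s & v in range t])).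
    by move=> _ [x _ <-]; exists (s x); [exists x|exists (t x) => //; exists x].
  exact: finite_image2.
move=> Y; rewrite (_ : _ @^-1` _ =
   \bigcup_(u in range s) (s @^-1` [set u] `&` t @^-1` [set v | Y (Phi u v)])).
  by apply: fin_bigcup_measurable => // u _; apply: measurableI.
apply/seteqP; split => [x /= Yx|x [u _ [/= -> //]]].
by exists (s x) => //; exists x.
Qed.

Lemma msimple1 (V1 V2 : Type) (Phi : V1 -> V2) s : msimple s -> msimple (fun x => Phi (s x)).
Proof. by move=> ms; exact: (msimple2 (fun u _ => Phi u) ms ms). Qed.

Lemma msimple_indic (V : Type) (A : set T) (u v : V) : measurable A ->
  msimple (fun x => if x \in A then u else v).
Proof.
move=> mA; apply: (@msimple1 bool V (fun b => if b then u else v) (fun x => x \in A)).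
apply: msimple_fibres; first exact: finite_finset.
case.
  rewrite (_ : _ @^-1` _ = A)//; apply/seteqP; split => x /=; first by move/set_mem.
  by move/mem_set.
rewrite (_ : _ @^-1` _ = ~` A); first exact: measurableC.
apply/seteqP; split => x /=; first by move/negbT/negP => h /mem_set.
by move=> h; apply: memNset.
Qed.

Lemma msimple_sum (R : realType) (E : normedModType R[i]) (I : Type) (r : seq I) (F : I -> T -> E) :
  (forall i, msimple (F i)) -> msimple (fun x => \sum_(i <- r) F i x).
Proof.
move=> mF; elim: r => [|i r ih].
  by under eq_fun do rewrite big_nil; exact: msimple_cst.
by under eq_fun do rewrite big_cons; exact: (msimple2 +%R).
Qed.

Lemma msimple_measurable (R : realType) (V : Type) (s : T -> V) (h : V -> R) :
  msimple s -> measurable_fun setT (fun x => h (s x)).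
Proof. by move=> [_ ms] _ Y mY; rewrite setTI; exact: (ms (h @^-1` Y)). Qed.

End msimple.

Section bochner_theory.
Context d (T : measurableType d) (R : realType) (E : normedModType R[i]).
Variable mu : {measure set T -> \bar R}.
Implicit Types (f s : T -> E).
Local Notation bsimple := (bochner_simple mu).

(** The tests for vector-valued identities. Real linearity admits the real and imaginary parts of
    inner products, and boundedness lets a test commute with the Bochner integral. *)
Definition rfunctional (psi : E -> R) :=
  [/\ forall x y, psi (x + y) = psi x + psi y,
      forall (t : R) x, psi (t%:C *: x) = t * psi x &
      exists2 C : R, 0 <= C & forall x, `|psi x| <= C * rnorm x].

Lemma rfunctional0 psi : rfunctional psi -> psi 0 = 0.
Proof. by case=> _ pZ _; have := pZ 0 0; rewrite scaler0 mul0r. Qed.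

Lemma rfunctionalN psi x : rfunctional psi -> psi (- x) = - psi x.
Proof. by case=> _ pZ _; have := pZ (-1) x; rewrite rmorphN1 scaleN1r mulN1r. Qed.

Lemma rfunctionalB psi x y : rfunctional psi -> psi (x - y) = psi x - psi y.
Proof. by move=> p; have [pD _ _] := p; rewrite pD rfunctionalN. Qed.

Lemma rfunctional_sum psi (I : Type) (r : seq I) (F : I -> E) : rfunctional psi ->
  psi (\sum_(i <- r) F i) = \sum_(i <- r) psi (F i).
Proof.
move=> p; have [pD _ _] := p.
by elim/big_rec2: _ => [|i x y _ <-]; [exact: rfunctional0|exact: pD].
Qed.

Lemma bsimple_msimple s : bsimple s -> msimple s.
Proof. by move=> [fs ms _]; exact: msimple_fibres. Qed.

(** The form with a general [h] covers both functionals and the norm. The condition [h 0 = 0]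
    disposes of the fibre over 0, whose measure may be infinite. *)
Lemma int_bsimple s (h : E -> R) : bsimple s -> h 0 = 0 ->
  mu.-integrable setT (fun x => (h (s x))%:E) /\
  (\int[mu]_x (h (s x))%:E =
   \sum_(y <- fset_set (range s)) (h y)%:E * mu (s @^-1` [set y]))%E.
Proof.
move=> [fs ms mfin] h0.
have E1 x : (h (s x))%:E = (\sum_(y <- fset_set (range s)) (h y * \1_(s @^-1` [set y]) x)%:E)%E.
  rewrite (big_fsetD1 (s x))/=; last by rewrite in_fset_set// inE; exists x.
  rewrite indicE mem_set//= mulr1 big1_fset ?adde0// => y.
  rewrite !inE => /andP[yx _] _; rewrite indicE memNset ?mulr0// => /= e.
  by move: yx; rewrite e eqxx.
have I1 y : mu.-integrable setT (fun x => (h y * \1_(s @^-1` [set y]) x)%:E).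
  have [->|y0] := eqVneq y 0.
    by under eq_fun do rewrite h0 mul0r; exact: integrable0.
  under eq_fun do rewrite EFinM.
  apply: integrableZl => //; apply/integrableP; split.
    by apply/measurable_EFinP; exact: measurable_indic.
  under eq_integral do rewrite gee0_abs ?lee_fin//.
  by rewrite -measure_indic// mfin.
have E2 : (fun x => (h (s x))%:E) = (fun x => \sum_(y <- fset_set (range s)) (h y * \1_(s @^-1` [set y]) x)%:E)%E.
  exact/funext.
split; first by rewrite E2; apply: integrable_sum.
rewrite E2 integral_sum//; apply: eq_bigr => y _.
have [->|y0] := eqVneq y 0.
  by under eq_integral do rewrite h0 mul0r; rewrite integral0 h0 mul0e.
under eq_integral do rewrite EFinM.
rewrite integralZl//.
  by rewrite -measure_indic.
apply/integrableP; split; first by apply/measurable_EFinP; exact: measurable_indic.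
under eq_integral do rewrite gee0_abs ?lee_fin//.
by rewrite -measure_indic// mfin.
Qed.

Lemma simple_integralE s : bsimple s -> simple_integral mu s =
  \sum_(y <- fset_set (range s)) (fine (mu (s @^-1` [set y])))%:C *: y.
Proof. by move=> [fs _ _]; rewrite /simple_integral fsbig_finite. Qed.

Lemma bsimple_fine s y : bsimple s -> y != 0 ->
  ((fine (mu (s @^-1` [set y])))%:E = mu (s @^-1` [set y]))%E.
Proof. by move=> [_ _ h] y0; rewrite fineK// ge0_fin_numE// h. Qed.

Lemma rfunctional_simple psi s : rfunctional psi -> bsimple s ->
  (psi (simple_integral mu s))%:E = (\int[mu]_x (psi (s x))%:E)%E.
Proof.
move=> p bs; have [_ ->] := int_bsimple bs (rfunctional0 p).
rewrite simple_integralE// rfunctional_sum// -sumEFin; apply: eq_bigr => y _.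
have [->|y0] := eqVneq y 0; first by rewrite scaler0 (rfunctional0 p) mul0e.
by have [_ -> _] := p; rewrite mulrC EFinM bsimple_fine.
Qed.

Lemma rnorm_simple_integral s : bsimple s ->
  ((rnorm (simple_integral mu s))%:E <= \int[mu]_x (rnorm (s x))%:E)%E.
Proof.
move=> bs; have [_ ->] := int_bsimple bs rnorm0; rewrite simple_integralE//.
apply: (@le_trans _ _ (\sum_(y <- fset_set (range s)) rnorm ((fine (mu (s @^-1` [set y])))%:C *: y))%:E).
  by rewrite lee_fin; exact: ler_rnorm_sum.
rewrite -sumEFin; apply: lee_sum => y _; rewrite rnormRZ.
have [->|y0] := eqVneq y 0; first by rewrite rnorm0 mulr0 mul0e.
by rewrite ger0_norm ?fine_ge0// mulrC EFinM bsimple_fine.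
Qed.

(** Markov's inequality on each nonzero fibre. *)
Lemma msimple_bsimple s : msimple s -> (\int[mu]_x (rnorm (s x))%:E < +oo)%E -> bsimple s.
Proof.
move=> [fs ms] soo; split=> // y y0.
have ry : 0 < rnorm y.
  by rewrite lt_neqAle rnorm_ge0 andbT eq_sym; apply: contra_neq y0; exact: rnorm_eq0.
have : ((rnorm y)%:E * mu (s @^-1` [set y]) <= \int[mu]_x (rnorm (s x))%:E)%E.
  rewrite measure_indic// -ge0_integralZl//; last 2 first.
  - exact: measurable_indicE.
  - by rewrite lee_fin rnorm_ge0.
  apply: ge0_ae_le_integral => [x|x|]; rewrite ?mule_ge0 ?lee_fin ?rnorm_ge0//.
  apply: aeW => x; rewrite -EFinM lee_fin indicE; case: (boolP (x \in _)).
    by rewrite inE => /= ->; rewrite mulr1.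
  by rewrite mulr0 rnorm_ge0.
move=> /le_lt_trans/(_ soo) h; rewrite ltey; apply/eqP => yoo; move: h.
by rewrite yoo mulry gtr0_sg// mul1e ltxx.
Qed.

Lemma bsimple2 (Phi : E -> E -> E) s t : bsimple s -> bsimple t ->
  (exists2 C : R, 0 <= C & forall x y, rnorm (Phi x y) <= C * (rnorm x + rnorm y)) ->
  bsimple (fun x => Phi (s x) (t x)).
Proof.
move=> bs bt [C C0 PC]; apply: msimple_bsimple.
  by apply: msimple2; exact: bsimple_msimple.
have [i1 _] := int_bsimple bs rnorm0; have [i2 _] := int_bsimple bt rnorm0.
have := integrableZl measurableT C (integrableD measurableT i1 i2).
move=> /integrableP[_]; apply: le_lt_trans.
apply: ge0_ae_le_integral => [x|x|]; rewrite ?lee_fin ?rnorm_ge0//.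
by apply: aeW => x; rewrite -EFinD -EFinM abse_EFin lee_fin; apply: le_trans (ler_norm _).
Qed.

Hypothesis sep : forall x : E, (forall psi, rfunctional psi -> psi x = 0) -> x = 0.

Lemma simple_integralB s t : bsimple s -> bsimple t ->
  simple_integral mu s - simple_integral mu t = simple_integral mu (fun x => s x - t x).
Proof.
move=> bs bt.
have bst : bsimple (fun x => s x - t x).
  apply: (bsimple2 (Phi := fun x y => x - y)) => //; exists 1 => // x y.
  by rewrite mul1r ler_rnormB.
apply/eqP; rewrite -subr_eq0; apply/eqP; apply: sep => psi p.
rewrite !(rfunctionalB _ _ p); apply/EFin_inj.
rewrite !EFinB !rfunctional_simple//.
under [X in (_ - X)%E]eq_integral do rewrite (rfunctionalB _ _ p) EFinB.
have [i1 _] := int_bsimple bs (rfunctional0 p).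
have [i2 _] := int_bsimple bt (rfunctional0 p).
rewrite integralB// subee// fin_numB.
by rewrite !integrable_fin_num.
Qed.

(** An almost everywhere limit need not be measurable itself; the upper limit of the sequence is a
    measurable version of it. *)
Lemma ae_lim_measurable (u : nat -> T -> R) (v : T -> R) :
  (forall n, measurable_fun setT (u n)) -> {ae mu, forall x, u n x @[n --> \oo] --> v x} ->
  exists2 v' : T -> R, measurable_fun setT v' & {ae mu, forall x, v x = v' x}.
Proof.
move=> mu_ uv; exists (fun x => fine (limn_esup (fun n => (u n x)%:E))).
  apply: (measurableT_comp (fine_measurable measurableT)).
  by apply: measurable_fun_limn_esup => n; exact/measurable_EFinP.
apply: filterS uv => x ux.
suff -> : limn_esup (fun n => (u n x)%:E) = (v x)%:E by [].
have h : (fun n => (u n x)%:E) @ \oo --> (v x)%:E.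
  by apply: cvg_EFin => //; exact: nearW.
rewrite is_cvg_limn_esupE; last by apply/cvg_ex; exists (v x)%:E.
exact/cvg_lim.
Qed.

Lemma has_bochner_ae f f' I : {ae mu, forall x, f x = f' x} ->
  has_bochner_integral mu f I -> has_bochner_integral mu f' I.
Proof.
move=> ff' [s [bs sf L1 sI]]; exists s; split => //.
  by apply: filterS2 ff' sf => x <-.
rewrite (_ : (fun n => _) = (fun n => \int[mu]_x (rnorm (f x - s n x))%:E)%E)//.
apply/funext => n; apply: ge0_ae_eq_integralT => [x|x|]; rewrite ?lee_fin ?rnorm_ge0//.
by apply: filterS ff' => x ->.
Qed.

(** The function [psi (f x)] is approximated in [L^1] by [psi (s n x)] with error at most [C] times
    that of [s n], so both sides are limits of the same sequence. The functions [v] and [r] below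
    are measurable versions of [psi (f x)] and [rnorm (f x - s n x)]. *)
Lemma rfunctional_bochner psi f I : rfunctional psi -> has_bochner_integral mu f I ->
  (psi I)%:E = (\int[mu]_x (psi (f x))%:E)%E.
Proof.
move=> p [s [bs sf L1 sI]]; have [_ _ [C C0 pC]] := p.
have psub x y : `|psi x - psi y| <= C * rnorm (x - y) by rewrite -rfunctionalB.
have mps n : measurable_fun setT (fun x => psi (s n x)).
  by apply: (@msimple_measurable _ _ _ _ _ psi); exact: bsimple_msimple.
have pcv (u : nat -> E) l : u @ \oo --> l -> psi (u n) @[n --> \oo] --> psi l.
  move=> /cvg_rnormP h; apply/cvgrPdist_lt => e e0.
  have C1 : 0 < C + 1 by rewrite ltr_wpDl.
  apply: filterS (h (e / (C + 1)) (divr_gt0 e0 C1)) => n hn.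
  apply: le_lt_trans (psub _ _) _; apply: le_lt_trans (_ : (C + 1) * rnorm (l - u n) < _).
    by rewrite ler_wpM2r ?rnorm_ge0// lerDl.
  by rewrite mulrC -ltr_pdivlMr.
have [v mv pv] : exists2 v' : T -> R, measurable_fun setT v' & {ae mu, forall x, psi (f x) = v' x}.
  by apply: (ae_lim_measurable mps); apply: filterS sf => x; exact: pcv.
have -> : (\int[mu]_x (psi (f x))%:E = \int[mu]_x (v x)%:E)%E.
  by apply: ae_eq_integralT; apply: filterS pv => x ->.
have K n : (\int[mu]_x `|(v x)%:E - (psi (s n x))%:E| <= C%:E * \int[mu]_x (rnorm (f x - s n x))%:E)%E.
  have [r mr fr] : exists2 v' : T -> R, measurable_fun setT v' & {ae mu, forall x, rnorm (f x - s n x) = v' x}.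
    apply: (@ae_lim_measurable (fun m x => rnorm (s m x - s n x))).
      move=> m; apply: (@msimple_measurable _ _ _ _ _ rnorm).
      by apply: (msimple2 (fun x y => x - y)); exact: bsimple_msimple.
    apply: filterS sf => x sx; apply: cvg_rnorm; apply: cvgB => //; exact: cvg_cst.
  rewrite (_ : (\int[mu]_x (rnorm (f x - s n x))%:E = \int[mu]_x `|r x|%:E)%E); last first.
    apply: ge0_ae_eq_integralT => [x|x|]; rewrite ?lee_fin ?rnorm_ge0//.
    by apply: filterS fr => x <-; rewrite ger0_norm// rnorm_ge0.
  rewrite -ge0_integralZl//; last first.
    by apply/measurable_EFinP; exact: measurableT_comp.
  apply: ge0_ae_le_integral => [x|x|]; rewrite ?mule_ge0//.
  apply: filterS2 fr pv => x rx <-; rewrite -EFinB /= -EFinM lee_fin.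
  by rewrite -rx (ger0_norm (rnorm_ge0 _)); exact: psub.
have K0 : (C%:E * \int[mu]_x (rnorm (f x - s n x))%:E)%E @[n --> \oo] --> 0%E.
  by rewrite -(mule0 C%:E); apply: cvgeZl.
have ips n := (int_bsimple (bs n) (rfunctional0 p)).1.
have iv : mu.-integrable setT (EFin \o v).
  have /(ge0_cvge0P _)/(_ 1 ltr01)[|N _ /(_ N (leqnn N)) KN] := K0.
    by move=> n; apply: mule_ge0; rewrite ?lee_fin//; apply: integral_ge0 => x _; rewrite lee_fin rnorm_ge0.
  have : mu.-integrable setT (fun x => (v x)%:E - (psi (s N x))%:E)%E.
    apply/integrableP; split.
      by apply: emeasurable_funB; exact/measurable_EFinP.
    by apply: le_lt_trans (K N) _; apply: le_lt_trans KN _; rewrite ltry.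
  move=> /integrableD /(_ (ips N)) h.
  have := h measurableT; apply: eq_integrable => // x _ /=.
  by rewrite -!EFinD subrK.
have c1 : (psi (simple_integral mu (s n)))%:E @[n --> \oo] --> (psi I)%:E.
  by apply: cvg_EFin; [exact: nearW|exact: pcv].
have c2 : (psi (simple_integral mu (s n)))%:E @[n --> \oo] --> (\int[mu]_x (v x)%:E)%E.
  have fi := integrable_fin_num measurableT iv.
  rewrite -(fineK fi); apply: cvg_EFin; first exact: nearW.
  apply/cvgrPdist_le => e e0.
  have /(ge0_cvge0P _)/(_ e e0) := K0.
  move=> /(_ (fun n => _)) h; apply: filterS (h _) => [n Kn|n]; last first.
    by apply: mule_ge0; rewrite ?lee_fin//; apply: integral_ge0 => x _; rewrite lee_fin rnorm_ge0.
  rewrite -lee_fin; apply: le_trans Kn; apply: le_trans (K n).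
  rewrite -abse_EFin EFinB fineK// rfunctional_simple// -integralB//.
  by apply: le_abse_integral => //; apply: emeasurable_funB; exact/measurable_EFinP.
exact: (cvg_unique _ c1 c2).
Qed.

Lemma has_bochner_unique f I J : has_bochner_integral mu f I ->
  has_bochner_integral mu f J -> I = J.
Proof.
move=> fI fJ; apply/eqP; rewrite -subr_eq0; apply/eqP; apply: sep => psi p.
rewrite rfunctionalB//; apply/EFin_inj; rewrite EFinB.
by rewrite (rfunctional_bochner p fI) -(rfunctional_bochner p fJ) subee.
Qed.

Lemma bochnerE D f I : has_bochner_integral mu (cutoff D f) I -> bochner mu D f = I.
Proof.
move=> fI; rewrite /bochner; case: xgetP => [J _ /= fJ|/(_ I)//].
exact: has_bochner_unique fJ fI.
Qed.

(** Limits are required at every point and no measure enters, so the class is stable under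
    translation, periodization and continuous operations. A strongly measurable function agrees
    almost everywhere with a member of it. *)
Definition aplim f := exists s : nat -> T -> E,
  (forall n, msimple (s n)) /\ forall x, s n x @[n --> \oo] --> f x.

Lemma aplim_rnorm f : aplim f -> measurable_fun setT (fun x => rnorm (f x)).
Proof.
move=> [s [ms sf]]; apply: (measurable_fun_cvg (h := fun n x => rnorm (s n x))).
  by move=> n; exact: (@msimple_measurable _ _ _ _ _ rnorm).
by move=> x _; apply: cvg_rnorm.
Qed.

(* truncating the approximants at 2|f| makes them dominated *)
Lemma aplim_dominated f : aplim f -> exists s : nat -> T -> E,
  [/\ forall n, msimple (s n), forall x, s n x @[n --> \oo] --> f x &
      forall n x, rnorm (s n x) <= 2 * rnorm (f x)].
Proof.
move=> fa; have mf := aplim_rnorm fa; have [s [ms sf]] := fa.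
pose A n := [set x | rnorm (s n x) <= 2 * rnorm (f x)].
have mA n : measurable (A n).
  have := @measurable_fun_ler _ _ R setT (fun x => rnorm (s n x)) (fun x => 2 * rnorm (f x)).
  move=> /(_ _ _ measurableT [set true]); rewrite setTI; apply => //.
    exact: (@msimple_measurable _ _ _ _ _ rnorm).
  by apply: measurable_funM => //; exact: measurable_cst.
exists (fun n x => if x \in A n then s n x else 0); split.
- move=> n; apply: (msimple2 (fun (b : bool) y => if b then y else 0) (s := fun x => x \in A n)) => //.
  have := @msimple_indic _ T bool (A n) true false (mA n).
  by congr msimple; apply/funext => x; case: (x \in A n).
- move=> x; apply/cvg_rnormP => e e0; have /cvg_rnormP sx := sf x.
  (* At a zero of [f] the truncation may act for every [n], but its value 0 is then the right limit.
     Elsewhere it eventually stops acting. *)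
  have [fx0|fx0] := eqVneq (rnorm (f x)) 0.
    near=> n; case: ifPn => _; first by near: n; exact: sx.
    by rewrite subr0 fx0.
  have fx1 : 0 < rnorm (f x) by rewrite lt_neqAle eq_sym fx0 rnorm_ge0.
  near=> n; rewrite ifT; first by near: n; exact: sx.
  rewrite inE /A /=; rewrite mulr2n mulrDl !mul1r -lerBlDr.
  apply: le_trans (ler_norm _) _; apply: le_trans (ler_rnorm_dist _ _) _.
  by rewrite rnorm_distC; apply: ltW; near: n; exact: sx.
- move=> n x; case: ifPn => [|_]; first by rewrite inE.
  by rewrite rnorm0 mulr_ge0// rnorm_ge0.
Unshelve. all: by end_near. Qed.

Lemma aplimB f g : aplim f -> aplim g -> aplim (fun x => f x - g x).
Proof.
move=> [s [ms sf]] [t [mt tg]]; exists (fun n x => s n x - t n x); split.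
  by move=> n; exact: (msimple2 (fun x y => x - y)).
by move=> x; apply: cvgB.
Qed.

Lemma msimple_aplim s : msimple s -> aplim s.
Proof. by move=> ms; exists (fun=> s); split => // x; exact: cvg_cst. Qed.

Hypothesis cmpl : forall u : nat -> E,
  (forall e : R, 0 < e -> exists N, forall m n, (N <= m)%N -> (N <= n)%N -> rnorm (u m - u n) < e) ->
  exists l : E, u n @[n --> \oo] --> l.

(** With the truncated approximants [|f - s_n|] is at most [3 |f|], so dominated convergence gives
    the [L^1] limit, and the simple integrals form a Cauchy sequence. *)
Lemma has_bochner_exists f : aplim f -> (\int[mu]_x (rnorm (f x))%:E < +oo)%E ->
  exists I, has_bochner_integral mu f I.
Proof.
move=> fa foo; have mf := aplim_rnorm fa; have [s [ms sf sb]] := aplim_dominated fa.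
have if1 : mu.-integrable setT (fun x => (rnorm (f x))%:E).
  apply/integrableP; split; first exact/measurable_EFinP.
  by under eq_integral do rewrite gee0_abs ?lee_fin ?rnorm_ge0//.
have i3 := integrableZl measurableT 3 if1.
have bs n : bsimple (s n).
  apply: msimple_bsimple => //.
  have /integrableP[_] := integrableZl measurableT 2 if1; apply: le_lt_trans.
  apply: ge0_ae_le_integral => [x|x|]; rewrite ?lee_fin ?rnorm_ge0//.
  apply: aeW => x; rewrite -EFinM gee0_abs ?lee_fin ?mulr_ge0 ?rnorm_ge0//.
have mfs n : measurable_fun setT (fun x => (rnorm (f x - s n x))%:E).
  by apply/measurable_EFinP; apply: aplim_rnorm; apply: aplimB => //; exact: msimple_aplim.
have L1 : (\int[mu]_x (rnorm (f x - s n x))%:E)%E @[n --> \oo] --> 0%E.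
  have := @dominated_convergence _ T R mu setT measurableT
    (fun n x => (rnorm (f x - s n x))%:E) (cst 0%E) (fun x => 3%:E * (rnorm (f x))%:E)%E mfs.
  case=> //.
  - apply: aeW => x _; apply: cvg_EFin; first exact: nearW.
    by apply/cvg_rnorm0P; exact: sf.
  - apply: aeW => x n _; rewrite gee0_abs ?lee_fin ?rnorm_ge0//.
    apply: le_trans (ler_rnormB _ _) _.
    rewrite (_ : 3 = 1 + 2 :> R); last by rewrite -natr1 addrC.
    by rewrite mulrDl mul1r lerD2l.
  by move=> _ _; rewrite integral0.
have I0 n : (0 <= \int[mu]_x (rnorm (f x - s n x))%:E)%E.
  by apply: integral_ge0 => x _; rewrite lee_fin rnorm_ge0.
have [l sl] : exists l : E, simple_integral mu (s n) @[n --> \oo] --> l.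
  apply: cmpl => e e0; have e3 : 0 < e / 3 by rewrite divr_gt0.
  have /(ge0_cvge0P _ I0)/(_ _ e3)[N _ hN] := L1.
  exists N => m n Nm Nn; rewrite simple_integralB// -lte_fin.
  have bmn : bsimple (fun x => s m x - s n x).
    apply: (bsimple2 (Phi := fun x y => x - y)) => //; exists 1 => // x y.
    by rewrite mul1r ler_rnormB.
  apply: le_lt_trans (rnorm_simple_integral bmn) _.
  apply: (@le_lt_trans _ _ (\int[mu]_x ((rnorm (f x - s m x))%:E + (rnorm (f x - s n x))%:E))%E).
    apply: ge0_ae_le_integral => [x|x|]; rewrite ?adde_ge0 ?lee_fin ?rnorm_ge0//.
    apply: aeW => x; rewrite -EFinD lee_fin (rnorm_distC (f x)).
    by rewrite -(subrKA (f x)) ler_rnormD.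
  rewrite ge0_integralD//; last 2 first.
  - by move=> x _; rewrite lee_fin rnorm_ge0.
  - by move=> x _; rewrite lee_fin rnorm_ge0.
  apply: (@le_lt_trans _ _ ((e / 3)%:E + (e / 3)%:E)%E).
    by apply: leeD; [exact: hN|exact: hN].
  rewrite -EFinD lte_fin; lra.
exists l; exists s; split => //.
by apply: aeW.
Qed.

End bochner_theory.

(** * Hilbert spaces, bounded operators, absolutely convergent sums *)

Section complex_rnorm.
Context {R : realType}.
Implicit Types z w : R[i].
Local Notation Re := (@complex.Re R).
Local Notation Im := (@complex.Im R).

Lemma rnormC_sqr z : rnorm (z : R[i]^o) ^+ 2 = Re z ^+ 2 + Im z ^+ 2.
Proof.
by rewrite /rnorm normc_def /= sqr_sqrtr// addr_ge0// sqr_ge0.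
Qed.

Lemma rnormCE z : rnorm (z : R[i]^o) = Num.sqrt (Re z ^+ 2 + Im z ^+ 2).
Proof. by rewrite /rnorm normc_def. Qed.

Lemma rnormCM z w : rnorm (z * w : R[i]^o) = rnorm (z : R[i]^o) * rnorm (w : R[i]^o).
Proof. exact: (rnormZ z (w : R[i]^o)). Qed.

Lemma ler_Re_rnorm z : `|Re z| <= rnorm (z : R[i]^o).
Proof. by rewrite rnormCE -sqrtr_sqr ler_sqrt ?addr_ge0 ?sqr_ge0// lerDl sqr_ge0. Qed.

Lemma ler_Im_rnorm z : `|Im z| <= rnorm (z : R[i]^o).
Proof. by rewrite rnormCE -sqrtr_sqr ler_sqrt ?addr_ge0 ?sqr_ge0// lerDr sqr_ge0. Qed.

Lemma rnormC_le z : rnorm (z : R[i]^o) <= `|Re z| + `|Im z|.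
Proof.
rewrite -(@ler_pXn2r _ 2)// ?nnegrE ?rnorm_ge0 ?addr_ge0//.
rewrite rnormC_sqr sqrrD !real_normK ?num_real// -addrA lerD2l addrC lerDl.
by rewrite mulrn_wge0// mulr_ge0.
Qed.

Lemma rnormC_conj z : rnorm (z^*%R : R[i]^o) = rnorm (z : R[i]^o).
Proof. by rewrite !rnormCE; case: z => a b /=; rewrite sqrrN. Qed.

Lemma ReD z w : Re (z + w) = Re z + Re w. Proof. by case: z; case: w. Qed.
Lemma ImD z w : Im (z + w) = Im z + Im w. Proof. by case: z; case: w. Qed.
Lemma ReM z w : Re (z * w) = Re z * Re w - Im z * Im w. Proof. by case: z; case: w. Qed.
Lemma ImM z w : Im (z * w) = Re z * Im w + Im z * Re w. Proof. by case: z; case: w. Qed.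
Lemma ReZ (t : R) z : Re (t%:C * z) = t * Re z.
Proof. by rewrite ReM /= mul0r subr0. Qed.
Lemma ImZ (t : R) z : Im (t%:C * z) = t * Im z.
Proof. by rewrite ImM /= mul0r addr0. Qed.

Lemma complexE2 z w : Re z = Re w -> Im z = Im w -> z = w.
Proof. by case: z; case: w => a b c d /= -> ->. Qed.

Lemma rfunctional_Re : rfunctional (Re : R[i]^o -> R).
Proof.
split; [exact: ReD|exact: ReZ|exists 1 => // z; rewrite mul1r; exact: ler_Re_rnorm].
Qed.

Lemma rfunctional_Im : rfunctional (Im : R[i]^o -> R).
Proof.
split; [exact: ImD|exact: ImZ|exists 1 => // z; rewrite mul1r; exact: ler_Im_rnorm].
Qed.

Lemma sepC (z : R[i]^o) : (forall psi, rfunctional psi -> psi z = 0) -> z = 0.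
Proof.
move=> h; apply: complexE2; first by rewrite (h _ rfunctional_Re).
by rewrite (h _ rfunctional_Im).
Qed.

Lemma cvgC_ReIm (T : Type) (F : set_system T) (FF : Filter F) (u : T -> R[i]^o) (l : R[i]^o) :
  (u x @[x --> F] --> l) <->
  (Re (u x) @[x --> F] --> Re l /\ Im (u x) @[x --> F] --> Im l).
Proof.
have ReB (a b : R[i]) : Re a - Re b = Re (a - b) by case: a; case: b.
have ImB (a b : R[i]) : Im a - Im b = Im (a - b) by case: a; case: b.
split=> [/cvg_rnormP h|[/cvgrPdist_lt h1 /cvgrPdist_lt h2]].
  split; apply/cvgrPdist_lt => e e0; apply: filterS (h e e0) => x.
    by rewrite ReB; apply: le_lt_trans; exact: ler_Re_rnorm.
  by rewrite ImB; apply: le_lt_trans; exact: ler_Im_rnorm.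
apply/cvg_rnormP => e e0; have e2 : 0 < e / 2 by rewrite divr_gt0.
apply: filterS2 (h1 _ e2) (h2 _ e2) => x; rewrite ReB ImB => hr hi.
apply: le_lt_trans (rnormC_le _) _; rewrite (splitr e); exact: ltrD.
Qed.

(** Completeness in terms of sequences and the real-valued norm, since [bounded_op H] carries only a
    normed structure. *)
Definition cmplt (E : normedModType R[i]) := forall u : nat -> E,
  (forall e : R, 0 < e -> exists N, forall m n, (N <= m)%N -> (N <= n)%N -> rnorm (u m - u n) < e) ->
  exists l : E, u n @[n --> \oo] --> l.

Lemma cmpltC : cmplt R[i]^o.
Proof.
move=> u hu.
have ReB (a b : R[i]) : Re a - Re b = Re (a - b) by case: a; case: b.
have ImB (a b : R[i]) : Im a - Im b = Im (a - b) by case: a; case: b.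
have c1 : cvgn (fun n => Re (u n)).
  apply/cauchy_cvgP/cauchy_ballP => e e0; have [N hN] := hu e e0.
  exists ([set Re (u n) | n in [set n | N <= n]%N], [set Re (u n) | n in [set n | N <= n]%N]) => /=.
    by split; exists N => // n Nn; exists n.
  move=> [_ _] /= [[m Nm <-] [n Nn <-]]; rewrite /ball/= ReB.
  by apply: le_lt_trans (hN m n Nm Nn); exact: ler_Re_rnorm.
have c2 : cvgn (fun n => Im (u n)).
  apply/cauchy_cvgP/cauchy_ballP => e e0; have [N hN] := hu e e0.
  exists ([set Im (u n) | n in [set n | N <= n]%N], [set Im (u n) | n in [set n | N <= n]%N]) => /=.
    by split; exists N => // n Nn; exists n.
  move=> [_ _] /= [[m Nm <-] [n Nn <-]]; rewrite /ball/= ImB.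
  by apply: le_lt_trans (hN m n Nm Nn); exact: ler_Im_rnorm.
by exists (limn (fun n => Re (u n)) +i* limn (fun n => Im (u n))); apply/cvgC_ReIm.
Qed.

End complex_rnorm.

Section hilbert.
Context {R : realType} {H : hilbertType R}.
Implicit Types x y z : H.
Local Notation Re := (@complex.Re R).
Local Notation Im := (@complex.Im R).

Lemma innerDl x y z : inner (x + y) z = inner x z + inner y z.
Proof. exact: linearDl. Qed.
Lemma innerDr x y z : inner x (y + z) = inner x y + inner x z.
Proof. exact: linearDr. Qed.
Lemma innerBl x y z : inner (x - y) z = inner x z - inner y z.
Proof. exact: linearBl. Qed.
Lemma innerBr x y z : inner x (y - z) = inner x y - inner x z.
Proof. exact: linearBr. Qed.
Lemma innerZl (a : R[i]) x y : inner (a *: x) y = a * inner x y.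
Proof. exact: linearZl_LR. Qed.
Lemma innerZr (a : R[i]) x y : inner x (a *: y) = a^*%R * inner x y.
Proof. exact: linearZr_LR. Qed.
Lemma innerC x y : inner x y = (inner y x)^*%R.
Proof. by rewrite hermC expr0 mul1r. Qed.
Lemma inner0l y : inner (0 : H) y = 0. Proof. exact: linear0l. Qed.
Lemma inner0r x : inner x (0 : H) = 0. Proof. exact: linear0r. Qed.
Lemma inner_suml (I : Type) (r : seq I) (F : I -> H) y :
  inner (\sum_(i <- r) F i) y = \sum_(i <- r) inner (F i) y.
Proof. exact: linear_sumlz. Qed.

Lemma inner_rnorm x : inner x x = (rnorm x ^+ 2)%:C.
Proof. by rewrite inner_norm -rnormE rmorphXn. Qed.

Lemma rnorm_inner x y : rnorm (inner x y : R[i]^o) <= rnorm x * rnorm y.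
Proof. by rewrite -lecR rmorphM/= !rnormE inner_CauchySchwarz. Qed.

Lemma rfunctional_ReI z : rfunctional (fun x => Re (inner x z)).
Proof.
split => [x y|t x|]; [by rewrite innerDl ReD|by rewrite innerZl ReZ|].
exists (rnorm z); first exact: rnorm_ge0.
by move=> x; rewrite mulrC; apply: le_trans (ler_Re_rnorm _) (rnorm_inner _ _).
Qed.

Lemma rfunctional_ImI z : rfunctional (fun x => Im (inner x z)).
Proof.
split => [x y|t x|]; [by rewrite innerDl ImD|by rewrite innerZl ImZ|].
exists (rnorm z); first exact: rnorm_ge0.
by move=> x; rewrite mulrC; apply: le_trans (ler_Im_rnorm _) (rnorm_inner _ _).
Qed.

Lemma sepH x : (forall psi, rfunctional psi -> psi x = 0) -> x = 0.
Proof.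
move=> h; have := h _ (rfunctional_ReI x); rewrite inner_rnorm /= => /eqP.
by rewrite sqrf_eq0 => /eqP /rnorm_eq0.
Qed.

Lemma cmpltH : cmplt H.
Proof.
move=> u hu; apply/cvg_ex; apply/cauchy_cvgP/cauchy_ballP => e e0.
have eE : (Re e)%:C = e by rewrite RRe_real// gtr0_real.
have e0' : 0 < Re e by rewrite -ltcR eE.
have [N hN] := hu _ e0'.
exists ([set u n | n in [set n | N <= n]%N], [set u n | n in [set n | N <= n]%N]) => /=.
  by split; exists N => // n Nn; exists n.
by move=> [_ _] /= [[m Nm <-] [n Nn <-]]; rewrite -ball_normE /= -eE -rnormE ltcR hN.
Qed.

Local Notation BH := (bounded_op H).
Implicit Types A B : BH.

Lemma op_addE A B x : (A + B) x = A x + B x. Proof. by []. Qed.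
Lemma op_subE A B x : (A - B) x = A x - B x. Proof. by []. Qed.
Lemma op_scaleE (a : R[i]) A x : (a *: A) x = a *: A x. Proof. by []. Qed.
Lemma op_bound A x : rnorm (A x) <= rnorm A * rnorm x.
Proof.
have [->|x0] := eqVneq x 0; first by rewrite linear0 !rnorm0 mulr0.
have rx : 0 < rnorm x.
  by rewrite lt_neqAle rnorm_ge0 andbT eq_sym; apply: contra_neq x0; exact: rnorm_eq0.
have := @le_op_norm _ _ A ((rnorm x)^-1%:C *: x).
rewrite linearZ/= !rnormRZ ger0_norm ?invr_ge0 ?rnorm_ge0// mulVf ?gt_eqF// => /(_ (lexx _)).
by rewrite ler_pdivrMl// mulrC.
Qed.

Lemma rnorm_op_le A (M : R) : 0 <= M -> (forall x, rnorm (A x) <= M * rnorm x) -> rnorm A <= M.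
Proof.
move=> M0 h; apply: op_norm_le => x x1; apply: le_trans (h x) _.
by rewrite -[leRHS]mulr1 ler_wpM2l.
Qed.

Lemma rank_oneE x y z : rank_one x y z = inner z y *: x. Proof. by []. Qed.

Lemma rnorm_rank_one x y : rnorm (rank_one x y) <= rnorm x * rnorm y.
Proof.
apply: rnorm_op_le; first by rewrite mulr_ge0// rnorm_ge0.
move=> z; rewrite rank_oneE rnormZ -mulrA mulrC [leRHS]mulrC.
rewrite -mulrA [rnorm y * _]mulrC mulrC.
rewrite [leRHS](_ : _ = rnorm z * rnorm y * rnorm x); last ring.
by rewrite ler_wpM2r ?rnorm_ge0// rnorm_inner.
Qed.

Lemma rfunctional_op (psi : H -> R) z : rfunctional psi -> rfunctional (fun A : BH => psi (A z)).
Proof.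
move=> [pD pZ [C C0 pC]]; split => [A B|t A|]; [exact: pD|exact: pZ|].
exists (C * rnorm z); first by rewrite mulr_ge0// rnorm_ge0.
move=> A; apply: le_trans (pC _) _; rewrite -mulrA ler_wpM2l// mulrC; exact: op_bound.
Qed.

Lemma sepB A : (forall psi, rfunctional psi -> psi A = 0) -> A = 0.
Proof.
move=> h; apply: bounded_opP => x; apply: sepH => psi p.
exact: (h _ (rfunctional_op x p)).
Qed.

Lemma cmpltB : cmplt BH.
Proof.
move=> u hu.
have hux x : exists l : H, u n x @[n --> \oo] --> l.
  apply: cmpltH => e e0.
  have x1 : 0 < rnorm x + 1 by rewrite ltr_wpDl// rnorm_ge0.
  have [N hN] := hu _ (divr_gt0 e0 x1); exists N => m n Nm Nn.
  rewrite -op_subE; apply: le_lt_trans (op_bound _ _) _.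
  have := hN m n Nm Nn; rewrite ltr_pdivlMr//; apply: le_lt_trans.
  by rewrite ler_wpM2l ?rnorm_ge0// lerDl.
pose l x : H := xget 0 [set l : H | u n x @[n --> \oo] --> l].
have lP x : u n x @[n --> \oo] --> l x.
  by rewrite /l; case: xgetP => [//|hn]; have [y /hn] := hux x.
have [N0 hN0] := hu 1 ltr01.
(* The Cauchy estimate with [m] sent to infinity. With [e = 1] it bounds the pointwise limit [l],
   with [e / 2] it gives convergence in operator norm. *)
have lle N e (x : H) : (forall m n, (N <= m)%N -> (N <= n)%N -> rnorm (u m - u n) < e) ->
    forall n, (N <= n)%N -> rnorm (l x - u n x) <= e * rnorm x.
  move=> hN n Nn.
  have c : rnorm (u m x - u n x) @[m --> \oo] --> rnorm (l x - u n x).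
    by apply: cvg_rnorm; apply: cvgB; [exact: lP|exact: cvg_cst].
  rewrite -(cvg_lim _ c)//; apply: limr_le; first by apply/cvg_ex; eexists; exact: c.
  near=> m; rewrite -op_subE; apply: le_trans (op_bound _ _) _.
  rewrite ler_wpM2r ?rnorm_ge0// ltW// hN//.
  by near: m; exists N.
have llin : linear l.
  move=> a x y; have c1 := lP (a *: x + y).
  have c2 : u n (a *: x + y) @[n --> \oo] --> a *: l x + l y.
    rewrite (_ : (fun n => _) = (fun n => a *: u n x + u n y)).
      by apply: cvgD; [apply: cvgZr; exact: lP|exact: lP].
    by apply/funext => n; rewrite linearP.
  exact: (cvg_unique _ c1 c2).
have lbd x : rnorm (l x) <= (1 + rnorm (u N0)) * rnorm x.
  rewrite -[X in rnorm X](subrK (u N0 x)) mulrDl; apply: le_trans (ler_rnormD _ _) _.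
  by apply: lerD; [exact: (lle _ _ _ hN0)|exact: op_bound].
have lop : l \in is_bounded_op.
  apply/asboolP; split=> //.
  pose f : {linear H -> H} := HB.pack l (GRing.isLinear.Build _ _ _ _ _ llin).
  apply: (@bounded_linear_continuous _ _ _ f); apply/linear_boundedP.
  near=> r => z; rewrite -(rnormE (f z)) -(rnormE z).
  apply: (@le_trans _ _ ((1 + rnorm (u N0))%:C * (rnorm z)%:C)).
    by rewrite -rmorphM/= lecR lbd.
  apply: ler_wpM2r; first by rewrite ler0c rnorm_ge0.
  near: r; apply: nbhs_pinfty_ge; by rewrite ger0_real// ler0c addr_ge0// rnorm_ge0.
exists (BoundedOp lop); apply/cvg_rnormP => e e0.
have e2 : 0 < e / 2 by rewrite divr_gt0.
have [N hN] := hu _ e2; exists N => // n /= Nn.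
apply: le_lt_trans (_ : e / 2 < e); last by lra.
by apply: rnorm_op_le => [|x]; [exact: ltW|rewrite op_subE; exact: (lle _ _ _ hN)].
Unshelve. all: by end_near. Qed.

End hilbert.

Section tsum.
Context {R : realType} {E : normedModType R[i]}.

Lemma partial_sumE (I : choiceType) (f : I -> E) (A : {fset I}) :
  summability.partial_sum f A = \sum_(i <- A) f i.
Proof. by rewrite big_seq_fsetE. Qed.

(** Summation with an explicit error: the tail of a majorant [b]. This quantitative form passes
    through bounded additive maps, reindexing and iterated sums. It is empty of content where the
    tails are infinite, hence the finiteness conditions that accompany it. *)
Definition has_tsum (I : countType) (b : I -> \bar R) (f : I -> E) (s : E) :=
  forall A : {fset I}, ((rnorm (s - \sum_(i <- A) f i))%:E <= tl b A)%E.

Lemma sum_diff_le (I : countType) (b : I -> \bar R) (f : I -> E) (A B : {fset I}) :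
  (forall i, (rnorm (f i))%:E <= b i)%E -> fsubset A B ->
  ((rnorm (\sum_(i <- B) f i - \sum_(i <- A) f i))%:E <= tl b A)%E.
Proof.
move=> fb AB; have b0 i : (0 <= b i)%E by apply: le_trans (fb i); rewrite lee_fin rnorm_ge0.
have -> : \sum_(i <- B) f i - \sum_(i <- A) f i = \sum_(i <- B) (if i \in A then 0 else f i).
  rewrite (bigID (fun i => i \in A))/=.
  have -> : \sum_(i <- B | i \in A) f i = \sum_(i <- A) f i.
    rewrite -big_filter; apply: perm_big; apply: uniq_perm => [||i].
    - by rewrite filter_uniq.
    - exact: fset_uniq.
    rewrite mem_filter; case: (boolP (i \in A)) => //= iA.
    by rewrite (fsubsetP AB).
  rewrite addrAC subrr add0r big_mkcond; apply: eq_bigr => i _.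
  by case: (i \in A).
apply: (@le_trans _ _ (\sum_(i <- B) (if i \in A then 0 else b i))%E).
  apply: (@le_trans _ _ (\sum_(i <- B) rnorm (if i \in A then 0 else f i))%:E).
    by rewrite lee_fin; exact: ler_rnorm_sum.
  rewrite -sumEFin; apply: lee_sum => i _; case: ifP => _; first by rewrite rnorm0.
  exact: fb.
rewrite [leRHS](esum_fset_tl B); last by move=> i; case: ifP.
by rewrite leeDl// tl_ge0// => i; case: ifP.
Qed.

Lemma has_tsum_exists (I : countType) (b : I -> \bar R) (f : I -> E) : cmplt E ->
  (forall i, (rnorm (f i))%:E <= b i)%E -> (\esum_(i in [set: I]) b i < +oo)%E ->
  exists s, has_tsum b f s.
Proof.
move=> cE fb boo; have b0 i : (0 <= b i)%E by apply: le_trans (fb i); rewrite lee_fin rnorm_ge0.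
have tlc := tl_seg_cvg b0 boo.
have subseg m n : (m <= n)%N -> fsubset (@seg I m) (seg n).
  by move=> mn; apply/fsubsetP => i; rewrite !in_seg => /leq_trans; apply.
have [s hs] : exists s : E, (\sum_(i <- seg n) f i) @[n --> \oo] --> s.
  apply: cE => e e0; have e2 : 0 < e / 3 by rewrite divr_gt0.
  have /(ge0_cvge0P _ (fun n => tl_ge0 (seg n) b0))/(_ _ e2)[N _ hN] := tlc.
  exists N => m n Nm Nn.
  have key k : (N <= k)%N -> rnorm (\sum_(i <- seg k) f i - \sum_(i <- seg N) f i) <= e / 3.
    move=> Nk; rewrite -lee_fin; apply: le_trans (sum_diff_le fb _) (hN N (leqnn N)).
    exact: subseg.
  rewrite -(subrKA (\sum_(i <- seg N) f i)); apply: le_lt_trans (ler_rnormD _ _) _.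
  have := key m Nm; have := key n Nn; rewrite (rnorm_distC (\sum_(i <- seg N) f i)).
  lra.
(* The set [A] is arbitrary, but it lies in [seg n] for large [n], and the bound on finite
   differences passes to the limit. *)
exists s => A; have [N hN] : exists N, forall n, (N <= n)%N -> fsubset A (seg n).
  exists (\max_(i <- A) (choice.pickle i).+1)%N => n An; apply/fsubsetP => i iA.
  by rewrite in_seg; apply: leq_trans An; apply: (@leq_bigmax_seq _ _ _ (fun i => (choice.pickle i).+1)).
have c : (rnorm (\sum_(i <- seg n) f i - \sum_(i <- A) f i))%:E @[n --> \oo] -->
    (rnorm (s - \sum_(i <- A) f i))%:E.
  apply: cvg_EFin; first exact: nearW.
  by apply: cvg_rnorm; apply: cvgB => //; exact: cvg_cst.
rewrite -(cvg_lim _ c)//; apply: lime_le; first by apply/cvg_ex; eexists; exact: c.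
by exists N => // n /= Nn; apply: sum_diff_le => //; exact: hN.
Qed.

Section basic.
Context (I : countType) (b : I -> \bar R) (f : I -> E) (s : E).
Hypothesis b0 : forall i, (0 <= b i)%E.
Hypothesis boo : (\esum_(i in [set: I]) b i < +oo)%E.
Hypothesis hs : has_tsum b f s.

Lemma has_tsum_cvg :
  (fun A : {fset I} => \sum_(i <- A) f i) A @[A --> summability.totally] --> s.
Proof.
have FF := @summability.totally_filter I.
apply/cvg_rnormP => e e0; have e2 : 0 < e / 2 by rewrite divr_gt0.
have /(ge0_cvge0P _ (fun A => tl_ge0 A b0))/(_ _ e2) := tl_cvg b0 boo.
apply: filterS => A hA; rewrite -lte_fin; apply: le_lt_trans (hs A) _.
by apply: le_lt_trans hA _; rewrite lte_fin; lra.
Qed.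

Lemma has_tsum_sum : summability.sum f = s.
Proof.
have FF := @summability.totally_filter I.
rewrite /summability.sum; apply: cvg_lim => //.
rewrite (_ : summability.partial_sum f = fun A => \sum_(i <- A) f i); first exact: has_tsum_cvg.
by apply/funext => A; exact: partial_sumE.
Qed.

Lemma has_tsum_norm : ((rnorm s)%:E <= \esum_(i in [set: I]) b i)%E.
Proof.
have := hs fset0; rewrite big_seq_fset0 subr0 => /le_trans; apply; exact: tl_le.
Qed.

End basic.

Lemma has_tsum_le (I : countType) (b b' : I -> \bar R) (f : I -> E) s :
  (forall i, b i <= b' i)%E -> has_tsum b f s -> has_tsum b' f s.
Proof.
move=> bb' hs A; apply: le_trans (hs A) _; apply: le_esumT => i.
by case: ifP => // _; exact: bb'.
Qed.

(** Fubini for unordered sums. Both sides are compared with the finite double sum over [A] times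
    [seg n]; as [n] grows the finitely many row tails vanish and the tail over [A] remains. *)
Lemma has_tsum_double (I J : countType) (b : I -> J -> \bar R) (t : I -> J -> E) (s : E)
    (r : I -> E) : (forall i j, 0 <= b i j)%E ->
  (\esum_(i in [set: I]) \esum_(j in [set: J]) b i j < +oo)%E ->
  has_tsum (fun p : I * J => b p.1 p.2) (fun p => t p.1 p.2) s ->
  (forall i, has_tsum (b i) (t i) (r i)) ->
  has_tsum (fun i => \esum_(j in [set: J]) b i j)%E r s.
Proof.
move=> b0 boo hs hr A; pose b' i := (\esum_(j in [set: J]) b i j)%E.
rewrite -/b'.
have b'0 i : (0 <= b' i)%E by exact: esum_ge0T.
have b'oo i : (b' i < +oo)%E by apply: le_lt_trans boo; exact: (esum_term (a := b')).
(* The row tails are counted twice: once in the tail of the double family outside the rectangle,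
   once when each row sum replaces its finite part. *)
have key n : ((rnorm (s - \sum_(i <- A) r i))%:E <=
    tl b' A + 2%:E * \sum_(i <- A) tl (b i) (seg n))%E.
  set B := @seg J n.
  pose AB : {fset I * J} := (A `*` B)%fset.
  have sAB : \sum_(p <- AB) t p.1 p.2 = \sum_(i <- A) \sum_(j <- B) t i j.
    transitivity (\sum_(p <- [seq (i, j) | i <- A, j <- B]) t p.1 p.2); last first.
      by rewrite big_allpairs.
    apply: perm_big; apply: uniq_perm => [||p].
    - exact: fset_uniq.
    - by apply: allpairs_uniq => // -[? ?] [? ?] _ _ [-> ->].
    rewrite in_fsetM; apply/andP/allpairsP => [[p1 p2]|[[i j] /= [iA jB ->]]] //.
    by exists p; split => //; case: p p1 p2.
  have tAB : (tl (fun p : I * J => b p.1 p.2) AB = tl b' A + \sum_(i <- A) tl (b i) B)%E.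
    rewrite /tl; transitivity (\esum_(i in [set: I]) \esum_(j in [set: J])
      (if (i, j) \in AB then 0 else b i j))%E.
      rewrite esum_esum; last by move=> i j _ _; case: ifP.
      rewrite (_ : _ `*`` _ = setT); last by apply/seteqP; split.
      by apply: eq_esum => -[i j] _.
    rewrite (esum_fset_tl A); last by move=> i; apply: esum_ge0T => j; case: ifP.
    rewrite addeC; congr (_ + _)%E.
      apply: eq_esum => i _; case: ifPn => // iA; apply: eq_esum => j _.
      by rewrite in_fsetM /= (negbTE iA).
    rewrite [LHS]big_seq_cond [RHS]big_seq_cond; apply: eq_bigr => i /andP[iA _].
    by apply: eq_esum => j _; rewrite in_fsetM /= iA.
  rewrite -(subrKA (\sum_(p <- AB) t p.1 p.2)).
  apply: (@le_trans _ _ ((rnorm (s - \sum_(p <- AB) t p.1 p.2))%:E +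
     (rnorm (\sum_(p <- AB) t p.1 p.2 - \sum_(i <- A) r i))%:E)%E).
    by rewrite -EFinD lee_fin ler_rnormD.
  apply: (@le_trans _ _ (tl b' A + \sum_(i <- A) tl (b i) B + \sum_(i <- A) tl (b i) B)%E).
    apply: leeD; first by rewrite -tAB; exact: hs.
    rewrite sAB rnorm_distC -sumrB.
    apply: (@le_trans _ _ (\sum_(i <- A) rnorm (r i - \sum_(j <- B) t i j))%:E).
      by rewrite lee_fin; exact: ler_rnorm_sum.
    by rewrite -sumEFin; apply: lee_sum => i _; exact: hr.
  rewrite -addeA leeD2l// (_ : 2%:E = 1 + 1)%E; last by rewrite -EFinD.
  rewrite ge0_muleDl// mul1e//.
have c : (tl b' A + 2%:E * \sum_(i <- A) tl (b i) (seg n))%E @[n --> \oo] --> (tl b' A + 2%:E * 0)%E.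
  apply: cvgeD => //.
  - by rewrite mule0 fin_num_adde_defl.
  - exact: cvg_cst.
  apply: cvgeZl => //.
  have c0 : (\sum_(i <- A) tl (b i) (seg n))%E @[n --> \oo] --> (\sum_(i <- A) (0 : \bar R))%E.
    apply: cvg_nnesum => [i _|i _]; first by near=> n; exact: tl_ge0.
    by apply: tl_seg_cvg => //; exact: b'oo.
  by rewrite big1 in c0.
rewrite mule0 adde0 in c; rewrite -(cvg_lim _ c)//; apply: lime_ge.
  by apply/cvg_ex; eexists; exact: c.
exact: nearW.
Unshelve. all: by end_near. Qed.

End tsum.

(** * Orthonormal bases and Borel functions *)

Section orthonormal_basis.
Context {R : realType} {H : hilbertType R}.
Implicit Types x y z : H.
Local Notation Re := (@complex.Re R).

Lemma rnorm_sqrD x y : rnorm (x + y) ^+ 2 =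
  rnorm x ^+ 2 + rnorm y ^+ 2 + 2 * Re (inner x y).
Proof.
have h : (rnorm (x + y) ^+ 2)%:C = (rnorm x ^+ 2)%:C + (rnorm y ^+ 2)%:C + (inner x y + (inner x y)^*%R).
  by rewrite -!inner_rnorm innerDl !innerDr -(innerC y x); ring.
have := congr1 Re h; rewrite /= !ReD /= => ->; congr (_ + _).
by case: (inner x y) => a b /=; rewrite mulr2n mulrDl mul1r.
Qed.

Lemma rnorm_sqrD_orth x y : inner x y = 0 -> rnorm (x + y) ^+ 2 = rnorm x ^+ 2 + rnorm y ^+ 2.
Proof. by move=> xy; rewrite rnorm_sqrD xy mulr0 addr0. Qed.

(** A vector dependent on its predecessors yields 0 and is kept, so the family is indexed by all of
    [nat], also in finite dimension; the zero entries contribute nothing to Parseval sums. *)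
Definition unit_or_0 x : H := if x == 0 then 0 else (rnorm x)^-1%:C *: x.

Lemma unit_or_0P x : unit_or_0 x = 0 \/ rnorm (unit_or_0 x) = 1.
Proof.
rewrite /unit_or_0; case: eqVneq => [_|x0]; [by left|right].
rewrite rnormRZ ger0_norm ?invr_ge0 ?rnorm_ge0// mulVf//.
by apply: contra_neq x0; exact: rnorm_eq0.
Qed.

Section gram_schmidt.
Variable c : nat -> H.

Fixpoint gs n : seq H := if n is n'.+1 then
  rcons (gs n') (unit_or_0 (c n' - \sum_(e <- gs n') inner (c n') e *: e)) else [::].

Definition onb n : H := nth 0 (gs n.+1) n.

Lemma size_gs n : size (gs n) = n.
Proof. by elim: n => //= n ih; rewrite size_rcons ih. Qed.

Lemma gsE n : gs n = mkseq onb n.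
Proof.
elim: n => //= n ih; rewrite mkseqS -ih; congr rcons.
by rewrite /onb /= nth_rcons size_gs ltnn eqxx.
Qed.

Definition proj n z : H := \sum_(i < n) inner z (onb i) *: onb i.

Lemma onbE n : onb n = unit_or_0 (c n - proj n (c n)).
Proof.
rewrite /onb /= nth_rcons size_gs ltnn eqxx; congr (unit_or_0 (_ - _)).
by rewrite gsE big_map -val_enum_ord big_map big_enum.
Qed.

Lemma onb_01 n : onb n = 0 \/ rnorm (onb n) = 1.
Proof. by rewrite onbE; exact: unit_or_0P. Qed.

(** Orthogonality is a premise for indices below [n] only, because the induction that proves it
    calls this lemma. *)
Lemma inner_proj_onb n z i : (forall j k, (j < n)%N -> (k < n)%N -> j != k -> inner (onb j) (onb k) = 0) ->
  (i < n)%N -> inner (proj n z) (onb i) = inner z (onb i).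
Proof.
move=> orth ni; rewrite /proj inner_suml (bigD1 (Ordinal ni))//= big1 ?addr0.
  rewrite innerZl; case: (onb_01 i) => [->|e1]; first by rewrite !inner0r mulr0.
  by rewrite inner_rnorm e1 expr1n mulr1.
by move=> j ji; rewrite innerZl orth ?mulr0.
Qed.

Lemma onb_orth_lt n : forall j k, (j < n)%N -> (k < n)%N -> j != k -> inner (onb j) (onb k) = 0.
Proof.
elim: n => // n ih.
have key j : (j < n)%N -> inner (onb n) (onb j) = 0.
  move=> jn; rewrite onbE /unit_or_0; case: ifP => _; first by rewrite inner0l.
  by rewrite innerZl innerBl inner_proj_onb// subrr mulr0.
move=> j k; rewrite ltnS leq_eqVlt => /predU1P[->|jn]; rewrite ltnS leq_eqVlt => /predU1P[->|kn].
- by rewrite eqxx.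
- by move=> _; exact: key.
- by move=> _; rewrite innerC key// conjC0.
- exact: ih.
Qed.

Lemma onb_orth j k : j != k -> inner (onb j) (onb k) = 0.
Proof. by apply: (@onb_orth_lt (maxn j k).+1); rewrite ltnS ?leq_maxl ?leq_maxr. Qed.

Lemma inner_proj n z i : (i < n)%N -> inner (proj n z) (onb i) = inner z (onb i).
Proof. by apply: inner_proj_onb => j k _ _; exact: onb_orth. Qed.

Lemma inner_sumr (I : Type) (r : seq I) (F : I -> H) y :
  inner y (\sum_(i <- r) F i) = \sum_(i <- r) inner y (F i).
Proof. exact: linear_sumr. Qed.

Lemma orth_proj n z y : inner (z - proj n z) (proj n y) = 0.
Proof.
rewrite {2}/proj inner_sumr big1// => i _.
by rewrite innerZr innerBl inner_proj// subrr mulr0.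
Qed.

Lemma rnorm_proj n z : rnorm (proj n z) ^+ 2 =
  \sum_(i < n) rnorm (inner z (onb i) : R[i]^o) ^+ 2.
Proof.
apply: (@complexI R); rewrite -inner_rnorm {2}/proj inner_sumr rmorph_sum/=.
apply: eq_bigr => i _; rewrite innerZr inner_proj// mulrC -(normCK (inner z (onb i))).
by rewrite -rnormE rmorphXn.
Qed.

Lemma bessel n z : rnorm z ^+ 2 = rnorm (z - proj n z) ^+ 2 +
  \sum_(i < n) rnorm (inner z (onb i) : R[i]^o) ^+ 2.
Proof. by rewrite -rnorm_proj -rnorm_sqrD_orth ?subrK// orth_proj. Qed.

Lemma proj_span n m : (m < n)%N -> proj n (c m) = c m.
Proof.
elim: n => // n ih; rewrite ltnS leq_eqVlt => /predU1P[->|mn]; last first.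
  rewrite /proj big_ord_recr /= -/(proj n (c m)) ih// -[in X in inner X _](ih mn).
  have -> : inner (proj n (c m)) (onb n) = 0.
    rewrite /proj inner_suml big1// => i _; rewrite innerZl onb_orth ?mulr0//.
    by rewrite neq_ltn ltn_ord.
  by rewrite scale0r addr0.
rewrite /proj big_ord_recr /= -/(proj n (c n)).
suff -> : inner (c n) (onb n) *: onb n = c n - proj n (c n) by rewrite addrC subrK.
set y := c n - proj n (c n).
have cE : inner (c n) (onb n) = inner y (onb n).
  rewrite /y innerBl (_ : inner (proj n (c n)) (onb n) = 0) ?subr0//.
  rewrite /proj inner_suml big1// => i _; rewrite innerZl onb_orth ?mulr0//.
  by rewrite neq_ltn ltn_ord.
rewrite cE onbE -/y /unit_or_0; case: eqVneq => [->|y0]; first by rewrite inner0l scale0r.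
have ry : rnorm y != 0 by apply: contra_neq y0; exact: rnorm_eq0.
rewrite innerZr inner_rnorm scalerA.
have -> : (((rnorm y)^-1)%:C)^*%R = ((rnorm y)^-1)%:C :> R[i].
  by rewrite conj_Creal// complex_real.
rewrite -!rmorphM/= expr2 mulrA mulVf// mul1r mulfV//.
by rewrite scale1r.
Qed.

(** Best approximation: [c m] is fixed by the projection, so [z - c m] splits orthogonally into
    [z - proj n z] and [proj n (z - c m)]. *)
Lemma proj_dist n z m : (m < n)%N -> rnorm (z - proj n z) <= rnorm (z - c m).
Proof.
move=> mn; rewrite -(@ler_pXn2r _ 2)// ?nnegrE ?rnorm_ge0//.
have -> : z - c m = (z - proj n z) + (proj n (z - c m)).
  have pB : proj n (z - c m) = proj n z - proj n (c m).
    by rewrite /proj -sumrB; apply: eq_bigr => i _; rewrite innerBl scalerBl.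
  by rewrite pB proj_span// addrA subrK.
by rewrite [leRHS]rnorm_sqrD_orth ?orth_proj// lerDl sqr_ge0.
Qed.

Hypothesis c_dense : forall z (e : R), 0 < e -> exists m, rnorm (z - c m) < e.

Lemma proj_cvg z : proj n z @[n --> \oo] --> z.
Proof.
apply/cvg_rnormP => e e0; have [m hm] := c_dense z e0.
by exists m.+1 => // n /= mn; apply: le_lt_trans hm; exact: proj_dist.
Qed.

Lemma parseval z :
  (\sum_(i <oo) (rnorm (inner z (onb i) : R[i]^o) ^+ 2)%:E = (rnorm z ^+ 2)%:E)%E.
Proof.
apply/cvg_lim => //.
rewrite (_ : (fun n => _) = fun n => (rnorm z ^+ 2 - rnorm (z - proj n z) ^+ 2)%:E).
  apply: cvg_EFin; first exact: nearW.
  rewrite -[X in _ --> X]subr0; apply: cvgB; first exact: cvg_cst.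
  have h : rnorm (z - proj n z) @[n --> \oo] --> (0 : R) by apply/cvg_rnorm0P; exact: proj_cvg.
  by have h2 := cvgM h h; rewrite mulr0 in h2; exact: h2.
apply/funext => n; rewrite sumEFin big_mkord; congr EFin.
by rewrite [in RHS](bessel n z) addrAC subrr add0r.
Qed.

(** By Parseval the inner sums are [|A e_r|^2]. Expanding [x] in the basis then bounds [|A x|] by a
    sum of products, which is estimated against a number [M] whose square slightly exceeds the
    double sum. *)
Lemma op_norm_HS (A : bounded_op H) :
  (((rnorm A) ^+ 2)%:E <= \sum_(r <oo) \sum_(s <oo)
     (rnorm (inner (A (onb r)) (onb s) : R[i]^o) ^+ 2)%:E)%E.
Proof.
under eq_eseriesr do rewrite parseval.
set S := (\sum_(r <oo) _)%E.
have S0 : (0 <= S)%E by apply: nneseries_ge0 => n _ _; rewrite lee_fin sqr_ge0.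
have [->|Soo] := eqVneq S +oo%E; first by rewrite leey.
have Sfin : S \is a fin_num by rewrite ge0_fin_numE// ltey.
have Sn n : \sum_(i < n) rnorm (A (onb i)) ^+ 2 <= fine S.
  rewrite -lee_fin fineK// -sumEFin -(big_mkord xpredT (fun i => (rnorm (A (onb i)) ^+ 2)%:E)).
  by apply: nneseries_lim_ge => i _ _; rewrite lee_fin sqr_ge0.
rewrite -(fineK Sfin); apply/lee_addgt0Pr => e e0; rewrite -EFinD lee_fin.
(* The margin [e] keeps [M] invertible even when the double sum vanishes. *)
have M0 : 0 < fine S + e by rewrite ltr_wpDl// fine_ge0.
set M := Num.sqrt (fine S + e).
have Mp : 0 < M by rewrite sqrtr_gt0.
have M2 : M ^+ 2 = fine S + e by rewrite sqr_sqrtr// ltW.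
rewrite -M2 ler_pXn2r// ?nnegrE ?rnorm_ge0 ?(ltW Mp)//.
apply: op_norm_le => x x1.
have c1 : rnorm (A (proj n x)) @[n --> \oo] --> rnorm (A x).
  apply: cvg_rnorm; apply/cvg_rnormP => d d0.
  have A1 : 0 < rnorm A + 1 by rewrite ltr_wpDl// rnorm_ge0.
  have /cvg_rnormP/(_ _ (divr_gt0 d0 A1)) := (@proj_cvg x).
  apply: filterS => n hn; rewrite -linearB/=; apply: le_lt_trans (op_bound _ _) _.
  move: hn; rewrite ltr_pdivlMr// mulrC; apply: le_lt_trans.
  by rewrite ler_wpM2r ?rnorm_ge0// lerDl.
rewrite -(cvg_lim _ c1)//; apply: limr_le; first by apply/cvg_ex; eexists; exact: c1.
apply: nearW => n; rewrite linear_sum/=; apply: le_trans (ler_rnorm_sum _ _ _) _.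
(* The weight [M] is chosen so that, summed over the basis, each of the two halves is at most
   [M / 2]. *)
have amgm (a b : R) : a * b <= (M * a ^+ 2 + M^-1 * b ^+ 2) / 2.
  have : 0 <= (M * a - b) ^+ 2 / M by rewrite divr_ge0 ?sqr_ge0// ltW.
  have -> : (M * a - b) ^+ 2 / M = M * a ^+ 2 + M^-1 * b ^+ 2 - 2 * (a * b).
    by field; rewrite gt_eqF.
  lra.
apply: (@le_trans _ _ (\sum_(i < n) (M * rnorm (inner x (onb i) : R[i]^o) ^+ 2 + M^-1 * rnorm (A (onb i)) ^+ 2) / 2)).
  by apply: ler_sum => i _; rewrite linearZ/= rnormZ; exact: amgm.
rewrite -mulr_suml big_split/= -!mulr_sumr.
have h1 : \sum_(i < n) rnorm (inner x (onb i) : R[i]^o) ^+ 2 <= 1.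
  apply: (@le_trans _ _ (rnorm x ^+ 2)); first by rewrite (bessel n x) lerDr sqr_ge0.
  by rewrite expr_le1// rnorm_ge0.
have h2 : M^-1 * \sum_(i < n) rnorm (A (onb i)) ^+ 2 <= M.
  rewrite ler_pdivrMl// -expr2 M2; apply: le_trans (Sn n) _; rewrite lerDl ltW//.
have h3 : M * \sum_(i < n) rnorm (inner x (onb i) : R[i]^o) ^+ 2 <= M.
  by rewrite -[leRHS]mulr1 ler_wpM2l// ltW.
lra.
Qed.

End gram_schmidt.

Lemma dense_seq : (exists2 S : set H, countable S & dense S) ->
  exists c : nat -> H, forall z (e : R), 0 < e -> exists m, rnorm (z - c m) < e.
Proof.
move=> [S cS dS].
have [f finj] : exists f : H -> nat, set_inj S f by exact/countable_injP.
exists (fun n => xget 0 [set x | S x /\ f x = n]) => z e e0.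
have /dS : (ball z e%:C) !=set0 by exists z; apply: ballxx; rewrite ltcR.
move=> /(_ (ball_open _ _)) [x [zx Sx]].
exists (f x); case: xgetP => [y _ /= [Sy fy]|/(_ x)[]//].
rewrite (finj y x) ?inE//.
by move: zx; rewrite -ball_normE /= -rnormE ltcR.
Qed.

End orthonormal_basis.

Section borel.
Context d (T : measurableType d) {R : realType}.
Implicit Types (E : normedModType R[i]).

Lemma msimple_borel E (s : T -> E) : msimple s -> borel_fun s.
Proof. by move=> [_ h] U _; exact: h. Qed.

Lemma borel_lim E (s : nat -> T -> E) (f : T -> E) : (forall n, borel_fun (s n)) ->
  (forall x, s n x @[n --> \oo] --> f x) -> borel_fun f.
Proof.
move=> bs sf U oU.
(* Points lying at depth [1 / (m + 1)] inside [U], made open by taking the interior. The limit is in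
   [U] exactly when the sequence is eventually in some [V m]. *)
pose V (m : nat) : set E := (interior [set y | ball y (m.+1%:R^-1 : R)%:C `<=` U]).
have oV m : open (V m) by exact: open_interior.
rewrite (_ : f @^-1` U = \bigcup_m \bigcup_N \bigcap_(n in [set n | (N <= n)%N]) (s n @^-1` V m)).
  apply: bigcupT_measurable => m; apply: bigcupT_measurable => N.
  by apply: bigcap_measurable => [|n _]; [exists N => /=|exact: bs].
have e0 (m : nat) : 0 < (m.+1%:R^-1 : R) by rewrite invr_gt0.
apply/seteqP; split => [x /= Ux|x [m _ [N _ /= hN]]].
  have [e /= e_gt0 eU] : exists2 e : R, 0 < e & ball (f x) e%:C `<=` U.
    have /nbhs_ballP[e /= e0' eU] : nbhs (f x) U by exact: open_nbhs_nbhs.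
    have eE : (complex.Re e)%:C = e by rewrite RRe_real// gtr0_real.
    by exists (complex.Re e); [rewrite -ltcR eE|rewrite eE].
  have e3 : 0 < e / 3 by rewrite divr_gt0.
  have [m hm] : exists m : nat, (m.+1%:R^-1 : R) < e / 3.
    have := ltr_add_invr (ltr01 : 0 < (1:R)).
    exists (Num.truncn (e / 3)^-1).
    rewrite -[ltRHS]invrK ltf_pV2 ?posrE ?invr_gt0//.
    by apply: truncnS_gt.
  have /cvg_rnormP/(_ _ e3)[N _ hN] := sf x.
  exists m => //; exists N => // n /= Nn; rewrite /V /interior /=.
  apply/nbhs_ballP; exists (e / 3)%:C; first by rewrite /= ltcR.
  move=> y; rewrite -ball_normE /= -rnormE ltcR => sy z.
  rewrite /= -rnormE ltcR => yz; apply: eU.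
  rewrite -ball_normE /= -rnormE ltcR.
  have := hN n Nn; move: sy yz => /=.
  have := ler_rnormD (f x - s n x) (s n x - z); rewrite subrKA.
  have := ler_rnormD (s n x - y) (y - z); rewrite subrKA.
  move: hm; move: (m.+1%:R^-1 : R) => q.
  lra.
have /cvg_rnormP/(_ _ (e0 m))[N' _ hN'] := sf x.
have := hN (maxn N N') (leq_maxl _ _) => /interior_subset /=; apply.
rewrite -ball_normE /= -rnormE ltcR rnorm_distC.
by apply: hN'; exact: leq_maxr.
Qed.

Lemma aplim_borel E (f : T -> E) : aplim f -> borel_fun f.
Proof. by move=> [s [ms sf]]; apply: (borel_lim _ sf) => n; exact: msimple_borel. Qed.

Lemma open_rnorm_lt E (a b : E) : open [set z : E | rnorm (z - a) < rnorm (z - b)].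
Proof.
rewrite openE => z /= zab; apply/nbhs_ballP.
pose e := (rnorm (z - b) - rnorm (z - a)) / 2.
have e0 : 0 < e by rewrite divr_gt0// subr_gt0.
exists e%:C; first by rewrite /= ltcR.
move=> y; rewrite -ball_normE /= -rnormE ltcR => zy.
have := ler_rnormD (y - z) (z - a); rewrite subrKA (rnorm_distC y) => h1.
have := ler_rnormD (z - y) (y - b); rewrite subrKA => h2.
rewrite /e in zy; lra.
Qed.

(** The approximant is the best candidate so far, starting from 0: at stage [n] the value switches
    to [c n] where that is strictly closer to [f x]. The switching set is measurable because
    comparing distances to two fixed points is an open condition. The distance never increases, and
    density makes it small. *)
Lemma borel_aplim E (f : T -> E) (c : nat -> E) :
  (forall z (e : R), 0 < e -> exists m, rnorm (z - c m) < e) ->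
  borel_fun f -> aplim f.
Proof.
move=> cd bf.
pose s := fix s n : T -> E := if n is n'.+1 then
  (fun x => if rnorm (f x - c n') < rnorm (f x - s n' x) then c n' else s n' x) else cst 0.
have sS n x : s n.+1 x = if rnorm (f x - c n) < rnorm (f x - s n x) then c n else s n x by [].
exists s; split.
  elim=> [|n ih]; first exact: msimple_cst.
  pose A := [set x | rnorm (f x - c n) < rnorm (f x - s n x)].
  have mA : measurable A.
    rewrite (_ : A = \bigcup_(y in range (s n)) (s n @^-1` [set y] `&`
      f @^-1` [set z | rnorm (z - c n) < rnorm (z - y)])).
      apply: fin_bigcup_measurable; first by have [] := ih.
      move=> y _; apply: measurableI; first by have [_] := ih; apply.
      by apply: bf; exact: open_rnorm_lt.
    apply/seteqP; split => [x Ax|x [y _ [/= <-//]]].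
    by exists (s n x) => //; exists x.
  apply: (msimple2 (fun (b : bool) y => if b then c n else y)
    (s := fun x => rnorm (f x - c n) < rnorm (f x - s n x))) => //.
  have := @msimple_indic _ T bool A true false mA.
  congr msimple; apply/funext => x; case: (boolP (x \in A)); rewrite ?inE; first by move=> ->.
  by move=> /negP h; apply/esym/negP => Ax; apply: h; rewrite inE.
move=> x; apply/cvg_rnormP => e e0; have [m hm] := cd (f x) e e0.
exists m.+1 => // n; elim: n => // n ih; rewrite /= ltnS leq_eqVlt => /predU1P[<-|mn].
  by case: ifPn => // /negP/negP; rewrite -leNgt => /le_lt_trans; apply.
have := ih mn; case: ifPn => // h1 h2; exact: lt_trans h1 h2.
Qed.

Lemma aplim_phi3 E1 E2 E3 E4 (Phi : E1 -> E2 -> E3 -> E4) (f : T -> E1) (g : T -> E2) (h : T -> E3) :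
  (forall (a : nat -> E1) (b : nat -> E2) (c : nat -> E3) a0 b0 c0,
    a n @[n --> \oo] --> a0 -> b n @[n --> \oo] --> b0 -> c n @[n --> \oo] --> c0 ->
    Phi (a n) (b n) (c n) @[n --> \oo] --> Phi a0 b0 c0) ->
  aplim f -> aplim g -> aplim h -> aplim (fun x => Phi (f x) (g x) (h x)).
Proof.
move=> cPhi [s [ms sf]] [t [mt tg]] [r [mr rh]].
exists (fun n x => Phi (s n x) (t n x) (r n x)); split.
  move=> n; apply: (msimple2 (fun u v => Phi u.1 u.2 v) (s := fun x => (s n x, t n x))) => //.
  exact: (msimple2 (fun u v => (u, v))).
by move=> x; exact: cPhi.
Qed.

Lemma aplim_cst E (c : E) : aplim (fun _ : T => c).
Proof. by apply: msimple_aplim; exact: msimple_cst. Qed.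

Lemma aplim_if E (A : set T) (f g : T -> E) : measurable A -> aplim f -> aplim g ->
  aplim (fun x => if x \in A then f x else g x).
Proof.
move=> mA [s [ms sf]] [t [mt tg]].
exists (fun n x => if x \in A then s n x else t n x); split.
  move=> n; apply: (msimple2 (fun (u : bool) v => if u then v.1 else v.2)
     (s := fun x => x \in A) (t := fun x => (s n x, t n x))).
    have := @msimple_indic _ T bool A true false mA.
    by congr msimple; apply/funext => x; case: (x \in A).
  exact: (msimple2 (fun u v => (u, v))).
by move=> x; case: (x \in A).
Qed.

Lemma aplim_sum E (I : Type) (r : seq I) (F : I -> T -> E) : (forall i, aplim (F i)) ->
  aplim (fun x => \sum_(i <- r) F i x).
Proof.
move=> aF; elim: r => [|i r ih].
  by under eq_fun do rewrite big_nil; exact: aplim_cst.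
under eq_fun do rewrite big_cons.
apply: (@aplim_phi3 _ _ E _ (fun u v _ => u + v) _ _ (cst 0)) => //; last exact: aplim_cst.
by move=> a b c a0 b0 c0 ha hb _; exact: cvgD.
Qed.

End borel.

Section borel_translate.
Context {R : realType} {d : nat} (E : normedModType R[i]).

End borel_translate.

(** * Complex integrals and characters *)

Section complex_integral.
Context d (T : measurableType d) (R : realType).
Variable mu : {measure set T -> \bar R}.
Local Notation Re := (@complex.Re R).
Local Notation Im := (@complex.Im R).
Implicit Types (D : set T) (f g : T -> R[i]).

Definition cmeas f := measurable_fun setT (fun x => Re (f x)) /\
  measurable_fun setT (fun x => Im (f x)).

Definition cint D f : R[i] :=
  (fine (\int[mu]_(x in D) (Re (f x))%:E)) +i* (fine (\int[mu]_(x in D) (Im (f x))%:E)).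

Definition cintegrable D f := mu.-integrable D (fun x => (Re (f x))%:E) /\
  mu.-integrable D (fun x => (Im (f x))%:E).

Lemma cmeas_rnorm f : cmeas f -> measurable_fun setT (fun x => rnorm (f x : R[i]^o)).
Proof.
move=> [mr mi]; rewrite (_ : (fun _ => _) = fun x => Num.sqrt (Re (f x) ^+ 2 + Im (f x) ^+ 2)).
  apply: (measurableT_comp (continuous_measurable_fun (@sqrt_continuous R))).
  by apply: measurable_funD; exact: measurable_funX.
by apply/funext => x; rewrite rnormCE.
Qed.

Lemma cmeasD f g : cmeas f -> cmeas g -> cmeas (fun x => f x + g x).
Proof.
move=> [fr fi] [gr gi]; split.
  by rewrite (_ : (fun _ => _) = (fun x => Re (f x)) \+ (fun x => Re (g x)));
   [exact: measurable_funD|apply/funext => x; rewrite /= ReD].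
by rewrite (_ : (fun _ => _) = (fun x => Im (f x)) \+ (fun x => Im (g x)));
   [exact: measurable_funD|apply/funext => x; rewrite /= ImD].
Qed.

Lemma cmeasM f g : cmeas f -> cmeas g -> cmeas (fun x => f x * g x).
Proof.
move=> [fr fi] [gr gi]; split.
  rewrite (_ : (fun _ => _) = ((fun x => Re (f x)) \* (fun x => Re (g x))) \-
    ((fun x => Im (f x)) \* (fun x => Im (g x)))).
    by apply: measurable_funB; exact: measurable_funM.
  by apply/funext => x; rewrite ReM.
rewrite (_ : (fun _ => _) = ((fun x => Re (f x)) \* (fun x => Im (g x))) \+
    ((fun x => Im (f x)) \* (fun x => Re (g x)))).
  by apply: measurable_funD; exact: measurable_funM.
by apply/funext => x; rewrite ImM.
Qed.

Lemma cmeas_cst (c : R[i]) : cmeas (fun=> c).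
Proof. by split; exact: measurable_cst. Qed.

Lemma cmeas_conj f : cmeas f -> cmeas (fun x => (f x)^*%R).
Proof.
move=> [fr fi]; split.
  by rewrite (_ : (fun _ => _) = (fun x => Re (f x)))//; apply/funext => x; case: (f x).
rewrite (_ : (fun _ => _) = \- (fun x => Im (f x))); first exact: measurable_funN.
by apply/funext => x /=; case: (f x).
Qed.

Lemma cmeas_real (u : T -> R) : measurable_fun setT u -> cmeas (fun x => (u x)%:C).
Proof. by split => //=; exact: measurable_cst. Qed.

Lemma cintegrable_le D f : measurable D -> cmeas f ->
  (\int[mu]_(x in D) (rnorm (f x : R[i]^o))%:E < +oo)%E -> cintegrable D f.
Proof.
move=> mD mf foo; have [mr mi] := mf; have mn := cmeas_rnorm mf.
split; apply/integrableP; (split; first by apply: measurable_funTS; exact/measurable_EFinP).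
  apply: le_lt_trans foo; apply: ge0_le_integral => //.
  - by apply: measurable_funTS; apply: measurableT_comp => //; exact/measurable_EFinP.
  - by apply: measurable_funTS; exact/measurable_EFinP.
  - by move=> x _; rewrite lee_fin ler_Re_rnorm.
apply: le_lt_trans foo; apply: ge0_le_integral => //.
- by apply: measurable_funTS; apply: measurableT_comp => //; exact/measurable_EFinP.
- by apply: measurable_funTS; exact/measurable_EFinP.
- by move=> x _; rewrite lee_fin ler_Im_rnorm.
Qed.

Variable D : set T.
Hypothesis mD : measurable D.

Lemma cintegrableD f g : cintegrable D f -> cintegrable D g -> cintegrable D (fun x => f x + g x).
Proof.
move=> [fr fi] [gr gi]; split.
  by under eq_fun do rewrite ReD EFinD; exact: integrableD.
by under eq_fun do rewrite ImD EFinD; exact: integrableD.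
Qed.

Lemma cintegrableZ (c : R[i]) f : cintegrable D f -> cintegrable D (fun x => c * f x).
Proof.
move=> [fr fi]; split.
  by under eq_fun do rewrite ReM EFinB !EFinM; apply: integrableB => //; exact: integrableZl.
by under eq_fun do rewrite ImM EFinD !EFinM; apply: integrableD => //; exact: integrableZl.
Qed.

Lemma cintegrable0 : cintegrable D (fun=> 0).
Proof. by split; exact: integrable0. Qed.

Lemma cintegrable_sum (I : Type) (r : seq I) (F : I -> T -> R[i]) :
  (forall i, cintegrable D (F i)) -> cintegrable D (fun x => \sum_(i <- r) F i x).
Proof.
move=> iF; elim: r => [|i r ih].
  by under eq_fun do rewrite big_nil; exact: cintegrable0.
by under eq_fun do rewrite big_cons; exact: cintegrableD.
Qed.

Lemma cintD f g : cintegrable D f -> cintegrable D g ->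
  cint D (fun x => f x + g x) = cint D f + cint D g.
Proof.
move=> [fr fi] [gr gi]; apply: complexE2; rewrite ?ReD ?ImD /=.
  under eq_integral do rewrite ReD EFinD.
  by rewrite integralD//= fineD//; exact: integrable_fin_num.
under eq_integral do rewrite ImD EFinD.
by rewrite integralD//= fineD//; exact: integrable_fin_num.
Qed.

Lemma cintZ (c : R[i]) f : cintegrable D f -> cint D (fun x => c * f x) = c * cint D f.
Proof.
move=> [fr fi]; apply: complexE2; rewrite ?ReM ?ImM /=.
  under eq_integral do rewrite ReM EFinB !EFinM.
  rewrite integralB//=; [|exact: integrableZl..].
  by rewrite !integralZl//= fineB ?fineM//= ?fin_numM//; exact: integrable_fin_num.
under eq_integral do rewrite ImM EFinD !EFinM.
rewrite integralD//=; [|exact: integrableZl..].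
by rewrite !integralZl//= fineD ?fineM//= ?fin_numM//; exact: integrable_fin_num.
Qed.

Lemma cint0 : cint D (fun=> 0) = 0.
Proof. by rewrite /cint /= integral0. Qed.

Lemma cint_sum (I : Type) (r : seq I) (F : I -> T -> R[i]) :
  (forall i, cintegrable D (F i)) ->
  cint D (fun x => \sum_(i <- r) F i x) = \sum_(i <- r) cint D (F i).
Proof.
move=> iF; elim: r => [|i r ih].
  by under eq_fun do rewrite big_nil; rewrite big_nil cint0.
under eq_fun do rewrite big_cons; rewrite big_cons cintD// ?ih//.
exact: cintegrable_sum.
Qed.

Lemma eq_cint f g : (forall x, D x -> f x = g x) -> cint D f = cint D g.
Proof.
by move=> fg; apply: complexE2 => /=; congr fine; apply: eq_integral => x /set_mem /fg ->.
Qed.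

Definition cbounded f := cmeas f /\ exists M : R, forall x, rnorm (f x : R[i]^o) <= M.

Lemma cboundedD f g : cbounded f -> cbounded g -> cbounded (fun x => f x + g x).
Proof.
move=> [mf [M fM]] [mg [N gN]]; split; first exact: cmeasD.
by exists (M + N) => x; apply: le_trans (ler_rnormD _ _) (lerD _ _).
Qed.

Lemma cboundedM f g : cbounded f -> cbounded g -> cbounded (fun x => f x * g x).
Proof.
move=> [mf [M fM]] [mg [N gN]]; split; first exact: cmeasM.
by exists (M * N) => x; rewrite rnormCM ler_pM// ?rnorm_ge0.
Qed.

Lemma cbounded_cst (c : R[i]) : cbounded (fun=> c).
Proof. by split; [exact: cmeas_cst|exists (rnorm (c : R[i]^o))]. Qed.

Lemma cboundedN f : cbounded f -> cbounded (fun x => - f x).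
Proof.
by move=> bf; under eq_fun do rewrite -mulN1r; apply: cboundedM => //; exact: cbounded_cst.
Qed.

Lemma cbounded_conj f : cbounded f -> cbounded (fun x => (f x)^*%R).
Proof.
by move=> [mf [M fM]]; split; [exact: cmeas_conj|exists M => x; rewrite rnormC_conj].
Qed.

Lemma cbounded_sum (I : Type) (r : seq I) (F : I -> T -> R[i]) :
  (forall i, cbounded (F i)) -> cbounded (fun x => \sum_(i <- r) F i x).
Proof.
move=> mF; elim: r => [|i r ih].
  by under eq_fun do rewrite big_nil; exact: cbounded_cst.
by under eq_fun do rewrite big_cons; exact: cboundedD.
Qed.

Lemma cintegrableMb f g : cintegrable D f -> cmeas f -> cbounded g ->
  cintegrable D (fun x => f x * g x).
Proof.
move=> [fr fi] mf [mg [M gM]]; apply: cintegrable_le => //; first exact: cmeasM.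
have /integrableP[_ h] := integrableZl mD M (integrableD mD (integrable_abse fr) (integrable_abse fi)).
apply: le_lt_trans h; apply: ge0_le_integral => //.
- by move=> x _; rewrite lee_fin rnorm_ge0.
- by apply: measurable_funTS; apply/measurable_EFinP; apply: cmeas_rnorm; exact: cmeasM.
- apply: measurableT_comp => //; apply: measurable_funeM; apply: emeasurable_funD;
    apply: measurableT_comp => //; [exact: measurable_int fr|exact: measurable_int fi].
move=> x _; apply: le_trans (lee_abs _).
rewrite -[leRHS]/((M * (`|Re (f x)| + `|Im (f x)|))%:E) lee_fin rnormCM mulrC ler_pM ?rnorm_ge0//.
exact: rnormC_le.
Qed.

Hypothesis Dfin : (mu D < +oo)%E.

Lemma cbounded_integrable f : cbounded f -> cintegrable D f.
Proof.
move=> [mf [M fM]]; apply: cintegrable_le => //.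
apply: (@le_lt_trans _ _ (\int[mu]_(x in D) M%:E)%E).
  apply: ge0_le_integral => //.
  - by move=> x _; rewrite lee_fin rnorm_ge0.
  - by apply: measurable_funTS; apply/measurable_EFinP; exact: cmeas_rnorm.
  - by move=> x _; rewrite lee_fin.
rewrite integral_cst//; have [M0|M0] := leP 0 M.
  by apply: lte_mul_pinfty; rewrite ?lee_fin.
by apply: (@le_lt_trans _ _ 0%E); [rewrite mule_le0_ge0// lee_fin ltW|exact: ltry].
Qed.

End complex_integral.

Section bochner_cint.
Context d (T : measurableType d) (R : realType) (E : normedModType R[i]).
Variable mu : {measure set T -> \bar R}.
Local Notation Re := (@complex.Re R).
Local Notation Im := (@complex.Im R).

Lemma bochner_cint (Psi : E -> R[i]) (f : T -> E) (I : E) :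
  rfunctional (fun x => Re (Psi x)) -> rfunctional (fun x => Im (Psi x)) ->
  has_bochner_integral mu f I -> Psi I = cint mu setT (fun x => Psi (f x)).
Proof.
move=> pr pi fI; apply: complexE2 => /=.
  by rewrite -(rfunctional_bochner pr fI).
by rewrite -(rfunctional_bochner pi fI).
Qed.

Lemma cutoff_int (D : set T) (f : T -> E) (h : E -> R) : h 0 = 0 ->
  (\int[mu]_x (h (cutoff D f x))%:E = \int[mu]_(x in D) (h (f x))%:E)%E.
Proof.
move=> h0; rewrite [RHS]integral_mkcond; apply: eq_integral => x _.
rewrite /cutoff patchE indicE; case: (boolP (x \in D)) => xD; first by rewrite scale1r.
by rewrite scale0r h0.
Qed.

Lemma cint_cutoff (Psi : E -> R[i]) (D : set T) (f : T -> E) : Psi 0 = 0 ->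
  cint mu setT (fun x => Psi (cutoff D f x)) = cint mu D (fun x => Psi (f x)).
Proof.
move=> P0; apply: complexE2 => /=.
  by rewrite (cutoff_int D f (h := fun y => Re (Psi y))) ?P0.
by rewrite (cutoff_int D f (h := fun y => Im (Psi y))) ?P0.
Qed.

End bochner_cint.

Section characters.
Context {R : realType} {d : nat}.
Local Notation Rd := 'rV[R]_d.
Local Notation Zd := 'rV[int]_d.
Local Notation Re := (@complex.Re R).
Local Notation Im := (@complex.Im R).
Local Notation mu := (lebesgue_rV d).

Lemma cis2piD (s t : R) : cis2pi (s + t) = cis2pi s * cis2pi t.
Proof.
apply: complexE2; rewrite /cis2pi ?ReM ?ImM /= mulrDr; first exact: cosD.
by rewrite sinD addrC mulrC [X in _ + X]mulrC addrC mulrC [X in _ + X]mulrC.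
Qed.

Lemma cis2pi0 : cis2pi (0 : R) = 1.
Proof. by rewrite /cis2pi mulr0 cos0 sin0. Qed.

Lemma cis2piN (s : R) : cis2pi (- s) = (cis2pi s)^*%R.
Proof. by rewrite /cis2pi mulrN cosN sinN. Qed.

Lemma rnorm_cis2pi (s : R) : rnorm (cis2pi s : R[i]^o) = 1.
Proof. by rewrite rnormCE /= cos2Dsin2 sqrtr1. Qed.

Lemma cis2pi_nat (n : nat) : cis2pi (n%:R : R) = 1.
Proof.
elim: n => [|n ih]; first exact: cis2pi0.
rewrite -natr1 cis2piD ih mul1r /cis2pi mulr1 mulr2n mulrDl mul1r -mulr2n.
by rewrite cos2pi sin2pi.
Qed.

Lemma cis2pi_int (n : int) : cis2pi (n%:~R : R) = 1.
Proof.
case: n => n; first exact: cis2pi_nat.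
by rewrite NegzE rmorphN/= cis2piN cis2pi_nat conjC1.
Qed.

Lemma dotpDl (x y z : Rd) : dotp (x + y) z = dotp x z + dotp y z.
Proof. by rewrite /dotp -big_split/=; apply: eq_bigr => i _; rewrite mxE mulrDl. Qed.
Lemma dotpDr (x y z : Rd) : dotp x (y + z) = dotp x y + dotp x z.
Proof. by rewrite /dotp -big_split/=; apply: eq_bigr => i _; rewrite mxE mulrDr. Qed.
Lemma dotpNl (x z : Rd) : dotp (- x) z = - dotp x z.
Proof. by rewrite /dotp -sumrN; apply: eq_bigr => i _; rewrite mxE mulNr. Qed.
Lemma dotpZl (c : R) (x z : Rd) : dotp (c *: x) z = c * dotp x z.
Proof. by rewrite /dotp mulr_sumr; apply: eq_bigr => i _; rewrite mxE mulrA. Qed.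
Lemma dotpZr (c : R) (x z : Rd) : dotp x (c *: z) = c * dotp x z.
Proof. by rewrite /dotp mulr_sumr; apply: eq_bigr => i _; rewrite mxE mulrCA. Qed.

Lemma dotp_int (k l : Zd) : exists n : int, dotp (rV_of_int k) (rV_of_int l) = n%:~R :> R.
Proof.
exists (\sum_i k ord0 i * l ord0 i); rewrite /dotp rmorph_sum/=.
by apply: eq_bigr => i _; rewrite !mxE rmorphM.
Qed.

Variable a : R.
Hypothesis a0 : 0 < a.

Definition chi (l : Zd) (x : Rd) : R[i] := cis2pi (dotp (rV_of_int l) (a^-1 *: x)).

Lemma chiD l m x : chi (l + m) x = chi l x * chi m x.
Proof. by rewrite /chi rV_of_intD dotpDl cis2piD. Qed.

Lemma chi0 x : chi 0 x = 1.
Proof.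
rewrite /chi (_ : rV_of_int 0 = 0); last by apply/rowP => i; rewrite !mxE.
by rewrite -(scale0r (0 : Rd)) dotpZl mul0r cis2pi0.
Qed.

Lemma chiN l x : chi (- l) x = (chi l x)^*%R.
Proof. by rewrite /chi rV_of_intN dotpNl cis2piN. Qed.

Lemma chi_addx l x y : chi l (x + y) = chi l x * chi l y.
Proof. by rewrite /chi scalerDr dotpDr cis2piD. Qed.

Lemma chi_periodic l : Defs.periodic a (chi l).
Proof.
move=> x k; rewrite chi_addx [X in _ * X](_ : _ = 1) ?mulr1//.
rewrite /chi scalerA mulVf ?gt_eqF// scale1r.
by have [n ->] := dotp_int l k; exact: cis2pi_int.
Qed.

Lemma rnorm_chi l x : rnorm (chi l x : R[i]^o) = 1.
Proof. exact: rnorm_cis2pi. Qed.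

Lemma measurable_dotp (y : Rd) : measurable_fun setT (fun x : Rd => dotp y x).
Proof.
rewrite /dotp; apply: measurable_sum => i; apply: measurable_funM; first exact: measurable_cst.
exact: measurable_coord_rV.
Qed.

Lemma cmeas_cis (h : Rd -> R) : measurable_fun setT h -> cmeas (fun x => cis2pi (h x)).
Proof.
move=> mh; have m2 : measurable_fun setT (fun x : Rd => 2 * pi * h x).
  by apply: measurable_funM => //; exact: measurable_cst.
split => /=.
  by apply: (measurableT_comp (continuous_measurable_fun (@continuous_cos R))).
by apply: (measurableT_comp (continuous_measurable_fun (@continuous_sin R))).
Qed.

Lemma cmeas_chi l : cmeas (chi l).
Proof.
apply: cmeas_cis; rewrite (_ : (fun _ => _) = (fun x => a^-1 * dotp (rV_of_int l) x)).
  by apply: measurable_funM; [exact: measurable_cst|exact: measurable_dotp].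
by apply/funext => x; rewrite dotpZr.
Qed.

Lemma cbounded_chi l : cbounded (chi l).
Proof. by split; [exact: cmeas_chi|exists 1 => x; rewrite rnorm_chi]. Qed.

Lemma cube_fin : (mu (cube a) < +oo)%E.
Proof. by rewrite lebesgue_cube ?ltry// ltW. Qed.

Local Notation cintQ := (cint mu (cube a)).

Lemma cbounded_cube (f : Rd -> R[i]) : cbounded f -> cintegrable mu (cube a) f.
Proof. by apply: cbounded_integrable; [exact: measurable_cube|exact: cube_fin]. Qed.

(* a translation by half a period in the i-th coordinate changes the sign of chi l *)
Lemma cint_chi l : cintQ (chi l) = if l == 0 then (a ^+ d)%:C else 0.
Proof.
case: eqVneq => [->|l0].
  rewrite (@eq_cint _ _ _ mu (cube a) _ (fun=> 1)); last by move=> x _; exact: chi0.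
  rewrite /cint /= integral0 integral_cst; last exact: measurable_cube.
  by rewrite mul1e; apply: complexE2 => //=; rewrite (lebesgue_cube _ (ltW a0)).
have [i li] : exists i, l ord0 i != 0.
  apply: contrapT => h; move/eqP: l0; apply; apply/rowP => i; rewrite mxE.
  by apply: contrapT => li; apply: h; exists i; exact/eqP.
have li' : (l ord0 i)%:~R != 0 :> R by rewrite intr_eq0.
pose y : Rd := \row_j (if j == i then a / (2 * (l ord0 i)%:~R) else 0).
have chiy : chi l y = -1.
  have -> : chi l y = cis2pi 2^-1.
    rewrite /chi dotpZr /dotp (bigD1 i)//= big1 ?addr0.
      by rewrite !mxE eqxx; congr cis2pi; field; rewrite li' gt_eqF.
    by move=> j ji; rewrite !mxE (negbTE ji) mulr0.
  rewrite /cis2pi (_ : 2 * pi * 2^-1 = pi); last by field.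
  by rewrite cospi sinpi; apply: complexE2; rewrite //= oppr0.
have key (h : R[i] -> R) : (forall z, `|h z| <= rnorm (z : R[i]^o)) -> (forall z, h (- z) = - h z) ->
    measurable_fun setT (fun x => h (chi l x)) ->
    (\int[mu]_(x in cube a) (h (chi l x))%:E = 0)%E.
  move=> hb hN mh.
  have h1 x : -1 <= h (chi l x) <= 1.
    by rewrite -ler_norml -(rnorm_chi l x) hb.
  have ih : mu.-integrable (cube a) (fun x => (h (chi l x))%:E).
    apply: (@measurable_bounded_integrable _ _ _ mu (fun x => h (chi l x))).
    - exact: measurable_cube.
    - exact: cube_fin.
    - exact: measurable_funTS.
    exists 1; split=> // M M1 x _ /=; apply: le_trans (ltW M1).
    by rewrite ler_norml; exact: h1.
  have i1 : mu.-integrable (cube a) (fun x => 1%:E : \bar R).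
    apply: (@measurable_bounded_integrable _ _ _ mu (fun x => 1)).
    - exact: measurable_cube.
    - exact: cube_fin.
    - exact: measurable_cst.
    by exists 1; split=> // M M1 x _ /=; rewrite normr1 ltW.
  (* Adding 1 makes the integrand nonnegative, as the shift lemma demands. The shift replaces [h] by
     its opposite, so the integral of [h] equals its own negative. *)
  have := @ge0_integral_periodic_shift R d a a0 (fun x => (1 + h (chi l x))%:E) y.
  have mF : measurable_fun setT (fun x => (1 + h (chi l x))%:E).
    by apply/measurable_EFinP; apply: measurable_funD => //; exact: measurable_cst.
  move=> /(_ mF) H.
  have F0 x : (0 <= (1 + h (chi l x))%:E)%E.
    by rewrite lee_fin; have /andP[] := h1 x; lra.
  have {H} := H F0.
  have pF : Defs.periodic a (fun x => (1 + h (chi l x))%:E) by move=> x k; rewrite chi_periodic.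
  move=> /(_ pF).
  under eq_integral do rewrite chi_addx chiy mulrN1 hN EFinD EFinN.
  under [in RHS]eq_integral do rewrite EFinD.
  have mq := @measurable_cube R d a.
  rewrite (integralB mq i1 ih) (integralD mq i1 ih).
  move: (integrable_fin_num mq ih) (integrable_fin_num mq i1).
  move: (\int[mu]_(x in cube a) _)%E => u; move: (\int[mu]_(x in cube a) _)%E => v.
  case: u => // u; case: v => // v _ _; rewrite -!EFinD => -[] e; congr EFin.
  move: e; rewrite /= => e; lra.
have [mr mi] := cmeas_chi l.
apply: complexE2 => /=.
  rewrite (key Re)//; [exact: ler_Re_rnorm|by case].
rewrite (key Im)//; [exact: ler_Im_rnorm|by case].
Qed.

End characters.

(** * Approximation by trigonometric polynomials *)

Section threshold.
Context {R : realType}.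
Implicit Types (t u dlt th : R).

Lemma bernoulli_le u m : 0 <= u <= 1 -> 1 - m%:R * u <= (1 - u) ^+ m.
Proof.
move=> /andP[u0 u1]; elim: m => [|m ih]; first by rewrite mul0r subr0 expr0.
have m0 : 0 <= m%:R :> R by [].
rewrite exprS -natr1; move: m0 ih; set q := _ ^+ m; set s := _%:R => s0 ih.
have : (1 - u) * (1 - s * u) <= (1 - u) * q by rewrite ler_wpM2l// subr_ge0.
by nra.
Qed.

Lemma bernoulli_ge u m : 0 <= u <= 1 -> (1 - u) ^+ m * (1 + m%:R * u) <= 1.
Proof.
move=> /andP[u0 u1]; elim: m => [|m ih]; first by rewrite mul0r addr0 expr0 mul1r.
apply: le_trans ih; have m0 : 0 <= m%:R :> R by [].
rewrite exprSr -natr1 -mulrA ler_wpM2l ?exprn_ge0 ?subr_ge0//.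
by move: m0; set s := _%:R => s0; nra.
Qed.

(** A polynomial step at 1/2. By Bernoulli its size is governed by [n * 2^n * t^n = n * (2t)^n],
    which tends to 0 below 1/2 and to infinity from 1/2 on; the factor [n] in the exponent is what
    settles the point 1/2 itself. *)
Definition qthr n t := (1 - t ^+ n) ^+ (n * 2 ^ n).

Lemma qthr01 n t : 0 <= t <= 1 -> 0 <= qthr n t <= 1.
Proof.
move=> /andP[t0 t1]; have u0 : 0 <= t ^+ n by rewrite exprn_ge0.
have u1 : t ^+ n <= 1 by rewrite exprn_ile1.
by rewrite /qthr exprn_ge0 ?subr_ge0//= exprn_ile1 ?subr_ge0// lerBlDr lerDl.
Qed.

Lemma natr_expr_cvg0 t : 0 <= t < 1 -> (fun n => n%:R * t ^+ n) @ \oo --> (0 : R).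
Proof.
(* Writing [t = s^2], Bernoulli bounds [n * s^n] by [1 / (1 - s)], and the other factor [s^n] tends
   to 0. *)
move=> /andP[t0 t1]; pose s := Num.sqrt t.
have s0 : 0 <= s by exact: sqrtr_ge0.
have st : s ^+ 2 = t by rewrite sqr_sqrtr.
have s1 : s < 1 by rewrite -(@ltr_pXn2r _ 2)// ?nnegrE// st expr1n.
have b n : n%:R * t ^+ n <= (1 - s)^-1 * s ^+ n.
  rewrite -st -exprM mulnC exprM expr2 mulrA ler_wpM2r ?exprn_ge0//.
  rewrite -[leRHS]mul1r ler_pdivlMr ?subr_gt0//.
  have := @bernoulli_ge (1 - s) n; rewrite subr_ge0 (ltW s1)/= lerBlDr lerDl => /(_ s0).
  have -> : 1 - (1 - s) = s by ring.
  have : 0 <= s ^+ n by rewrite exprn_ge0.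
  by set x := s ^+ n; set y := n%:R => x0 h; nra.
apply: (@squeeze_cvgr _ _ _ _ (fun=> 0) (fun n => (1 - s)^-1 * s ^+ n)).
- by apply: nearW => n; rewrite mulr_ge0 ?exprn_ge0//= b.
- exact: cvg_cst.
by rewrite -[X in _ --> X](mulr0 (1 - s)^-1); apply: cvgMr; apply: cvg_expr; rewrite ger0_norm.
Qed.

Lemma qthr_cvg1 t : 0 <= t < 2^-1 -> qthr n t @[n --> \oo] --> (1 : R).
Proof.
move=> /andP[t0 t1]; apply: (@squeeze_cvgr _ _ _ _ (fun n => 1 - n%:R * (2 * t) ^+ n) (fun=> 1)).
- apply: nearW => n; have tt : 0 <= t <= 1 by lra.
  have /andP[_ ->] := qthr01 n tt; rewrite andbT.
  have u0 : 0 <= t ^+ n <= 1 by case/andP: tt => ? ?; rewrite exprn_ge0 ?exprn_ile1.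
  by apply: le_trans (bernoulli_le _ u0); rewrite exprMn mulrA natrM natrX.
- rewrite -[X in _ --> X]subr0; apply: cvgB; first exact: cvg_cst.
  by apply: natr_expr_cvg0; lra.
exact: cvg_cst.
Qed.

Lemma qthr_cvg0 t : 2^-1 <= t <= 1 -> qthr n t @[n --> \oo] --> (0 : R).
Proof.
move=> /andP[t0 t1]; have tt : 0 <= t <= 1 by lra.
apply: (@squeeze_cvgr _ _ _ _ (fun=> 0) (fun n => harmonic n)).
- apply: nearW => n; have /andP[-> _] /= := qthr01 n tt.
  have u0 : 0 <= t ^+ n <= 1 by case/andP: tt => ? ?; rewrite exprn_ge0 ?exprn_ile1.
  have := bernoulli_ge (n * 2 ^ n) u0; rewrite -/(qthr n t) natrM natrX.
  have h1 : 1 <= 2 ^+ n * t ^+ n by rewrite -exprMn exprn_ege1//; lra.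
  have /andP[q0 _] := qthr01 n tt; have n0 : 0 <= n%:R :> R by [].
  rewrite /harmonic /= -[_^-1]mul1r ler_pdivlMr// -mulrA.
  have -> : n.+1%:R = n%:R + 1 :> R by rewrite natr1.
  move: h1 q0 n0; set a := _ * t ^+ n; set q := qthr n t; set s := n%:R => a1 q0 s0.
  apply: le_trans; rewrite ler_wpM2l// addrC lerD2l.
  by rewrite -[leLHS]mulr1 ler_wpM2l.
- exact: cvg_cst.
exact: cvg_harmonic.
Qed.

(** On this window of length [2 pi] the cosine exceeds or equals its value at [dlt] exactly on the
    arc between [- dlt] and [dlt]. Angles beyond [pi] are reflected to [2 * pi - th]. *)
Lemma cos_window dlt th : 0 <= dlt -> dlt <= pi -> - dlt <= th -> th < 2 * pi - dlt ->
  (cos th < cos dlt) = (dlt < th).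
Proof.
move=> d0 dp t0 t1; have p0 := pi_gt0 R; have [h|h] := ltP dlt th.
  have [tp|tp] := leP th pi.
    by rewrite ltr_cos ?in_itv//=; apply/andP; split => //; lra.
  have -> : cos th = cos (2 * pi - th).
    by rewrite cosB (_ : 2 * pi = pi *+ 2) ?mulr2n ?mulrDl ?mul1r// -mulr2n cos2pi sin2pi; lra.
  by rewrite ltr_cos ?in_itv/=; [lra|apply/andP; split; lra..].
apply/negbTE; rewrite -leNgt; have -> : cos th = cos `|th|.
  by have [t2|t2] := leP 0 th; [rewrite ger0_norm|rewrite ltr0_norm ?cosN].
rewrite leNgt ltr_cos ?in_itv/= ?normr_ge0/=; [|apply/andP; split => //|].
- by rewrite -leNgt ler_norml t0 h.
- by rewrite ler_norml; apply/andP; split; lra.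
Qed.

End threshold.

Section trigonometric_polynomials.
Context {R : realType} {d : nat}.
Local Notation Rd := 'rV[R]_d.
Local Notation Zd := 'rV[int]_d.
Local Notation Re := (@complex.Re R).
Local Notation Im := (@complex.Im R).
Local Notation mu := (lebesgue_rV d).
Variable a : R.
Hypothesis a0 : 0 < a.
Local Notation Q := (cube a : set Rd).

Definition tpoly (s : seq (R[i] * Zd)) (x : Rd) : R[i] := \sum_(p <- s) p.1 * chi a p.2 x.

Lemma cbounded_tpoly s : cbounded (tpoly s).
Proof.
apply: (@cbounded_sum _ _ _ _ s (fun p x => p.1 * chi a p.2 x)) => p.
by apply: cboundedM; [exact: cbounded_cst|exact: cbounded_chi].
Qed.

Definition rtrig (P : Rd -> R) := exists s, forall x, (P x)%:C = tpoly s x.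

Lemma measurable_rtrig P : rtrig P -> measurable_fun setT P.
Proof.
move=> [s Ps]; have [[mr _] _] := cbounded_tpoly s.
by rewrite (_ : P = fun x => Re (tpoly s x))//; apply/funext => x; rewrite -Ps.
Qed.

Lemma rtrig_cst (c : R) : rtrig (fun=> c).
Proof. by exists [:: (c%:C, 0)] => x; rewrite /tpoly big_seq1 /= chi0 mulr1. Qed.

Lemma rtrigD P S : rtrig P -> rtrig S -> rtrig (fun x => P x + S x).
Proof.
move=> [s Ps] [t St]; exists (s ++ t) => x.
by rewrite rmorphD/= Ps St /tpoly big_cat.
Qed.

Lemma rtrigM P S : rtrig P -> rtrig S -> rtrig (fun x => P x * S x).
Proof.
move=> [s Ps] [t St]; exists [seq (p.1 * r.1, p.2 + r.2) | p <- s, r <- t] => x.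
rewrite rmorphM/= Ps St /tpoly big_allpairs_dep mulr_suml; apply: eq_bigr => p _.
by rewrite mulr_sumr; apply: eq_bigr => r _ /=; rewrite chiD mulrACA.
Qed.

Lemma rtrigN P : rtrig P -> rtrig (fun x => - P x).
Proof.
move=> rP; rewrite (_ : (fun _ => _) = fun x => (-1) * P x).
  by apply: rtrigM => //; exact: rtrig_cst.
by apply/funext => x; rewrite mulN1r.
Qed.

Lemma rtrigX P n : rtrig P -> rtrig (fun x => P x ^+ n).
Proof.
move=> rP; elim: n => [|n ih]; first exact: rtrig_cst.
by under eq_fun do rewrite exprS; exact: rtrigM.
Qed.

Lemma rtrig_cos (i : 'I_d) (dlt : R) :
  rtrig (fun x => cos (2 * pi * (a^-1 * x ord0 i) - dlt)).
Proof.
(* Here [z] is [exp (- i dlt)]: the cosine is half the sum of a phase-shifted character and its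
   conjugate. *)
pose e : Zd := delta_mx ord0 i; pose z : R[i] := cos dlt +i* (- sin dlt).
exists [:: (2^-1%:C * z, e); (2^-1%:C * z^*%R, - e)] => x.
have ce : chi a e x = cis2pi (a^-1 * x ord0 i).
  rewrite /chi dotpZr /dotp (bigD1 i)//= big1 ?addr0 => [|j ji].
    by rewrite !mxE !eqxx mul1r.
  by rewrite !mxE (negbTE ji) andbF mul0r.
rewrite /tpoly !big_cons big_nil addr0 /= chiN ce cosB.
apply: complexE2; rewrite /cis2pi ?ReD ?ImD ?ReM ?ImM /=; lra.
Qed.

Variable rho : Rd -> R.
Hypothesis mrho : measurable_fun setT rho.
Hypothesis rho0 : forall x, 0 <= rho x.
Hypothesis rhofin : (\int[mu]_(x in Q) (rho x)%:E < +oo)%E.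

Let mQ : measurable Q. Proof. exact: measurable_cube. Qed.

(** A weighted [L^1] distance on the cube. The weight is [|phi|] for uniqueness of Fourier
    coefficients and the constant 1 for density in [L^2]. *)
Definition terr (u v : Rd -> R) : \bar R := (\int[mu]_(x in Q) (`|u x - v x| * rho x)%:E)%E.

Let mterr (u v : Rd -> R) : measurable_fun setT u -> measurable_fun setT v ->
  measurable_fun Q (fun x => (`|u x - v x| * rho x)%:E).
Proof.
move=> mu' mv; apply: measurable_funTS; apply/measurable_EFinP; apply: measurable_funM => //.
by apply: measurableT_comp => //; exact: measurable_funB.
Qed.

Lemma terr_ge0 u v : (0 <= terr u v)%E.
Proof. by apply: integral_ge0 => x _; rewrite lee_fin mulr_ge0. Qed.

Lemma terrD (u1 u2 u v1 v2 v : Rd -> R) : measurable_fun setT u1 -> measurable_fun setT u2 ->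
  measurable_fun setT v1 -> measurable_fun setT v2 ->
  measurable_fun setT u -> measurable_fun setT v ->
  (forall x, `|u x - v x| <= `|u1 x - v1 x| + `|u2 x - v2 x|) ->
  (terr u v <= terr u1 v1 + terr u2 v2)%E.
Proof.
move=> m1 m2 m3 m4 m5 m6 h; rewrite /terr -ge0_integralD//; last 4 first.
- by move=> x _; rewrite lee_fin mulr_ge0.
- exact: mterr.
- by move=> x _; rewrite lee_fin mulr_ge0.
- exact: mterr.
apply: ge0_le_integral => //.
- by move=> x _; rewrite lee_fin mulr_ge0.
- exact: mterr.
- by apply: emeasurable_funD; exact: mterr.
by move=> x _; rewrite -EFinD lee_fin -mulrDl ler_wpM2r.
Qed.

Lemma terr_cvg (u : nat -> Rd -> R) (v : Rd -> R) :
  (forall n, measurable_fun setT (u n)) -> measurable_fun setT v ->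
  (forall n x, `|u n x - v x| <= 1) ->
  (forall x, Q x -> u n x @[n --> \oo] --> v x) -> terr (u n) v @[n --> \oo] --> 0%E.
Proof.
move=> mu' mv b c; rewrite -(@integral0 _ _ _ mu Q).
apply: (@dominated_cvg _ _ _ mu Q mQ (fun n x => (`|u n x - v x| * rho x)%:E) (cst 0%E)
  (fun x => (rho x)%:E)) => //.
- by move=> n; exact: mterr.
- move=> x Qx; apply/fine_cvgP; split; first exact: nearW.
  rewrite -[X in _ --> X](mul0r (rho x)); apply: cvgMl.
  rewrite -[X in _ --> X](normr0 R) -(subrr (v x)); apply: cvg_norm.
  by apply: cvgB; [exact: c|exact: cvg_cst].
- apply/integrableP; split; first by apply: measurable_funTS; exact/measurable_EFinP.
  by under eq_integral do rewrite gee0_abs ?lee_fin//.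
by move=> n x Qx; rewrite abse_EFin lee_fin normrM normr_id (ger0_norm (rho0 x)) ler_piMl.
Qed.

(** Approximants take values in the unit interval, so products of them approximate intersections and
    the sets so approximated form a sigma-algebra. *)
Definition tapprox (E : set Rd) := measurable E /\ forall e : R, 0 < e ->
  exists P, [/\ rtrig P, forall x, 0 <= P x <= 1 & (terr P \1_E <= e%:E)%E].

Lemma indic01 (E : set Rd) x : 0 <= (\1_E x : R) <= 1.
Proof. by rewrite indicE; case: (_ \in _); rewrite /= ?ler01 ?lexx. Qed.

Lemma tapproxC E : tapprox E -> tapprox (~` E).
Proof.
move=> [mE h]; split; first exact: measurableC.
move=> e /h[P [rP P01 Pe]]; exists (fun x => 1 - P x); split.
- by apply: rtrigD; [exact: rtrig_cst|exact: rtrigN].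
- by move=> x; have /andP[] := P01 x; lra.
apply: le_trans Pe; rewrite /terr; under eq_integral => x _.
  rewrite (_ : `|1 - P x - \1_(~` E) x| = `|P x - \1_E x|); first over.
  by rewrite !indicE in_setC -normrN; congr `|_|; case: (_ \in _) => /=; lra.
by [].
Qed.

Lemma tapproxI E F : tapprox E -> tapprox F -> tapprox (E `&` F).
Proof.
move=> [mE h] [mF k]; split; first exact: measurableI.
move=> e e0; have e2 : 0 < e / 2 by rewrite divr_gt0.
have [P [rP P01 Pe]] := h _ e2; have [S [rS S01 Se]] := k _ e2.
exists (fun x => P x * S x); split; first exact: rtrigM.
  by move=> x; have /andP[? ?] := P01 x; have /andP[? ?] := S01 x; nra.
have mP := measurable_rtrig rP; have mS := measurable_rtrig rS.
apply: (@le_trans _ _ (terr P \1_E + terr S \1_F)%E); last first.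
  by rewrite (splitr e) EFinD leeD.
apply: terrD => //.
- exact: measurable_funM.
- by apply: measurable_indic; exact: measurableI.
move=> x; rewrite indicI /=; have /andP[? ?] := P01 x; have /andP[? ?] := indic01 F x.
rewrite (_ : _ - _ = P x * (S x - \1_F x) + \1_F x * (P x - \1_E x)); last by ring.
apply: le_trans (ler_normD _ _) _; rewrite addrC !normrM (ger0_norm (x := P x))//.
by rewrite (ger0_norm (x := \1_F x))// lerD// ler_piMl.
Qed.

Lemma tapprox_cvg (E : nat -> set Rd) F : (forall n, tapprox (E n)) -> measurable F ->
  (forall x, \1_(E n) x @[n --> \oo] --> (\1_F x : R)) -> tapprox F.
Proof.
move=> aE mF c; split => // e e0; have e2 : 0 < e / 2 by rewrite divr_gt0.
have mE n : measurable (E n) by have [] := aE n.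
have : terr \1_(E n) \1_F @[n --> \oo] --> 0%E.
  apply: terr_cvg => // n x; have /andP[] := indic01 (E n) x; have /andP[] := indic01 F x.
  by rewrite ler_norml; lra.
move/(ge0_cvge0P _) => /(_ (fun n => terr_ge0 _ _) _ e2)[n _ /(_ n (leqnn n)) hn].
have [_ /(_ _ e2)[P [rP P01 Pe]]] := aE n; exists P; split => //.
apply: (@le_trans _ _ (terr P \1_(E n) + terr \1_(E n) \1_F)%E); last first.
  by rewrite (splitr e) EFinD leeD.
apply: terrD => //; first exact: measurable_rtrig.
- exact: measurable_rtrig.
by move=> x; apply: le_trans (ler_normD _ _); rewrite addrA subrK.
Qed.

Lemma tapprox_ext (E F : set Rd) : measurable F -> (forall x, Q x -> E x <-> F x) -> tapprox E -> tapprox F.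
Proof.
move=> mF EF [mE h]; split => // e /h[P [rP P01 Pe]]; exists P; split => //.
apply: le_trans Pe; rewrite /terr; under eq_integral => x /set_mem Qx.
  rewrite (_ : \1_F x = \1_E x); first over.
  by rewrite !indicE (_ : (x \in F) = (x \in E))//; apply/idP/idP => /set_mem/EF;
    move=> /(_ Qx) ?; exact/mem_set.
by [].
Qed.

Lemma tapproxT : tapprox setT.
Proof.
split; first exact: measurableT.
move=> e e0; exists (fun=> 1); split; first exact: rtrig_cst.
  by move=> x; rewrite ler01 lexx.
rewrite /terr; under eq_integral do rewrite indicT subrr normr0 mul0r.
by rewrite integral0 lee_fin ltW.
Qed.

Lemma tapprox0 : tapprox set0.
Proof. by rewrite -setCT; apply: tapproxC; exact: tapproxT. Qed.

Lemma tapproxU E F : tapprox E -> tapprox F -> tapprox (E `|` F).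
Proof.
move=> aE aF; rewrite -[_ `|` _]setCK setCU.
by apply: tapproxC; apply: tapproxI; exact: tapproxC.
Qed.

Lemma tapprox_bigcup (E : nat -> set Rd) : (forall n, tapprox (E n)) -> tapprox (\bigcup_n E n).
Proof.
move=> aE; pose U n := iteri n (fun i A => A `|` E i) set0.
have aU n : tapprox (U n).
  by elim: n => [|n ih]; [exact: tapprox0|exact: tapproxU].
apply: (tapprox_cvg aU); first by apply: bigcup_measurable => n _; have [] := aE n.
have sU n : U n `<=` \bigcup_n E n.
  by elim: n => [//|n ih] x [/ih//|Ex]; exists n.
have inU m n x : (m < n)%N -> E m x -> U n x.
  elim: n => // n ih; rewrite ltnS leq_eqVlt => /orP[/eqP ->|/ih h] Ex; first by right.
  by left; exact: h.
move=> x; have [[m _ Ex]|nE] := pselect ((\bigcup_n E n) x).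
  apply: cvg_near_cst; exists m.+1 => // n /= mn.
  by rewrite !indicE !mem_set//; [exists m|exact: (inU m)].
apply: cvg_near_cst; apply: nearW => n.
by rewrite !indicE !memNset// => /sU.
Qed.

Lemma measurable_gt_coord (i : 'I_d) (s : R) : measurable [set x : Rd | s < x ord0 i].
Proof.
rewrite (_ : [set _ | _] = (fun x : Rd => x ord0 i) @^-1` `]s, +oo[%classic).
  by rewrite -[X in measurable X]setTI; apply: measurable_coord_rV.
by apply/seteqP; split => x /=; rewrite in_itv/= andbT.
Qed.

(* on the cube, the trigonometric polynomial [t] crosses the value 1/2 exactly at [x_i = s] *)
Lemma tapprox_halfspace (i : 'I_d) (s : R) : tapprox [set x : Rd | s < x ord0 i].
Proof.
have mE := measurable_gt_coord i s.
have [s0|s0] := ltP s 0.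
  apply: (tapprox_ext mE _ tapproxT) => x /(_ i)/andP[xi _]; split => //= _.
  exact: lt_le_trans xi.
have [sa|sa] := leP a s.
  apply: (tapprox_ext mE _ tapprox0) => x /(_ i)/andP[_ xi]; split => //= sx.
  by have := lt_trans (le_lt_trans sa sx) xi; rewrite ltxx.
(* With this phase the angle is [- dl] at [x_i = 0] and [dl] at [x_i = s], and it stays below
   [2 * pi - dl] on the cube. *)
pose dl := pi * (s / a); have p0 := pi_gt0 R.
have d0 : 0 <= dl by apply: mulr_ge0; [exact: ltW|apply: divr_ge0 => //; exact: ltW].
have d1 : dl < pi by rewrite gtr_pMr// ltr_pdivrMr// mul1r.
(* A difference of two cosines lies in [[-2, 2]]; the factor 1/4 brings [t] into [[0, 1]]. *)
pose t (x : Rd) := 2^-1 + (cos (2 * pi * (a^-1 * x ord0 i) - dl) + - cos dl) * 4^-1.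
have t01 x : 0 <= t x <= 1.
  have := cos_le1 (2 * pi * (a^-1 * x ord0 i) - dl); have := cos_geN1 (2 * pi * (a^-1 * x ord0 i) - dl).
  by have := cos_le1 dl; have := cos_geN1 dl; rewrite /t; lra.
have th x : Q x -> (t x < 2^-1) = (s < x ord0 i).
  move=> /(_ i)/andP[xi0 xi1].
  rewrite (_ : (t x < 2^-1) = (cos (2 * pi * (a^-1 * x ord0 i) - dl) < cos dl)); last first.
    by rewrite /t; apply/idP/idP => ?; lra.
  have e1 : 0 <= a^-1 * x ord0 i by apply: mulr_ge0 => //; rewrite invr_ge0 ltW.
  have e2 : a^-1 * x ord0 i < 1 by rewrite ltr_pdivrMl ?mulr1.
  move: e1 e2; rewrite /dl (mulrC s); set y := a^-1 * _ => e1 e2.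
  rewrite -(ltr_pM2l (x := a^-1) _ s) ?invr_gt0// -/y.
  move: d0 d1; rewrite /dl (mulrC s); set z := a^-1 * s => d0 d1.
  by rewrite cos_window ?(ltW d1)//; [apply/idP/idP => ?; nra|nra|nra].
split => // e e0.
have rt : rtrig t.
  apply: rtrigD; first exact: rtrig_cst.
  apply: rtrigM; last exact: rtrig_cst.
  by apply: rtrigD; [exact: rtrig_cos|exact: rtrig_cst].
have rq n : rtrig (fun x => qthr n (t x)).
  by apply: rtrigX; apply: rtrigD; [exact: rtrig_cst|apply: rtrigN; exact: rtrigX].
have : terr (fun x => qthr n (t x)) \1_[set x : Rd | s < x ord0 i] @[n --> \oo] --> 0%E.
  apply: terr_cvg => //.
  - by move=> n; exact: measurable_rtrig.
  - move=> n x; have /andP[? ?] := qthr01 n (t01 x).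
    have /andP[? ?] := indic01 [set x : Rd | s < x ord0 i] x.
    by rewrite ler_norml; lra.
  move=> x Qx; rewrite indicE.
  have [sx|sx] := boolP (s < x ord0 i).
    rewrite mem_set//; apply: qthr_cvg1; have /andP[-> _] := t01 x.
    by rewrite th.
  rewrite memNset; last exact/negP.
  by apply: qthr_cvg0; have /andP[_ ->] := t01 x; rewrite leNgt th ?sx.
move/(ge0_cvge0P _) => /(_ (fun n => terr_ge0 _ _) _ e0)[n _ /(_ n (leqnn n)) hn].
by exists (fun x => qthr n (t x)); split => // x; exact: qthr01.
Qed.

(** Two nested generation arguments: the sigma-algebra of [R^d] is generated by the coordinates,
    that of the line by the open upper rays. *)
Lemma tapprox_measurable E : measurable E -> tapprox E.
Proof.
apply: smallest_sub.
  split; first exact: tapprox0.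
    by move=> A aA; rewrite setTD; exact: tapproxC.
  exact: tapprox_bigcup.
move=> A; rewrite -bigcup_seq => -[i _ [B mB <-]]; rewrite setTI.
have {mB} : (RGenOInfty.G (R:=R)).-sigma.-measurable B by rewrite -RGenOInfty.measurableE.
suff H : <<s RGenOInfty.G (R:=R) >> `<=` [set C | tapprox ((fun x : Rd => x ord0 i) @^-1` C)].
  by move=> /H.
apply: smallest_sub.
  split; first by rewrite /= preimage_set0; exact: tapprox0.
    by move=> C aC; rewrite /= setTD preimage_setC; exact: tapproxC.
  by move=> C aC; rewrite /= preimage_bigcup; exact: tapprox_bigcup.
move=> _ [s ->] /=; rewrite (_ : _ @^-1` _ = [set x : Rd | s < x ord0 i]).
  exact: tapprox_halfspace.
by apply/seteqP; split => x /=; rewrite in_itv/= andbT.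
Qed.

End trigonometric_polynomials.

(** * Fourier series on the cube *)

Section unfolding.
Context {R : realType} {d : nat}.
Local Notation Rd := 'rV[R]_d.
Local Notation Zd := 'rV[int]_d.
Local Notation Re := (@complex.Re R).
Local Notation Im := (@complex.Im R).
Local Notation mu := (lebesgue_rV d).
Variable a : R.
Hypothesis a0 : 0 < a.
Local Notation Q := (cube a : set Rd).
Local Notation cintQ := (cint mu Q).

Let mQ : measurable Q. Proof. exact: measurable_cube. Qed.

Lemma ae_eq_integral_on (f g : Rd -> \bar R) : {ae mu, forall x, Q x -> f x = g x} ->
  (\int[mu]_(x in Q) f x = \int[mu]_(x in Q) g x)%E.
Proof.
move=> fg; rewrite [LHS]integral_mkcond [RHS]integral_mkcond; apply: ae_eq_integralT.
by apply: filterS fg => x h; rewrite !patchE; case: ifPn => // /set_mem/h.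
Qed.

(** Writing [psi] as [(psi + n) - n] reduces signed unfolding to the nonnegative case. Almost
    everywhere [S] is the difference of the two periodized sums, since the partial sums of both are
    controlled by the tails of [n]. *)
Lemma real_unfold (psi n S : Rd -> R) : measurable_fun setT psi -> measurable_fun setT n ->
  (forall x, `|psi x| <= n x) -> (\int[mu]_x (n x)%:E < +oo)%E ->
  {ae mu, forall x, Q x -> forall A : {fset Zd},
    (`|S x - \sum_(k <- A) psi (x + a *: rV_of_int k)|%:E <=
     tl (fun k => (n (x + a *: rV_of_int k))%:E) A)%E} ->
  (\int[mu]_(x in Q) (S x)%:E = \int[mu]_x (psi x)%:E)%E.
Proof.
move=> mpsi mn pn nfin hS.
have n0 x : 0 <= n x by apply: le_trans (pn x).
pose r x := psi x + n x.
have r0 x : 0 <= r x by rewrite /r; have := pn x; rewrite ler_norml; lra.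
have r2 x : r x <= 2 * n x by rewrite /r; have := pn x; rewrite ler_norml; lra.
have mr : measurable_fun setT r by exact: measurable_funD.
have mrE : measurable_fun setT (fun x => (r x)%:E) by exact/measurable_EFinP.
have mnE : measurable_fun setT (fun x => (n x)%:E) by exact/measurable_EFinP.
pose er (x : Rd) := (\esum_(k in [set: Zd]) (r (x + a *: rV_of_int k)%R)%:E)%E.
pose en (x : Rd) := (\esum_(k in [set: Zd]) (n (x + a *: rV_of_int k)%R)%:E)%E.
have Ir : (\int[mu]_(x in Q) er x = \int[mu]_x (r x)%:E)%E.
  by rewrite (ge0_integral_unfold a0 mrE)// => x; rewrite lee_fin.
have In : (\int[mu]_(x in Q) en x = \int[mu]_x (n x)%:E)%E.
  by rewrite (ge0_integral_unfold a0 mnE)// => x; rewrite lee_fin.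
have ish (f : Rd -> R) : measurable_fun setT f -> (forall x, 0 <= f x) ->
    (\int[mu]_x (f x)%:E < +oo)%E -> mu.-integrable setT (fun x => (f x)%:E).
  move=> mf f0 ff; apply/integrableP; split; first exact/measurable_EFinP.
  by under eq_integral do rewrite gee0_abs ?lee_fin//.
have ipsi : mu.-integrable setT (fun x => (psi x)%:E).
  apply/integrableP; split; first exact/measurable_EFinP.
  apply: le_lt_trans nfin; apply: ge0_le_integral => //.
  - by apply: measurableT_comp => //; exact/measurable_EFinP.
  - by move=> x _; rewrite abse_EFin lee_fin.
have in_ := ish _ mn n0 nfin.
have ir : mu.-integrable setT (fun x => (r x)%:E).
  by under eq_fun do rewrite EFinD; exact: integrableD.
have mer (f : Rd -> R) : measurable_fun setT f -> (forall x, 0 <= f x) ->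
    measurable_fun setT (fun x : Rd => \esum_(k in [set: Zd]) (f (x + a *: rV_of_int k)%R)%:E)%E.
  move=> mf f0; apply: measurable_esum => [k x|k]; first by rewrite lee_fin.
  by apply: (@measurable_comp_addrV _ _ _ (fun x => (f x)%:E)); exact/measurable_EFinP.
have er0 x : (0 <= er x)%E by apply: esum_ge0 => k _; rewrite lee_fin.
have en0 x : (0 <= en x)%E by apply: esum_ge0 => k _; rewrite lee_fin.
have ien : mu.-integrable Q en.
  apply/integrableP; split; first by apply: measurable_funTS; exact: mer.
  by under eq_integral do rewrite gee0_abs//; rewrite In.
have ier : mu.-integrable Q er.
  apply/integrableP; split; first by apply: measurable_funTS; exact: mer.
  under eq_integral do rewrite gee0_abs//; rewrite Ir.
  have /integrableP[_] := ir; under eq_integral do rewrite gee0_abs ?lee_fin//.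
  by [].
have H : {ae mu, forall x, Q x -> (S x)%:E = (er x - en x)%E}.
  have := integrable_ae mQ ien; have := integrable_ae mQ ier.
  apply: filterS3 hS => x hx rx nx Qx; have {}hx := hx Qx.
  have {}rx := rx Qx; have {}nx := nx Qx.
  pose sn (k : Zd) := (n (x + a *: rV_of_int k))%:E; pose sr (k : Zd) := (r (x + a *: rV_of_int k))%:E.
  have sn0 k : (0 <= sn k)%E by rewrite lee_fin.
  have sr0 k : (0 <= sr k)%E by rewrite lee_fin.
  have tlr A : (tl sr A <= 2%:E * tl sn A)%E.
    rewrite /tl -esumZl; last 2 first.
    - by rewrite lee_fin.
    - by move=> k; case: ifP.
    apply: le_esumT => k; case: ifP => _; first by rewrite mule0.
    by rewrite lee_fin.
  have tn A : tl sn A \is a fin_num.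
    rewrite ge0_fin_numE ?tl_ge0//; apply: le_lt_trans (tl_le A sn0) _.
    by rewrite -ge0_fin_numE//; exact: en0.
  have tr A : tl sr A \is a fin_num.
    rewrite ge0_fin_numE ?tl_ge0//; apply: le_lt_trans (tl_le A sr0) _.
    by rewrite -ge0_fin_numE//; exact: er0.
  (* The constant 4 adds one tail of [n] from the premise on [S], at most two from [r] since
     [r <= 2 n], and one from [n]. *)
  have bnd A : (`|S x - (fine (er x) - fine (en x))|%:E <= 4%:E * tl sn A)%E.
    have eE : er x = ((\sum_(k <- A) r (x + a *: rV_of_int k))%:E + tl sr A)%E.
      by rewrite /er (esum_fset_tl A)// sumEFin.
    have nE : en x = ((\sum_(k <- A) n (x + a *: rV_of_int k))%:E + tl sn A)%E.
      by rewrite /en (esum_fset_tl A)// sumEFin.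
    have sE : \sum_(k <- A) r (x + a *: rV_of_int k) = \sum_(k <- A) psi (x + a *: rV_of_int k) +
        \sum_(k <- A) n (x + a *: rV_of_int k) by rewrite -big_split.
    have := hx A; have := tlr A; rewrite eE nE sE -/sn.
    have := tl_ge0 A sr0; have := tl_ge0 A sn0; rewrite !fineD//=.
    rewrite -(fineK (tn A)) -(fineK (tr A)) -!EFinM !lee_fin.
    set p := \sum_(k <- A) psi _; set m := \sum_(k <- A) n _.
    by rewrite !ler_norml => ? ? ? /andP[? ?]; apply/andP; split; lra.
  rewrite -(fineK rx) -(fineK nx) -EFinB; congr EFin; apply/eqP; rewrite -subr_eq0 -normr_le0.
  have c : (fun m => 4%:E * tl sn (seg m))%E @ \oo --> (0 : \bar R)%E.
    rewrite -[X in _ --> X](mule0 4%:E); apply: cvgeZl => //; apply: tl_seg_cvg => //.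
    by rewrite -ge0_fin_numE// -/(en x).
  by rewrite -lee_fin; apply: (@cvge_ge _ _ _ _ _ _ _ _ c); apply: nearW => m; exact: bnd.
rewrite (ae_eq_integral_on H) integralB// Ir In.
under eq_integral do rewrite EFinD.
rewrite integralD// -addeA subee ?adde0//; exact: integrable_fin_num.
Qed.

End unfolding.

Lemma rnormC_real (R : realType) (r : R) : rnorm (r%:C : R[i]^o) = `|r|.
Proof. by rewrite rnormCE /= expr0n addr0 sqrtr_sqr. Qed.

Section uniqueness.
Context {R : realType} {d : nat}.
Local Notation Rd := 'rV[R]_d.
Local Notation Zd := 'rV[int]_d.
Local Notation Re := (@complex.Re R).
Local Notation Im := (@complex.Im R).
Local Notation mu := (lebesgue_rV d).
Variable a : R.
Hypothesis a0 : 0 < a.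
Local Notation Q := (cube a : set Rd).
Local Notation cintQ := (cint mu Q).

Let mQ : measurable Q. Proof. exact: measurable_cube. Qed.

Lemma Re_cint_le (f : Rd -> R[i]) : cmeas f ->
  (\int[mu]_(x in Q) (rnorm (f x : R[i]^o))%:E < +oo)%E ->
  ((Re (cintQ f))%:E <= \int[mu]_(x in Q) (rnorm (f x : R[i]^o))%:E)%E.
Proof.
move=> mf ff; have [ir _] := cintegrable_le mQ mf ff.
rewrite fineK; last exact: integrable_fin_num.
apply: le_trans (lee_abs _) _; apply: le_trans (le_abse_integral mu mQ (measurable_int mu ir)) _.
apply: ge0_le_integral => //.
- by apply: measurableT_comp => //; exact: measurable_int ir.
- by apply: measurable_funTS; apply/measurable_EFinP; exact: cmeas_rnorm.
by move=> x _; rewrite lee_fin ler_Re_rnorm.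
Qed.

(** The function annihilates trigonometric polynomials. Approximating the indicator of [Re phi > 0]
    by them with error weighted by [|phi|] shows that the integral of the positive part is at most
    0. *)
Lemma fourier_unique_Re (phi : Rd -> R[i]) : cmeas phi ->
  (\int[mu]_(x in Q) (rnorm (phi x : R[i]^o))%:E < +oo)%E ->
  (forall l, cintQ (fun x => phi x * chi a l x) = 0) ->
  {ae mu, forall x, Q x -> Re (phi x) <= 0}.
Proof.
move=> mphi fin h; have iphi := cintegrable_le mQ mphi fin.
have tp0 s : cintQ (fun x => phi x * tpoly a s x) = 0.
  rewrite (_ : (fun x => _) = fun x => \sum_(p <- s) p.1 * (phi x * chi a p.2 x)); last first.
    by apply/funext => x; rewrite mulr_sumr; apply: eq_bigr => p _; rewrite mulrCA.
  have ic l : cintegrable mu Q (fun x => phi x * chi a l x).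
    by apply: cintegrableMb => //; exact: cbounded_chi.
  rewrite cint_sum//; last by move=> p; exact: cintegrableZ.
  by rewrite big1// => p _; rewrite cintZ// h mulr0.
pose E := [set x : Rd | 0 < Re (phi x)].
have mE : measurable E.
  rewrite (_ : E = (fun x => Re (phi x)) @^-1` `]0, +oo[%classic).
    by rewrite -[X in measurable X]setTI; case: mphi => + _; apply.
  by apply/seteqP; split => x /=; rewrite in_itv/= andbT.
have b1 : cbounded (fun x : Rd => (\1_E x : R)%:C).
  split; first by apply: cmeas_real.
  by exists (1 : R) => x; rewrite rnormC_real ger0_norm ?indicE//; case: (_ \in _); rewrite ?ler01.
pose f x := phi x * (\1_E x)%:C.
have key : Re (cintQ f) <= 0.
  apply/ler_addgt0Pr => e e0; rewrite add0r.
  have [_ /(_ e e0)[P [[s Ps] P01 Pe]]] :=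
    tapprox_measurable a0 (cmeas_rnorm mphi) (fun x => rnorm_ge0 (phi x : R[i]^o)) fin mE.
  have bP : cbounded (fun x : Rd => (P x)%:C).
    by rewrite (funext Ps); exact: cbounded_tpoly.
  have bD : cbounded (fun x : Rd => (\1_E x)%:C + - (P x)%:C) by apply: cboundedD => //; exact: cboundedN.
  have -> : cintQ f = cintQ (fun x => phi x * ((\1_E x)%:C + - (P x)%:C)).
    rewrite -[RHS]addr0 -(tp0 s) -cintD//; last 2 first.
    - exact: cintegrableMb.
    - by apply: cintegrableMb => //; exact: cbounded_tpoly.
    by apply: eq_cint => x _; rewrite -Ps -mulrDr addrNK.
  rewrite -lee_fin; apply: le_trans Pe.
  have eI : (\int[mu]_(x in Q) (rnorm (phi x * ((\1_E x)%:C + - (P x)%:C) : R[i]^o))%:E =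
      terr a (fun x => rnorm (phi x : R[i]^o)) P \1_E)%E.
    apply: eq_integral => x _; rewrite rnormCM -rmorphN -rmorphD/= rnormC_real mulrC.
    by rewrite distrC.
  rewrite -eI; apply: Re_cint_le; first by apply: cmeasM => //; case: bD.
  apply: le_lt_trans fin; apply: ge0_le_integral => //.
  - by move=> x _; rewrite lee_fin rnorm_ge0.
  - by apply: measurable_funTS; apply/measurable_EFinP; apply: cmeas_rnorm; apply: cmeasM => //; case: bD.
  - by apply: measurable_funTS; apply/measurable_EFinP; exact: cmeas_rnorm.
  move=> x _; rewrite lee_fin rnormCM ler_piMr ?rnorm_ge0// -rmorphN -rmorphD/= rnormC_real.
  by have /andP[? ?] := P01 x; have /andP[? ?] := indic01 (R := R) E x; rewrite ler_norml; lra.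
have f0 x : 0 <= Re (f x).
  rewrite /f ReM /= mulr0 subr0 indicE; case: (boolP (x \in E)) => xE; last by rewrite mulr0.
  by rewrite mulr1; have /set_mem/ltW := xE.
have [ir _] : cintegrable mu Q f by exact: cintegrableMb.
have I0 : (\int[mu]_(x in Q) `|(Re (f x))%:E| = 0)%E.
  under eq_integral do rewrite gee0_abs ?lee_fin//.
  have If := integrable_fin_num mQ ir.
  apply/eqP; rewrite eq_le integral_ge0 ?andbT; last by move=> x _; rewrite lee_fin.
  by rewrite -(fineK If) lee_fin.
move/(ae_eq_integral_abs mu mQ (measurable_int mu ir)) : I0.
apply: filterS => x h1 Qx; have [//|Ex] := leP (Re (phi x)) 0.
have := h1 Qx; rewrite /f ReM /= mulr0 subr0 indicE mem_set// mulr1 => -[].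
by move=> e; rewrite e ltxx in Ex.
Qed.

Lemma fourier_unique (phi : Rd -> R[i]) : cmeas phi ->
  (\int[mu]_(x in Q) (rnorm (phi x : R[i]^o))%:E < +oo)%E ->
  (forall l, cintQ (fun x => phi x * chi a l x) = 0) ->
  {ae mu, forall x, Q x -> phi x = 0}.
Proof.
move=> mphi fin h; have iphi := cintegrable_le mQ mphi fin.
have H (c : R[i]) : rnorm (c : R[i]^o) = 1 -> {ae mu, forall x, Q x -> Re (c * phi x) <= 0}.
  move=> c1; apply: fourier_unique_Re.
  - by apply: cmeasM => //; exact: cmeas_cst.
  - by under eq_integral do rewrite rnormCM c1 mul1r.
  move=> l; under eq_fun do rewrite -mulrA.
  by rewrite cintZ ?h ?mulr0//; apply: cintegrableMb => //; exact: cbounded_chi.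
have n1 (r s : R) : r ^+ 2 + s ^+ 2 = 1 -> rnorm (r +i* s : R[i]^o) = 1.
  by move=> rs; rewrite rnormCE /= rs sqrtr1.
(* Multiplication by 1, -1, [i] and [-i] carries either sign of either part of [phi] into the real
   part. *)
have H1 := H (1 +i* 0) (n1 _ _ _); have H2 := H (-1 +i* 0) (n1 _ _ _).
have H3 := H (0 +i* 1) (n1 _ _ _); have H4 := H (0 +i* -1) (n1 _ _ _).
have {}H1 := H1 ltac:(ring); have {}H2 := H2 ltac:(ring).
have {}H3 := H3 ltac:(ring); have {}H4 := H4 ltac:(ring).
apply: filterS2 (filterI H1 H2) (filterI H3 H4) => x [h1 h2] [h3 h4] Qx.
have := h1 Qx; have := h2 Qx; have := h3 Qx; have := h4 Qx; rewrite !ReM /=.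
by move=> *; apply: complexE2 => /=; lra.
Qed.

End uniqueness.

(** * Completeness of the characters in [L^2] of the cube *)

Section L2_completeness.
Context {R : realType} {d : nat}.
Local Notation Rd := 'rV[R]_d.
Local Notation Zd := 'rV[int]_d.
Local Notation Re := (@complex.Re R).
Local Notation Im := (@complex.Im R).
Local Notation mu := (lebesgue_rV d).
Variable a : R.
Hypothesis a0 : 0 < a.
Local Notation Q := (cube a : set Rd).
Local Notation cintQ := (cint mu Q).

Let mQ : measurable Q. Proof. exact: measurable_cube. Qed.

Implicit Types phi psi u : Rd -> R[i].

Definition ip phi psi := cintQ (fun x => phi x * (psi x)^*%R).
Definition n2 phi := Re (ip phi phi).

Let icb phi : cbounded phi -> cintegrable mu Q phi. Proof. exact: cbounded_cube. Qed.

Lemma cboundedZ (c : R[i]) phi : cbounded phi -> cbounded (fun x => c * phi x).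
Proof. by apply: cboundedM; exact: cbounded_cst. Qed.

Let bm phi psi : cbounded phi -> cbounded psi -> cbounded (fun x => phi x * (psi x)^*%R).
Proof. by move=> bp bs; apply: cboundedM => //; exact: cbounded_conj. Qed.

Lemma ipDl phi psi u : cbounded phi -> cbounded psi -> cbounded u ->
  ip (fun x => phi x + psi x) u = ip phi u + ip psi u.
Proof.
move=> bp bs bu; rewrite /ip; under eq_fun do rewrite mulrDl.
by rewrite cintD//; apply: icb; exact: bm.
Qed.

Lemma ipZl (c : R[i]) phi u : cbounded phi -> cbounded u ->
  ip (fun x => c * phi x) u = c * ip phi u.
Proof.
move=> bp bu; rewrite /ip; under eq_fun do rewrite -mulrA.
by rewrite cintZ//; apply: icb; exact: bm.
Qed.

Lemma ip_suml (I : Type) (r : seq I) (F : I -> Rd -> R[i]) u : (forall i, cbounded (F i)) ->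
  cbounded u -> ip (fun x => \sum_(i <- r) F i x) u = \sum_(i <- r) ip (F i) u.
Proof.
move=> bF bu; rewrite /ip; under eq_fun do rewrite mulr_suml.
by rewrite cint_sum// => i; apply: icb; exact: bm.
Qed.

Lemma ip_sumr (I : Type) (r : seq I) (F : I -> Rd -> R[i]) u : (forall i, cbounded (F i)) ->
  cbounded u -> ip u (fun x => \sum_(i <- r) F i x) = \sum_(i <- r) ip u (F i).
Proof.
move=> bF bu; rewrite /ip; under eq_fun do rewrite rmorph_sum mulr_sumr.
by rewrite cint_sum// => i; apply: icb; exact: bm.
Qed.

Lemma ipZr (c : R[i]) phi u : cbounded phi -> cbounded u ->
  ip u (fun x => c * phi x) = c^*%R * ip u phi.
Proof.
move=> bp bu; rewrite /ip; under eq_fun do rewrite rmorphM/= mulrCA.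
by rewrite cintZ//; apply: icb; exact: bm.
Qed.

Lemma n2E phi : n2 phi = fine (\int[mu]_(x in Q) (rnorm (phi x : R[i]^o) ^+ 2)%:E)%E.
Proof.
rewrite /n2 /ip /cint /=; congr fine; apply: eq_integral => x _; congr EFin.
by rewrite ReM rnormC_sqr; case: (phi x) => ? ? /=; ring.
Qed.

Lemma n2_fin phi : cbounded phi ->
  (n2 phi)%:E = (\int[mu]_(x in Q) (rnorm (phi x : R[i]^o) ^+ 2)%:E)%E.
Proof.
move=> bp; have [ir _] := icb (bm bp bp); rewrite /n2 /ip /cint /= fineK; last exact: integrable_fin_num.
apply: eq_integral => x _; congr EFin.
by rewrite ReM rnormC_sqr; case: (phi x) => ? ? /=; ring.
Qed.

Lemma n2_ge0 phi : 0 <= n2 phi.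
Proof. by rewrite n2E fine_ge0// integral_ge0// => x _; rewrite lee_fin sqr_ge0. Qed.

Lemma n2_bound phi (M : R) : cbounded phi -> (forall x, rnorm (phi x : R[i]^o) <= M) ->
  n2 phi <= M ^+ 2 * a ^+ d.
Proof.
move=> bp pM; rewrite -lee_fin n2_fin//.
apply: (@le_trans _ _ (\int[mu]_(x in Q) (M ^+ 2)%:E)%E).
  apply: ge0_le_integral => //.
  - by move=> x _; rewrite lee_fin sqr_ge0.
  - apply: measurable_funTS; apply/measurable_EFinP; apply: measurable_funX.
    by apply: cmeas_rnorm; case: bp.
  - move=> x _; rewrite lee_fin ler_pXn2r ?nnegrE ?rnorm_ge0//.
    by apply: le_trans (pM x); exact: rnorm_ge0.
by rewrite integral_cst//= EFinM (lebesgue_cube _ (ltW a0)).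
Qed.

Lemma n2Z (c : R[i]) phi : cbounded phi -> n2 (fun x => c * phi x) = rnorm (c : R[i]^o) ^+ 2 * n2 phi.
Proof.
move=> bp; apply: EFin_inj; rewrite n2_fin; last exact: cboundedZ.
rewrite EFinM n2_fin// -ge0_integralZl//=.
- by apply: eq_integral => x _; rewrite rnormCM exprMn.
- apply: measurable_funTS; apply/measurable_EFinP; apply: measurable_funX.
  by apply: cmeas_rnorm; case: bp.
- by move=> x _; rewrite lee_fin sqr_ge0.
by rewrite lee_fin sqr_ge0.
Qed.

Lemma n2D_le phi psi : cbounded phi -> cbounded psi ->
  n2 (fun x => phi x + psi x) <= 2 * n2 phi + 2 * n2 psi.
Proof.
move=> bp bs; have m2 u : cbounded u -> measurable_fun Q (fun x => (rnorm (u x : R[i]^o) ^+ 2)%:E).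
  move=> [mu' _]; apply: measurable_funTS; apply/measurable_EFinP; apply: measurable_funX.
  exact: cmeas_rnorm.
rewrite -lee_fin EFinD !EFinM !n2_fin//; last exact: cboundedD.
rewrite -!ge0_integralZl//=; [|exact: m2|by move=> x _; rewrite lee_fin sqr_ge0|exact: m2|
  by move=> x _; rewrite lee_fin sqr_ge0].
rewrite -ge0_integralD//; last 4 first.
- by move=> x _; rewrite lee_fin mulr_ge0// sqr_ge0.
- by apply: measurable_funeM; exact: m2.
- by move=> x _; rewrite lee_fin mulr_ge0// sqr_ge0.
- by apply: measurable_funeM; exact: m2.
apply: ge0_le_integral => //.
- by move=> x _; rewrite lee_fin sqr_ge0.
- by apply: m2; exact: cboundedD.
- by apply: emeasurable_funD; apply: measurable_funeM; exact: m2.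
move=> x _; rewrite -!EFinM -EFinD lee_fin.
have := ler_rnormD (phi x : R[i]^o) (psi x); have := rnorm_ge0 (phi x + psi x : R[i]^o).
have := rnorm_ge0 (phi x : R[i]^o); have := rnorm_ge0 (psi x : R[i]^o).
set t := rnorm (_ + _); set r := rnorm (phi x : R[i]^o); set s := rnorm (psi x : R[i]^o).
move=> s0 r0 t0 tsr; have : t ^+ 2 <= (r + s) ^+ 2 by rewrite ler_pXn2r ?nnegrE ?addr_ge0.
by have := sqr_ge0 (r - s); nra.
Qed.

Lemma n2D_ortho phi psi : cbounded phi -> cbounded psi -> ip phi psi = 0 ->
  n2 (fun x => phi x + psi x) = n2 phi + n2 psi.
Proof.
move=> bp bs o; have [ip1 _] := icb (bm bp bp); have [is1 _] := icb (bm bs bs).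
have [io _] := icb (bm bp bs).
have O : (\int[mu]_(x in Q) (Re (phi x * (psi x)^*%R))%:E = 0)%E.
  by have := congr1 Re o; rewrite /ip /cint /= => e; rewrite -[LHS]fineK ?e//; exact: integrable_fin_num.
apply: EFin_inj; rewrite EFinD !n2_fin//; last exact: cboundedD.
have E u x : Re (u x * (u x)^*%R) = rnorm (u x : R[i]^o) ^+ 2.
  by rewrite ReM rnormC_sqr; case: (u x) => ? ? /=; ring.
under [X in _ = (X + _)%E]eq_integral do rewrite -E.
under [X in _ = (_ + X)%E]eq_integral do rewrite -E.
rewrite -[X in _ = (X + _)%E]adde0 -[X in (_ + X + _)%E](mule0 2%:E) -O -integralZl//.
rewrite -integralD//; last exact: integrableZl.
rewrite -integralD//; last by apply: integrableD => //; exact: integrableZl.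
apply: eq_integral => x _; rewrite -!EFinM -!EFinD; congr EFin.
rewrite !E !rnormC_sqr !ReD !ImD ReM.
by case: (phi x) => ? ?; case: (psi x) => ? ? /=; ring.
Qed.

(** The orthogonal projection of [phi] onto the span of the characters in [A]; each character has
    squared norm [a^d]. *)
Definition fsum (A : {fset Zd}) phi x := \sum_(l <- A) ((a ^- d)%:C * ip phi (chi a l)) * chi a l x.

Let bchi (l : Zd) : cbounded (chi a l). Proof. exact: cbounded_chi. Qed.

Lemma cbounded_fsum A phi : cbounded (fsum A phi).
Proof.
apply: (@cbounded_sum _ _ _ _ _ (fun l x => ((a ^- d)%:C * ip phi (chi a l)) * chi a l x)) => l.
exact: cboundedZ.
Qed.

Lemma ip_chi l m : ip (chi a l) (chi a m) = if l == m then (a ^+ d)%:C else 0.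
Proof.
rewrite /ip -subr_eq0 -cint_chi//; congr cint; apply/funext => x.
by rewrite chiD chiN.
Qed.

Lemma fsum_ortho A phi l : cbounded phi -> l \in A ->
  ip (fun x => phi x - fsum A phi x) (chi a l) = 0.
Proof.
move=> bp lA; have -> : (fun x => phi x - fsum A phi x) = fun x => phi x + (-1) * fsum A phi x.
  by apply/funext => x; rewrite mulN1r.
rewrite ipDl//; last by apply: cboundedZ; exact: cbounded_fsum.
rewrite ipZl//; last exact: cbounded_fsum.
rewrite {2}/ip /fsum -/(ip _ _) ip_suml//; last by move=> m; exact: cboundedZ.
rewrite (bigD1_seq l)//= big1 ?addr0; last first.
  by move=> m ml; rewrite ipZl// ip_chi (negbTE ml) mulr0.
rewrite ipZl// ip_chi eqxx mulrAC -rmorphM/= mulVf ?mul1r ?mulN1r ?subrr//.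
by rewrite expf_neq0// gt_eqF.
Qed.

(** The remainder is orthogonal to every polynomial with frequencies in [A], so Pythagoras applies
    to the polynomial [t] that represents [fsum] minus the competitor. *)
Lemma fsum_best A phi s : cbounded phi -> (forall p, p \in s -> p.2 \in A) ->
  n2 (fun x => phi x - fsum A phi x) <= n2 (fun x => phi x - tpoly a s x).
Proof.
move=> bp sA; pose t := [seq ((a ^- d)%:C * ip phi (chi a l), l) | l <- A] ++ [seq (- p.1, p.2) | p <- s].
have tE x : tpoly a t x = fsum A phi x - tpoly a s x.
  rewrite /tpoly big_cat /= !big_map /=; congr (_ + _).
  by rewrite -sumrN; apply: eq_bigr => p _; rewrite mulNr.
have tA p : p \in t -> p.2 \in A.
  by rewrite mem_cat => /orP[/mapP[l lA ->] //=|/mapP[r rs ->] /=]; exact: sA.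
have bu : cbounded (fun x => phi x - fsum A phi x).
  by apply: cboundedD => //; apply: cboundedN; exact: cbounded_fsum.
rewrite (_ : (fun x => phi x - tpoly a s x) = fun x => (phi x - fsum A phi x) + tpoly a t x); last first.
  by apply/funext => x; rewrite tE addrA subrK.
have bt : cbounded (tpoly a t) by exact: cbounded_tpoly.
suff o : ip (fun x => phi x - fsum A phi x) (tpoly a t) = 0 by rewrite (n2D_ortho bu bt o) lerDl n2_ge0.
rewrite /tpoly ip_sumr//; last by move=> p; exact: cboundedZ.
rewrite big_seq big1// => p pt; rewrite ipZr// fsum_ortho ?mulr0//; exact: tA.
Qed.

Definition tdense phi := cbounded phi /\ forall e : R, 0 < e ->
  exists s, n2 (fun x => phi x - tpoly a s x) <= e.

Lemma tdenseD phi psi : tdense phi -> tdense psi -> tdense (fun x => phi x + psi x).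
Proof.
move=> [bp hp] [bs hs]; split; first exact: cboundedD.
move=> e e0; have e4 : 0 < e / 4 by rewrite divr_gt0.
have [s sP] := hp _ e4; have [t tP] := hs _ e4; exists (s ++ t).
rewrite (_ : (fun _ => _) = fun x => (phi x - tpoly a s x) + (psi x - tpoly a t x)); last first.
  by apply/funext => x; rewrite /tpoly big_cat/=; ring.
apply: le_trans (n2D_le _ _) _; last by lra.
- by apply: cboundedD => //; apply: cboundedN; exact: cbounded_tpoly.
- by apply: cboundedD => //; apply: cboundedN; exact: cbounded_tpoly.
Qed.

Lemma tdenseZ (c : R[i]) phi : tdense phi -> tdense (fun x => c * phi x).
Proof.
move=> [bp hp]; split; first exact: cboundedZ.
move=> e e0; pose K := rnorm (c : R[i]^o) ^+ 2 + 1.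
have K0 : 0 < K by rewrite ltr_wpDl ?sqr_ge0.
have [s sP] := hp (e / K) (divr_gt0 e0 K0); exists [seq (c * p.1, p.2) | p <- s].
rewrite (_ : (fun _ => _) = fun x => c * (phi x - tpoly a s x)); last first.
  apply/funext => x; rewrite /tpoly big_map mulrBr mulr_sumr; congr (_ - _).
  by apply: eq_bigr => p _; rewrite mulrA.
rewrite n2Z; last by apply: cboundedD => //; apply: cboundedN; exact: cbounded_tpoly.
apply: (@le_trans _ _ (K * (e / K))); last by rewrite mulrCA divff ?mulr1 ?gt_eqF.
by rewrite ler_pM ?sqr_ge0 ?n2_ge0// lerDl.
Qed.

Lemma tdense_indic (E : set Rd) : measurable E -> tdense (fun x => (\1_E x : R)%:C).
Proof.
move=> mE; have b1 : cbounded (fun x : Rd => (\1_E x : R)%:C).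
  split; first by apply: cmeas_real.
  by exists (1 : R) => x; rewrite rnormC_real ger0_norm ?indicE//; case: (_ \in _); rewrite ?ler01.
split => // e e0.
have m1 : measurable_fun setT (fun _ : Rd => 1 : R) by exact: measurable_cst.
have f1 : (\int[mu]_(x in Q) ((fun=> 1) x)%:E < +oo)%E by rewrite integral_cst// mul1e; exact: cube_fin.
have [_ /(_ e e0)[P [[s Ps] P01 Pe]]] :=
    tapprox_measurable a0 m1 (fun x => ler01) f1 mE.
exists s; rewrite -lee_fin n2_fin; last first.
  by apply: cboundedD => //; apply: cboundedN; exact: cbounded_tpoly.
have mP := measurable_rtrig (ex_intro _ s Ps).
apply: le_trans Pe; apply: ge0_le_integral => //.
- by move=> x _; rewrite lee_fin sqr_ge0.
- apply: measurable_funTS; apply/measurable_EFinP; apply: measurable_funX; apply: cmeas_rnorm.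
  by apply: cmeasD; [case: b1|apply: (cboundedN _).1; exact: cbounded_tpoly].
- by apply: measurable_funTS; apply/measurable_EFinP; apply: measurable_funM => //;
    apply: measurableT_comp => //; exact: measurable_funB.
(* Polynomial and indicator both lie in [[0, 1]], so the squared difference is at most the
   difference itself and the [L^1] error bounds the [L^2] error. *)
move=> x _; rewrite lee_fin mulr1 -Ps -rmorphB/= rnormC_real distrC.
have /andP[? ?] := P01 x; have /andP[? ?] := indic01 (R := R) E x.
by rewrite expr2 ler_piMl// ler_norml; lra.
Qed.

Lemma tdense_unif phi : cbounded phi -> (forall e : R, 0 < e -> exists2 psi, tdense psi &
  forall x, rnorm (phi x - psi x : R[i]^o) <= e) -> tdense phi.
Proof.
move=> bp h; split => // e e0; pose K := a ^+ d + 1.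
have K0 : 0 < K by rewrite ltr_wpDl ?exprn_ge0 ?ltW.
(* Being at most 1, [e'] satisfies [e'^2 * a^d <= e' * K <= e / 4]; the factor 2 in [n2D_le] then
   leaves [e / 2] for each summand. *)
pose e' := Num.min 1 (e / (4 * K)).
have e'0 : 0 < e' by rewrite lt_min ltr01 divr_gt0 ?mulr_gt0.
have [psi [bs hs] ps] := h _ e'0; have [s hsP] := hs (e / 4) ltac:(by rewrite divr_gt0).
exists s; rewrite (_ : (fun _ => _) = fun x => (phi x - psi x) + (psi x - tpoly a s x)); last first.
  by apply/funext => x; rewrite addrA subrK.
have b1 : cbounded (fun x => phi x - psi x) by apply: cboundedD => //; exact: cboundedN.
have b2 : cbounded (fun x => psi x - tpoly a s x).
  by apply: cboundedD => //; apply: cboundedN; exact: cbounded_tpoly.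
apply: le_trans (n2D_le b1 b2) _; have := n2_bound b1 ps.
have l1 : e' <= 1 by rewrite ge_min lexx.
have : e' * K <= e / 4.
  by rewrite -ler_pdivlMr// -mulrA -invfM ge_min lexx orbT.
have : 0 <= a ^+ d by rewrite exprn_ge0// ltW.
by rewrite /K; set A := a ^+ d => A0; nra.
Qed.

(** Extracts binary digits: subtracting [M / 2] on the set where [u] is at least [M / 2] leaves a
    remainder between 0 and [M / 2]. *)
Lemma tdense_bisect n (M : R) (u : Rd -> R) : 0 <= M -> measurable_fun setT u ->
  (forall x, 0 <= u x <= M) -> exists2 psi : Rd -> R, tdense (fun x => (psi x)%:C) &
  forall x, 0 <= u x - psi x <= M / 2 ^+ n.
Proof.
elim: n M u => [|n ih] M u M0 mu' uM.
  exists (fun=> 0); last by move=> x; rewrite subr0 expr0 divr1.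
  split; first exact: cbounded_cst.
  move=> e e0; exists [::]; rewrite /tpoly; under eq_fun do rewrite big_nil subr0.
  by rewrite /n2 /ip; under eq_fun do rewrite mul0r; rewrite cint0 /= ltW.
pose E := [set x : Rd | M / 2 <= u x].
have mE : measurable E.
  rewrite (_ : E = u @^-1` `[M / 2, +oo[%classic); first by rewrite -[X in measurable X]setTI; apply: mu'.
  by apply/seteqP; split => x /=; rewrite in_itv/= andbT.
pose u' x := u x - M / 2 * \1_E x.
have mu2 : measurable_fun setT u' by apply: measurable_funB => //; apply: measurable_funM.
have u'M x : 0 <= u' x <= M / 2.
  rewrite /u' indicE; have /andP[? ?] := uM x; case: (boolP (x \in E)) => [/set_mem|] xE; rewrite /=.
    by move: xE; rewrite /E /= => ?; lra.
  have : ~~ (M / 2 <= u x) by apply: contra xE => ?; exact/mem_set.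
  by rewrite -ltNge; lra.
have [psi td pM] := ih (M / 2) u' ltac:(by rewrite divr_ge0) mu2 u'M.
exists (fun x => psi x + M / 2 * \1_E x).
  rewrite (_ : (fun _ => _) = fun x => (psi x)%:C + (M / 2)%:C * (\1_E x : R)%:C).
    by apply: tdenseD => //; apply: tdenseZ; exact: tdense_indic.
  by apply/funext => x; rewrite rmorphD rmorphM.
move=> x; have := pM x; rewrite /u' exprS invfM mulrA.
by set t := _ / 2 ^+ n; move=> ?; lra.
Qed.

Lemma tdense_real (u : Rd -> R) : cbounded (fun x => (u x)%:C) -> tdense (fun x => (u x)%:C).
Proof.
move=> bu; have [[mu' _] [M uM]] := bu.
have M0 : 0 <= M by apply: le_trans (uM 0); exact: rnorm_ge0.
have uM2 x : 0 <= u x + M <= 2 * M by have := uM x; rewrite rnormC_real ler_norml; lra.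
have t1 : tdense (fun x => (u x + M)%:C).
  apply: tdense_unif; first by under eq_fun do rewrite rmorphD/=; apply: cboundedD => //; exact: cbounded_cst.
  move=> e e0.
  have [n ne] : exists n, 2 * M / 2 ^+ n <= e.
    have /cvgrPdist_le/(_ _ e0)[n _ /(_ n (leqnn n))] : 2 * M * 2^-1 ^+ n @[n --> \oo] --> (0 : R).
      rewrite -[X in _ --> X](mulr0 (2 * M)); apply: cvgMr; apply: cvg_expr.
      by rewrite ger0_norm; lra.
    by rewrite sub0r normrN exprVn => h; exists n; apply: le_trans (ler_norm _) h.
  have [psi td pM] := @tdense_bisect n (2 * M) (fun x => u x + M) ltac:(by rewrite mulr_ge0)
    ltac:(by apply: measurable_funD) uM2.
  exists (fun x => (psi x)%:C) => // x; rewrite -rmorphB/= rnormC_real.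
  by have /andP[? ?] := pM x; rewrite ger0_norm//; exact: le_trans ne.
rewrite (_ : (fun _ => _) = fun x => (u x + M)%:C + (- M)%:C * (\1_setT x : R)%:C).
  by apply: tdenseD => //; apply: tdenseZ; exact: tdense_indic.
by apply/funext => x; rewrite indicT mulr1 -rmorphD/= addrK.
Qed.

Lemma tdense_cbounded phi : cbounded phi -> tdense phi.
Proof.
move=> [[mr mi] [M pM]].
rewrite (_ : phi = fun x => (Re (phi x))%:C + (0 +i* 1) * (Im (phi x))%:C); last first.
  by apply/funext => x; apply: complexE2; rewrite ?ReD ?ImD ?ReM ?ImM /=; ring.
apply: tdenseD; last apply: tdenseZ.
  apply: tdense_real; split; first exact: cmeas_real.
  by exists M => x; rewrite rnormC_real; apply: le_trans (ler_Re_rnorm _) (pM x).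
apply: tdense_real; split; first exact: cmeas_real.
by exists M => x; rewrite rnormC_real; apply: le_trans (ler_Im_rnorm _) (pM x).
Qed.

Lemma fsum_anti phi (A B : {fset Zd}) : cbounded phi -> fsubset A B ->
  n2 (fun x => phi x - fsum B phi x) <= n2 (fun x => phi x - fsum A phi x).
Proof.
move=> bp /fsubsetP AB.
have e x : fsum A phi x = tpoly a [seq ((a ^- d)%:C * ip phi (chi a l), l) | l <- A] x.
  by rewrite /tpoly big_map.
under [in leRHS]eq_fun do rewrite e; apply: fsum_best => //.
by move=> p /mapP[l lA ->]; exact: AB.
Qed.

Lemma fsum_le phi (A : {fset Zd}) : cbounded phi ->
  n2 (fun x => phi x - fsum A phi x) <= n2 phi.
Proof.
move=> bp; have := @fsum_best A phi [::] bp; rewrite /tpoly.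
by under [in leRHS]eq_fun do rewrite big_nil subr0; apply.
Qed.

Lemma fsum_cvg phi (e : R) : cbounded phi -> 0 < e ->
  exists A0, forall A, fsubset A0 A -> n2 (fun x => phi x - fsum A phi x) <= e.
Proof.
move=> bp e0; have [_ /(_ e e0)[s hs]] := tdense_cbounded bp.
exists [fset l in [seq p.2 | p <- s]]%fset => A /fsubsetP sA.
apply: le_trans hs; apply: fsum_best => // p ps; apply: sA.
by rewrite !inE /=; apply/mapP; exists p.
Qed.

End L2_completeness.

(** * Amalgam norms and Walnut's estimate *)

Section esum_reindexing.
Local Open Scope ereal_scope.
Context {R : realType}.

Lemma esum_bij (I J : choiceType) (e : I -> J) (a : J -> \bar R) : bijective e ->
  \esum_(i in [set: I]) a (e i) = \esum_(j in [set: J]) a j.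
Proof.
move=> [e' ee' e'e]; rewrite (reindex_esum [set: I] [set: J] e)//.
split=> //; first by move=> x y _ _ /(can_inj ee').
by move=> y _; exists (e' y).
Qed.

Lemma esum_exchange (I J : choiceType) (a : I -> J -> \bar R) : (forall i j, 0 <= a i j) ->
  \esum_(i in [set: I]) \esum_(j in [set: J]) a i j =
  \esum_(j in [set: J]) \esum_(i in [set: I]) a i j.
Proof.
move=> a0; rewrite !esum_esum//.
rewrite (reindex_esum (setT `*`` (fun=> setT)) (setT `*`` (fun=> setT)) (fun x : J * I => (x.2, x.1)))//.
split=> //=; first by move=> [i1 i2] [j1 j2] /= _ _ [] -> ->.
by move=> [i j] _; exists (j, i).
Qed.

Lemma esumZr (I : countType) (c : \bar R) (a : I -> \bar R) : 0 <= c -> (forall i, 0 <= a i) ->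
  \esum_(i in [set: I]) (a i * c) = (\esum_(i in [set: I]) a i) * c.
Proof. by move=> c0 a0; rewrite muleC -esumZl//; apply: eq_esum => i _; rewrite muleC. Qed.

Lemma lq_norm_bij (I J : countType) (e : I -> J) q (a : J -> \bar R) : 1 <= q -> bijective e ->
  lq_norm q (fun i => a (e i)) = lq_norm q a.
Proof.
move=> /ge1_real[->|[r r1 ->]] be /=; last by rewrite -(esum_bij _ be).
congr ereal_sup; apply/seteqP; split => _ [i _ <-]; first by exists (e i).
by have [e' ee' e'e] := be; exists (e' i) => //; rewrite e'e.
Qed.

End esum_reindexing.

Section lattice_points.
Context {R : realType} {d : nat}.
Local Notation Rd := 'rV[R]_d.
Local Notation Zd := 'rV[int]_d.

Definition lbox (N : nat) : set Zd := [set b | forall i, `|b ord0 i| <= N%:Z].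

Lemma finite_lbox N : finite_set (lbox N).
Proof.
pose f (x : 'rV['I_(N + N).+1]_d) : Zd := \row_i ((x ord0 i)%:Z - N%:Z).
apply: (@sub_finite_set _ _ (range f)); last exact: finite_image finite_finset.
move=> b bN; exists (\row_i inord (absz (b ord0 i + N%:Z))) => //.
apply/rowP => i; have /andP[b1 b2] : - N%:Z <= b ord0 i <= N%:Z by rewrite -ler_norml; exact: bN.
have b0 : 0 <= b ord0 i + N%:Z by rewrite -lerBlDr sub0r.
rewrite !mxE inordK.
  by rewrite gez0_abs ?addrK.
by rewrite ltnS -lez_nat gez0_abs// PoszD lerD2r.
Qed.

Lemma esum_lbox N : (\esum_(b in [set: Zd]) (if `[< lbox N b >] then 1 else 0) < +oo :> \bar R)%E.
Proof.
rewrite (_ : (\esum_(b in _) _ = \esum_(b in lbox N) 1)%E); last first.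
  rewrite [RHS]esum_mkcond; apply: eq_esum => b _.
  by rewrite /in_mem /= /in_set.
rewrite esum_fset//; last exact: finite_lbox.
rewrite fsbig_finite; last exact: finite_lbox.
by elim/big_ind: _ => [|x y|i _]; [exact: ltry|exact: lte_add_pinfty|exact: ltry].
Qed.

Definition close_to (L : R) (z : Rd) (n : Zd) := forall i, `|(n ord0 i)%:~R - z ord0 i| < L.

Lemma close_lbox (L : R) : exists N : nat, forall z n, close_to L z n ->
  lbox N (n - (\row_i Num.floor (z ord0 i))).
Proof.
(* The distance from [n] to the rounded point is below [L + 1], and [L] is below the successor of
   its truncation. *)
exists (Num.truncn L).+2 => z n h i; have {h} := h i; rewrite !mxE.
have /andP[f1 f2] := floor_itv (z ord0 i).
have t := truncnS_gt L; rewrite ltr_norml => /andP[h1 h2].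
rewrite -(ler_int R) intr_norm rmorphB /= ler_norml.
move: f2 t h1 h2 f1; rewrite rmorphD/= -pmulrn -natr1; set y := _%:~R; set m := (_.+1)%:R.
by move=> *; apply/andP; split; lra.
Qed.

(** Rounding the centre [z] and translating compares every count with that of one fixed box, so a
    single bound serves all centres. *)
Lemma close_count (L : R) : exists2 K : R, 0 <= K & forall z,
  (\esum_(n in [set: Zd]) (if `[< close_to L z n >] then 1 else 0) <= K%:E)%E.
Proof.
have [N hN] := close_lbox L; have foo := esum_lbox N.
have K0 : (0 <= \esum_(b in [set: Zd]) (if `[< lbox N b >] then 1 else 0) :> \bar R)%E.
  by apply: esum_ge0T => b; case: ifP.
exists (fine (\esum_(b in [set: Zd]) (if `[< lbox N b >] then 1 else 0))%E); first exact: fine_ge0.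
move=> z; rewrite fineK ?ge0_fin_numE//.
pose m : Zd := \row_i Num.floor (z ord0 i).
rewrite -[leRHS](@esum_bij R _ _ (fun n : Zd => n - m)); last first.
  by exists (fun n => n + m) => n; rewrite ?subrK ?addrK.
apply: le_esumT => n; case: asboolP => [/hN h|_]; last by case: ifP.
by case: asboolP.
Qed.

Lemma close_sum (L : R) : exists2 K : R, 0 <= K & forall z (c : Zd -> \bar R) (M : \bar R),
  (0 <= M)%E -> (forall n, 0 <= c n)%E -> (forall n, close_to L z n -> c n <= M)%E ->
  (\esum_(n in [set: Zd]) (if `[< close_to L z n >] then c n else 0) <= K%:E * M)%E.
Proof.
have [K K0 hK] := close_count L; exists K => // z c M M0 c0 cM.
apply: (@le_trans _ _ ((\esum_(n in [set: Zd]) (if `[< close_to L z n >] then 1 else 0)) * M)%E).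
  rewrite -esumZr//; last by move=> n; case: ifP.
  apply: le_esumT => n; case: asboolP => h; last by rewrite mul0e.
  by rewrite mul1e; exact: cM.
by apply: lee_wpmul2r.
Qed.

End lattice_points.

Section weights.
Context {R : realType} {d : nat}.
Local Notation Rd := 'rV[R]_d.

Lemma weight_bounded (w : Rd -> R) (L : R) : weight w -> 0 <= L ->
  exists2 W : R, 0 < W & forall x : Rd, (forall i, `|x ord0 i| <= L) -> w x <= W.
Proof.
move=> [cw w0 _] L0; pose A := [set x : Rd | forall i, `[- L, L]%classic (x ord0 i)].
have cA : compact A by exact: (@rV_compact _ d (fun=> `[- L, L]%classic) (fun=> @segment_compact _ _ _)).
have A0 : A !=set0 by exists 0 => i /=; rewrite mxE in_itv/= oppr_le0 L0.
have [c _ hc] := EVT_max_rV A0 cA (continuous_subspaceT cw).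
exists (w c) => // x xL; apply: hc; apply/mem_set => i /=.
by rewrite in_itv/= -ler_norml.
Qed.

End weights.

Section amalgam_norm.
Context {R : realType} {d : nat}.
Local Notation Rd := 'rV[R]_d.
Local Notation Zd := 'rV[int]_d.
Local Notation mu := (lebesgue_rV d).
Local Open Scope ereal_scope.
Implicit Types (F G : Rd -> \bar R) (p q : \bar R).

Lemma Lnorm_infty_ae F : {ae mu, forall x, `|F x| <= 'N[mu]_(+oo)[F]}.
Proof.
rewrite unlock; case: ifPn => [_|m0]; first exact: ess_sup_ge.
exists setT; split; [exact: measurableT| |exact: subsetT].
by apply/eqP; rewrite eq_le measure_ge0 andbT leNgt.
Qed.

Lemma Lnorm_translate p F (y : Rd) : 1 <= p -> measurable_fun setT F ->
  'N[mu]_p[(fun x => F (x + y)%R)] = 'N[mu]_p[F].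
Proof.
move=> p1 mF; have [-> {p1}|[r r1 ->]] := ge1_real p1.
  have le G z : 'N[mu]_(+oo)[(fun x => G (x + z)%R)] <= 'N[mu]_(+oo)[G].
    have := ae_translate z (Lnorm_infty_ae G); rewrite unlock; case: ifPn => // _ h.
    exact/ess_supP.
  apply/eqP; rewrite eq_le le /=; have := le (fun x => F (x + y)%R) (- y)%R.
  by under [X in 'N[_]_(_)[X]]eq_fun do rewrite subrK.
rewrite unlock; congr (_ `^ _).
rewrite (ge0_integral_translate y (F := fun x => `|F x| `^ r))//.
  by apply: (measurableT_comp (measurable_poweR _)); exact: measurableT_comp.
by move=> x; exact: poweR_ge0.
Qed.

Variables (a : R).
Hypothesis a0 : (0 < a)%R.
Local Notation Q k := (rV_of_int k : Rd).

(** Compares two ways of cutting space: only the cells met by the support of [G] contribute. It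
    serves for translated cells and for cells of another lattice. *)
Lemma Lnorm_cover p F G : 1 <= p -> measurable_fun setT F -> measurable_fun setT G ->
  (forall x, 0 <= G x) -> (forall x, G x <= F x) ->
  'N[mu]_p[G] <= \esum_(i in [set: Zd])
     (if `[< exists2 x, G x != 0 & cell a x = i >] then 'N[mu]_p[onc a i F] else 0).
Proof.
move=> p1 mF mG G0 GF.
rewrite [in leLHS](_ : G = fun x => \esum_(i in [set: Zd]) onc a i G x); last first.
  by apply/funext => x; rewrite esum_onc.
apply: le_trans (Lnorm_esum _ p1 _ _) _.
- by move=> i x; exact: onc_ge0.
- by move=> i; exact: measurable_onc.
apply: le_esumT => i; case: asboolP => h.
  apply: Lnorm_ge0_le => // x; first exact: onc_ge0.
  by rewrite /onc; case: ifP.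
rewrite (_ : onc a i G = fun=> 0) ?Lnorm0//; first by rewrite gt_eqF// (lt_le_trans _ p1).
apply/funext => x; rewrite /onc; case: eqP => // ci; apply/eqP; apply: contrapT => /negP Gx.
by apply: h; exists x.
Qed.

(** The amalgam norm at the level of the scalar function [|f|]. Extended-real arguments allow
    majorants given by infinite sums, whose finiteness almost everywhere is a consequence of finite
    norm. *)
Definition amnorm p q (v : Rd -> R) F : \bar R :=
  lq_norm q (fun k : Zd => 'N[mu]_p[onc a k F] * (v (a *: rV_of_int k)%R)%:E).

Lemma amalgam_normE (H : hilbertType R) p q v (f : Rd -> H) :
  amalgam_norm a p q v f = amnorm p q v (fun x => (rnorm (f x))%:E).
Proof.
rewrite /amalgam_norm /amnorm; congr lq_norm; apply/funext => k; congr (_ * _).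
congr Lnorm; apply/funext => x; rewrite /onc /translate indicE.
case: eqP => [/(cellP a0) ck|ck]; first by rewrite mem_set// mulr1.
by rewrite memNset ?mulr0// => /(cellP a0).
Qed.

Variables (p q : \bar R) (v : Rd -> R).
Hypotheses (p1 : 1 <= p) (q1 : 1 <= q) (v0 : forall x, (0 < v x)%R).
Local Notation N := (amnorm p q v).

Let v0E x : 0 <= (v x)%:E. Proof. by rewrite lee_fin ltW. Qed.

Lemma amnorm_ge0 F : 0 <= N F.
Proof. by apply: (lq_norm_ge0 0%R) => // k; apply: mule_ge0 => //; exact: Lnorm_ge0. Qed.

Lemma amnorm_ae_le F G : (forall x, 0 <= F x) -> (forall x, 0 <= G x) ->
  {ae mu, forall x, F x <= G x} -> N F <= N G.
Proof.
move=> F0 G0 FG; apply: (le_lq_norm 0%R) => // k; first by apply: mule_ge0 => //; exact: Lnorm_ge0.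
apply: lee_wpmul2r => //; apply: Lnorm_ae_le => //; apply: filterS FG => x h.
by rewrite !gee0_abs ?onc_ge0// /onc; case: ifP.
Qed.

Lemma amnorm_le F G : (forall x, 0 <= F x) -> (forall x, F x <= G x) -> N F <= N G.
Proof.
by move=> F0 FG; apply: amnorm_ae_le => //; [move=> x; apply: le_trans (FG x)|exact: aeW].
Qed.

Lemma amnorm_ae_eq F G : {ae mu, forall x, F x = G x} -> N F = N G.
Proof.
move=> FG; congr lq_norm; apply/funext => k; congr (_ * _); apply: Lnorm_ae_eq => //.
by apply: filterS FG => x; rewrite /onc => ->.
Qed.

Lemma amnormZ (c : R) F : (0 <= c)%R -> measurable_fun setT F ->
  N (fun x => c%:E * F x) = c%:E * N F.
Proof.
move=> c0 mF; rewrite -(lq_normZl 0%R)//; last first.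
  by move=> k; apply: mule_ge0 => //; exact: Lnorm_ge0.
congr lq_norm; apply/funext => k; rewrite muleA; congr (_ * _).
rewrite -LnormZl//; last exact: measurable_onc.
by congr Lnorm; apply/funext => x; rewrite /onc; case: ifP => // _; rewrite mule0.
Qed.

Lemma amnorm_esum (J : countType) (F : J -> Rd -> \bar R) : (forall j x, 0 <= F j x) ->
  (forall j, measurable_fun setT (F j)) ->
  N (fun x => \esum_(j in [set: J]) F j x) <= \esum_(j in [set: J]) N (F j).
Proof.
move=> F0 mF; apply: le_trans (lq_norm_esum 0%R q1 _); last first.
  by move=> j k; apply: mule_ge0 => //; exact: Lnorm_ge0.
apply: (le_lq_norm 0%R) => // k; first by apply: mule_ge0 => //; exact: Lnorm_ge0.
rewrite esumZr//; last by move=> j; exact: Lnorm_ge0.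
apply: lee_wpmul2r => //; apply: le_trans (Lnorm_esum _ p1 _ _); last first.
- by move=> j; exact: measurable_onc.
- by move=> j x; exact: onc_ge0.
rewrite le_eqVlt; apply/orP; left; apply/eqP; congr Lnorm; apply/funext => x.
by rewrite /onc; case: ifP => // _; rewrite esum1.
Qed.

Lemma amnorm_term F k : N F < +oo -> 'N[mu]_p[onc a k F] < +oo.
Proof.
move=> NF; have t0 i : 0 <= 'N[mu]_p[onc a i F] * (v (a *: rV_of_int i)%R)%:E.
  by apply: mule_ge0 => //; exact: Lnorm_ge0.
have := le_lt_trans (lq_norm_term k q1 t0) NF.
have := Lnorm_ge0 mu p (onc a k F); case: Lnorm => [r||]//= _; first by move=> _; exact: ltry.
by rewrite gt0_mulye ?lte_fin.
Qed.

Lemma amnorm_lty_ae F : measurable_fun setT F -> N F < +oo -> {ae mu, forall x, `|F x| < +oo}.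
Proof.
move=> mF NF.
have := ae_forall_count (fun k => Lnorm_lty_ae p1 (measurable_onc a0 k mF) (amnorm_term k NF)).
by apply: filterS => x /(_ (cell a x)); rewrite /onc eqxx.
Qed.

(** Dominated convergence is applied in [L^p] of each cell and then in [l^q] over the cells, which
    is why both exponents are finite. *)
Lemma amnorm_dct G (u : nat -> Rd -> \bar R) : p != +oo -> q != +oo ->
  measurable_fun setT G -> (forall n, measurable_fun setT (u n)) ->
  (forall n x, 0 <= u n x) -> (forall n x, u n x <= G x) -> N G < +oo ->
  {ae mu, forall x, u ^~ x @ \oo --> 0} -> N (u n) @[n --> \oo] --> 0.
Proof.
move=> pf qf mG mu' u0 uG NG uc.
have [/eqP|[r r1 pr]] := ge1_real p1; first by rewrite (negbTE pf).
have [/eqP|[s s1 qs]] := ge1_real q1; first by rewrite (negbTE qf).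
have G0 x : 0 <= G x by apply: le_trans (uG 0%N x).
have mt F' k : 0 <= 'N[mu]_p[onc a k F'] * (v (a *: rV_of_int k)%R)%:E.
  by apply: mule_ge0 => //; exact: Lnorm_ge0.
rewrite /amnorm qs; apply: (@lq_norm_dct _ _ 0%R s _
  (fun k => 'N[mu]_p[onc a k G] * (v (a *: rV_of_int k)%R)%:E)) => //.
- move=> n k; apply: lee_wpmul2r => //; apply: Lnorm_ge0_le => // x; first exact: onc_ge0.
  by rewrite /onc; case: ifP.
- by move: NG; rewrite /amnorm qs.
move=> k; rewrite -[X in _ --> X](mul0e (v (a *: rV_of_int k)%R)%:E); apply: cvgeZr => //.
rewrite pr; apply: (@Lnorm_dct _ _ _ _ _ _ (onc a k G)) => //.
- by move=> n x; exact: onc_ge0.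
- by move=> n; exact: measurable_onc.
- exact: measurable_onc.
- by rewrite -pr; exact: amnorm_term.
- by move=> n x; rewrite gee0_abs ?onc_ge0// /onc; case: ifP.
apply: filterS uc => x xc; rewrite /onc; have [_|_] := eqVneq (cell a x) k; [exact: xc|exact: cvg_cst].
Qed.

(** Hoelder in each cell, then over the lattice; the weights [v] and [1 / v] cancel at every lattice
    point. *)
Lemma amnorm_hoelder F G : measurable_fun setT F -> measurable_fun setT G ->
  (forall x, 0 <= F x) -> (forall x, 0 <= G x) -> N F < +oo ->
  amnorm (hoelder_conjugate p) (hoelder_conjugate q) (fun x => (v x)^-1)%R G < +oo ->
  \int[mu]_x (F x * G x) < +oo.
Proof.
move=> mF mG F0 G0 NF NG.
set p' := hoelder_conjugate p; set q' := hoelder_conjugate q.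
have p'1 : 1 <= p' by exact: hoelder_conj_ge1.
have vi x : 0 <= ((v x)^-1)%:E by rewrite lee_fin invr_ge0 ltW.
have NGk k : 'N[mu]_p'[onc a k G] < +oo.
  have t0 i : 0 <= 'N[mu]_p'[onc a i G] * ((v (a *: rV_of_int i)%R)^-1)%:E.
    by apply: mule_ge0 => //; exact: Lnorm_ge0.
  have := le_lt_trans (lq_norm_term k (hoelder_conj_ge1 q1) t0) NG.
  have := Lnorm_ge0 mu p' (onc a k G); case: Lnorm => [r||]//= _; first by move=> _; exact: ltry.
  by rewrite gt0_mulye// lte_fin invr_gt0.
have oM k x : onc a k (fun x => F x * G x) x = onc a k F x * onc a k G x.
  by rewrite /onc; case: ifP => // _; rewrite mule0.
rewrite (_ : \int[mu]_x _ = \int[mu]_x \esum_(k in [set: Zd]) (onc a k F x * onc a k G x)); last first.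
  apply: eq_integral => x _; rewrite -[LHS](esum_onc a (F := fun x => F x * G x))//; last first.
    by move=> y; exact: mule_ge0.
  by apply: eq_esum => k _; exact: oM.
rewrite integral_esum; last 2 first.
- by move=> k x; apply: mule_ge0; exact: onc_ge0.
- by move=> k; apply: emeasurable_funM; exact: measurable_onc.
apply: (@le_lt_trans _ _ (N F * amnorm p' q' (fun x => (v x)^-1)%R G)); last first.
  by apply: lte_mul_pinfty => //; [exact: amnorm_ge0|rewrite ge0_fin_numE// amnorm_ge0].
apply: le_trans (lq_norm_hoelder 0%R q1 _ _ NF NG).
- apply: le_esumT => k; rewrite muleACA -EFinM divff ?gt_eqF// mule1.
  apply: Lnorm_hoelder => //; [by move=> x; exact: onc_ge0|by move=> x; exact: onc_ge0|
    exact: measurable_onc|exact: measurable_onc|exact: amnorm_term].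
- by move=> k; apply: mule_ge0 => //; exact: Lnorm_ge0.
- by move=> k; apply: mule_ge0 => //; exact: Lnorm_ge0.
Qed.

End amalgam_norm.

Section Walnut_bounds.
Context {R : realType} {d : nat}.
Local Notation Rd := 'rV[R]_d.
Local Notation Zd := 'rV[int]_d.
Local Notation mu := (lebesgue_rV d).
Local Open Scope ereal_scope.
Variables (a b : R) (w v : Rd -> R).
Hypotheses (a0 : (0 < a)%R) (b0 : (0 < b)%R).
Hypotheses (w_weight : weight w) (w_sub : submultiplicative w).
Hypotheses (v_weight : weight v) (v_mod : moderate w v).
Implicit Types (F u s : Rd -> \bar R) (p q : \bar R).

Let w0 x : (0 < w x)%R. Proof. by case: w_weight. Qed.
Let v0 x : (0 < v x)%R. Proof. by case: v_weight. Qed.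

Lemma cell_close (x : Rd) i : (0 <= x ord0 i - a * (cell a x ord0 i)%:~R < a)%R.
Proof. by have /(cellP a0)/(_ i) := erefl (cell a x); rewrite !mxE. Qed.

(** The vector [z] differs from the difference of the corners of the two cells by a vector with
    coordinates in [[-a, a]], where [w] is bounded by [W]. Submultiplicativity and evenness do the
    rest. *)
Lemma weight_cells : exists2 W : R, (0 < W)%R & forall x y z : Rd, y = (x + z)%R ->
  (w z <= W * (w (a *: rV_of_int (cell a y)) * w (a *: rV_of_int (cell a x))) /\
   w (a *: rV_of_int (cell a y) - a *: rV_of_int (cell a x)) <= W * w z)%R.
Proof.
have [W W0 hW] := weight_bounded w_weight (ltW a0); exists W => // x y z yE.
pose e := (z - (a *: rV_of_int (cell a y) - a *: rV_of_int (cell a x)))%R.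
have eW : (w e <= W)%R.
  apply: hW => i; have /andP[h1 h2] := cell_close x i; have /andP[h3 h4] := cell_close y i.
  have yi : y ord0 i = (x ord0 i + z ord0 i)%R by rewrite yE mxE.
  have -> : e ord0 i = (z ord0 i - (a * (cell a y ord0 i)%:~R - a * (cell a x ord0 i)%:~R))%R.
    by rewrite !mxE.
  by rewrite ler_norml; apply/andP; split; lra.
have wN t : w (- t) = w t by case: w_weight.
have wW t : (0 <= w t)%R by exact: ltW.
split.
  rewrite (_ : z = e + (a *: rV_of_int (cell a y) - a *: rV_of_int (cell a x)))%R; last by rewrite subrK.
  apply: le_trans (w_sub _ _) _; apply: ler_pM => //.
  by apply: le_trans (w_sub _ _) _; rewrite wN.
rewrite (_ : a *: rV_of_int (cell a y) - a *: rV_of_int (cell a x) = - e + z)%R; last first.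
  by rewrite /e opprB subrK.
by apply: le_trans (w_sub _ _) _; rewrite wN ler_wpM2r.
Qed.

Lemma cell_diff_close (x y z : Rd) (c : R) : (0 < c)%R -> y = (x + z)%R ->
  close_to 1 (c^-1 *: z)%R (cell c y - cell c x).
Proof.
move=> c0 yE i; rewrite !mxE rmorphB/=.
have /(cellP c0)/(_ i) := erefl (cell c x); have /(cellP c0)/(_ i) := erefl (cell c y).
rewrite yE !mxE => /andP[h1 h2] /andP[h3 h4].
set m := (Num.floor _)%:~R in h1 h2 *; set n := (Num.floor _)%:~R in h3 h4 *.
rewrite -(ltr_pM2l c0) -(ger0_norm (ltW c0)) -normrM (ger0_norm (ltW c0)) mulr1.
have -> : (c * (m - n - c^-1 * z ord0 i) = c * m - c * n - z ord0 i)%R.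
  by rewrite !mulrBr mulVKf// gt_eqF.
by rewrite ltr_norml; apply/andP; split; lra.
Qed.

(** A translated cell meets a bounded number of cells, whatever [y], and passing from one of them to
    the original costs a factor of order [w y] in the weight. *)
Lemma amnorm_translate p q : 1 <= p -> 1 <= q -> exists2 C : R, (0 < C)%R &
  forall F (y : Rd), measurable_fun setT F -> (forall x, 0 <= F x) ->
  amnorm a p q v (fun x => F (x - y)%R) <= (C * w y)%:E * amnorm a p q v F.
Proof.
move=> p1 q1; have [W W0 hW] := weight_cells; have [Cv Cv0 hCv] := v_mod.
have [N0 hN] := close_lbox (R := R) (d := d) 1; have foo := @esum_lbox R d N0.
set Kx := (\esum_(m in [set: Zd]) (if `[< lbox N0 m >] then 1 else 0) : \bar R) in foo.
have Kx0 : 0 <= Kx by apply: esum_ge0T => m; case: ifP.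
pose K := (fine Kx + 1)%R; have K0 : (0 < K)%R by rewrite ltr_wpDl// fine_ge0.
have KxK : Kx <= K%:E by rewrite EFinD fineK ?ge0_fin_numE// leeDl.
exists (Cv * W * K)%R; first by rewrite !mulr_gt0.
move=> F y mF F0; pose Fv (i : Zd) := 'N[mu]_p[onc a i F] * (v (a *: rV_of_int i)%R)%:E.
have v0E x : 0 <= (v x)%:E by rewrite lee_fin ltW.
have Fv0 i : 0 <= Fv i by apply: mule_ge0 => //; exact: Lnorm_ge0.
pose m : Zd := (\row_i Num.floor ((a^-1 *: y)%R ord0 i))%R.
have c0 : (0 <= Cv * W * w y)%R by rewrite !mulr_ge0// ltW.
(* Translated back by [y], the cell [k] meets only cells [k - m - j] with [j] in a fixed box, where
   [m] is the cell of [y]. *)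
have step k : 'N[mu]_p[onc a k (fun x => F (x - y)%R)] * (v (a *: rV_of_int k)%R)%:E <=
    (Cv * W * w y)%:E * \esum_(j in [set: Zd]) (if `[< lbox N0 j >] then Fv (k - m - j)%R else 0).
  rewrite -(Lnorm_translate (F := onc a k (fun x => F (x - y)%R)) y)//; last first.
    by apply: measurable_onc => //; exact: (@measurable_comp_addrV _ _ (- y)%R F).
  pose G x := onc a k (fun x => F (x - y)%R) (x + y)%R.
  have GE x : G x = if cell a (x + y)%R == k then F x else 0 by rewrite /G /onc addrK.
  have mG : measurable_fun setT G.
    apply: (@measurable_comp_addrV _ _ y (onc a k (fun x => F (x - y)%R))).
    by apply: measurable_onc => //; exact: (@measurable_comp_addrV _ _ (- y)%R F).
  have G0 x : 0 <= G x by rewrite GE; case: ifP.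
  have GF x : G x <= F x by rewrite GE; case: ifP.
  apply: le_trans (lee_wpmul2r (v0E _) (Lnorm_cover a0 p1 mF mG G0 GF)) _.
  rewrite -esumZr//; last by move=> i; case: ifP => // _; exact: Lnorm_ge0.
  rewrite -(@esum_bij R _ _ (fun j : Zd => (k - m - j)%R)); last first.
    by exists (fun j => (k - m - j)%R) => j; rewrite opprB addrC subrK.
  rewrite -esumZl; [|by rewrite lee_fin|by move=> j; case: ifP].
  apply: le_esumT => j; case: asboolP => [[x Gx cx]|_]; last first.
    by rewrite mul0e mule_ge0// ?lee_fin//; case: ifP.
  have cxy : cell a (x + y)%R = k.
    by have [//|ne] := eqVneq (cell a (x + y)%R) k; move: Gx; rewrite GE (negbTE ne) eqxx.
  have jb : lbox N0 j.
    have := hN _ _ (cell_diff_close a0 (erefl (x + y)%R)).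
    rewrite cxy cx -/m (_ : (k - (k - m - j) - m = j)%R)//.
    by clear; clearbody m; apply/rowP => i; rewrite !mxE; ring.
  case: asboolP => // _; rewrite /Fv muleCA; apply: lee_wpmul2l; first exact: Lnorm_ge0.
  rewrite -EFinM lee_fin -cx -cxy; have [_ h] := hW x (x + y)%R y (erefl _).
  rewrite -[X in v X](subrK (a *: rV_of_int (cell a x))).
  apply: le_trans (hCv _ _) _; apply: ler_wpM2r; first exact: ltW.
  by rewrite -mulrA ler_wpM2l// ltW.
rewrite /amnorm; apply: le_trans (le_lq_norm 0%R q1 _ step) _.
  by move=> k; apply: mule_ge0 => //; exact: Lnorm_ge0.
rewrite (lq_normZl 0%R)//; last by move=> k; apply: esum_ge0T => j; case: ifP.
rewrite [X in _ <= X * _](_ : _ = (Cv * W * w y)%:E * K%:E); last by rewrite -EFinM mulrAC.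
rewrite -[leRHS]muleA; apply: lee_wpmul2l; first by rewrite lee_fin.
apply: le_trans (lq_norm_esum 0%R (F := fun j k => if `[< lbox N0 j >] then Fv (k - m - j)%R else 0) q1 _) _.
  by move=> j k; case: ifP.
apply: (@le_trans _ _ (Kx * lq_norm q Fv)); last first.
  by apply: lee_wpmul2r => //; exact: (lq_norm_ge0 0%R).
rewrite -esumZr//; [|exact: (lq_norm_ge0 0%R)|by move=> j; case: ifP].
apply: le_esumT => j; case: asboolP => _.
  rewrite mul1e -(@lq_norm_bij R _ _ (fun k : Zd => (k - m - j)%R) q Fv)//.
  by exists (fun k => (k + j + m)%R) => k; rewrite ?subrK ?addrK.
rewrite mul0e (_ : (fun _ : Zd => 0) = fun i : Zd => 0%:E * (fun=> 0) i).
  by rewrite (lq_normZl 0%R)// mul0e.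
by apply/funext => i; rewrite mul0e.
Qed.

Section windows.
Variables (u s : Rd -> \bar R).
Hypotheses (mu_ : measurable_fun setT u) (ms : measurable_fun setT s).
Hypotheses (u0 : forall x, 0 <= u x) (s0 : forall x, 0 <= s x).
Hypotheses (ufin : amnorm a +oo 1 w u < +oo) (sfin : amnorm a +oo 1 w s < +oo).

Let gm (f : Rd -> \bar R) (i : Zd) := 'N[mu]_(+oo)[onc a i f].
Let wl (i : Zd) := (w (a *: rV_of_int i)%R)%:E.

Let gm0 f i : 0 <= gm f i. Proof. exact: Lnorm_ge0. Qed.
Let wl0 i : 0 <= wl i. Proof. by rewrite lee_fin ltW. Qed.

Let amnorm1 f : amnorm a +oo 1 w f = \esum_(i in [set: Zd]) (gm f i * wl i).
Proof. by rewrite /amnorm lq_norm1// => i; exact: (mule_ge0 (gm0 f i) (wl0 i)). Qed.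

Let gm_ae (f : Rd -> \bar R) : (forall x, 0 <= f x) -> {ae mu, forall x, f x <= gm f (cell a x)}.
Proof.
move=> f0; have := ae_forall_count (fun i => Lnorm_infty_ae (onc a i f)).
by apply: filterS => x /(_ (cell a x)); rewrite /onc eqxx gee0_abs.
Qed.

(** A constant that dominates the Walnut sum at almost every [x]. The inner sum runs over the cells
    met by the cell [j] moved by [- n/b], and [gm] is the essential supremum on a cell. *)
Definition walnut_bound (n : Zd) : \bar R := \esum_(j in [set: Zd]) (gm s j *
  \esum_(i in [set: Zd]) (if `[< exists2 y, cell a y = j & cell a (y - b^-1 *: rV_of_int n)%R = i >]
    then gm u i else 0)).

Let G (j n : Zd) := \esum_(i in [set: Zd])
  (if `[< exists2 y, cell a y = j & cell a (y - b^-1 *: rV_of_int n)%R = i >] then gm u i else 0).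

Let G0 j n : 0 <= G j n. Proof. by apply: esum_ge0T => i; case: ifP. Qed.

Lemma walnut_bound_ge0 n : 0 <= walnut_bound n.
Proof. by apply: esum_ge0T => j; exact: (mule_ge0 (gm0 s j) (G0 j n)). Qed.

Lemma walnut_ae n : {ae mu, forall x, \esum_(k in [set: Zd])
  (s (x - a *: rV_of_int k)%R * u (x - a *: rV_of_int k - b^-1 *: rV_of_int n)%R) <= walnut_bound n}.
Proof.
have h1 := ae_forall_count (fun k : Zd => ae_translate (- (a *: rV_of_int k))%R (gm_ae s0)).
have h2 := ae_forall_count (fun k : Zd =>
  ae_translate (- (a *: rV_of_int k) - b^-1 *: rV_of_int n)%R (gm_ae u0)).
apply: filterS2 h1 h2 => x h1 h2.
have cx k : cell a (x - a *: rV_of_int k)%R = (cell a x - k)%R.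
  by rewrite -scalerN -rV_of_intN cellD.
(* As [k] varies, the cell of [x - a k] runs once through all cells, so the sum over [k] becomes a
   sum over cells. *)
rewrite /walnut_bound -[leRHS](@esum_bij R _ _ (fun k : Zd => (cell a x - k)%R)); last first.
  by exists (fun k => (cell a x - k)%R) => k; rewrite opprB addrC subrK.
apply: le_esumT => k; rewrite -cx; apply: lee_pmul => //.
rewrite -addrA; apply: le_trans (h2 k) _.
apply: le_trans (esum_term (cell a (x + (- (a *: rV_of_int k) - b^-1 *: rV_of_int n)))%R _); last first.
  by move=> i; case: ifP.
rewrite /=; case: asboolP => // h; exfalso; apply: h.
by exists (x - a *: rV_of_int k)%R; [by []|rewrite addrA].
Qed.

(** Exchange the sums. For two fixed cells [j] and [i], the points [n] whose shift [n/b] connects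
    them lie within [b a] of one centre, so their number is bounded, and [w (n/b)] is at most
    [W * w (a j) * w (a i)]. The sum is then at most a constant times the product of the amalgam
    norms of [s] and [u]. *)
Lemma walnut_bound_sum :
  \esum_(n in [set: Zd]) (walnut_bound n * (w (b^-1 *: rV_of_int n)%R)%:E) < +oo.
Proof.
have [W W0 hW] := weight_cells; have [K K0 hK] := close_sum (R := R) (d := d) (b * a).
pose wn (n : Zd) := (w (b^-1 *: rV_of_int n)%R)%:E.
have wn0 n : 0 <= wn n by rewrite lee_fin ltW.
have KW0 : 0 <= (K * W)%:E by rewrite lee_fin mulr_ge0// ltW.
pose C (j i n : Zd) := exists2 y : Rd, cell a y = j & cell a (y - b^-1 *: rV_of_int n)%R = i.
have Cw j i n : C j i n -> wn n <= W%:E * (wl j * wl i).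
  move=> [y yj yi]; have [h _] := hW (y - b^-1 *: rV_of_int n)%R y (b^-1 *: rV_of_int n)%R ltac:(by rewrite subrK).
  by rewrite /wl -!EFinM lee_fin -yj -yi.
have Cc j i n : C j i n -> close_to (b * a) (b *: (a *: rV_of_int j - a *: rV_of_int i))%R n.
  move=> [y yj yi] r; have := cell_close y r; have := cell_close (y - b^-1 *: rV_of_int n)%R r.
  rewrite yj yi; rewrite !mxE => /andP[h1 h2] /andP[h3 h4].
  move: h1 h2 h3 h4; set J := (j ord0 r)%:~R; set I := (i ord0 r)%:~R; set n' := (n ord0 r)%:~R.
  set t := y ord0 r => h1 h2 h3 h4.
  rewrite (_ : n' - _ = b * (b^-1 * n' - (a * J - a * I)))%R; last by rewrite !mulrBr mulVKf// gt_eqF.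
  rewrite normrM (ger0_norm (ltW b0)) ltr_pM2l// ltr_norml.
  by move: h1 h2; set z := (b^-1 * n')%R => h1 h2; apply/andP; split; lra.
have sumG j : \esum_(n in [set: Zd]) (G j n * wn n) <=
    (K * W)%:E * wl j * amnorm a +oo 1 w u.
  rewrite amnorm1 -esumZl; [|exact: mule_ge0|by move=> i; exact: (mule_ge0 (gm0 u i) (wl0 i))].
  have -> : \esum_(n in [set: Zd]) (G j n * wn n) = \esum_(i in [set: Zd]) \esum_(n in [set: Zd])
      ((if `[< C j i n >] then gm u i else 0) * wn n).
    rewrite esum_exchange; last by move=> i n; apply: mule_ge0 => //; case: ifP.
    by apply: eq_esum => n _; rewrite esumZr// => i; case: ifP.
  apply: le_esumT => i.
  rewrite [leRHS](_ : _ = gm u i * (K%:E * (W%:E * (wl j * wl i)))); last first.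
    by rewrite EFinM [RHS]muleC -!muleA; congr (_ * (_ * (_ * _))); rewrite muleC.
  apply: le_trans (lee_wpmul2l (gm0 u i) (hK (b *: (a *: rV_of_int j - a *: rV_of_int i))%R
    (fun n => if `[< C j i n >] then wn n else 0) (W%:E * (wl j * wl i)) _ _ _)); first last.
  - by move=> n _; case: asboolP => [/Cw//|_]; rewrite !mule_ge0// lee_fin ltW.
  - by move=> n; case: ifP.
  - by rewrite !mule_ge0// lee_fin ltW.
  rewrite -esumZl//; last by move=> n; case: ifP => // _; case: ifP.
  apply: le_esumT => n; case: asboolP => [h|_]; last first.
    by rewrite mul0e mule_ge0//; case: ifP => // _; case: ifP.
  by case: asboolP => // -[]; exact: Cc.
have -> : \esum_(n in [set: Zd]) (walnut_bound n * wn n) =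
    \esum_(j in [set: Zd]) (gm s j * \esum_(n in [set: Zd]) (G j n * wn n)).
  have t0 n j : 0 <= gm s j * (G j n * wn n) by apply: mule_ge0 => //; exact: (mule_ge0 (G0 j n) (wn0 n)).
  have -> : \esum_(j in [set: Zd]) (gm s j * \esum_(n in [set: Zd]) (G j n * wn n)) =
      \esum_(j in [set: Zd]) \esum_(n in [set: Zd]) (gm s j * (G j n * wn n)).
    by apply: eq_esum => j _; rewrite esumZl// => n; exact: (mule_ge0 (G0 j n) (wn0 n)).
  rewrite esum_exchange//; apply: eq_esum => n _; rewrite /walnut_bound -esumZr//.
    by apply: eq_esum => j _; rewrite muleA.
  by move=> j; exact: (mule_ge0 (gm0 s j) (G0 j n)).
apply: (@le_lt_trans _ _ (\esum_(j in [set: Zd]) ((K * W)%:E * amnorm a +oo 1 w u * (gm s j * wl j)))).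
  apply: le_esumT => j; apply: le_trans (lee_wpmul2l (gm0 s j) (sumG j)) _.
  have e (x y z t : \bar R) : x * (y * z * t) = y * t * (x * z).
    by rewrite muleCA [x * t]muleC muleACA [z * x]muleC.
  by rewrite e.
rewrite esumZl; last 2 first.
- by apply: mule_ge0 => //; exact: amnorm_ge0.
- by move=> j; exact: (mule_ge0 (gm0 s j) (wl0 j)).
have n0 f : 0 <= amnorm a +oo 1 w f by exact: amnorm_ge0.
rewrite -amnorm1; apply: lte_mul_pinfty => //; first exact: mule_ge0.
by rewrite fin_numM// ge0_fin_numE.
Qed.

Lemma walnut_bound_fin n : walnut_bound n < +oo.
Proof.
have t0 m : 0 <= walnut_bound m * (w (b^-1 *: rV_of_int m)%R)%:E.
  by apply: mule_ge0; [exact: walnut_bound_ge0|rewrite lee_fin ltW].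
have := le_lt_trans (esum_term n t0) walnut_bound_sum.
have := walnut_bound_ge0 n; case: (walnut_bound n) => [r||]//= _; first by move=> _; exact: ltry.
by rewrite gt0_mulye ?lte_fin.
Qed.

Let mshift (f : Rd -> \bar R) (y : Rd) : measurable_fun setT f ->
  measurable_fun setT (fun x : Rd => f (x - y)%R).
Proof. by move=> mf; exact: (@measurable_comp_addrV _ _ (- y)%R f). Qed.

Lemma walnut_total p q F : 1 <= p -> 1 <= q -> measurable_fun setT F -> (forall x, 0 <= F x) ->
  amnorm a p q v F < +oo ->
  \esum_(n in [set: Zd]) amnorm a p q v (fun x => F (x - b^-1 *: rV_of_int n)%R *
    \esum_(k in [set: Zd])
      (s (x - a *: rV_of_int k)%R * u (x - a *: rV_of_int k - b^-1 *: rV_of_int n)%R)) < +oo.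
Proof.
move=> p1 q1 mF F0 NF; have [C C0 hC] := amnorm_translate p1 q1.
have NF0 : 0 <= amnorm a p q v F by exact: amnorm_ge0.
apply: (@le_lt_trans _ _ (\esum_(n in [set: Zd]) ((C%:E * amnorm a p q v F) *
    (walnut_bound n * (w (b^-1 *: rV_of_int n)%R)%:E)))); last first.
  rewrite esumZl; last 2 first.
  - by rewrite mule_ge0// lee_fin ltW.
  - by move=> n; rewrite mule_ge0 ?walnut_bound_ge0// lee_fin ltW.
  apply: lte_mul_pinfty; last exact: walnut_bound_sum.
    by rewrite mule_ge0// lee_fin ltW.
  by rewrite fin_numM// ge0_fin_numE.
apply: le_esumT => n; have An : walnut_bound n \is a fin_num.
  by rewrite ge0_fin_numE ?walnut_bound_ge0 ?walnut_bound_fin.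
set T := fun x => _; have T0 x : 0 <= F (x - b^-1 *: rV_of_int n)%R by [].
apply: (@le_trans _ _ (amnorm a p q v (fun x => (fine (walnut_bound n))%:E * F (x - b^-1 *: rV_of_int n)%R))).
  apply: amnorm_ae_le => //.
  - by move=> x; rewrite mule_ge0//; apply: esum_ge0T => k; rewrite mule_ge0.
  - by move=> x; rewrite mule_ge0// lee_fin fine_ge0// walnut_bound_ge0.
  apply: filterS (walnut_ae n) => x h; rewrite /T fineK// muleC; exact: lee_wpmul2r.
rewrite amnormZ//; [|by rewrite fine_ge0// walnut_bound_ge0|exact: mshift].
rewrite fineK// [leRHS]muleCA; apply: lee_wpmul2l; first exact: walnut_bound_ge0.
by rewrite muleAC -EFinM; exact: hC.
Qed.

(** Supplies the [L^p] bound for the [1/b]-periodization of [f] times a shifted window. The growth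
    of [1 / v] allowed for [f] is absorbed by the [w]-decay of the window. *)
Lemma window_sum p q F k : 1 <= p -> 1 <= q -> measurable_fun setT F -> (forall x, 0 <= F x) ->
  amnorm a p q v F < +oo ->
  \esum_(j in [set: Zd]) 'N[mu]_p[onc b^-1 j (fun x => F x * u (x - a *: rV_of_int k)%R)] < +oo.
Proof.
move=> p1 q1 mF F0 NF; have bi0 : (0 < b^-1)%R by rewrite invr_gt0.
pose psi x := F x * u (x - a *: rV_of_int k)%R.
have mpsi : measurable_fun setT psi by apply: emeasurable_funM => //; exact: mshift.
have psi0 x : 0 <= psi x by exact: mule_ge0.
(* A cell of side [1/b] with index [j] that meets the cell [i] of side [a] has [j] within [b a + 1]
   of [b a i], coordinate by coordinate. *)
have [K K0 hK] := close_sum (R := R) (d := d) (b * a + 1).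
pose P (i : Zd) := 'N[mu]_p[onc a i psi]; have P0 i : 0 <= P i by exact: Lnorm_ge0.
apply: (@le_lt_trans _ _ (\esum_(i in [set: Zd]) (K%:E * P i))).
  apply: (@le_trans _ _ (\esum_(j in [set: Zd]) \esum_(i in [set: Zd])
      (if `[< exists2 x : Rd, cell b^-1 x = j & cell a x = i >] then P i else 0))).
    apply: le_esumT => j.
    have o0 x : 0 <= onc b^-1 j psi x by exact: onc_ge0.
    have ole x : onc b^-1 j psi x <= psi x by rewrite /onc; case: ifP.
    apply: le_trans (Lnorm_cover a0 p1 mpsi (measurable_onc bi0 j mpsi) o0 ole) _.
    apply: le_esumT => i; case: asboolP => [[x ox xi]|_]; last by case: ifP.
    case: asboolP => // -[]; exists x => //.
    by have [//|ne] := eqVneq (cell b^-1 x) j; move: ox; rewrite /onc (negbTE ne) eqxx.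
  rewrite esum_exchange; last by move=> j i; case: ifP.
  apply: le_esumT => i; apply: le_trans (hK (b *: (a *: rV_of_int i))%R (fun=> P i) (P i) _ _ _) => //.
  apply: le_esumT => j; case: asboolP => [[x xj xi]|_]; last by case: ifP.
  case: asboolP => // -[] r; have /andP[h1 h2] := cell_close x r.
  have /(cellP bi0)/(_ r) := xj; rewrite xi in h1 h2; rewrite !mxE => /andP[h3 h4].
  move: h1 h2 h3 h4; set J := (j ord0 r)%:~R; set I := (i ord0 r)%:~R; set t := x ord0 r => h1 h2 h3 h4.
  have h3' : (J <= b * t)%R by rewrite -(ler_pM2l bi0) mulKf ?gt_eqF// -subr_ge0.
  have h4' : (b * t - J < 1)%R by rewrite -(ltr_pM2l bi0) mulr1 mulrBr mulKf ?gt_eqF.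
  have h1' : (b * (a * I) <= b * t)%R by rewrite ler_pM2l// -subr_ge0.
  have h2' : (b * t - b * (a * I) < b * a)%R by rewrite -mulrBr ltr_pM2l.
  by rewrite ltr_norml; apply/andP; split; lra.
rewrite esumZl//; apply: lte_mul_pinfty => //.
have [Cv Cv0 hCv] := v_mod.
(* Moderateness at the points [- a i] and [a i] gives [1 / v (a i) <= Cv * w (a i) / v 0], and
   [w (a i)] is at most [w (a k) * w (a (i - k))]; [D] gathers the factors that do not depend on
   [i]. *)
pose D := (Cv * w (a *: rV_of_int k)%R / v 0)%R.
have D0 : (0 <= D)%R by rewrite /D divr_ge0 ?mulr_ge0// ltW.
have NF0 : 0 <= amnorm a p q v F by exact: amnorm_ge0.
apply: (@le_lt_trans _ _ (\esum_(i in [set: Zd]) (amnorm a p q v F * D%:E * (gm u (i - k)%R * wl (i - k)%R)))); last first.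
  rewrite esumZl; last 2 first.
  - by rewrite mule_ge0.
  - by move=> i; exact: (mule_ge0 (gm0 u _) (wl0 _)).
  rewrite (@esum_bij R _ _ (fun i : Zd => (i - k)%R) (fun i => gm u i * wl i)); last first.
    by exists (fun i => (i + k)%R) => i; rewrite ?subrK ?addrK.
  rewrite -amnorm1; apply: lte_mul_pinfty => //; first by rewrite mule_ge0.
  by rewrite fin_numM// ge0_fin_numE.
apply: le_esumT => i.
have gfin : gm u (i - k)%R \is a fin_num.
  rewrite ge0_fin_numE//; apply: (amnorm_term (q := 1) (v := w)) => //.
have Pi : P i <= gm u (i - k)%R * 'N[mu]_p[onc a i F].
  rewrite -(fineK gfin) -LnormZl//; [|by rewrite fine_ge0|exact: measurable_onc].
  apply: Lnorm_ae_le => //.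
  have := ae_translate (- (a *: rV_of_int k))%R (gm_ae u0); apply: filterS => x h.
  rewrite fineK// !gee0_abs; [|by rewrite mule_ge0// onc_ge0|exact: onc_ge0].
  rewrite /onc; case: eqP => [xi|_]; last by rewrite mule0.
  rewrite /psi muleC; apply: lee_wpmul2r => //; apply: le_trans h _.
  by rewrite -scalerN -rV_of_intN cellD// xi.
have Fi : 'N[mu]_p[onc a i F] <= amnorm a p q v F * D%:E * wl (i - k)%R.
  have t0 j : 0 <= 'N[mu]_p[onc a j F] * (v (a *: rV_of_int j)%R)%:E.
    by apply: mule_ge0; [exact: Lnorm_ge0|rewrite lee_fin ltW].
  have h := lq_norm_term i q1 t0.
  apply: (@le_trans _ _ (amnorm a p q v F * ((v (a *: rV_of_int i)%R)^-1)%:E)).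
    apply: le_trans (lee_wpmul2r _ h); last by rewrite lee_fin invr_ge0 ltW.
    by rewrite -muleA -EFinM divff ?mule1// gt_eqF.
  rewrite -muleA; apply: lee_wpmul2l => //; rewrite -EFinM lee_fin.
  have wN t : w (- t) = w t by case: w_weight.
  have h1 : (v 0 <= Cv * w (a *: rV_of_int i) * v (a *: rV_of_int i))%R.
    by have := hCv (- (a *: rV_of_int i))%R (a *: rV_of_int i)%R; rewrite addNr wN.
  have h2 : (w (a *: rV_of_int i) <= w (a *: rV_of_int k) * w (a *: rV_of_int (i - k)))%R.
    apply: le_trans (w_sub _ _); rewrite rV_of_intD rV_of_intN scalerDr scalerN.
    by rewrite addrCA subrr addr0.
  rewrite /D [leRHS]mulrAC ler_pdivlMr// mulrC ler_pdivrMr// -[X in (_ <= X * _)%R]mulrA.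
  by apply: le_trans h1 _; apply: ler_wpM2r; [exact: ltW|apply: ler_wpM2l => //; exact: ltW].
apply: le_trans Pi _; rewrite [leRHS]muleCA; apply: lee_wpmul2l => //.
Qed.

End windows.

End Walnut_bounds.

(** * Periodization *)

Section tsum_operations.
Context {R : realType}.
Implicit Types (E F : normedModType R[i]).

Lemma has_tsum_bij E (I J : countType) (e : J -> I) (b : I -> \bar R) (t : I -> E) (s : E) :
  bijective e -> has_tsum b t s -> has_tsum (fun j => b (e j)) (fun j => t (e j)) s.
Proof.
move=> be hs A'; pose A : {fset I} := [fset e j | j in A']%fset.
have einj := bij_inj be.
have sw j : (e j \in A) = (j \in A') by rewrite mem_imfset.
have -> : \sum_(j <- A') t (e j) = \sum_(i <- A) t i.
  by rewrite big_imfset//= => ? ? _ _ /einj.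
apply: le_trans (hs A) _; rewrite /tl -(esum_bij _ be).
by apply: le_esumT => p; rewrite sw.
Qed.

Lemma has_tsum_map E F (I : countType) (Psi : E -> F) (C : R) (b : I -> \bar R) (t : I -> E) (s : E) :
  0 <= C -> (forall x y, Psi (x + y) = Psi x + Psi y) -> (forall x, rnorm (Psi x) <= C * rnorm x) ->
  (forall i, 0 <= b i)%E -> has_tsum b t s ->
  has_tsum (fun i => C%:E * b i)%E (fun i => Psi (t i)) (Psi s).
Proof.
move=> C0 PD PC b0 hs A.
have P0 : Psi 0 = 0 by apply: rnorm_eq0; apply/eqP; rewrite eq_le rnorm_ge0 andbT (le_trans (PC 0))// rnorm0 mulr0.
have PN x : Psi (- x) = - Psi x by apply/eqP; rewrite -addr_eq0 -PD addNr P0.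
have -> : \sum_(i <- A) Psi (t i) = Psi (\sum_(i <- A) t i).
  by elim/big_rec2: _ => [//|i x y _ ->]; rewrite PD.
rewrite -PN -PD; apply: (@le_trans _ _ (C%:E * tl b A)%E).
  apply: (@le_trans _ _ (C * rnorm (s - \sum_(i <- A) t i))%:E); first by rewrite lee_fin.
  by rewrite EFinM; apply: lee_wpmul2l => //; exact: hs.
rewrite /tl -esumZl//; last by move=> i; case: ifP.
by apply: le_esumT => i; case: ifP => // _; rewrite mule0.
Qed.

Lemma has_tsum_exact E (I : countType) (f : I -> E) : cmplt E ->
  (\esum_(i in [set: I]) (rnorm (f i))%:E < +oo)%E ->
  has_tsum (fun i => (rnorm (f i))%:E) f (summability.sum f).
Proof.
move=> cE fin; have b0 i : (0 <= (rnorm (f i))%:E)%E by rewrite lee_fin rnorm_ge0.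
have [s hs] := has_tsum_exists cE (fun i => lexx (rnorm (f i))%:E) fin.
by rewrite (has_tsum_sum b0 fin hs).
Qed.

Lemma has_tsum_dominated E (I : countType) (b : I -> \bar R) (f : I -> E) : cmplt E ->
  (forall i, (rnorm (f i))%:E <= b i)%E -> (\esum_(i in [set: I]) b i < +oo)%E ->
  has_tsum b f (summability.sum f).
Proof.
move=> cE fb boo; have b0 i : (0 <= b i)%E by apply: le_trans (fb i); rewrite lee_fin rnorm_ge0.
have [s hs] := has_tsum_exists cE fb boo.
by rewrite (has_tsum_sum b0 boo hs).
Qed.

End tsum_operations.

Import HBSimple HBNNSimple.

(** * Closure properties of pointwise limits of simple functions *)

Section measurable_limits.
Context d (T : measurableType d) {R : realType}.
Implicit Types E F : normedModType R[i].

Lemma measurable_lty (g : T -> \bar R) : measurable_fun setT g ->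
  measurable [set x | (g x < +oo)%E].
Proof.
move=> mg; rewrite (_ : [set x | _] = ~` (g @^-1` [set +oo%E])).
  by apply: measurableC; rewrite -[X in measurable X]setTI; exact: mg.
by apply/seteqP; split => x /=; rewrite ltey => /eqP.
Qed.

(** A diagonal argument: the [m]-th approximant adds the [m]-th dominated approximants of the terms
    in [seg m]. This is how measurability reaches the operator-valued sums. *)
Lemma aplim_tsum E (I : countType) (i0 : I) (f : I -> T -> E) (S : T -> E) :
  (forall k, aplim (f k)) ->
  (forall x, (\esum_(k in [set: I]) (rnorm (f k x))%:E < +oo)%E ->
    has_tsum (fun k => (rnorm (f k x))%:E) (f ^~ x) (S x)) ->
  aplim (fun x => if x \in [set x | (\esum_(k in [set: I]) (rnorm (f k x))%:E < +oo)%E]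
    then S x else 0).
Proof.
move=> af hS; have [s hs] := choice (fun k => aplim_dominated (af k)).
pose g x := (\esum_(k in [set: I]) (rnorm (f k x))%:E)%E; rewrite -/(g _).
set Z := [set x | _].
have mZ : measurable Z.
  apply: measurable_lty; apply: measurable_esum => [k x|k]; first by rewrite lee_fin rnorm_ge0.
  by apply/measurable_EFinP; exact: aplim_rnorm.
exists (fun m x => if x \in Z then \sum_(k <- seg m) s k m x else 0); split.
  move=> m; apply: (msimple2 (fun (u : bool) v => if u then v else 0) (s := fun x => x \in Z)).
    have := @msimple_indic _ T bool Z true false mZ.
    by congr msimple; apply/funext => x; case: (x \in Z).
  by apply: msimple_sum => k; have [] := hs k.
move=> x; case: (boolP (x \in Z)) => [/set_mem xZ|_]; last exact: cvg_cst.
have hx := hS x xZ.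
(* One family for both errors: the approximation error inside [seg m] and the discarded term
   outside. It is dominated by [3 |f_k x|], so dominated convergence for series applies. *)
pose F m k := (if k \in seg m then (rnorm (f k x - s k m x))%:E else (rnorm (f k x))%:E)%E.
have F0 m k : (0 <= F m k)%E by rewrite /F; case: ifP; rewrite lee_fin rnorm_ge0.
have b0 k : (0 <= (rnorm (f k x))%:E)%E by rewrite lee_fin rnorm_ge0.
have FG m k : (F m k <= 3%:E * (rnorm (f k x))%:E)%E.
  have := rnorm_ge0 (f k x); rewrite /F -EFinM; case: ifP => _; rewrite lee_fin => r0; last by lra.
  have [_ _ /(_ m x) h] := hs k; apply: le_trans (ler_rnormB _ _) _.
  by move: h r0; set r := rnorm (f k x); set r' := rnorm (s k m x) => *; lra.
have Gfin : (\esum_(k in [set: I]) (3%:E * (rnorm (f k x))%:E) < +oo)%E.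
  by rewrite esumZl//; exact: lte_mul_pinfty.
have Fc k : F ^~ k @ \oo --> 0%E.
  apply/(ge0_cvge0P _ (fun m => F0 m k)) => e e0.
  have [_ /(_ x)/cvg_rnormP/(_ _ e0) c _] := hs k.
  apply: filterS2 c (seg_ev k) => m h km.
  by rewrite /F km lee_fin ltW.
have /(ge0_cvge0P _ (fun m => esum_ge0T (F0 m))) H := esum_dct i0 F0 FG Gfin Fc.
apply/cvg_rnormP => e e0; have e2 : 0 < e / 2 by rewrite divr_gt0.
apply: filterS (H _ e2) => m hm; apply: (@le_lt_trans _ _ (e / 2)); last by lra.
rewrite -lee_fin; apply: le_trans hm.
rewrite (esum_fset_tl (seg m))//.
rewrite (_ : tl (F m) (seg m) = tl (fun k => (rnorm (f k x))%:E) (seg m)); last first.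
  by apply: eq_esum => k _; case: ifP => // km; rewrite /F km.
rewrite (_ : (\sum_(k <- seg m) F m k = \sum_(k <- seg m) (rnorm (f k x - s k m x))%:E)%E); last first.
  by rewrite [LHS]big_seq_cond [RHS]big_seq_cond; apply: eq_bigr => k /andP[km _]; rewrite /F km.
rewrite -(subrKA (\sum_(k <- seg m) f k x)).
apply: (@le_trans _ _ ((rnorm (S x - \sum_(k <- seg m) f k x))%:E +
  (rnorm (\sum_(k <- seg m) f k x - \sum_(k <- seg m) s k m x))%:E)%E).
  by rewrite -EFinD lee_fin ler_rnormD.
rewrite [leRHS]addeC; apply: leeD; first exact: hx.
by rewrite -sumrB sumEFin lee_fin; exact: ler_rnorm_sum.
Qed.

Lemma rfunctional_measurable E (psi : E -> R) (f : T -> E) : rfunctional psi -> aplim f ->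
  measurable_fun setT (fun x => psi (f x)).
Proof.
move=> p [s [ms sf]]; have [_ _ [C C0 pC]] := p.
apply: (measurable_fun_cvg (h := fun n x => psi (s n x))) => [n|x _].
  exact: (@msimple_measurable _ _ _ _ _ psi).
apply/cvgrPdist_le => e e0; have K0 : 0 < C + 1 by rewrite ltr_wpDl.
have /cvg_rnormP/(_ _ (divr_gt0 e0 K0)) := sf x; apply: filterS => n /ltW h.
rewrite -rfunctionalB//; apply: le_trans (pC _) _.
rewrite ler_pdivlMr// in h; apply: le_trans h; rewrite mulrC ler_wpM2l ?rnorm_ge0//.
by rewrite lerDl.
Qed.

Variable mu : {measure set T -> \bar R}.

Lemma strongly_aplim E (f : T -> E) : strongly_measurable mu f ->
  exists2 f', aplim f' & {ae mu, forall x, f x = f' x}.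
Proof.
move=> [s [bs [N [mN N0 sf]]]]; exists (fun x => if x \in N then 0 else f x).
  exists (fun n x => if x \in N then 0 else s n x); split.
    move=> n; apply: (msimple2 (fun (u : bool) v => if u then 0 else v) (s := fun x => x \in N)).
      have := @msimple_indic _ T bool N true false mN.
      by congr msimple; apply/funext => x; case: (x \in N).
    by have [? ? _] := bs n; exact: msimple_fibres.
  move=> x; case: (boolP (x \in N)) => [_|/negP xN]; first exact: cvg_cst.
  by apply: contrapT => h; apply: xN; apply/mem_set; exact: sf.
exists N; split => // x h; apply: contrapT => xN; apply: h => /=.
by rewrite memNset.
Qed.

Lemma strongly_measurable_ae E (f f' : T -> E) : {ae mu, forall x, f x = f' x} ->
  strongly_measurable mu f -> strongly_measurable mu f'.
Proof.
move=> ff' [s [bs sf]]; exists s; split => //.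
by apply: filterS2 ff' sf => x <-.
Qed.

Lemma aplim_cutoff E (D : set T) (f : T -> E) : measurable D -> aplim f -> aplim (cutoff D f).
Proof.
move=> mD af; rewrite (_ : cutoff D f = fun x => if x \in D then f x else 0).
  by apply: aplim_if => //; exact: aplim_cst.
apply/funext => x; rewrite /cutoff indicE; case: (x \in D); first by rewrite scale1r.
by rewrite scale0r.
Qed.

Lemma aplim_strongly E (D : set T) (f : T -> E) : measurable D -> (mu D < +oo)%E ->
  aplim f -> strongly_measurable mu (cutoff D f).
Proof.
move=> mD Dfin [s [ms sf]]; exists (fun n => cutoff D (s n)); split; last first.
  apply: aeW => x; rewrite /cutoff indicE; case: (x \in D).
    by rewrite !scale1r; under eq_fun do rewrite scale1r; exact: sf.
  by rewrite !scale0r; under eq_fun do rewrite scale0r; exact: cvg_cst.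
move=> n; have [fin m] : msimple (cutoff D (s n)).
  apply: (msimple2 (fun u v => (u : R)%:C *: v)) (ms n).
  have := @msimple_indic _ T R D 1 0 mD.
  by congr msimple; apply/funext => x; rewrite indicE; case: (x \in D).
split=> // y y0; apply: le_lt_trans Dfin; apply: le_measure; [exact: mem_set (m _)|exact: mem_set|].
move=> x /= xy; apply: contrapT => xD; move: y0; rewrite -xy /cutoff indicE memNset//.
by rewrite scale0r eqxx.
Qed.

Lemma aplim_bilinear (E1 E2 E3 : normedModType R[i]) (B : E1 -> E2 -> E3) (f : T -> E1) (g : T -> E2) :
  (forall x x' y, B (x - x') y = B x y - B x' y) -> (forall x y y', B x (y - y') = B x y - B x y') ->
  (forall x y, rnorm (B x y) <= rnorm x * rnorm y) ->
  aplim f -> aplim g -> aplim (fun x => B (f x) (g x)).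
Proof.
move=> Bl Br Bb [s [ms sf]] [t [mt tg]]; exists (fun n x => B (s n x) (t n x)); split.
  by move=> n; exact: msimple2.
move=> x; apply/cvg_rnorm0P.
have /cvg_rnorm0P ca := sf x; have /cvg_rnorm0P cb := tg x.
have nb := cvg_rnorm _ (tg x).
apply: (@squeeze_cvgr _ _ _ _ (fun=> 0) (fun n => rnorm (f x - s n x) * rnorm (t n x) +
    rnorm (f x) * rnorm (g x - t n x))).
- apply: nearW => n; rewrite rnorm_ge0/=.
  rewrite (_ : B (f x) (g x) - B (s n x) (t n x) =
    B (f x - s n x) (t n x) + B (f x) (g x - t n x)); last first.
    by rewrite Bl Br [RHS]addrC subrKA.
  by apply: le_trans (ler_rnormD _ _) _; apply: lerD; exact: Bb.
- exact: cvg_cst.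
have c1 := cvgM ca (nb _).
have c2 : rnorm (f x) * rnorm (g x - t n x) @[n --> \oo] --> rnorm (f x) * 0 by apply: cvgMr.
rewrite [X in _ --> X](_ : 0 = 0 * rnorm (g x) + rnorm (f x) * 0); last by rewrite mul0r mulr0 addr0.
by apply: cvgD; [exact: c1|exact: c2].
Qed.

Lemma aplimZ E (z : T -> R[i]^o) (f : T -> E) : aplim z -> aplim f ->
  aplim (fun x => (z x : R[i]) *: f x).
Proof.
apply: (@aplim_bilinear R[i]^o E E (fun u v => (u : R[i]) *: v)).
- by move=> u u' v; exact: scalerBl.
- by move=> u v v'; exact: scalerBr.
by move=> u v; rewrite rnormZ.
Qed.

Lemma aplim_inner (H : hilbertType R) (f g : T -> H) : aplim f -> aplim g ->
  aplim (fun x => inner (f x) (g x) : R[i]^o).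
Proof.
apply: (@aplim_bilinear H H R[i]^o (fun u v => inner u v : R[i]^o)).
- by move=> u u' v; exact: innerBl.
- by move=> u v v'; exact: innerBr.
exact: rnorm_inner.
Qed.

Lemma aplim_rank_one (H : hilbertType R) (f g : T -> H) : aplim f -> aplim g ->
  aplim (fun x => rank_one (f x) (g x)).
Proof.
apply: (@aplim_bilinear H H (bounded_op H) (fun u v => rank_one u v)).
- by move=> u u' v; apply: bounded_opP => z; rewrite op_subE !rank_oneE scalerBr.
- by move=> u v v'; apply: bounded_opP => z; rewrite op_subE !rank_oneE innerBr scalerBl.
exact: rnorm_rank_one.
Qed.

Lemma aplim_nonneg (u : T -> R) : measurable_fun setT u -> (forall x, 0 <= u x) ->
  aplim (fun x => (u x)%:C : R[i]^o).
Proof.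
move=> mu' u0; have mE : measurable_fun setT (EFin \o u) by exact/measurable_EFinP.
pose s n := nnsfun_approx measurableT mE n.
exists (fun n (x : T) => (s n x)%:C : R[i]^o); split.
  move=> n; apply: (msimple1 (fun r : R => r%:C : R[i]^o)); apply: msimple_fibres.
    exact: fimfunP.
  by move=> y; exact: measurable_funPTI.
move=> x; have /fine_cvgP[_ c] := cvg_nnsfun_approx measurableT mE (fun x _ => u0 x) (I : setT x).
apply/cvg_rnormP => e e0; move/cvgrPdist_lt : c => /(_ e e0); apply: filterS => n.
by rewrite /= -rmorphB/= rnormC_real.
Qed.

Lemma aplim_complex (z : T -> R[i]) : cmeas z -> aplim (z : T -> R[i]^o).
Proof.
have real (u : T -> R) : measurable_fun setT u -> aplim (fun x => (u x)%:C : R[i]^o).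
  move=> mu'; rewrite (_ : (fun _ => _) = fun x => ((u^\+ x)%:C : R[i]^o) - ((u^\- x)%:C : R[i]^o)).
    by apply: aplimB; apply: aplim_nonneg => //; [exact: measurable_funrpos|exact: measurable_funrneg].
  by apply/funext => x; rewrite -rmorphB/= -[in LHS](funrposBneg u).
move=> [mr mi].
rewrite (_ : z = fun x => (complex.Re (z x))%:C - ((0 -i* 1) : R[i]) *: ((complex.Im (z x))%:C : R[i]^o)).
  by apply: aplimB; [exact: real|apply: aplimZ; [exact: aplim_cst|exact: real]].
by apply/funext => x; case: (z x) => r s; apply: complexE2; rewrite ?ReD ?ImD /=; ring.
Qed.

End measurable_limits.

Section periodization.
Context {R : realType} {d : nat} {E : normedModType R[i]}.
Local Notation Rd := 'rV[R]_d.
Local Notation Zd := 'rV[int]_d.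
Local Notation mu := (lebesgue_rV d).
Variable a : R.
Hypothesis a0 : 0 < a.
Local Notation Q := (cube a : set Rd).
Hypothesis sepE : forall x : E, (forall psi, rfunctional psi -> psi x = 0) -> x = 0.
Hypothesis cE : cmplt E.
Variable phi : Rd -> E.
Hypothesis aphi : aplim phi.
Hypothesis phifin : (\int[mu]_x (rnorm (phi x))%:E < +oo)%E.

Let mQ : measurable Q. Proof. exact: measurable_cube. Qed.

Definition pnorm (x : Rd) : \bar R := (\esum_(k in [set: Zd]) (rnorm (phi (x + a *: rV_of_int k)%R))%:E)%E.

(* the sum over all translates, set to 0 where it does not converge absolutely *)
Definition periodization (x : Rd) : E :=
  if x \in [set x | (pnorm x < +oo)%E] then summability.sum (fun k : Zd => phi (x + a *: rV_of_int k)) else 0.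

Lemma aplim_shift (f : Rd -> E) (y : Rd) : aplim f -> aplim (fun x : Rd => f (x + y)).
Proof.
move=> [s [ms sf]]; exists (fun n x => s n (x + y)); split => // n.
have [fin m] := ms n; split; first by apply: sub_finite_set fin => _ [x _ <-]; exists (x + y).
move=> Y; rewrite -[X in measurable X]setTI.
by have := @measurable_addrV R d y measurableT _ (m Y).
Qed.

Lemma aplim_periodization : aplim periodization.
Proof.
apply: (aplim_tsum (0 : Zd)) => [k|x fin]; first exact: aplim_shift.
exact: has_tsum_exact.
Qed.

Lemma periodization_periodic : Defs.periodic a periodization.
Proof.
move=> x k0.
have bij : bijective (fun k : Zd => k + k0).
  by exists (fun k => k - k0) => k; rewrite ?addrK ?subrK.
have sh k : x + a *: rV_of_int k0 + a *: rV_of_int k = x + a *: rV_of_int (k + k0).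
  by rewrite rV_of_intD scalerDr addrA addrAC.
have pE : pnorm (x + a *: rV_of_int k0) = pnorm x.
  by rewrite /pnorm -[RHS](esum_bij _ bij); apply: eq_esum => k _; rewrite sh.
rewrite /periodization (_ : (x + a *: rV_of_int k0 \in _) = (x \in [set x | (pnorm x < +oo)%E])); last first.
  by apply/idP/idP => /set_mem /= h; apply/mem_set => /=; rewrite ?pE// -pE.
case: (boolP (x \in _)) => // /set_mem /= fin.
have h := has_tsum_bij bij (has_tsum_exact cE fin).
under eq_fun do rewrite sh.
apply: (has_tsum_sum _ _ h) => [k|]; first by rewrite lee_fin rnorm_ge0.
by rewrite (esum_bij (fun k => (rnorm (phi (x + a *: rV_of_int k)%R))%:E) bij).
Qed.

Lemma measurable_pnorm : measurable_fun setT pnorm.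
Proof.
apply: measurable_esum => [k x|k]; first by rewrite lee_fin rnorm_ge0.
by apply/measurable_EFinP; apply: aplim_rnorm; exact: aplim_shift.
Qed.

Lemma int_pnorm : (\int[mu]_(x in Q) pnorm x = \int[mu]_x (rnorm (phi x))%:E)%E.
Proof.
rewrite (ge0_integral_unfold a0 (F := fun x => (rnorm (phi x))%:E))//.
  by apply/measurable_EFinP; exact: aplim_rnorm.
by move=> x; rewrite lee_fin rnorm_ge0.
Qed.

Lemma pnorm_ge0 x : (0 <= pnorm x)%E.
Proof. by apply: esum_ge0 => k _; rewrite lee_fin rnorm_ge0. Qed.

Lemma periodization_tsum : {ae mu, forall x, Q x ->
  has_tsum (fun k : Zd => (rnorm (phi (x + a *: rV_of_int k)))%:E) (fun k => phi (x + a *: rV_of_int k))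
    (periodization x)}.
Proof.
have ip : mu.-integrable Q pnorm.
  apply/integrableP; split; first by apply: measurable_funTS; exact: measurable_pnorm.
  by under eq_integral do rewrite gee0_abs ?pnorm_ge0//; rewrite int_pnorm.
have := integrable_ae mQ ip; apply: filterS => x h Qx.
have fin : (pnorm x < +oo)%E by rewrite -ge0_fin_numE ?pnorm_ge0//; exact: h.
by rewrite /periodization mem_set//; exact: has_tsum_exact.
Qed.

Lemma rnorm_periodization x : ((rnorm (periodization x))%:E <= pnorm x)%E.
Proof.
rewrite /periodization; case: (boolP (x \in _)) => [/set_mem /= fin|_]; last by rewrite rnorm0 pnorm_ge0.
by apply: (has_tsum_norm _ (has_tsum_exact cE fin)) => k; rewrite lee_fin rnorm_ge0.
Qed.

(** The periodic factor [zeta] passes through the sum over translates, and each real functional then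
    reduces the claim to scalar unfolding. Conjugate characters as [zeta] give the Fourier
    coefficients of [G_n] and of the multipliers. *)
Lemma bochner_periodization (zeta : Rd -> R[i]^o) : aplim zeta -> Defs.periodic a zeta ->
  (forall x, rnorm (zeta x) <= 1) ->
  exists2 I, has_bochner_integral mu (cutoff Q (fun x => (zeta x : R[i]) *: periodization x)) I &
    has_bochner_integral mu (cutoff setT (fun x => (zeta x : R[i]) *: phi x)) I.
Proof.
move=> az pz z1.
have zb (f : Rd -> E) x : rnorm ((zeta x : R[i]) *: f x) <= rnorm (f x).
  by rewrite rnormZ ler_piMl// rnorm_ge0.
have aS : aplim (cutoff Q (fun x => (zeta x : R[i]) *: periodization x)).
  by apply: aplim_cutoff => //; exact: (aplimZ az aplim_periodization).
have aP : aplim (cutoff setT (fun x => (zeta x : R[i]) *: phi x)).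
  by apply: aplim_cutoff => //; exact: (aplimZ az aphi).
have [I hI] : exists I, has_bochner_integral mu (cutoff Q (fun x => (zeta x : R[i]) *: periodization x)) I.
  apply: has_bochner_exists => //.
  rewrite (cutoff_int mu Q (fun x => (zeta x : R[i]) *: periodization x) (h := fun y => rnorm y)) ?rnorm0//.
  apply: le_lt_trans phifin; rewrite -int_pnorm; apply: ge0_le_integral => //.
  - by move=> x _; rewrite lee_fin rnorm_ge0.
  - apply: measurable_funTS; apply/measurable_EFinP; apply: aplim_rnorm.
    exact: (aplimZ az aplim_periodization).
  - by apply: measurable_funTS; exact: measurable_pnorm.
  by move=> x _; apply: le_trans (rnorm_periodization x); rewrite lee_fin zb.
have [J hJ] : exists J, has_bochner_integral mu (cutoff setT (fun x => (zeta x : R[i]) *: phi x)) J.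
  apply: has_bochner_exists => //.
  rewrite (cutoff_int mu setT (fun x => (zeta x : R[i]) *: phi x) (h := fun y => rnorm y)) ?rnorm0//.
  apply: le_lt_trans phifin; apply: ge0_le_integral => //.
  - by move=> x _; rewrite lee_fin rnorm_ge0.
  - by apply/measurable_EFinP; apply: aplim_rnorm; exact: (aplimZ az aphi).
  - by apply/measurable_EFinP; exact: aplim_rnorm.
  by move=> x _; rewrite lee_fin zb.
exists I => //; suff -> : I = J by [].
apply/eqP; rewrite -subr_eq0; apply/eqP; apply: sepE => psi p.
have [pD pZ [C C0 pC]] := p; have p0 := rfunctional0 p.
rewrite rfunctionalB//; apply/eqP; rewrite subr_eq0; apply/eqP; apply: EFin_inj.
rewrite (rfunctional_bochner p hI) (rfunctional_bochner p hJ).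
rewrite (cutoff_int mu Q (fun x => (zeta x : R[i]) *: periodization x) p0).
rewrite (cutoff_int mu setT (fun x => (zeta x : R[i]) *: phi x) p0).
apply: (real_unfold a0 (n := fun x => C * rnorm (phi x))).
- by apply: (rfunctional_measurable p); exact: (aplimZ az aphi).
- by apply: measurable_funM => //; exact: aplim_rnorm.
- by move=> x; apply: le_trans (pC _) _; rewrite ler_wpM2l.
- under eq_integral do rewrite EFinM.
  rewrite ge0_integralZl//.
  + by apply: lte_mul_pinfty.
  + by apply/measurable_EFinP; exact: aplim_rnorm.
  + by move=> x _; rewrite lee_fin rnorm_ge0.
apply: filterS periodization_tsum => x h Qx A; have {}h := h Qx A.
rewrite -rfunctional_sum// -rfunctionalB//.
apply: (@le_trans _ _ (C * rnorm (periodization x - \sum_(k <- A) phi (x + a *: rV_of_int k)))%:E).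
  rewrite lee_fin; apply: le_trans (pC _) _; apply: ler_wpM2l => //.
  under eq_bigr do rewrite pz; rewrite -scaler_sumr -scalerBr.
  by rewrite rnormZ ler_piMl// rnorm_ge0.
rewrite EFinM; apply: le_trans (lee_wpmul2l _ h) _; first by rewrite lee_fin.
rewrite /tl -esumZl//; last by move=> k; case: ifP; rewrite ?lee_fin ?rnorm_ge0.
by apply: le_esumT => k; case: ifP => // _; rewrite mule0.
Qed.

End periodization.

(** * Fourier series of periodized rank-one operators *)

Lemma ae_on_periodic (R : realType) d (a : R) (P : 'rV[R]_d -> Prop) : 0 < a ->
  Defs.periodic a P -> {ae lebesgue_rV d, forall x, cube a x -> P x} ->
  {ae lebesgue_rV d, forall x, P x}.
Proof.
move=> a0 pP h.
have := ae_forall_count (fun k : 'rV[int]_d => ae_translate (- (a *: rV_of_int k)) h).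
apply: filterS => x /(_ (cell a x)); rewrite -scalerN -rV_of_intN pP; apply.
by rewrite rV_of_intN scalerN; exact/cellP.
Qed.

Lemma integral_esum_on d (T : measurableType d) (R : realType) (mu : {measure set T -> \bar R})
    (I : countType) (D : set T) (F : I -> T -> \bar R) : measurable D ->
  (forall i x, 0 <= F i x)%E -> (forall i, measurable_fun setT (F i)) ->
  (\int[mu]_(x in D) (\esum_(i in [set: I]) F i x) = \esum_(i in [set: I]) \int[mu]_(x in D) F i x)%E.
Proof.
move=> mD F0 mF; rewrite integral_mkcond.
rewrite (_ : _ \_ D = fun x => \esum_(i in [set: I]) (F i \_ D) x)%E; last first.
  apply/funext => x; rewrite patchE; case: (boolP (x \in D)) => xD.
    by apply: eq_esum => i _; rewrite patchE xD.
  by rewrite esum1// => i _; rewrite patchE (negbTE xD).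
rewrite integral_esum.
- by apply: eq_esum => i _; rewrite [RHS]integral_mkcond.
- by move=> i x; rewrite patchE; case: ifP.
by move=> i; apply/(measurable_restrictT _ mD).1; exact: measurable_funTS.
Qed.

Lemma seg_sub (I : countType) (A : {fset I}) : \forall n \near \oo, fsubset A (seg n).
Proof.
exists (\max_(i <- A) (choice.pickle i).+1)%N => // n An; apply/fsubsetP => i iA.
by rewrite in_seg; apply: leq_trans An; apply: (@leq_bigmax_seq _ _ _ (fun i => (choice.pickle i).+1)).
Qed.

Section hilbert_schmidt.
Context {R : realType} {H : hilbertType R}.
Variable c : nat -> H.
Hypothesis cd : forall (z : H) (e : R), 0 < e -> exists m, rnorm (z - c m) < e.

Lemma rnorm_rank_oneE (x y : H) : rnorm (rank_one x y) = rnorm x * rnorm y.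
Proof.
apply/eqP; rewrite eq_le rnorm_rank_one/=.
have [->|y0] := eqVneq y 0; first by rewrite rnorm0 mulr0 rnorm_ge0.
have ny : 0 < rnorm y by rewrite lt_neqAle rnorm_ge0 andbT eq_sym; apply: contra_neq y0; exact: rnorm_eq0.
have := op_bound (rank_one x y) y; rewrite rank_oneE inner_rnorm rnormRZ ger0_norm ?sqr_ge0//.
by rewrite expr2 -mulrA mulrC ler_pM2r// mulrC.
Qed.

Definition opcoef (A : bounded_op H) (i : nat * nat) : R[i] := inner (A (onb c i.1)) (onb c i.2).

Lemma opcoefD A B i : opcoef (A + B) i = opcoef A i + opcoef B i.
Proof. by rewrite /opcoef op_addE innerDl. Qed.

Lemma opcoefZ (z : R[i]) A i : opcoef (z *: A) i = z * opcoef A i.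
Proof. by rewrite /opcoef op_scaleE innerZl. Qed.

Lemma opcoef0 i : opcoef 0 i = 0.
Proof. by rewrite -(scale0r (0 : bounded_op H)) opcoefZ mul0r. Qed.

Lemma opcoef_sum (I : Type) (r : seq I) (F : I -> bounded_op H) i :
  opcoef (\sum_(j <- r) F j) i = \sum_(j <- r) opcoef (F j) i.
Proof.
by elim/big_rec2: _ => [|j x y _ <-]; [exact: opcoef0|exact: opcoefD].
Qed.

Lemma onb_le1 n : rnorm (onb c n) <= 1.
Proof. by case: (onb_01 c n) => ->; rewrite ?rnorm0 ?ler01. Qed.

Lemma rnorm_opcoef A i : rnorm (opcoef A i : R[i]^o) <= rnorm A.
Proof.
apply: le_trans (rnorm_inner _ _) _; apply: (@le_trans _ _ (rnorm A * rnorm (onb c i.1) * 1)).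
  by apply: ler_pM; rewrite ?rnorm_ge0 ?op_bound ?onb_le1.
by rewrite mulr1 ler_piMr ?rnorm_ge0 ?onb_le1.
Qed.

Lemma rfunctional_Re_opcoef i : rfunctional (fun A : bounded_op H => complex.Re (opcoef A i)).
Proof. exact: (rfunctional_op (onb c i.1) (rfunctional_ReI (onb c i.2))). Qed.

Lemma rfunctional_Im_opcoef i : rfunctional (fun A : bounded_op H => complex.Im (opcoef A i)).
Proof. exact: (rfunctional_op (onb c i.1) (rfunctional_ImI (onb c i.2))). Qed.

Lemma parseval_esum z : (\esum_(i in [set: nat]) (rnorm (inner z (onb c i) : R[i]^o) ^+ 2)%:E = (rnorm z ^+ 2)%:E)%E.
Proof. by rewrite -(parseval cd) nneseries_esumT// => n; rewrite lee_fin sqr_ge0. Qed.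

Lemma op_norm_coef A :
  ((rnorm A ^+ 2)%:E <= \esum_(i in [set: nat * nat]) (rnorm (opcoef A i : R[i]^o) ^+ 2)%:E)%E.
Proof.
apply: le_trans (op_norm_HS cd A) _.
have s0 r s : (0 <= (rnorm (inner (A (onb c r)) (onb c s) : R[i]^o) ^+ 2)%:E)%E by rewrite lee_fin sqr_ge0.
rewrite nneseries_esumT; last by move=> r; apply: nneseries_ge0 => s _ _.
under eq_esum => r _ do rewrite nneseries_esumT//.
rewrite esum_esum; last by move=> r s _ _.
by rewrite (_ : _ `*`` _ = setT) //; apply/seteqP; split.
Qed.

(** The matrix entries of a rank-one operator factor, so Parseval is applied once in each
    variable. *)
Lemma lq2_rank_one (x y : H) :
  lq_norm 2%:E (fun i : nat * nat => (rnorm (opcoef (rank_one x y) i : R[i]^o))%:E) = (rnorm (rank_one x y))%:E.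
Proof.
have e (i : nat * nat) : ((rnorm (opcoef (rank_one x y) i : R[i]^o))%:E `^ 2 =
    (rnorm (inner y (onb c i.1) : R[i]^o) ^+ 2)%:E * (rnorm (inner x (onb c i.2) : R[i]^o) ^+ 2)%:E)%E.
  rewrite poweR_EFin powR_mulrn ?rnorm_ge0// /opcoef rank_oneE innerZl rnormCM exprMn EFinM.
  by rewrite innerC rnormC_conj.
have s0 z j : (0 <= (rnorm (inner z (onb c j) : R[i]^o) ^+ 2)%:E)%E by rewrite lee_fin sqr_ge0.
rewrite /lq_norm; under eq_esum do rewrite e.
rewrite (_ : [set: nat * nat] = setT `*`` (fun=> setT)); last by apply/esym/seteqP; split.
rewrite -(esum_esum (a := fun r s => (rnorm (inner y (onb c r) : R[i]^o) ^+ 2)%:E *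
   (rnorm (inner x (onb c s) : R[i]^o) ^+ 2)%:E)%E); last by move=> r s _ _; rewrite mule_ge0.
under eq_esum do rewrite esumZl// parseval_esum.
rewrite esumZr ?lee_fin ?sqr_ge0// parseval_esum -EFinM -exprMn poweR_EFin.
rewrite rnorm_rank_oneE mulrC -powR_mulrn ?mulr_ge0 ?rnorm_ge0//.
by rewrite -powRrM divff// powRr1// mulr_ge0 ?rnorm_ge0.
Qed.

End hilbert_schmidt.

Section rank_one_periodization.
Context {R : realType} {d : nat} {H : hilbertType R}.
Local Notation Rd := 'rV[R]_d.
Local Notation Zd := 'rV[int]_d.
Local Notation mu := (lebesgue_rV d).
Local Notation BH := (bounded_op H).
Variable a : R.
Hypothesis a0 : 0 < a.
Local Notation Q := (cube a : set Rd).
Variable c : nat -> H.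
Hypothesis cd : forall (z : H) (e : R), 0 < e -> exists m, rnorm (z - c m) < e.
Variables s u : Rd -> H.
Hypotheses (as_ : aplim s) (au : aplim u).
Local Notation phi := (fun x : Rd => rank_one (s x) (u x)).
Variable A : R.
Hypothesis A0 : 0 <= A.
Hypothesis phiA : {ae mu, forall x, (pnorm a phi x <= A%:E)%E}.

Let mQ : measurable Q. Proof. exact: measurable_cube. Qed.
Let cB := @cmpltB R H.
Let sB := @sepB R H.
Local Notation P := (periodization a phi).

Let aphi : aplim phi. Proof. exact: aplim_rank_one. Qed.

Lemma rank_one_int : (\int[mu]_x (rnorm (phi x))%:E < +oo)%E.
Proof.
rewrite -(int_pnorm a0 aphi).
apply: (@le_lt_trans _ _ (\int[mu]_(x in Q) A%:E)%E).
  rewrite [leLHS]integral_mkcond [leRHS]integral_mkcond; apply: ge0_ae_le_integral.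
  - by move=> x; rewrite patchE; case: ifP => // _; exact: pnorm_ge0.
  - by move=> x; rewrite patchE; case: ifP => // _; rewrite lee_fin.
  by apply: filterS phiA => x h; rewrite !patchE; case: ifP.
by rewrite integral_cst//=; apply: lte_mul_pinfty => //; exact: cube_fin.
Qed.

(** A representative bounded at every point, so that its matrix entries belong to the bounded
    measurable functions for which the [L^2] theory is set up. *)
Definition bperiodization x := if x \in [set x | (pnorm a phi x <= A%:E)%E] then P x else 0.
Local Notation G := bperiodization.

Lemma aplim_bperiodization : aplim G.
Proof.
apply: aplim_if; [|exact: aplim_periodization|exact: aplim_cst].
rewrite (_ : [set x | _] = pnorm a phi @^-1` [set y | (y <= A%:E)%E]).
  rewrite -[X in measurable X]setTI; apply: (measurable_pnorm _ aphi) => //.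
  by rewrite -set_itvNyc; exact: emeasurable_itv.
by apply/seteqP; split.
Qed.

Lemma bperiodization_ae : {ae mu, forall x, P x = G x}.
Proof. by apply: filterS phiA => x h; rewrite /G mem_set. Qed.

Lemma bperiodization_tsum x : (pnorm a phi x <= A%:E)%E ->
  has_tsum (fun k : Zd => (rnorm (phi (x + a *: rV_of_int k)))%:E) (fun k => phi (x + a *: rV_of_int k)) (P x).
Proof.
move=> h; have fin : (pnorm a phi x < +oo)%E by apply: le_lt_trans h _; exact: ltry.
by rewrite /periodization mem_set//; exact: has_tsum_exact.
Qed.

(** Minkowski in [l^2] over the entries bounds the Hilbert-Schmidt norm of the sum by the sum of the
    Hilbert-Schmidt norms of the terms. Those equal operator norms, whose sum is at most [A]. *)
Lemma lq2_bperiodization x :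
  (lq_norm 2%:E (fun i : nat * nat => (rnorm (opcoef c (G x) i : R[i]^o))%:E) <= A%:E)%E.
Proof.
have b0 (B : BH) i : (0 <= (rnorm (opcoef c B i : R[i]^o))%:E)%E by rewrite lee_fin rnorm_ge0.
have q2 : (1 <= 2%:E :> \bar R)%E by rewrite lee_fin ler1n.
rewrite /G; case: (boolP (x \in _)) => [/set_mem h|_]; last first.
  rewrite (_ : (fun _ => _) = fun i : nat * nat => 0%:E * 1%:E)%E; last first.
    by apply/funext => i; rewrite opcoef0 rnorm0 mul0e.
  by rewrite (lq_normZl (0%N, 0%N))// mul0e lee_fin.
have {}h : (pnorm a phi x <= A%:E)%E := h.
have hs := bperiodization_tsum h.
apply: le_trans (h); apply: (@le_trans _ _ (lq_norm 2%:E (fun i : nat * nat =>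
    \esum_(k in [set: Zd]) (rnorm (opcoef c (phi (x + a *: rV_of_int k)) i : R[i]^o))%:E))%E).
  apply: (le_lq_norm (0%N, 0%N)) => // i.
  have fin : (\esum_(k in [set: Zd]) (rnorm (opcoef c (phi (x + a *: rV_of_int k)) i : R[i]^o))%:E < +oo)%E.
    apply: le_lt_trans (le_lt_trans h (ltry A)).
    by apply: le_esumT => k; rewrite lee_fin; exact: rnorm_opcoef.
  have r1 (B : BH) : rnorm (opcoef c B i : R[i]^o) <= 1 * rnorm B by rewrite mul1r rnorm_opcoef.
  have r0 (k : Zd) : (0 <= (rnorm (phi (x + a *: rV_of_int k)))%:E)%E by rewrite lee_fin rnorm_ge0.
  have h1 := has_tsum_map (Psi := fun B => opcoef c B i : R[i]^o) ler01 (fun B B' => opcoefD c B B' i) r1 r0 hs.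
  have e : summability.sum (fun k : Zd => opcoef c (phi (x + a *: rV_of_int k)) i : R[i]^o) = opcoef c (P x) i.
    apply: (has_tsum_sum _ _ h1); first by move=> k; rewrite mul1e lee_fin rnorm_ge0.
    by under eq_esum do rewrite mul1e; exact: (le_lt_trans h (ltry A)).
  rewrite -e; apply: (has_tsum_norm (b := fun k => (rnorm (opcoef c (phi (x + a *: rV_of_int k)) i : R[i]^o))%:E)) => //.
  by apply: has_tsum_exact => //; exact: cmpltC.
apply: le_trans (lq_norm_esum (0%N, 0%N) q2 _) _; first by move=> k i; exact: b0.
by apply: le_esumT => k; rewrite lq2_rank_one.
Qed.

Lemma rnorm_bperiodization x : rnorm (G x) <= A.
Proof.
rewrite /G; case: (boolP (x \in _)) => [/set_mem /= h|_]; last by rewrite rnorm0.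
by rewrite -lee_fin; apply: le_trans h; exact: rnorm_periodization.
Qed.

Definition mcoef i x := opcoef c (G x) i.

Lemma cbounded_mcoef i : cbounded (mcoef i).
Proof.
split.
  split; first exact: (rfunctional_measurable (rfunctional_Re_opcoef c i) aplim_bperiodization).
  exact: (rfunctional_measurable (rfunctional_Im_opcoef c i) aplim_bperiodization).
by exists A => x; apply: le_trans (rnorm_opcoef _ _ _) (rnorm_bperiodization x).
Qed.

(** The integrated Hilbert-Schmidt bound. It is the summable majorant for the errors of the
    entrywise Fourier series. *)
Lemma sum_n2_mcoef : (\esum_(i in [set: nat * nat]) (n2 a (mcoef i))%:E < +oo)%E.
Proof.
under eq_esum => i _ do rewrite (n2_fin (a := a) a0 (cbounded_mcoef i)).
rewrite -integral_esum_on//; last 2 first.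
- by move=> i x; rewrite lee_fin sqr_ge0.
- move=> i; apply/measurable_EFinP; apply: measurable_funX.
  by apply: cmeas_rnorm; case: (cbounded_mcoef i).
apply: (@le_lt_trans _ _ (\int[mu]_(x in Q) (A ^+ 2)%:E)%E); last first.
  rewrite integral_cst//=; apply: lte_mul_pinfty; rewrite ?lee_fin ?sqr_ge0//; exact: cube_fin.
apply: ge0_le_integral => //.
- by move=> x _; apply: esum_ge0 => i _; rewrite lee_fin sqr_ge0.
- apply: measurable_funTS; apply: measurable_esum => [i x|i]; first by rewrite lee_fin sqr_ge0.
  apply/measurable_EFinP; apply: measurable_funX.
  by apply: cmeas_rnorm; case: (cbounded_mcoef i).
move=> x _; have := lq2_bperiodization x; rewrite /lq_norm.
have e (i : nat * nat) : ((rnorm (opcoef c (G x) i : R[i]^o))%:E `^ 2 = (rnorm (mcoef i x : R[i]^o) ^+ 2)%:E)%E.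
  by rewrite poweR_EFin powR_mulrn ?rnorm_ge0.
under eq_esum do rewrite e.
set S := (\esum_(i in _) _)%E; have S0 : (0 <= S)%E by apply: esum_ge0 => i _; rewrite lee_fin sqr_ge0.
move=> h; have := le_poweR (r := 2) (ler0n _ _) (poweR_ge0 _ _) h.
rewrite -poweRrM mulVf// poweRe1// poweR_EFin powR_mulrn//.
Qed.

Let zeta (l : Zd) (x : Rd) : R[i]^o := chi a (- l) x.

Lemma aplim_zeta l : aplim (zeta l).
Proof. by apply: aplim_complex; exact: cmeas_chi. Qed.

Lemma bochner_rank_one l :
  exists2 I, has_bochner_integral mu (cutoff Q (fun x => (zeta l x : R[i]) *: P x)) I &
    has_bochner_integral mu (cutoff setT (fun x => (zeta l x : R[i]) *: phi x)) I.
Proof.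
apply: bochner_periodization => //.
- exact: rank_one_int.
- exact: aplim_zeta.
- exact: chi_periodic.
by move=> x; rewrite rnorm_chi.
Qed.

Variable C : Zd -> BH.
Hypothesis hC : forall l, has_bochner_integral mu (cutoff Q (fun x => (zeta l x : R[i]) *: P x)) (C l).

Lemma ip_mcoef i l : ip a (mcoef i) (chi a l) = opcoef c (C l) i.
Proof.
have h : has_bochner_integral mu (cutoff Q (fun x => (zeta l x : R[i]) *: G x)) (C l).
  apply: has_bochner_ae (hC l); apply: filterS bperiodization_ae => x.
  by rewrite /cutoff => ->.
rewrite (bochner_cint (Psi := fun B => opcoef c B i) (rfunctional_Re_opcoef c i) (rfunctional_Im_opcoef c i) h).
rewrite (cint_cutoff mu (Psi := fun B => opcoef c B i) Q (fun x => (zeta l x : R[i]) *: G x) (opcoef0 c i)).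
by apply: eq_cint => x _; rewrite opcoefZ /zeta chiN mulrC.
Qed.

Lemma fourier_sum_coef (F : {fset Zd}) i x :
  opcoef c (fourier_sum a (fun l => (a ^- d)%:C *: C l) F x) i = fsum a F (mcoef i) x.
Proof.
rewrite /fourier_sum partial_sumE opcoef_sum /fsum; apply: eq_bigr => l _.
by rewrite !opcoefZ ip_mcoef mulrC.
Qed.

Lemma fourier_series_rank_one :
  fourier_series_L2 a (fun l => (a ^- d)%:C *: C l) P.
Proof.
have cE : {ae mu, forall x, cutoff Q G x = cutoff Q P x}.
  by apply: filterS bperiodization_ae => x; rewrite /cutoff => ->.
have q2 : (1 <= 2%:E :> \bar R)%E by rewrite lee_fin ler1n.
split.
  split.
    apply: (strongly_measurable_ae cE); apply: aplim_strongly => //; first exact: cube_fin.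
    exact: aplim_bperiodization.
  rewrite /Lp_norm (Lnorm_ae_eq (g := fun x => (rnorm (cutoff Q G x))%:E) q2); last first.
    by apply: filterS cE => x ->.
  rewrite unlock /=.
  have fin : (\int[mu]_x (`|(rnorm (cutoff Q G x))%:E| `^ 2) < +oo)%E.
    apply: (@le_lt_trans _ _ (\int[mu]_(x in Q) (A ^+ 2)%:E)%E).
      rewrite [leRHS]integral_mkcond; apply: ge0_ae_le_integral; [by move=> x; exact: poweR_ge0| |].
        by move=> x; rewrite patchE; case: ifP => // _; rewrite lee_fin sqr_ge0.
      apply: aeW => x; rewrite gee0_abs ?lee_fin ?rnorm_ge0// poweR_EFin powR_mulrn ?rnorm_ge0//.
      rewrite patchE /cutoff indicE; case: (x \in Q); last by rewrite scale0r rnorm0 expr0n.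
      by rewrite scale1r lee_fin ler_pXn2r ?nnegrE ?rnorm_ge0 ?rnorm_bperiodization.
    rewrite integral_cst//=; apply: lte_mul_pinfty; rewrite ?lee_fin ?sqr_ge0//; exact: cube_fin.
  by apply: poweR_lty.
(* The total squared error over all entries. Each entry tends to 0 and never exceeds its value
   without any Fourier term, so dominated convergence over the entries applies. *)
pose B m := (\esum_(i in [set: nat * nat]) (n2 a (fun x => (mcoef i x - fsum a (seg m) (mcoef i) x)%R))%:E)%E.
have n0 (ph : Rd -> R[i]) : (0 <= (n2 a ph)%:E)%E by rewrite lee_fin n2_ge0.
have Bc : B m @[m --> \oo] --> 0%E.
  apply: (esum_dct (0%N, 0%N) (g := fun i => (n2 a (mcoef i))%:E)) => //.
  - by move=> m i; rewrite lee_fin fsum_le//; exact: cbounded_mcoef.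
  - exact: sum_n2_mcoef.
  move=> i; apply/(ge0_cvge0P _ (fun m => n0 _)) => e e0.
  have [F0 hF] := fsum_cvg a0 (cbounded_mcoef i) e0.
  by apply: filterS (seg_sub F0) => m sm; rewrite lee_fin hF.
have r0 : 0 < 2^-1 :> R by rewrite invr_gt0.
have B2c := cvge_poweR0 r0 (fun m => esum_ge0T (fun i => n0 _)) Bc.
apply: (cvg_totally0 _ _ B2c) => [F|F m mF]; first exact: Lnorm_ge0.
rewrite /Lp_norm unlock; apply: le_poweR; [by rewrite invr_ge0|by apply: integral_ge0 => x _; exact: poweR_ge0|].
apply: (@le_trans _ _ (\esum_(i in [set: nat * nat]) (n2 a (fun x => (mcoef i x - fsum a F (mcoef i) x)%R))%:E)%E); last first.
  by apply: le_esumT => i; rewrite lee_fin fsum_anti//; exact: cbounded_mcoef.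
have bD i : cbounded (fun x => mcoef i x - fsum a F (mcoef i) x).
  by apply: cboundedD; [exact: cbounded_mcoef|apply: cboundedN; exact: cbounded_fsum].
under [leRHS]eq_esum => i _ do rewrite (n2_fin a0 (bD i)).
rewrite -integral_esum_on//; last 2 first.
- by move=> i x; rewrite lee_fin sqr_ge0.
- by move=> i; apply/measurable_EFinP; apply: measurable_funX; apply: cmeas_rnorm; case: (bD i).
rewrite [leRHS]integral_mkcond; apply: ge0_ae_le_integral; [by move=> x; exact: poweR_ge0| |].
  by move=> x; rewrite patchE; case: ifP => // _; apply: esum_ge0 => i _; rewrite lee_fin sqr_ge0.
apply: filterS bperiodization_ae => x Px.
rewrite gee0_abs ?lee_fin ?rnorm_ge0// poweR_EFin powR_mulrn ?rnorm_ge0//.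
rewrite patchE /cutoff indicE; case: (x \in Q); last by rewrite scale0r rnorm0 expr0n.
rewrite scale1r rnorm_distC Px; apply: le_trans (op_norm_coef cd _) _; apply: le_esumT => i.
by rewrite -[X in _ + X]scaleN1r opcoefD opcoefZ mulN1r fourier_sum_coef.
Qed.

End rank_one_periodization.

(** * Scalar pairings, and uniqueness almost everywhere of functions chosen by their Fourier data *)

Section uniqueness_of_limits.
Context {R : realType} {d : nat}.
Local Notation Rd := 'rV[R]_d.
Local Notation Zd := 'rV[int]_d.
Local Notation mu := (lebesgue_rV d).

Lemma aplim_cmeas e (T : measurableType e) (z : T -> R[i]) : aplim (z : T -> R[i]^o) -> cmeas z.
Proof.
by split; [exact: (rfunctional_measurable (@rfunctional_Re R))|
  exact: (rfunctional_measurable (@rfunctional_Im R))].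
Qed.

Lemma rnorm_cint_le e (T : measurableType e) (nu : {measure set T -> \bar R}) (D : set T) (z : T -> R[i]) :
  measurable D -> cmeas z -> (\int[nu]_(x in D) (rnorm (z x : R[i]^o))%:E < +oo)%E ->
  ((rnorm (cint nu D z : R[i]^o))%:E <= 2%:E * \int[nu]_(x in D) (rnorm (z x : R[i]^o))%:E)%E.
Proof.
move=> mD mz zfin; have [ir ii] := cintegrable_le mD mz zfin.
have mn : measurable_fun D (fun x => (rnorm (z x : R[i]^o))%:E).
  by apply: measurable_funTS; apply/measurable_EFinP; exact: cmeas_rnorm.
have b (h : T -> R) : nu.-integrable D (fun x => (h x)%:E) -> (forall x, `|h x| <= rnorm (z x : R[i]^o)) ->
    ((`|fine (\int[nu]_(x in D) (h x)%:E)|)%:E <= \int[nu]_(x in D) (rnorm (z x : R[i]^o))%:E)%E.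
  move=> ih hz; rewrite -abse_EFin fineK; last exact: integrable_fin_num.
  apply: le_trans (le_abse_integral nu mD (measurable_int nu ih)) _.
  apply: ge0_le_integral => //.
  - by apply: measurableT_comp => //; exact: measurable_int ih.
  - by move=> x _; rewrite lee_fin.
apply: (@le_trans _ _ (`|complex.Re (cint nu D z)| + `|complex.Im (cint nu D z)|)%:E).
  by rewrite lee_fin; exact: rnormC_le.
rewrite EFinD (_ : 2%:E = 1 + 1)%E; last by rewrite -EFinD.
rewrite ge0_muleDl// !mul1e; apply: leeD; apply: b => //.
- by move=> x; exact: ler_Re_rnorm.
- by move=> x; exact: ler_Im_rnorm.
Qed.

Lemma pairing_cint (H : hilbertType R) (f phi : Rd -> H) (z : Rd -> R[i]^o) : aplim z ->
  {ae mu, forall x, (inner (f x) (phi x) : R[i]^o) = z x} ->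
  (\int[mu]_x (rnorm (z x))%:E < +oo)%E -> pairing f phi = cint mu setT z.
Proof.
move=> az ez zfin; have [I hI] := has_bochner_exists (@sepC R) (@cmpltC R) az zfin.
have cutT (y : Rd -> R[i]^o) : cutoff setT y = y.
  by apply/funext => x; rewrite /cutoff indicT scale1r.
rewrite /pairing (bochnerE (I := I) (@sepC R)).
  exact: (@bochner_cint _ _ _ R[i]^o _ (fun w => w) z I (@rfunctional_Re R) (@rfunctional_Im R) hI).
by rewrite cutT; apply: has_bochner_ae hI; apply: filterS ez => x ->.
Qed.

Lemma has_bochner_vector e (T : measurableType e) (nu : {measure set T -> \bar R}) (H : hilbertType R)
    (z : T -> R[i]^o) (I : R[i]^o) (h : H) : aplim z -> (\int[nu]_x (rnorm (z x))%:E < +oo)%E ->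
  has_bochner_integral nu z I -> has_bochner_integral nu (fun x => (z x : R[i]) *: h) ((I : R[i]) *: h).
Proof.
move=> az zfin hI.
have azh : aplim (fun x => (z x : R[i]) *: h) by apply: aplimZ => //; exact: aplim_cst.
have [J hJ] : exists J, has_bochner_integral nu (fun x => (z x : R[i]) *: h) J.
  apply: has_bochner_exists => //; [exact: sepH|exact: cmpltH|].
  under eq_integral do rewrite rnormZ EFinM.
  rewrite ge0_integralZr//; first by rewrite muleC; apply: lte_mul_pinfty; rewrite ?lee_fin ?rnorm_ge0.
  - by apply/measurable_EFinP; exact: aplim_rnorm.
  - by move=> x _; rewrite lee_fin rnorm_ge0.
  - by rewrite lee_fin rnorm_ge0.
suff -> : (I : R[i]) *: h = J by [].
apply/eqP; rewrite -subr_eq0; apply/eqP; apply: sepH => psi p.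
have [pD pZ [C C0 pC]] := p.
have ph : rfunctional (fun w : R[i]^o => psi ((w : R[i]) *: h)).
  split=> [x y|t x|]; first by rewrite scalerDl pD.
    by rewrite -scalerA pZ.
  exists (C * rnorm h); first by rewrite mulr_ge0 ?rnorm_ge0.
  by move=> x; apply: le_trans (pC _) _; rewrite rnormZ -mulrA [rnorm h * _]mulrC.
rewrite rfunctionalB//; apply/eqP; rewrite subr_eq0; apply/eqP; apply: EFin_inj.
by rewrite (rfunctional_bochner p hJ) (rfunctional_bochner ph hI).
Qed.

Variable a : R.
Hypothesis a0 : 0 < a.
Local Notation Q := (cube a : set Rd).
Let mQ : measurable Q. Proof. exact: measurable_cube. Qed.

Lemma Lnorm_cube_fin p : (1 <= p)%E -> ('N[mu]_p[onc a 0 (fun _ : Rd => 1%E)] < +oo)%E.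
Proof.
move=> /ge1_real[->|[r r1 ->]].
  apply: (@le_lt_trans _ _ 1%E); last exact: ltry.
  rewrite unlock; case: ifPn => // _; apply/ess_supP; apply: aeW => x /=.
  by rewrite /onc; case: ifP; rewrite ?abse0 // abse_EFin normr1.
rewrite unlock; apply: poweR_lty.
apply: (@le_lt_trans _ _ (mu Q)); last exact: cube_fin.
rewrite -[leRHS]mul1e -integral_cst// [leRHS]integral_mkcond; apply: ge0_ae_le_integral.
- by move=> x; exact: poweR_ge0.
- by move=> x; rewrite patchE; case: ifP.
apply: aeW => x; rewrite patchE /onc; case: eqP => [/(cube_cell0 a0) h|h].
  by rewrite mem_set// abse_EFin normr1 poweR1r.
by rewrite abse0 poweR0r ?lt0r_neq0 ?(lt_le_trans ltr01)//; case: ifP.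
Qed.

Lemma Lp_norm_int (E : normedModType R[i]) p (f : Rd -> E) : (1 <= p)%E ->
  measurable_fun setT (fun x => rnorm (f x)) ->
  ('N[mu]_p[(fun x => (rnorm (f x))%:E)] < +oo)%E -> (\int[mu]_(x in Q) (rnorm (f x))%:E < +oo)%E.
Proof.
move=> p1 mf ff; rewrite integral_mkcond.
have mo : measurable_fun setT (onc a 0 (fun _ : Rd => 1%E : \bar R)) by exact: measurable_onc.
have o0 x : (0 <= onc a 0 (fun _ : Rd => 1%E : \bar R) x)%E by exact: onc_ge0.
have p'1 := hoelder_conj_ge1 p1.
apply: (@le_lt_trans _ _ (\int[mu]_x ((rnorm (f x))%:E * onc a 0 (fun _ : Rd => 1%E) x))%E).
  apply: ge0_ae_le_integral.
  - by move=> x; rewrite patchE; case: ifP => // _; rewrite lee_fin rnorm_ge0.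
  - by move=> x; rewrite mule_ge0// lee_fin rnorm_ge0.
  apply: aeW => x; rewrite patchE; case: ifPn => [/set_mem/(cube_cell0 a0) h|_].
    by rewrite /onc h eqxx mule1.
  by rewrite mule_ge0// lee_fin rnorm_ge0.
apply: le_lt_trans (Lnorm_hoelder p1 _ _ _ _ ff (Lnorm_cube_fin p'1)) _ => //.
- by move=> x; rewrite lee_fin rnorm_ge0.
- exact/measurable_EFinP.
apply: lte_mul_pinfty; rewrite ?Lnorm_ge0 ?ge0_fin_numE ?Lnorm_ge0//.
exact: Lnorm_cube_fin.
Qed.

(** Replaces a member of [L^p] by a representative for which every integral exists, so that the
    chosen value in [fourier_coef] becomes a genuine one. *)
Lemma in_Lp_fourier (H : hilbertType R) p (m : Rd -> H) : (1 <= p)%E -> in_Lp mu Q p m ->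
  exists2 m1, aplim m1 & [/\ {ae mu, forall x, Q x -> m x = m1 x},
    (\int[mu]_(x in Q) (rnorm (m1 x))%:E < +oo)%E &
    forall l, has_bochner_integral mu (cutoff Q (fun x => (chi a (- l) x : R[i]) *: m1 x))
      ((a ^+ d)%:C *: fourier_coef a m l)].
Proof.
move=> p1 [sm mfin]; have [m1 am1 e1] := strongly_aplim sm; exists m1 => //.
have eQ : {ae mu, forall x, Q x -> m x = m1 x}.
  by apply: filterS e1 => x h Qx; rewrite -h /cutoff indicE mem_set// scale1r.
have fin1 : (\int[mu]_(x in Q) (rnorm (m1 x))%:E < +oo)%E.
  apply: (Lp_norm_int p1); first exact: aplim_rnorm.
  by move: mfin; rewrite /Lp_norm (Lnorm_ae_eq (g := fun x => (rnorm (m1 x))%:E) p1)//; apply: filterS e1 => x ->.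
split => // l; set J := (X in has_bochner_integral _ _ X).
have az : aplim (cutoff Q (fun x => (chi a (- l) x : R[i]) *: m1 x)).
  by apply: aplim_cutoff => //; apply: aplimZ => //; apply: aplim_complex; exact: cmeas_chi.
have [I hI] : exists I, has_bochner_integral mu (cutoff Q (fun x => (chi a (- l) x : R[i]) *: m1 x)) I.
  apply: has_bochner_exists => //; [exact: sepH|exact: cmpltH|].
  rewrite (cutoff_int mu Q _ (h := fun y => rnorm y)) ?rnorm0//.
  by under eq_integral do rewrite rnormZ rnorm_chi mul1r.
suff -> : J = I by [].
rewrite /J /fourier_coef scalerA -rmorphM/= mulfV ?expf_neq0 ?gt_eqF// scale1r.
apply: (bochnerE (@sepH _ _)); apply: has_bochner_ae hI; apply: filterS eQ => x h.
rewrite /cutoff indicE; case: (boolP (x \in Q)) => [/set_mem Qx|_]; last by rewrite !scale0r.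
by rewrite -h// /chi rV_of_intN dotpNl.
Qed.

(** Synthesis sees the multipliers only through their inner products with [h], so scalar uniqueness
    is applied to a single function. *)
Lemma fourier_fun_unique (H : hilbertType R) p (m m' : Rd -> H) (h : H) : (1 <= p)%E ->
  Defs.periodic a m -> Defs.periodic a m' -> in_Lp mu Q p m -> in_Lp mu Q p m' ->
  (forall l, fourier_coef a m l = fourier_coef a m' l) ->
  {ae mu, forall x, inner (m x) h = inner (m' x) h}.
Proof.
move=> p1 pm pm' im im' e.
have [m1 am1 [em1 f1 hm1]] := in_Lp_fourier p1 im.
have [m2 am2 [em2 f2 hm2]] := in_Lp_fourier p1 im'.
apply: (ae_on_periodic a0); first by move=> x k; rewrite pm pm'.
have ai m0 : aplim m0 -> aplim (fun x => inner (m0 x) h : R[i]^o).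
  by move=> am; apply: aplim_inner => //; exact: aplim_cst.
pose z x : R[i]^o := (inner (m1 x) h : R[i]^o) - inner (m2 x) h.
have az : aplim z by apply: aplimB; exact: ai.
have fi m0 : aplim m0 -> (\int[mu]_(x in Q) (rnorm (m0 x))%:E < +oo)%E ->
    (\int[mu]_(x in Q) (rnorm (inner (m0 x) h : R[i]^o))%:E < +oo)%E.
  move=> am f0; apply: (@le_lt_trans _ _ (\int[mu]_(x in Q) ((rnorm (m0 x))%:E * (rnorm h)%:E))%E).
    apply: ge0_le_integral => //.
    - by move=> x _; rewrite lee_fin rnorm_ge0.
    - by apply: measurable_funTS; apply/measurable_EFinP; apply: aplim_rnorm; exact: ai.
    - apply: measurable_funTS; apply: emeasurable_funM => //; apply/measurable_EFinP; exact: aplim_rnorm.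
    - by move=> x _; rewrite -EFinM lee_fin rnorm_inner.
  rewrite ge0_integralZr//.
  - by rewrite muleC; apply: lte_mul_pinfty; rewrite ?lee_fin ?rnorm_ge0.
  - by apply: measurable_funTS; apply/measurable_EFinP; exact: aplim_rnorm.
  - by move=> x _; rewrite lee_fin rnorm_ge0.
  - by rewrite lee_fin rnorm_ge0.
have ci m0 : aplim m0 -> (\int[mu]_(x in Q) (rnorm (m0 x))%:E < +oo)%E ->
    cintegrable mu Q (fun x => inner (m0 x) h).
  by move=> am f0; apply: cintegrable_le => //; [apply: aplim_cmeas; exact: ai|exact: fi].
have zfin : (\int[mu]_(x in Q) (rnorm (z x))%:E < +oo)%E.
  apply: (@le_lt_trans _ _ (\int[mu]_(x in Q) ((rnorm (inner (m1 x) h : R[i]^o))%:E +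
      (rnorm (inner (m2 x) h : R[i]^o))%:E))%E).
    apply: ge0_le_integral => //.
    - by move=> x _; rewrite lee_fin rnorm_ge0.
    - by apply: measurable_funTS; apply/measurable_EFinP; exact: aplim_rnorm.
    - apply: measurable_funTS; apply: emeasurable_funD; apply/measurable_EFinP; apply: aplim_rnorm; exact: ai.
    - by move=> x _; rewrite -EFinD lee_fin; exact: ler_rnormB.
  rewrite ge0_integralD//.
  - by apply: lte_add_pinfty; exact: fi.
  - by move=> x _; rewrite lee_fin rnorm_ge0.
  - by apply: measurable_funTS; apply/measurable_EFinP; apply: aplim_rnorm; exact: ai.
  - by move=> x _; rewrite lee_fin rnorm_ge0.
  - by apply: measurable_funTS; apply/measurable_EFinP; apply: aplim_rnorm; exact: ai.
have coef m0 F l : aplim m0 ->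
    has_bochner_integral mu (cutoff Q (fun x => (chi a (- l) x : R[i]) *: m0 x)) F ->
    inner F h = cint mu Q (fun x => inner (m0 x) h * chi a (- l) x).
  move=> am hF.
  rewrite (bochner_cint (Psi := fun B => inner B h) (rfunctional_ReI h) (rfunctional_ImI h) hF).
  rewrite (cint_cutoff mu (Psi := fun B => inner B h) Q _ (inner0l h)).
  by apply: eq_cint => x _; rewrite innerZl mulrC.
have := fourier_unique a0 (aplim_cmeas az) zfin.
have z0 l : cint mu Q (fun x => z x * chi a l x) = 0.
  rewrite (_ : (fun _ => _) = fun x => inner (m1 x) h * chi a l x + (-1) * (inner (m2 x) h * chi a l x)); last first.
    by apply/funext => x; rewrite /z mulN1r -mulrBl.
  have cc m0 : aplim m0 -> (\int[mu]_(x in Q) (rnorm (m0 x))%:E < +oo)%E ->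
      cintegrable mu Q (fun x => inner (m0 x) h * chi a l x).
    move=> am f0; apply: cintegrableMb => //; [exact: ci|apply: aplim_cmeas; exact: ai|exact: cbounded_chi].
  rewrite cintD//; [|exact: cc|by apply: cintegrableZ => //; exact: cc].
  rewrite cintZ//; last exact: cc.
  have := coef m1 _ (- l) am1 (hm1 (- l)); have := coef m2 _ (- l) am2 (hm2 (- l)).
  by rewrite opprK e => <- <-; rewrite mulN1r subrr.
move=> /(_ z0); apply: filterS3 em1 em2 => x e1 e2 e3 Qx.
by apply/eqP; rewrite -subr_eq0 e1// e2//; apply/eqP; exact: e3.
Qed.

Lemma fourier_L2_unique (E : normedModType R[i]) (c : Zd -> E) (F F' : Rd -> E) :
  Defs.periodic a F -> Defs.periodic a F' -> fourier_series_L2 a c F -> fourier_series_L2 a c F' ->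
  {ae mu, forall x, F x = F' x}.
Proof.
move=> pF pF' [[sF _] cF] [[sF' _] cF'].
have q2 : (1 <= 2%:E :> \bar R)%E by rewrite lee_fin ler1n.
have [F1 aF1 e1] := strongly_aplim sF; have [F2 aF2 e2] := strongly_aplim sF'.
apply: (ae_on_periodic a0); first by move=> x k; rewrite pF pF'.
have aS A : aplim (cutoff Q (fourier_sum a c A)).
  apply: aplim_cutoff => //; rewrite /fourier_sum; under eq_fun do rewrite partial_sumE.
  apply: (@aplim_sum _ _ _ _ _ _ (fun l x => (chi a l x : R[i]) *: c l)) => l.
  by apply: aplimZ; [apply: aplim_complex; exact: cmeas_chi|exact: aplim_cst].
have cut0 (f f' : Rd -> E) x : cutoff Q (fun x => f x - f' x) x = cutoff Q f x - cutoff Q f' x.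
  by rewrite /cutoff scalerBr.
pose D A (F0 : Rd -> E) x := (rnorm (cutoff Q (fourier_sum a c A) x - F0 x))%:E.
have mD A F0 : aplim F0 -> measurable_fun setT (D A F0).
  by move=> aF; apply/measurable_EFinP; apply: aplim_rnorm; exact: aplimB.
have D0 A F0 x : (0 <= D A F0 x)%E by rewrite lee_fin rnorm_ge0.
have conv G F0 : {ae mu, forall x, cutoff Q G x = F0 x} ->
    Lp_norm mu Q 2%:E (fun x => fourier_sum a c A x - G x) @[A --> summability.totally] --> 0%E ->
    ('N[mu]_2%:E[D A F0])%E @[A --> summability.totally] --> 0%E.
  move=> eG; rewrite (_ : (fun A => Lp_norm _ _ _ _) = fun A => 'N[mu]_2%:E[D A F0]%E)//.
  apply/funext => A; apply: Lnorm_ae_eq => //; apply: filterS eG => x h.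
  by rewrite cut0 h.
have c1 := conv _ _ e1 cF; have c2 := conv _ _ e2 cF'.
have N0 : ('N[mu]_2%:E[(fun x => (rnorm (F1 x - F2 x))%:E)] = 0)%E.
  apply/eqP; rewrite eq_le Lnorm_ge0 andbT.
  have c3 : ('N[mu]_2%:E[D A F1] + 'N[mu]_2%:E[D A F2])%E @[A --> summability.totally] --> (0 + 0 : \bar R)%E.
    by apply: cvgeD => //; exact: summability.totally_filter.
  rewrite adde0 in c3; apply: (cvge_ge (FF := summability.totally_filter) _ c3).
  have FF := @summability.totally_filter Zd.
  apply: filterE => A; apply: le_trans (LnormD mu q2 (D0 _ _) (D0 _ _) (mD _ _ aF1) (mD _ _ aF2)).
  apply: Lnorm_ge0_le => // x; first by rewrite lee_fin rnorm_ge0.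
  rewrite /D /= -EFinD lee_fin rnorm_distC.
  rewrite -(subrKA (cutoff Q (fourier_sum a c A) x)); apply: le_trans (ler_rnormD _ _) _.
  by rewrite addrC rnorm_distC addrC rnorm_distC [X in _ <= _ + X]rnorm_distC addrC.
have := Lnorm_eq0_eq0 _ _ N0; move=> H.
have {H} H : {ae mu, forall x, (rnorm (F1 x - F2 x))%:E = 0%E}.
  by have := H ltac:(by apply/measurable_EFinP; apply: aplim_rnorm; exact: aplimB) ltac:(by rewrite lte_fin);
    apply: filterS => x /(_ I).
apply: filterS3 e1 e2 H => x h1 h2 [h3] Qx.
have cE (f : Rd -> E) : cutoff Q f x = f x by rewrite /cutoff indicE mem_set// scale1r.
by rewrite -(cE F) -(cE F') h1 h2; apply/eqP; rewrite -subr_eq0; apply/eqP; exact: rnorm_eq0.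
Qed.

End uniqueness_of_limits.

(** * Duality and convergence in amalgam spaces *)

Section amalgam_duality.
Context {R : realType} {d : nat}.
Local Notation Rd := 'rV[R]_d.
Local Notation Zd := 'rV[int]_d.
Local Notation mu := (lebesgue_rV d).
Local Open Scope ereal_scope.
Variable a : R.
Hypothesis a0 : (0 < a)%R.

Lemma lq_normD (I : countType) (i0 : I) q (f g : I -> \bar R) : 1 <= q ->
  (forall i, 0 <= f i) -> (forall i, 0 <= g i) ->
  lq_norm q (fun i => f i + g i) <= lq_norm q f + lq_norm q g.
Proof.
move=> q1 f0 g0; rewrite !(lq_normE i0)//; last by move=> i; exact: adde_ge0.
rewrite (_ : ext (fun i => f i + g i) = ext f \+ ext g).
  apply: LnormD => //; by move=> n; exact: ext_ge0.
by apply/funext => n; rewrite /ext; case: pickle_inv => //=; rewrite adde0.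
Qed.

Lemma lq_norm_single (I : countType) (k : I) q (f : I -> \bar R) : 1 <= q ->
  (forall i, 0 <= f i) -> (forall i, i != k -> f i = 0) -> lq_norm q f <= f k.
Proof.
move=> /ge1_real[->|[r r1 ->]] f0 fk /=.
  apply: ge_ereal_sup => _ [i _ <-]; have [->//|ik] := eqVneq i k.
  by rewrite fk.
have r0 : (0 < r)%R by apply: lt_le_trans r1.
rewrite [X in X `^ _](_ : _ = f k `^ r).
  by rewrite -poweRrM mulfV ?gt_eqF// poweRe1.
rewrite -(@esum_set1 _ _ k (fun i => f i `^ r)); last exact: poweR_ge0.
rewrite [RHS]esum_mkcond; apply: eq_esum => i _; have [->|ik] := eqVneq i k.
  by rewrite mem_set.
by rewrite memNset; [rewrite fk// poweR0r ?gt_eqF|move/eqP : ik].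
Qed.

Lemma amnormD p q (v : Rd -> R) F G : 1 <= p -> 1 <= q -> (forall x, (0 < v x)%R) ->
  (forall x, 0 <= F x) -> (forall x, 0 <= G x) -> measurable_fun setT F -> measurable_fun setT G ->
  amnorm a p q v (fun x => F x + G x) <= amnorm a p q v F + amnorm a p q v G.
Proof.
move=> p1 q1 v0 F0 G0 mF mG; have v0E x : 0 <= (v x)%:E by rewrite lee_fin ltW.
have t0 F' k : 0 <= 'N[mu]_p[onc a k F'] * (v (a *: rV_of_int k)%R)%:E.
  by apply: mule_ge0 => //; exact: Lnorm_ge0.
apply: le_trans (lq_normD 0%R q1 (t0 F) (t0 G)).
apply: (le_lq_norm 0%R) => // k; rewrite -ge0_muleDl ?Lnorm_ge0//.
apply: lee_wpmul2r => //; apply: le_trans (LnormD mu p1 _ _ _ _).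
- rewrite le_eqVlt; apply/orP; left; apply/eqP; congr Lnorm; apply/funext => x.
  by rewrite /onc; case: ifP => // _; rewrite adde0.
- by move=> x; exact: onc_ge0.
- by move=> x; exact: onc_ge0.
- exact: measurable_onc.
- exact: measurable_onc.
Qed.

Lemma amnorm0_ae p q (v : Rd -> R) F : 1 <= p -> 1 <= q -> (forall x, (0 < v x)%R) ->
  measurable_fun setT F -> amnorm a p q v F = 0 -> {ae mu, forall x, F x = 0}.
Proof.
move=> p1 q1 v0 mF NF.
have t0 k : 0 <= 'N[mu]_p[onc a k F] * (v (a *: rV_of_int k)%R)%:E.
  by apply: mule_ge0; [exact: Lnorm_ge0|rewrite lee_fin ltW].
have N0 k : 'N[mu]_p[onc a k F] = 0.
  have := lq_norm_term k q1 t0; rewrite -/(amnorm a p q v F) NF => h.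
  have /eqP : 'N[mu]_p[onc a k F] * (v (a *: rV_of_int k)%R)%:E = 0 by apply/eqP; rewrite eq_le h t0.
  by rewrite mule_eq0 => /orP[/eqP//|]; rewrite eqe gt_eqF.
have p0 : 0 < p by apply: lt_le_trans p1.
have := ae_forall_count (fun k => Lnorm_eq0_eq0 (measurable_onc a0 k mF) p0 (N0 k)).
by apply: filterS => x /(_ (cell a x) I); rewrite /onc eqxx.
Qed.

Variable H : hilbertType R.
Variable c : nat -> H.
Hypothesis cd : forall (z : H) (e : R), (0 < e)%R -> exists m, (rnorm (z - c m) < e)%R.
Variables (p q : \bar R) (v : Rd -> R).
Hypotheses (p1 : 1 <= p) (q1 : 1 <= q) (v0 : forall x, (0 < v x)%R).
Local Notation vi := (fun x => (v x)^-1)%R.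
Local Notation p' := (hoelder_conjugate p).
Local Notation q' := (hoelder_conjugate q).

Lemma amalgam_aplim r s (w : Rd -> R) (f : Rd -> H) : amalgam a r s w f -> aplim f.
Proof. by move=> [bf _]; exact: borel_aplim cd bf. Qed.

Lemma measurable_rnorm_aplim e (T : measurableType e) (E : normedModType R[i]) (f : T -> E) : aplim f ->
  measurable_fun setT (fun x => (rnorm (f x))%:E).
Proof. by move=> af; apply/measurable_EFinP; exact: aplim_rnorm. Qed.

Lemma amalgam_pairing (F : Rd -> \bar R) (phi : Rd -> H) : measurable_fun setT F ->
  (forall x, 0 <= F x) -> amnorm a p q v F < +oo -> amalgam a p' q' vi phi ->
  \int[mu]_x (F x * (rnorm (phi x))%:E) < +oo.
Proof.
move=> mF F0 NF aphi; have ap := amalgam_aplim aphi; have [_] := aphi.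
rewrite amalgam_normE// => Nphi.
apply: (amnorm_hoelder a0 p1 q1 v0) => //; first exact: measurable_rnorm_aplim.
by move=> x; rewrite lee_fin rnorm_ge0.
Qed.

Lemma inner_int (F : Rd -> H) (phi : Rd -> H) : aplim F -> amnorm a p q v (fun x => (rnorm (F x))%:E) < +oo ->
  amalgam a p' q' vi phi -> \int[mu]_x (rnorm (inner (F x) (phi x) : R[i]^o))%:E < +oo.
Proof.
move=> aF NF aphi; have ap := amalgam_aplim aphi.
apply: le_lt_trans (amalgam_pairing (measurable_rnorm_aplim aF) _ NF aphi); last first.
  by move=> x; rewrite lee_fin rnorm_ge0.
apply: ge0_ae_le_integral.
- by move=> x; rewrite lee_fin rnorm_ge0.
- by move=> x; rewrite mule_ge0// lee_fin rnorm_ge0.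
by apply: aeW => x; rewrite -EFinM lee_fin rnorm_inner.
Qed.

(* the difference of the limits, truncated to a cell and to a bounded range, is a test function *)
Lemma weak_limit_unique (F F0 : Rd -> H) : amalgam a p q v F -> amalgam a p q v F0 ->
  (forall phi, amalgam a p' q' vi phi -> pairing F phi = pairing F0 phi) ->
  {ae mu, forall x, F x = F0 x}.
Proof.
move=> amF amF0 h; have aF := amalgam_aplim amF; have aF0 := amalgam_aplim amF0.
pose D x := (F x - F0 x)%R; have aD : aplim D by exact: aplimB.
have p'1 := hoelder_conj_ge1 p1; have q'1 := hoelder_conj_ge1 q1.
have vi0 x : (0 < vi x)%R by rewrite invr_gt0.
(* Cells and integer bounds give countably many truncations which together reach every point, so
   their null sets may be united. *)
suff key (kM : Zd * nat) : {ae mu, forall x, (cell a x == kM.1) && (rnorm (D x) <= kM.2%:R)%R -> D x = 0%R}.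
  have := ae_forall_count key; apply: filterS => x hx.
  apply/eqP; rewrite -subr_eq0; apply/eqP; apply: (hx (cell a x, (Num.truncn (rnorm (D x))).+1)).
  by rewrite eqxx /= ltW// truncnS_gt.
move: kM => [k M] /=.
pose E := [set x | (cell a x == k) && (rnorm (D x) <= M%:R)%R].
have mE : measurable E.
  rewrite (_ : E = [set x | cell a x = k] `&` [set x | (rnorm (D x) <= M%:R)%R]).
    apply: measurableI; first exact: measurable_cell.
    rewrite (_ : [set x | _] = (fun x => rnorm (D x)) @^-1` `]-oo, M%:R]%classic).
      by rewrite -[X in measurable X]setTI; apply: (aplim_rnorm aD).
    by apply/seteqP; split => x /=; rewrite in_itv.
  by apply/seteqP; split => x /= => [/andP[/eqP]|[/eqP ? ?]]; last exact/andP.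
pose phi x := if x \in E then D x else 0%R.
have aphi : aplim phi by apply: aplim_if => //; exact: aplim_cst.
have o1 x : 0 <= onc a k (fun _ : Rd => 1) x by exact: onc_ge0.
have dphi : amalgam a p' q' vi phi.
  split; first exact: aplim_borel.
  rewrite amalgam_normE//; apply: (@le_lt_trans _ _ (amnorm a p' q' vi (fun x => M%:R%:E * onc a k (fun _ => 1) x))).
    apply: amnorm_le => //; first by move=> x; rewrite lee_fin rnorm_ge0.
    move=> x; rewrite /phi; case: (boolP (x \in E)) => [/set_mem /andP[xk xM]|_].
      by rewrite /onc xk mule1 lee_fin.
    by rewrite rnorm0 mule_ge0// lee_fin.
  have mo : measurable_fun setT (onc a k (fun _ : Rd => 1 : \bar R)) by exact: measurable_onc.
  rewrite amnormZ//; apply: lte_mul_pinfty; rewrite ?lee_fin//.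
  have t0 i : 0 <= 'N[mu]_p'[onc a i (onc a k (fun _ : Rd => 1))] * (vi (a *: rV_of_int i))%:E.
    by apply: mule_ge0; [exact: Lnorm_ge0|rewrite lee_fin ltW].
  apply: le_lt_trans (lq_norm_single (k := k) q'1 t0 _) _.
    move=> i ik; rewrite (_ : onc a i _ = fun=> 0) ?Lnorm0 ?mul0e//.
      by rewrite gt_eqF// (lt_le_trans _ p'1).
    apply/funext => x; rewrite /onc; case: eqP => // xi; case: eqP => // xk.
    by move: ik; rewrite -xi -xk eqxx.
  rewrite muleC; apply: lte_mul_pinfty; rewrite ?lee_fin ?(ltW (vi0 _))//.
  rewrite (_ : onc a k _ = fun x => onc a 0 (fun=> 1) (x + - (a *: rV_of_int k))%R).
    rewrite Lnorm_translate//; first exact: Lnorm_cube_fin.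
    exact: measurable_onc.
  apply/funext => x; rewrite /onc -scalerN -rV_of_intN cellD// subr_eq0.
  by case: eqP.
have pz (f : Rd -> H) : amalgam a p q v f ->
    exists2 z : Rd -> R[i]^o, (aplim z /\ z = fun x => inner (f x) (phi x)) &
      \int[mu]_x (rnorm (z x))%:E < +oo /\ pairing f phi = cint mu setT z.
  move=> amf; have af := amalgam_aplim amf; have [_] := amf; rewrite amalgam_normE// => Nf.
  exists (fun x => inner (f x) (phi x)); first by split => //; exact: aplim_inner.
  have fin := inner_int af Nf dphi; split => //.
  by apply: (pairing_cint (aplim_inner af aphi)) => //; exact: aeW.
have [z1 [az1 z1E] [f1 P1]] := pz _ amF; have [z2 [az2 z2E] [f2 P2]] := pz _ amF0.
have i1 := cintegrable_le measurableT (aplim_cmeas az1) f1.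
have i2 := cintegrable_le measurableT (aplim_cmeas az2) f2.
have e0 : cint mu setT (fun x => z1 x + (-1) * z2 x)%R = 0%R.
  rewrite cintD//; last exact: cintegrableZ.
  by rewrite cintZ// -P1 -P2 h// mulN1r subrr.
have [ir _] : cintegrable mu setT (fun x => z1 x + (-1) * z2 x)%R.
  by apply: cintegrableD => //; exact: cintegrableZ.
(* Paired with its own truncation, the difference [D] has the integrand [|D|^2] on [E], whose
   vanishing integral forces [D = 0] there. *)
have zE x : complex.Re (z1 x + (-1) * z2 x)%R = (if x \in E then rnorm (D x) ^+ 2 else 0)%R.
  rewrite z1E z2E mulN1r -innerBl -/(D x) /phi; case: (x \in E); last by rewrite inner0r.
  by rewrite inner_rnorm.
have I0 : \int[mu]_x `|(complex.Re (z1 x + (-1) * z2 x)%R)%:E| = 0.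
  have := congr1 (@complex.Re R) e0; rewrite /cint /= => e1.
  rewrite -[RHS](_ : (\int[mu]_x (complex.Re (z1 x + (-1) * z2 x)%R)%:E) = 0); last first.
    by rewrite -[LHS]fineK ?e1//; exact: integrable_fin_num.
  apply: eq_integral => x _; congr EFin; rewrite ger0_norm// zE.
  by case: ifP => // _; exact: sqr_ge0.
move/(ae_eq_integral_abs mu measurableT (measurable_int mu ir)) : I0.
apply: filterS => x h1 xE; have := h1 I; rewrite zE mem_set// => -[/eqP].
by rewrite sqrf_eq0 => /eqP/rnorm_eq0.
Qed.

End amalgam_duality.

(** * Janssen's representation *)

Lemma fourier_series_L2_ae (R : realType) d (E : normedModType R[i]) (a : R) (c : 'rV[int]_d -> E)
    (F F' : 'rV[R]_d -> E) : {ae lebesgue_rV d, forall x, F x = F' x} ->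
  fourier_series_L2 a c F -> fourier_series_L2 a c F'.
Proof.
move=> FF' [[sF NF] cF].
have N2 (U U' : 'rV[R]_d -> E) : {ae lebesgue_rV d, forall x, U x = U' x} ->
    Lp_norm (lebesgue_rV d) (cube a) 2%:E U = Lp_norm (lebesgue_rV d) (cube a) 2%:E U'.
  move=> UU'; rewrite /Lp_norm; apply: Lnorm_ae_eq; first by rewrite lee_fin ler1n.
  by apply: filterS UU' => x h; rewrite /cutoff h.
split; first split.
- by apply: strongly_measurable_ae sF; apply: filterS FF' => x h; rewrite /cutoff h.
- by rewrite -(N2 _ _ FF').
- rewrite (_ : (fun A => _) = (fun A => Lp_norm (lebesgue_rV d) (cube a) 2%:E
      (fun x => fourier_sum a c A x - F x)))//.
  by apply/funext => A; apply: N2; apply: filterS FF' => x ->.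
Qed.

Lemma fourier_series_L2Z (R : realType) d (E : normedModType R[i]) (a t : R) (c : 'rV[int]_d -> E)
    (F : 'rV[R]_d -> E) : 0 < a -> 0 <= t -> aplim F ->
  fourier_series_L2 a c F -> fourier_series_L2 a (fun l => t%:C *: c l) (fun x => t%:C *: F x).
Proof.
move=> a0 t0 aF [[sF NF] cF].
have mQ : measurable (cube a : set 'rV[R]_d) by exact: measurable_cube.
have tZ (U : 'rV[R]_d -> E) : aplim U -> aplim (fun x => t%:C *: U x).
  by move=> aU; apply: (@aplimZ _ _ _ _ (fun=> t%:C)) => //; exact: aplim_cst.
have NZ (U : 'rV[R]_d -> E) : aplim U -> (Lp_norm (lebesgue_rV d) (cube a) 2%:E (fun x => t%:C *: U x)
    = t%:E * Lp_norm (lebesgue_rV d) (cube a) 2%:E U)%E.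
  move=> aU; rewrite /Lp_norm -LnormZl ?lee_fin ?ler1n//; last first.
    by apply/measurable_EFinP/aplim_rnorm/aplim_cutoff.
  congr Lnorm; apply/funext => x; rewrite -EFinM; congr EFin.
  by rewrite /cutoff !rnormRZ (ger0_norm t0) mulrCA.
split; first split.
- by apply: aplim_strongly => //; [exact: cube_fin|exact: tZ].
- by rewrite NZ// lte_mul_pinfty// lee_fin.
rewrite (_ : (fun A => _) = (fun A => t%:E * Lp_norm (lebesgue_rV d) (cube a) 2%:E
    (fun x => (fourier_sum a c A x - F x)%R))%E).
  by rewrite -[0%E](mule0 t%:E); apply: cvgeZl.
apply/funext => A; rewrite -NZ; last first.
  apply: aplimB => //; rewrite (_ : fourier_sum a c A = fun x => \sum_(l <- A) (chi a l x : R[i]) *: c l).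
    apply: aplim_sum => l; apply: (@aplimZ _ _ _ _ (chi a l)); last exact: aplim_cst.
    by apply: aplim_complex; exact: cmeas_chi.
  by apply/funext => x; rewrite /fourier_sum partial_sumE.
congr Lp_norm; apply/funext => x; rewrite scalerBr; congr (_ - _).
rewrite /fourier_sum !partial_sumE scaler_sumr; apply: eq_bigr => l _.
by rewrite !scalerA mulrC.
Qed.

(** * The functions [G_n] as periodizations and their Fourier series *)

Section walnut_coefficients.
Context {R : realType} {d : nat} {H : hilbertType R}.
Local Notation Rd := 'rV[R]_d.
Local Notation Zd := 'rV[int]_d.
Local Notation mu := (lebesgue_rV d).
Variables (a b : R) (w : Rd -> R) (g gam : Rd -> H).
Hypotheses (a0 : 0 < a) (b0 : 0 < b) (ww : weight w) (ws : submultiplicative w).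
Variable cc : nat -> H.
Hypothesis cd : forall (z : H) (e : R), 0 < e -> exists m, rnorm (z - cc m) < e.
Hypotheses (gw : amalgam a +oo%E 1%E w g) (gamw : amalgam a +oo%E 1%E w gam).
Local Notation bn n := (b^-1 *: rV_of_int n : Rd).
Local Notation u := (fun x : Rd => (rnorm (g x))%:E).
Local Notation s := (fun x : Rd => (rnorm (gam x))%:E).

Let ag : aplim g := amalgam_aplim cd gw.
Let agam : aplim gam := amalgam_aplim cd gamw.
Let u0 x : (0 <= u x)%E. Proof. by rewrite lee_fin rnorm_ge0. Qed.
Let s0 x : (0 <= s x)%E. Proof. by rewrite lee_fin rnorm_ge0. Qed.
Let ufin : (amnorm a +oo 1 w u < +oo)%E. Proof. by have [_] := gw; rewrite amalgam_normE. Qed.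
Let sfin : (amnorm a +oo 1 w s < +oo)%E. Proof. by have [_] := gamw; rewrite amalgam_normE. Qed.

(** Its [a]-periodization is [G_n] almost everywhere, after the change of index from [k] to
    [- k]. *)
Definition walnut_kernel (n : Zd) (x : Rd) := rank_one (gam x) (translate (bn n) g x).
Local Notation phi := walnut_kernel.

Definition walnut_sum (n : Zd) (x : Rd) : \bar R := (\esum_(k in [set: Zd])
  (s (x - a *: rV_of_int k)%R * u (x - a *: rV_of_int k - bn n)%R))%E.

Lemma pnorm_walnut n x : pnorm a (phi n) x = walnut_sum n x.
Proof.
rewrite /pnorm -(@esum_bij _ _ _ (fun k : Zd => - k)); last by exists (fun k : Zd => - k); exact: opprK.
apply: eq_esum => k _; rewrite /phi rnorm_rank_oneE EFinM /translate.
by rewrite rV_of_intN scalerN.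
Qed.

Definition walnut_const n : R := fine (walnut_bound a b u s n).

Lemma walnut_const_ge0 n : 0 <= walnut_const n.
Proof. by apply: fine_ge0; exact: walnut_bound_ge0. Qed.

Lemma walnut_sum_ae n : {ae mu, forall x, (pnorm a (phi n) x <= (walnut_const n)%:E)%E}.
Proof.
have := walnut_ae b a0 u0 s0 n; apply: filterS => x h.
rewrite pnorm_walnut /walnut_const fineK// ge0_fin_numE; last exact: walnut_bound_ge0.
exact: (walnut_bound_fin a0 b0 ww ws ufin sfin).
Qed.

Lemma walnut_coef_tsum n x : (walnut_sum n x < +oo)%E ->
  has_tsum (fun k : Zd => s (x - a *: rV_of_int k)%R * u (x - a *: rV_of_int k - bn n)%R)%E
    (fun k : Zd => rank_one (gam (x - a *: rV_of_int k)) (g (x - a *: rV_of_int k - bn n)))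
    (walnut_coef a b g gam n x).
Proof.
move=> fin.
have := @has_tsum_dominated _ (bounded_op H) _
  (fun k : Zd => s (x - a *: rV_of_int k)%R * u (x - a *: rV_of_int k - bn n)%R)%E
  (fun k : Zd => rank_one (gam (x - a *: rV_of_int k)) (g (x - a *: rV_of_int k - bn n)))
  (@cmpltB R H) _ fin.
rewrite /walnut_coef /translate.
rewrite (_ : (fun k : Zd => rank_one (gam (x - a *: rV_of_int k))
   (g (x - (a *: rV_of_int k + b^-1 *: rV_of_int n)))) =
   (fun k : Zd => rank_one (gam (x - a *: rV_of_int k)) (g (x - a *: rV_of_int k - bn n)))); last first.
  by apply/funext => k; rewrite opprD addrA.
by apply => k; rewrite -EFinM lee_fin rnorm_rank_one.
Qed.

Lemma walnut_coef_periodization n x : (walnut_sum n x < +oo)%E ->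
  walnut_coef a b g gam n x = periodization a (phi n) x.
Proof.
move=> fin; have h := walnut_coef_tsum fin.
rewrite /periodization mem_set; last by rewrite /= pnorm_walnut.
have bo : bijective (fun k : Zd => - k) by exists (fun k : Zd => - k); exact: opprK.
have := has_tsum_bij bo h.
set bb := (fun j => _) => h2.
have := @has_tsum_sum _ _ _ bb _ _ _ _ h2.
rewrite (_ : (fun j : Zd => rank_one _ _) = (fun k : Zd => phi n (x + a *: rV_of_int k))); last first.
  by apply/funext => k; rewrite /phi /translate rV_of_intN scalerN opprK.
move=> -> //; first by move=> k; apply: mule_ge0; [exact: s0|exact: u0].
rewrite /bb (@esum_bij _ _ _ (fun k : Zd => - k)
  (fun k : Zd => s (x - a *: rV_of_int k)%R * u (x - a *: rV_of_int k - bn n)%R)%E)//.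
Qed.

Lemma walnut_coef_ae n : {ae mu, forall x, walnut_coef a b g gam n x = periodization a (phi n) x}.
Proof.
apply: filterS (walnut_sum_ae n) => x h; apply: walnut_coef_periodization.
by apply: le_lt_trans (ltry (walnut_const n)); rewrite -pnorm_walnut.
Qed.

Local Notation shifted_g l n := (modulate (a^-1 *: rV_of_int l) (translate (bn n) g)).

(** Unfolding the Fourier integral of the periodization. A rank-one operator is conjugate-linear in
    its second vector, so the modulation of [g] comes out as the conjugate character. *)
Lemma has_bracket n l : has_bochner_integral mu
  (cutoff (cube a) (fun x => (chi a (- l) x : R[i]) *: periodization a (phi n) x))
  (op_bracket gam (shifted_g l n)).
Proof.
have atg : aplim (translate (bn n) g) by exact: (aplim_shift (- bn n) ag).
have [I hI1 hI2] := bochner_rank_one a0 agam atg (walnut_const_ge0 n) (walnut_sum_ae n) l.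
suff hI3 : has_bochner_integral mu (cutoff setT (fun x => rank_one (gam x) (shifted_g l n x))) I.
  by rewrite /op_bracket (bochnerE (@sepB R H) hI3); exact: hI1.
move: hI2; congr (has_bochner_integral mu _ I); apply/funext => x.
rewrite /cutoff; congr (_ *: _).
apply: bounded_opP => z; rewrite op_scaleE !rank_oneE scalerA; congr (_ *: _).
rewrite /modulate innerZr; congr (_ * _).
by rewrite -cis2piN /chi rV_of_intN dotpNl dotpZl dotpZr.
Qed.

Lemma fourier_coef_walnut n l :
  fourier_coef a (walnut_coef a b g gam n) l = (a ^- d)%:C *: op_bracket gam (shifted_g l n).
Proof.
have hb : has_bochner_integral mu (cutoff (cube a) (fun x =>
    cis2pi (- dotp (rV_of_int l) (a^-1 *: x)) *: walnut_coef a b g gam n x))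
    (op_bracket gam (shifted_g l n)).
  apply: has_bochner_ae (has_bracket n l); apply: filterS (walnut_coef_ae n) => x hx.
  by rewrite /cutoff hx /chi rV_of_intN dotpNl.
by rewrite /fourier_coef (bochnerE (@sepB R H) hb).
Qed.

Lemma fourier_series_periodization n :
  fourier_series_L2 a (fun l => (a ^- d)%:C *: op_bracket gam (shifted_g l n)) (periodization a (phi n)).
Proof.
have atg : aplim (translate (bn n) g) by exact: (aplim_shift (- bn n) ag).
exact: (fourier_series_rank_one a0 cd agam atg (walnut_const_ge0 n) (walnut_sum_ae n) (has_bracket n)).
Qed.

Lemma fourier_series_walnut n :
  fourier_series_L2 a (fun l => (a ^- d)%:C *: op_bracket gam (shifted_g l n)) (walnut_coef a b g gam n).
Proof.
apply: fourier_series_L2_ae (fourier_series_periodization n).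
by apply: filterS (walnut_coef_ae n) => x ->.
Qed.

End walnut_coefficients.

Section periodization_Lp.
Context {R : realType} {d : nat}.
Local Notation Rd := 'rV[R]_d.
Local Notation Zd := 'rV[int]_d.
Local Notation mu := (lebesgue_rV d).
Local Open Scope ereal_scope.
Variable a : R.
Hypothesis a0 : (0 < a)%R.

Lemma Lnorm_cell_fin p j : 1 <= p ->
  'N[mu]_p[onc a j (fun _ : Rd => 1)] = 'N[mu]_p[onc a 0 (fun _ : Rd => 1)].
Proof.
move=> p1; rewrite (_ : onc a j _ = fun x => onc a 0 (fun=> 1) (x + - (a *: rV_of_int j))%R).
  by rewrite Lnorm_translate//; exact: measurable_onc.
apply/funext => x; rewrite /onc -scalerN -rV_of_intN cellD// subr_eq0.
by case: eqP.
Qed.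

Variable p : \bar R.
Hypothesis p1 : 1 <= p.

(** Hoelder on each cell against the constant 1, whose dual norm is the same for all cells. *)
Lemma Lnorm_cells_integrable (G : Rd -> \bar R) : measurable_fun setT G -> (forall x, 0 <= G x) ->
  \esum_(j in [set: Zd]) 'N[mu]_p[onc a j G] < +oo -> \int[mu]_x G x < +oo.
Proof.
move=> mG G0 NG; have p'1 := hoelder_conj_ge1 p1.
pose K := 'N[mu]_(hoelder_conjugate p)[onc a 0 (fun _ : Rd => 1)].
have K0 : 0 <= K by exact: Lnorm_ge0.
have Kfin : K < +oo by exact: Lnorm_cube_fin.
have NGj j : 'N[mu]_p[onc a j G] < +oo.
  by apply: le_lt_trans NG; apply: (@esum_term _ _ (fun j => 'N[mu]_p[onc a j G])) => i; exact: Lnorm_ge0.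
rewrite (_ : \int[mu]_x G x = \int[mu]_x \esum_(j in [set: Zd]) onc a j G x); last first.
  by apply: eq_integral => x _; rewrite esum_onc.
rewrite integral_esum; last 2 first.
- by move=> j x; exact: onc_ge0.
- by move=> j; exact: measurable_onc.
apply: (@le_lt_trans _ _ (\esum_(j in [set: Zd]) ('N[mu]_p[onc a j G] * K))); last first.
  rewrite esumZr//; last by move=> j; exact: Lnorm_ge0.
  by rewrite muleC; apply: lte_mul_pinfty => //; rewrite ge0_fin_numE.
apply: le_esumT => j; rewrite /K -(Lnorm_cell_fin j p'1).
rewrite (_ : \int[mu]_x onc a j G x = \int[mu]_x (onc a j G x * onc a j (fun=> 1) x)); last first.
  by apply: eq_integral => x _; rewrite /onc; case: ifP => _; rewrite ?mule1 ?mule0.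
apply: Lnorm_hoelder => //.
- by move=> x; exact: onc_ge0.
- by move=> x; exact: onc_ge0.
- exact: measurable_onc.
- exact: measurable_onc.
- by rewrite Lnorm_cell_fin.
Qed.

Variables (E : normedModType R[i]) (phi : Rd -> E).
Hypothesis aphi : aplim phi.

Lemma Lnorm_pnorm : 'N[mu]_p[onc a 0 (pnorm a phi)] <=
  \esum_(j in [set: Zd]) 'N[mu]_p[onc a j (fun x => (rnorm (phi x))%:E)].
Proof.
have mF : measurable_fun setT (fun x => (rnorm (phi x))%:E) by exact: measurable_rnorm_aplim.
have r0 x : 0 <= (rnorm (phi x))%:E by rewrite lee_fin rnorm_ge0.
rewrite (_ : onc a 0 _ = fun x => \esum_(k in [set: Zd])
    (fun x => onc a k (fun x => (rnorm (phi x))%:E) (x + a *: rV_of_int k)%R) x); last first.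
  apply/funext => x; rewrite {1}/onc; case: eqP => [x0|x0].
    by apply: eq_esum => k _; rewrite onc_shift// /onc x0 eqxx.
  by rewrite esum1// => k _; rewrite onc_shift// /onc; case: eqP.
apply: le_trans (Lnorm_esum _ p1 _ _) _.
- by move=> k x; exact: onc_ge0.
- by move=> k; apply: measurable_comp_addrV; exact: measurable_onc.
apply: le_esumT => k; rewrite Lnorm_translate//; exact: measurable_onc.
Qed.

End periodization_Lp.

(** * Identification of the multipliers in the synthesis operator *)

Section synthesis_multipliers.
Context {R : realType} {d : nat} {H : hilbertType R}.
Local Notation Rd := 'rV[R]_d.
Local Notation Zd := 'rV[int]_d.
Local Notation mu := (lebesgue_rV d).
Variables (a b : R) (w v : Rd -> R) (g f : Rd -> H) (h : H) (p q : \bar R).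
Hypotheses (a0 : 0 < a) (b0 : 0 < b) (ww : weight w) (ws : submultiplicative w).
Hypotheses (vw : weight v) (vm : moderate w v) (p1 : (1 <= p)%E) (q1 : (1 <= q)%E).
Variable cc : nat -> H.
Hypothesis cd : forall (z : H) (e : R), 0 < e -> exists m, rnorm (z - cc m) < e.
Hypotheses (gw : amalgam a +oo%E 1%E w g) (fv : amalgam a p q v f).
Hypothesis h1 : `|h| = 1.

Let ag : aplim g := amalgam_aplim cd gw.
Let af : aplim f := amalgam_aplim cd fv.
Let ib0 : 0 < b^-1. Proof. by rewrite invr_gt0. Qed.

Definition window_inner (k : Zd) (x : Rd) : R[i]^o := inner (f x) (g (x - a *: rV_of_int k)).
Local Notation psi := window_inner.

Lemma aplim_window k : aplim (psi k).
Proof. by apply: aplim_inner => //; exact: (aplim_shift (- (a *: rV_of_int k)) ag). Qed.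

Lemma window_cells k :
  (\esum_(j in [set: Zd]) 'N[mu]_p[onc b^-1 j (fun x => (rnorm (psi k x))%:E)] < +oo)%E.
Proof.
have mg : measurable_fun setT (fun x => (rnorm (g x))%:E) by exact: measurable_rnorm_aplim.
have mf : measurable_fun setT (fun x => (rnorm (f x))%:E) by exact: measurable_rnorm_aplim.
have g0 x : (0 <= (rnorm (g x))%:E)%E by rewrite lee_fin rnorm_ge0.
have f0 x : (0 <= (rnorm (f x))%:E)%E by rewrite lee_fin rnorm_ge0.
have [_] := gw; rewrite amalgam_normE// => Ng.
have [_] := fv; rewrite amalgam_normE// => Nf.
apply: le_lt_trans (window_sum a0 b0 ww ws vw vm mg g0 Ng k p1 q1 mf f0 Nf).
apply: le_esumT => j; apply: Lnorm_ge0_le => // x.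
  by apply: onc_ge0 => y; rewrite lee_fin rnorm_ge0.
by rewrite /onc; case: ifP => // _; rewrite -EFinM lee_fin; exact: rnorm_inner.
Qed.

Lemma window_int k : (\int[mu]_x (rnorm (psi k x))%:E < +oo)%E.
Proof.
apply: (Lnorm_cells_integrable ib0 p1 _ _ (window_cells k)).
  exact: (measurable_rnorm_aplim (aplim_window k)).
by move=> x; rewrite lee_fin rnorm_ge0.
Qed.

Local Notation P k := (periodization b^-1 (psi k)).
Local Notation Q := (cube b^-1 : set Rd).

(** The explicit candidate for the function chosen by [fourier_fun]. The factor [b^-d] cancels the
    normalization [b^d] of Fourier coefficients on the cube of side [1/b]. *)
Definition multiplier (k : Zd) (x : Rd) : H := (P k x : R[i]) *: ((b ^- d)%:C *: h).

Lemma multiplier_periodic k : Defs.periodic b^-1 (multiplier k).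
Proof.
by move=> x n; rewrite /multiplier (periodization_periodic b^-1 (@cmpltC R)).
Qed.

Lemma aplim_P k : aplim (P k).
Proof. exact: (aplim_periodization b^-1 (@cmpltC R) (aplim_window k)). Qed.

Lemma multiplier_Lp k : in_Lp mu Q p (multiplier k).
Proof.
have mQ : measurable Q by exact: measurable_cube.
split; first by apply: aplim_strongly => //; [exact: cube_fin|apply: (aplimZ (aplim_P k)); exact: aplim_cst].
rewrite /Lp_norm; set K := rnorm ((b ^- d)%:C *: h).
have K0 : 0 <= K by exact: rnorm_ge0.
have mP : measurable_fun setT (pnorm b^-1 (psi k)) by exact: (measurable_pnorm b^-1 (aplim_window k)).
have le1 x : ((rnorm (cutoff Q (multiplier k) x))%:E <= K%:E * onc b^-1 0 (pnorm b^-1 (psi k)) x)%E.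
  rewrite /cutoff /onc indicE; case: (boolP (x \in Q)) => [/set_mem xQ|xQ].
    have/cube_cell0 -> := xQ => //; rewrite eqxx scale1r rnormZ mulrC EFinM.
    by apply: lee_wpmul2l; [rewrite lee_fin|exact: (rnorm_periodization b^-1 (@cmpltC R))].
  rewrite scale0r rnorm0 mule_ge0 ?lee_fin//; case: ifP => // _; exact: pnorm_ge0.
apply: le_lt_trans (Lnorm_ge0_le _ p1 _ le1) _; first by move=> x; rewrite lee_fin rnorm_ge0.
rewrite LnormZl//; last exact: measurable_onc.
apply: lte_mul_pinfty; rewrite ?lee_fin//.
exact: le_lt_trans (Lnorm_pnorm ib0 p1 (aplim_window k)) (window_cells k).
Qed.

Lemma multiplier_coef k n :
  fourier_coef b^-1 (multiplier k) n = analysis_op a b g h f k n.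
Proof.
pose zeta (x : Rd) : R[i]^o := chi b^-1 (- n) x.
have az : aplim zeta by apply: aplim_complex; exact: cmeas_chi.
have zper : Defs.periodic b^-1 zeta by exact: chi_periodic.
have z1 x : rnorm (zeta x) <= 1 by rewrite rnorm_chi.
have [I hI1 hI2] := bochner_periodization ib0 (@sepC R) (@cmpltC R) (aplim_window k) (window_int k) az zper z1.
have mQ : measurable Q by exact: measurable_cube.
have pI : pairing f (gabor_atom a b g k n) = I.
  have hI3 : has_bochner_integral mu (cutoff setT
      (fun x => inner (f x) (gabor_atom a b g k n x) : R[i]^o)) I.
    move: hI2; congr (has_bochner_integral mu _ I); apply/funext => x.
    rewrite /cutoff; congr (_ *: _); rewrite /gabor_atom /modulate innerZr.
    by rewrite -cis2piN /zeta /chi rV_of_intN dotpNl dotpZl dotpZr invrK.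
  exact: (bochnerE (@sepC R) hI3).
pose z : Rd -> R[i]^o := cutoff Q (fun x => (zeta x : R[i]) *: P k x).
have azP : aplim z := (aplim_cutoff mQ (aplimZ az (aplim_P k))).
have zint : (\int[mu]_x (rnorm (z x))%:E < +oo)%E.
  rewrite /z (cutoff_int mu Q (fun x => (zeta x : R[i]) *: P k x) (@rnorm0 _ R[i]^o)).
  apply: le_lt_trans (window_int k); rewrite -(int_pnorm ib0 (aplim_window k)).
  apply: ge0_le_integral => //.
  - by move=> x _; rewrite lee_fin rnorm_ge0.
  - by apply: measurable_funTS; exact: (measurable_rnorm_aplim (aplimZ az (aplim_P k))).
  - by apply: measurable_funTS; exact: (measurable_pnorm b^-1 (aplim_window k)).
  - move=> x _; rewrite (_ : rnorm _ = rnorm (P k x)); first exact: (rnorm_periodization b^-1 (@cmpltC R)).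
    by rewrite rnormCM rnorm_chi mul1r.
have hv := has_bochner_vector ((b ^- d)%:C *: h) azP zint hI1.
have hm : has_bochner_integral mu (cutoff Q (fun x =>
    cis2pi (- dotp (rV_of_int n) (b^-1^-1 *: x)) *: multiplier k x)) ((I : R[i]) *: ((b ^- d)%:C *: h)).
  move: hv; congr (has_bochner_integral mu _ _); apply/funext => x.
  rewrite /z /cutoff -[LHS]/(((\1_Q x : R)%:C * (zeta x * (P k x : R[i]))) *: ((b ^- d)%:C *: h)).
  by rewrite -scalerA; congr (_ *: _); rewrite -scalerA /zeta /chi rV_of_intN dotpNl.
rewrite /fourier_coef (bochnerE (@sepH R H) hm) /analysis_op pI !scalerA; congr (_ *: _).
rewrite mulrCA -rmorphM/= exprVn invrK mulfV ?mulr1// expf_neq0// gt_eqF//.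
Qed.

(** The candidate shows that the choice is not a default value, and uniqueness transfers the
    identity to the chosen function. The unit norm of [h] removes it from the result, so the
    synthesized series is independent of [h] almost everywhere. *)
Lemma synthesis_multiplier k : {ae mu, forall x,
  inner (fourier_fun b^-1 p (analysis_op a b g h f k) x) h = (b ^- d)%:C * P k x}.
Proof.
have [m1 m2 m3] : [/\ Defs.periodic b^-1 (fourier_fun b^-1 p (analysis_op a b g h f k)),
    in_Lp mu Q p (fourier_fun b^-1 p (analysis_op a b g h f k)) &
    forall n, fourier_coef b^-1 (fourier_fun b^-1 p (analysis_op a b g h f k)) n = analysis_op a b g h f k n].
  apply: (@xgetPex _ (fun=> 0) [set m : Rd -> H | [/\ Defs.periodic b^-1 m, in_Lp mu Q p m &
    forall n, fourier_coef b^-1 m n = analysis_op a b g h f k n]]).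
  exists (multiplier k); split; [exact: multiplier_periodic|exact: multiplier_Lp|exact: multiplier_coef].
have := fourier_fun_unique ib0 h p1 m1 (multiplier_periodic k) m2 (multiplier_Lp k)
  (fun l => etrans (m3 l) (esym (multiplier_coef k l))).
apply: filterS => x ->; rewrite /multiplier !innerZl inner_rnorm.
have -> : rnorm h = 1 by apply: (@complexI R); rewrite rnormE h1.
by rewrite expr1n mulr1 mulrC.
Qed.

End synthesis_multipliers.

Section limits_in_amalgams.
Context {R : realType} {d : nat} {H : hilbertType R}.
Local Notation Rd := 'rV[R]_d.
Local Notation Zd := 'rV[int]_d.
Local Notation mu := (lebesgue_rV d).
Variables (a : R) (p q : \bar R) (v : Rd -> R).
Hypotheses (a0 : 0 < a) (p1 : (1 <= p)%E) (q1 : (1 <= q)%E) (v0 : forall x, 0 < v x).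
Variable cc : nat -> H.
Hypothesis cd : forall (z : H) (e : R), 0 < e -> exists m, rnorm (z - cc m) < e.

Lemma amalgam_cvg_ae (I : choiceType) (s s' : {fset I} -> Rd -> H) (F F' : Rd -> H) :
  (forall A, {ae mu, forall x, s A x = s' A x}) -> {ae mu, forall x, F x = F' x} ->
  amalgam a p q v F' ->
  amalgam_cvg a p q v s F -> amalgam_cvg a p q v s' F'.
Proof.
move=> ss' FF' aF' [_ c]; split => //.
rewrite (_ : (fun A => _) = (fun A => amalgam_norm a p q v (fun x => s A x - F x)))//.
apply/funext => A; rewrite !(amalgam_normE a0); apply: (amnorm_ae_eq a q v p1).
by apply: filterS2 (ss' A) FF' => x -> ->.
Qed.

Lemma amalgam_cvg_unique (I : choiceType) (s : {fset I} -> Rd -> H) (F F' : Rd -> H) :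
  (forall A, aplim (s A)) ->
  amalgam_cvg a p q v s F -> amalgam_cvg a p q v s F' -> {ae mu, forall x, F x = F' x}.
Proof.
move=> as_ [aF cF] [aF' cF']; have apF := amalgam_aplim cd aF; have apF' := amalgam_aplim cd aF'.
have FF := @summability.totally_filter I.
have mD (f g : Rd -> H) : aplim f -> aplim g -> measurable_fun setT (fun x => (rnorm (f x - g x))%:E).
  by move=> af ag; apply: measurable_rnorm_aplim; exact: aplimB.
have n0 (f : Rd -> H) : (0 <= amalgam_norm a p q v f)%E.
  by rewrite (amalgam_normE a0); exact: (amnorm_ge0 a p q1 v0).
have D0 : amnorm a p q v (fun x => (rnorm (F x - F' x))%:E) = 0%E.
  apply/eqP; rewrite eq_le; apply/andP; split; last exact: (amnorm_ge0 a p q1 v0).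
  apply/lee_addgt0Pr => e e0; rewrite add0e.
  have e2 : 0 < e / 2 by rewrite divr_gt0.
  have c1 := (ge0_cvge0P FF (fun A => n0 (fun x => s A x - F x))).1 cF _ e2.
  have c2 := (ge0_cvge0P FF (fun A => n0 (fun x => s A x - F' x))).1 cF' _ e2.
  have [A [h1 h2]] := filter_ex (filterI c1 c2).
  rewrite [e]splitr EFinD; apply: le_trans (leeD h1 h2); rewrite !(amalgam_normE a0).
  apply: le_trans (amnormD a0 p1 q1 v0 _ _ (mD _ _ (as_ A) apF) (mD _ _ (as_ A) apF')); last 2 first.
  - by move=> x; rewrite lee_fin rnorm_ge0.
  - by move=> x; rewrite lee_fin rnorm_ge0.
  apply: (amnorm_le a p1 q1 v0) => x; first by rewrite lee_fin rnorm_ge0.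
  rewrite -EFinD lee_fin -(rnorm_distC (F x) (s A x)).
  by rewrite (_ : F x - F' x = (F x - s A x) + (s A x - F' x)) ?ler_rnormD// addrA subrK.
have := amnorm0_ae a0 p1 q1 v0 (mD _ _ apF apF') D0.
apply: filterS => x [/rnorm_eq0 e]; apply/eqP; rewrite -subr_eq0; exact/eqP.
Qed.

Lemma measurable_tl (I : countType) (C : I -> Rd -> \bar R) (A : {fset I}) :
  (forall i x, (0 <= C i x)%E) -> (forall i, measurable_fun setT (C i)) ->
  measurable_fun setT (fun x => tl (C ^~ x) A).
Proof.
move=> C0 mC; rewrite /tl; apply: (measurable_esum (F := fun i x => if i \in A then 0%E else C i x)).
  by move=> i x; case: ifP.
by move=> i; case: (boolP (i \in A)) => _; [exact: measurable_cst|exact: mC].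
Qed.

Lemma amnorm0 : amnorm a p q v (fun=> 0%E) = 0%E.
Proof.
have m0 : measurable_fun setT (fun _ : Rd => 0%E : \bar R) by exact: measurable_cst.
have := amnormZ a0 p1 q1 v0 (lexx (0 : R)) m0; rewrite [X in _ = X -> _]mul0e => e; rewrite -[RHS]e.
by congr amnorm; apply/funext => x; rewrite mul0e.
Qed.

Variable (I : countType) (C : I -> Rd -> \bar R).
Hypotheses (C0 : forall i x, (0 <= C i x)%E) (mC : forall i, measurable_fun setT (C i)).
Local Notation T := (fun x : Rd => \esum_(i in [set: I]) C i x)%E.
Hypothesis NT : (amnorm a p q v T < +oo)%E.

Let mT : measurable_fun setT T. Proof. exact: measurable_esum. Qed.
Let T0 x : (0 <= T x)%E. Proof. exact: esum_ge0T. Qed.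

Lemma total_ae_fin : {ae mu, forall x, (T x < +oo)%E}.
Proof.
by apply: filterS (amnorm_lty_ae a0 p1 q1 v0 mT NT) => x; rewrite gee0_abs.
Qed.

Lemma amnorm_tl_cvg : p != +oo%E -> q != +oo%E ->
  amnorm a p q v (fun x => tl (C ^~ x) A) @[A --> summability.totally] --> 0%E.
Proof.
move=> pF qF; apply: (cvg_totally0 (u := fun n => amnorm a p q v (fun x => tl (C ^~ x) (seg n)))).
- by move=> A; exact: (amnorm_ge0 a p q1 v0).
- by move=> A n nA; apply: (amnorm_le a p1 q1 v0) => // x; [exact: tl_ge0|exact: le_tl].
apply: (amnorm_dct a0 p1 q1 v0 (G := T)) => //.
- by move=> n; exact: measurable_tl.
- by move=> n x; exact: tl_ge0.
- by move=> n x; exact: tl_le.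
by apply: filterS total_ae_fin => x Tx; apply: tl_seg_cvg.
Qed.

(** The substitute for norm convergence of the tails when an exponent is infinite: against a fixed
    test function the majorant is integrable, and dominated convergence works in [L^1]. *)
Lemma int_tl_cvg (G : Rd -> \bar R) : measurable_fun setT G -> (forall x, (0 <= G x < +oo)%E) ->
  (\int[mu]_x (T x * G x) < +oo)%E ->
  (\int[mu]_x (tl (C ^~ x) A * G x))%E @[A --> summability.totally] --> 0%E.
Proof.
move=> mG G0 TG; have G1 x : (0 <= G x)%E by have /andP[] := G0 x.
apply: (cvg_totally0 (u := fun n => (\int[mu]_x (tl (C ^~ x) (seg n) * G x))%E)).
- by move=> A; apply: integral_ge0 => x _; rewrite mule_ge0// tl_ge0.
- move=> A n nA; apply: ge0_le_integral => //.
  + by move=> x _; rewrite mule_ge0// tl_ge0.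
  + by apply: emeasurable_funM => //; exact: measurable_tl.
  + by apply: emeasurable_funM => //; exact: measurable_tl.
  + by move=> x _; apply: lee_wpmul2r => //; exact: le_tl.
rewrite (_ : (fun n => _) = (fun n => 'N[mu]_1%:E[(fun x => tl (C ^~ x) (seg n) * G x)])%E); last first.
  apply/funext => n; rewrite Lnorm1; apply: eq_integral => x _; rewrite gee0_abs//; apply: mule_ge0 => //; exact: tl_ge0.
apply: (@Lnorm_dct _ _ _ mu 1 _ (fun x => (T x * G x)%E)) => //.
- by move=> n x; rewrite mule_ge0// tl_ge0.
- by move=> n; apply: emeasurable_funM => //; exact: measurable_tl.
- by apply: emeasurable_funM.
- rewrite Lnorm1; apply: le_lt_trans TG; apply: ge0_le_integral => //.
  + by apply: measurableT_comp => //; exact: emeasurable_funM.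
  + exact: emeasurable_funM.
  + by move=> x _; rewrite gee0_abs// mule_ge0.
- by move=> n x; rewrite gee0_abs ?mule_ge0//; apply: lee_wpmul2r => //; exact: tl_le.
apply: filterS total_ae_fin => x Tx; rewrite -[0%E](mul0e (G x)); apply: cvgeZr.
  by rewrite ge0_fin_numE//; have /andP[] := G0 x.
exact: tl_seg_cvg.
Qed.

End limits_in_amalgams.

Lemma has_tsum0 (R : realType) (E : normedModType R[i]) (I : countType) (b : I -> \bar R) (t : I -> E) :
  (forall i, 0 <= b i)%E -> (forall i, t i = 0) -> has_tsum b t 0.
Proof.
move=> b0 t0 A; rewrite big1; last by move=> i _; exact: t0.
by rewrite subr0 rnorm0; exact: tl_ge0.
Qed.

Section janssen_sum.
Context {R : realType} {d : nat} {H : hilbertType R}.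
Local Notation Rd := 'rV[R]_d.
Local Notation Zd := 'rV[int]_d.
Local Notation mu := (lebesgue_rV d).
Variables (a b : R) (w v : Rd -> R) (g gam f : Rd -> H) (p q : \bar R).
Hypotheses (a0 : 0 < a) (b0 : 0 < b) (ww : weight w) (ws : submultiplicative w).
Hypotheses (vw : weight v) (vm : moderate w v) (p1 : (1 <= p)%E) (q1 : (1 <= q)%E).
Variable cc : nat -> H.
Hypothesis cd : forall (z : H) (e : R), 0 < e -> exists m, rnorm (z - cc m) < e.
Hypotheses (gw : amalgam a +oo%E 1%E w g) (gamw : amalgam a +oo%E 1%E w gam).
Hypothesis fv : amalgam a p q v f.
Local Notation bn n := (b^-1 *: rV_of_int n : Rd).
Local Notation ak k := (a *: rV_of_int k : Rd).
Local Notation u := (fun x : Rd => (rnorm (g x))%:E).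
Local Notation s := (fun x : Rd => (rnorm (gam x))%:E).
Local Notation F := (fun x : Rd => (rnorm (f x))%:E).

Let ag : aplim g := amalgam_aplim cd gw.
Let agam : aplim gam := amalgam_aplim cd gamw.
Let af : aplim f := amalgam_aplim cd fv.
Let v0 x : 0 < v x. Proof. by case: vw. Qed.
Let ashift (E : normedModType R[i]) (F : Rd -> E) (y : Rd) : aplim F -> aplim (fun x : Rd => F (x - y)).
Proof. exact: aplim_shift. Qed.

Definition jterm (kn : Zd * Zd) (x : Rd) : H :=
  inner (f (x - bn kn.2)) (g (x - ak kn.1 - bn kn.2)) *: gam (x - ak kn.1).

Definition jbound (kn : Zd * Zd) (x : Rd) : \bar R :=
  (F (x - bn kn.2)%R * (s (x - ak kn.1)%R * u (x - ak kn.1 - bn kn.2)%R))%E.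

Definition walnut_part (n : Zd) (x : Rd) : \bar R := (\esum_(k in [set: Zd]) jbound (k, n) x)%E.
Definition synthesis_part (k : Zd) (x : Rd) : \bar R := (\esum_(n in [set: Zd]) jbound (k, n) x)%E.
Definition jtotal (x : Rd) : \bar R := (\esum_(n in [set: Zd]) walnut_part n x)%E.

(** Cut to 0 where absolute convergence fails, which makes it a limit of simple functions at every
    point and bounds it by [jtotal] everywhere. *)
Definition jsum (x : Rd) : H :=
  if x \in [set x | (\esum_(kn in [set: Zd * Zd]) (rnorm (jterm kn x))%:E < +oo)%E]
  then summability.sum (jterm ^~ x) else 0.

Lemma jbound_ge0 kn x : (0 <= jbound kn x)%E.
Proof. by rewrite /jbound -!EFinM lee_fin !mulr_ge0// rnorm_ge0. Qed.

Lemma walnut_part_ge0 n x : (0 <= walnut_part n x)%E.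
Proof. by apply: esum_ge0T => k; exact: jbound_ge0. Qed.

Lemma synthesis_part_ge0 n x : (0 <= synthesis_part n x)%E.
Proof. by apply: esum_ge0T => k; exact: jbound_ge0. Qed.

Lemma jtotal_ge0 x : (0 <= jtotal x)%E.
Proof. by apply: esum_ge0T => n; exact: walnut_part_ge0. Qed.

Lemma rnorm_jterm kn x : ((rnorm (jterm kn x))%:E <= jbound kn x)%E.
Proof.
rewrite /jterm /jbound -!EFinM lee_fin rnormZ mulrCA mulrC.
by apply: ler_wpM2l; [exact: rnorm_ge0|exact: rnorm_inner].
Qed.

Lemma aplim_jterm kn : aplim (jterm kn).
Proof.
apply: aplimZ; last exact: ashift.
apply: (aplim_inner (f := fun x : Rd => f (x - bn kn.2))); first exact: ashift.
by apply: (ashift (F := fun x : Rd => g (x - bn kn.2))); exact: ashift.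
Qed.

Lemma measurable_jbound kn : measurable_fun setT (jbound kn).
Proof.
have m (e : Rd -> H) : aplim e -> measurable_fun setT (fun x : Rd => (rnorm (e x))%:E).
  by move=> ae; exact: measurable_rnorm_aplim.
apply: emeasurable_funM.
  by apply: (m (fun x : Rd => f (x - bn kn.2))); exact: ashift.
apply: emeasurable_funM; first by apply: (m (fun x : Rd => gam (x - ak kn.1))); exact: ashift.
apply: (m (fun x : Rd => g (x - ak kn.1 - bn kn.2))).
by apply: (ashift (F := fun x : Rd => g (x - bn kn.2))); exact: ashift.
Qed.

Lemma measurable_walnut_part n : measurable_fun setT (walnut_part n).
Proof.
apply: measurable_esum; first by move=> k x; exact: jbound_ge0.
by move=> k; exact: measurable_jbound.
Qed.

Lemma measurable_synthesis_part n : measurable_fun setT (synthesis_part n).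
Proof.
apply: measurable_esum; first by move=> k x; exact: jbound_ge0.
by move=> k; exact: measurable_jbound.
Qed.

Lemma walnut_partE n x : walnut_part n x = (F (x - bn n)%R * walnut_sum a b g gam n x)%E.
Proof.
rewrite /walnut_part /jbound /walnut_sum -esumZl//; first by rewrite lee_fin rnorm_ge0.
by move=> k; rewrite -EFinM lee_fin mulr_ge0 ?rnorm_ge0.
Qed.

Lemma jtotal_synthesis x : jtotal x = (\esum_(k in [set: Zd]) synthesis_part k x)%E.
Proof.
rewrite /jtotal /walnut_part (esum_exchange (a := fun n k => jbound (k, n) x))//.
by move=> n k; exact: jbound_ge0.
Qed.

Lemma jtotal_pairs x : (\esum_(kn in [set: Zd * Zd]) jbound kn x)%E = jtotal x.
Proof.
rewrite jtotal_synthesis /synthesis_part (esum_esum (a := fun k n => jbound (k, n) x)); last first.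
  by move=> k n _ _; exact: jbound_ge0.
rewrite (_ : [set: Zd] `*`` (fun=> [set: Zd]) = [set: Zd * Zd]); last first.
  by apply/seteqP; split => -[].
by apply: eq_esum => -[].
Qed.

Lemma walnut_parts : (\esum_(n in [set: Zd]) amnorm a p q v (walnut_part n) < +oo)%E.
Proof.
have [_] := gw; rewrite (amalgam_normE a0) => Ng.
have [_] := gamw; rewrite (amalgam_normE a0) => Ngam.
have [_] := fv; rewrite (amalgam_normE a0) => Nf.
have r0 (e : Rd -> H) x : (0 <= (rnorm (e x))%:E)%E by rewrite lee_fin rnorm_ge0.
have := walnut_total a0 b0 ww ws vw vm (r0 g) (r0 gam) Ng Ngam p1 q1 (measurable_rnorm_aplim af) (r0 f) Nf.
apply: le_lt_trans; rewrite le_eqVlt; apply/orP; left; apply/eqP; apply: eq_esum => n _.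
by congr amnorm; apply/funext => x; rewrite walnut_partE.
Qed.

Lemma amnorm_jtotal : (amnorm a p q v jtotal < +oo)%E.
Proof.
apply: le_lt_trans walnut_parts; apply: (amnorm_esum a0 p1 q1 v0).
  by move=> n x; exact: walnut_part_ge0.
exact: measurable_walnut_part.
Qed.

Lemma aplim_jsum : aplim jsum.
Proof.
apply: (aplim_tsum (0, 0) (f := jterm)); first exact: aplim_jterm.
by move=> x; exact: (has_tsum_exact (@cmpltH R H)).
Qed.

Lemma jsum_tsum x : (jtotal x < +oo)%E -> has_tsum (jbound ^~ x) (jterm ^~ x) (jsum x).
Proof.
rewrite -jtotal_pairs => fin; rewrite /jsum mem_set; last first.
  by apply: le_lt_trans fin; apply: le_esumT => kn; exact: rnorm_jterm.
by apply: (has_tsum_dominated (@cmpltH R H)) => // kn; exact: rnorm_jterm.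
Qed.

Lemma rnorm_jsum x : ((rnorm (jsum x))%:E <= jtotal x)%E.
Proof.
have [fin|inf] := ltP (jtotal x) +oo%E; last by apply: le_trans inf; exact: leey.
rewrite -jtotal_pairs; apply: has_tsum_norm (jsum_tsum fin).
by move=> kn; exact: jbound_ge0.
Qed.

Lemma jsum_walnut x : (jtotal x < +oo)%E ->
  has_tsum (walnut_part ^~ x) (fun n => walnut_coef a b g gam n x (f (x - bn n))) (jsum x).
Proof.
move=> fin; have sw : bijective (fun nk : Zd * Zd => (nk.2, nk.1)).
  by exists (fun nk : Zd * Zd => (nk.2, nk.1)) => -[].
have hs := has_tsum_bij sw (jsum_tsum fin).
apply: (has_tsum_double (b := fun n k => jbound (k, n) x) (t := fun n k => jterm (k, n) x)) => //.
  by move=> n k; exact: jbound_ge0.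
move=> n; have fn : (walnut_part n x < +oo)%E.
  by apply: le_lt_trans fin; apply: (esum_term (a := walnut_part ^~ x)) => i; exact: walnut_part_ge0.
(* Where [f] vanishes, a finite [walnut_part] says nothing about [walnut_sum], and the value of
   [G_n] may be a default; being linear, it still sends 0 to 0. *)
have [f0|f0] := eqVneq (f (x - bn n)) 0.
  have -> : walnut_coef a b g gam n x (f (x - bn n)) = 0 by rewrite f0 linear0.
  apply: has_tsum0 => k; first exact: jbound_ge0.
  by rewrite /jterm f0 inner0l scale0r.
have fw : (walnut_sum a b g gam n x < +oo)%E.
  rewrite ltey; apply/eqP => wo; move: fn; rewrite walnut_partE wo gt0_muley ?ltxx// lte_fin.
  by rewrite lt_neqAle rnorm_ge0 andbT eq_sym; apply: contra_neq f0; exact: rnorm_eq0.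
have := has_tsum_map (Psi := fun A : bounded_op H => A (f (x - bn n))) (rnorm_ge0 (f (x - bn n)))
  (fun A B => op_addE A B _) _ _ (walnut_coef_tsum fw).
apply.
- by move=> A; rewrite mulrC; exact: op_bound.
- by move=> k; rewrite -EFinM lee_fin mulr_ge0 ?rnorm_ge0.
Qed.

Lemma jsum_synthesis x : (jtotal x < +oo)%E ->
  has_tsum (synthesis_part ^~ x)
    (fun k => (periodization b^-1 (window_inner a g f k) x : R[i]) *: gam (x - ak k)) (jsum x).
Proof.
move=> fin; have hs := jsum_tsum fin.
apply: (has_tsum_double (b := fun k n => jbound (k, n) x) (t := fun k n => jterm (k, n) x)).
- by move=> n k; exact: jbound_ge0.
- by move: fin; rewrite jtotal_synthesis.
- move: hs; congr (has_tsum _ _ (jsum x)); by apply/funext => -[].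
move=> k; have fk : (synthesis_part k x < +oo)%E.
  move: fin; rewrite jtotal_synthesis; apply: le_lt_trans.
  by apply: (esum_term (a := synthesis_part ^~ x)) => i; exact: synthesis_part_ge0.
(* Likewise, where [gam] vanishes the periodization may be a default value, but it only multiplies
   the zero vector. *)
have [gam0|gam0] := eqVneq (gam (x - ak k)) 0.
  rewrite gam0 scaler0; apply: has_tsum0 => n; first exact: jbound_ge0.
  by rewrite /jterm gam0 scaler0.
have bo : bijective (fun k : Zd => - k) by exists (fun k : Zd => - k); exact: opprK.
have sg : 0 < rnorm (gam (x - ak k)).
  by rewrite lt_neqAle rnorm_ge0 andbT eq_sym; apply: contra_neq gam0; exact: rnorm_eq0.
have psiN n : window_inner a g f k (x + b^-1 *: rV_of_int (- n)) =
    inner (f (x - bn n)) (g (x - ak k - bn n)).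
  by rewrite /window_inner rV_of_intN scalerN addrAC.
have pn : (pnorm b^-1 (window_inner a g f k) x < +oo)%E.
  rewrite ltey; apply/eqP => po; move: fk; rewrite ltNge => /negP; apply.
  rewrite -(gt0_muley (x := (rnorm (gam (x - ak k)))%:E)) ?lte_fin// -po /pnorm.
  rewrite -(esum_bij _ bo) -esumZl ?lee_fin ?rnorm_ge0//; last by move=> n; rewrite lee_fin rnorm_ge0.
  apply: le_esumT => n; rewrite psiN -EFinM; apply: le_trans (rnorm_jterm (k, n) x).
  by rewrite lee_fin /jterm rnormZ mulrC.
have hp : has_tsum (fun n : Zd => (rnorm (window_inner a g f k (x + b^-1 *: rV_of_int n)))%:E)
   (fun n : Zd => window_inner a g f k (x + b^-1 *: rV_of_int n)) (periodization b^-1 (window_inner a g f k) x).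
  by rewrite /periodization mem_set//; exact: (has_tsum_exact (@cmpltC R)).
have bd (z : R[i]^o) : rnorm ((z : R[i]) *: gam (x - ak k)) <= rnorm (gam (x - ak k)) * rnorm z.
  by rewrite rnormZ mulrC.
have nn n : (0 <= (rnorm (window_inner a g f k (x + b^-1 *: rV_of_int (- n))))%:E)%E.
  by rewrite lee_fin rnorm_ge0.
have h1 := has_tsum_map (Psi := fun z : R[i]^o => (z : R[i]) *: gam (x - ak k))
  (rnorm_ge0 (gam (x - ak k))) (fun z z' => scalerDl (gam (x - ak k)) z z') bd nn (has_tsum_bij bo hp).
have le1 n : ((rnorm (gam (x - ak k)))%:E * (rnorm (window_inner a g f k (x + b^-1 *: rV_of_int (- n))))%:E
    <= jbound (k, n) x)%E.
  by apply: le_trans (rnorm_jterm (k, n) x); rewrite -EFinM lee_fin psiN /jterm rnormZ mulrC.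
rewrite (_ : (fun n => jterm (k, n) x) = (fun n : Zd =>
    (window_inner a g f k (x + b^-1 *: rV_of_int (- n)) : R[i]) *: gam (x - ak k))).
  exact: has_tsum_le le1 h1.
by apply/funext => n; rewrite psiN.
Qed.

End janssen_sum.

(** * Expansions with a common majorant in the amalgam space *)

Section dominated_expansions.
Context {R : realType} {d : nat} {H : hilbertType R}.
Local Notation Rd := 'rV[R]_d.
Local Notation Zd := 'rV[int]_d.
Local Notation mu := (lebesgue_rV d).
Variables (a t : R) (v : Rd -> R) (p q : \bar R).
Hypotheses (a0 : 0 < a) (t0 : 0 <= t) (v0 : forall x, 0 < v x) (p1 : (1 <= p)%E) (q1 : (1 <= q)%E).
Variable cc : nat -> H.
Hypothesis cd : forall (z : H) (e : R), 0 < e -> exists m, rnorm (z - cc m) < e.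
Variables (S : Rd -> H) (T : Rd -> \bar R).
Hypotheses (aS : aplim S) (mT : measurable_fun setT T) (T0 : forall x, (0 <= T x)%E).
Hypotheses (NT : (amnorm a p q v T < +oo)%E) (ST : forall x, ((rnorm (S x))%:E <= T x)%E).
Local Notation F0 := (fun x => t%:C *: S x).

Let Tfin : {ae mu, forall x, (T x < +oo)%E}.
Proof.
by apply: filterS (amnorm_lty_ae a0 p1 q1 v0 mT NT) => x; rewrite (gee0_abs (T0 x)).
Qed.

Let aZ (c : R) (F : Rd -> H) : aplim F -> aplim (fun x => c%:C *: F x).
Proof. by move=> aF; apply: (@aplimZ _ _ _ _ (fun=> c%:C)) aF; exact: aplim_cst. Qed.

Let F0T x : ((rnorm (F0 x))%:E <= t%:E * T x)%E.
Proof.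
by rewrite rnormRZ (ger0_norm t0) EFinM; apply: lee_wpmul2l; [rewrite lee_fin|exact: ST].
Qed.

Lemma amalgam_dominated (G : Rd -> H) (c : R) : aplim G -> 0 <= c ->
  {ae mu, forall x, ((rnorm (G x))%:E <= c%:E * T x)%E} -> amalgam a p q v G.
Proof.
move=> aG c0 hG; split; first exact: aplim_borel.
rewrite (amalgam_normE a0).
apply: (@le_lt_trans _ _ (amnorm a p q v (fun x => c%:E * T x)%E)).
  apply: (amnorm_ae_le a p1 q1 v0) hG => x; first by rewrite lee_fin rnorm_ge0.
  by apply: mule_ge0; [rewrite lee_fin|exact: T0].
rewrite (amnormZ a0 p1 q1 v0 c0 mT); apply: lte_mul_pinfty NT => //; by rewrite lee_fin.
Qed.

Lemma amalgam_limit : amalgam a p q v F0.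
Proof.
by apply: (amalgam_dominated (c := t) (aZ t aS) t0); apply: aeW => x; exact: F0T.
Qed.

Section expansions.
Variables (C : Zd -> Rd -> \bar R) (r : Zd -> Rd -> H).
Hypotheses (C0 : forall i x, (0 <= C i x)%E) (mC : forall i, measurable_fun setT (C i)).
Hypothesis CT : forall x, (\esum_(i in [set: Zd]) C i x)%E = T x.
Hypothesis hr : forall x, (T x < +oo)%E -> has_tsum (C ^~ x) (r ^~ x) (S x).
Local Notation rs A := (fun x => t%:C *: summability.partial_sum (r ^~ x) A).

(** Shared by the Walnut and the synthesis expansions: they have the same sum [S] and total majorant
    [T], and differ only in which index is summed first. *)
Lemma expansion_error (A : {fset Zd}) x : (T x < +oo)%E ->
  ((rnorm (rs A x - F0 x))%:E <= t%:E * tl (C ^~ x) A)%E.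
Proof.
move=> fin; rewrite rnorm_distC -scalerBr rnormRZ (ger0_norm t0) EFinM.
apply: lee_wpmul2l; first by rewrite lee_fin.
by rewrite partial_sumE; exact: (hr fin).
Qed.

Lemma expansion_cvg :
  amnorm a p q v (fun x => tl (C ^~ x) A) @[A --> summability.totally] --> 0%E ->
  amalgam_cvg a p q v (fun A => rs A) F0.
Proof.
move=> c; split; first exact: amalgam_limit.
have FF := @summability.totally_filter Zd.
have n0 A : (0 <= amalgam_norm a p q v (fun x => rs A x - F0 x)%R)%E.
  by rewrite (amalgam_normE a0); exact: (amnorm_ge0 a p q1 v0).
apply/(ge0_cvge0P FF n0) => e e0.
have c2 : (t%:E * amnorm a p q v (fun x => tl (C ^~ x) A))%E @[A --> summability.totally] --> 0%E.
  by rewrite -[0%E](mule0 t%:E); apply: cvgeZl.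
have m0 A : (0 <= t%:E * amnorm a p q v (fun x => tl (C ^~ x) A))%E.
  by apply: mule_ge0; [rewrite lee_fin|exact: (amnorm_ge0 a p q1 v0)].
have := (ge0_cvge0P FF m0).1 c2 e e0; apply: filterS => A; apply: le_trans.
rewrite (amalgam_normE a0) -(amnormZ a0 p1 q1 v0)//; last exact: measurable_tl.
apply: (amnorm_ae_le a p1 q1 v0) => [x|x|].
- by rewrite lee_fin rnorm_ge0.
- by apply: mule_ge0; [rewrite lee_fin|exact: tl_ge0].
- by apply: filterS Tfin => x; exact: expansion_error.
Qed.

Hypothesis ar : forall i, aplim (r i).

Lemma aplim_expansion (A : {fset Zd}) : aplim (rs A).
Proof.
apply: (@aZ t (fun x => summability.partial_sum (r ^~ x) A)).
rewrite (_ : (fun x => _) = fun x => \sum_(i <- A) r i x); first exact: aplim_sum.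
by apply/funext => x; rewrite partial_sumE.
Qed.

Lemma amalgam_expansion (A : {fset Zd}) : amalgam a p q v (rs A).
Proof.
(* One [t] bounds the distance to the limit, the other the limit itself. *)
apply: (amalgam_dominated (c := t + t) (aplim_expansion A) (addr_ge0 t0 t0)).
apply: filterS Tfin => x fin.
rewrite (_ : rs A x = (rs A x - F0 x) + F0 x); last by rewrite subrK.
apply: (@le_trans _ _ ((rnorm (rs A x - F0 x))%:E + (rnorm (F0 x))%:E)%E).
  by rewrite -EFinD lee_fin ler_rnormD.
rewrite EFinD ge0_muleDl ?lee_fin//; apply: leeD.
  apply: le_trans (expansion_error A fin) _; apply: lee_wpmul2l; first by rewrite lee_fin.
  by rewrite -CT; exact: tl_le.
exact: F0T.
Qed.

(** The net [s] may differ from the explicit partial sums on null sets, which pairings do not see.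
    This matters because the synthesis series is built from chosen multipliers. *)
Lemma expansion_weak_cvg (s : {fset Zd} -> Rd -> H) :
  (forall A, {ae mu, forall x, s A x = rs A x}) -> amalgam_weak_cvg a p q v s F0.
Proof.
move=> sr; split; first exact: amalgam_limit.
move=> phi aphi; have FF := @summability.totally_filter Zd.
have ap := amalgam_aplim cd aphi.
have amF (G : Rd -> H) : amalgam a p q v G -> aplim (fun x => inner (G x) (phi x) : R[i]^o) /\
    (\int[mu]_x (rnorm (inner (G x) (phi x) : R[i]^o))%:E < +oo)%E.
  move=> aG; have apG := amalgam_aplim cd aG; split; first exact: aplim_inner.
  by apply: (inner_int a0 cd p1 q1 v0 apG _ aphi); have [_] := aG; rewrite (amalgam_normE a0).
have pT : (\int[mu]_x (T x * (rnorm (phi x))%:E) < +oo)%E.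
  apply: (amalgam_pairing a0 cd p1 q1 v0 mT _ NT aphi) => x; exact: T0.
have mphi : measurable_fun setT (fun x => (rnorm (phi x))%:E) by exact: measurable_rnorm_aplim.
pose e_ A := (\int[mu]_x (tl (C ^~ x) A * (rnorm (phi x))%:E))%E.
have TC : T = (fun x => (\esum_(i in [set: Zd]) C i x)%E) by apply/funext => x; rewrite CT.
have ch : e_ A @[A --> summability.totally] --> 0%E.
  have NC : (amnorm a p q v (fun x => \esum_(i in [set: Zd]) C i x)%E < +oo)%E by rewrite -TC.
  apply: (int_tl_cvg a0 p1 q1 v0 C0 mC NC mphi) => [x|]; first by rewrite lee_fin rnorm_ge0 ltry.
  by move: pT; rewrite TC.
have e_0 A : (0 <= e_ A)%E by apply: integral_ge0 => x _; rewrite mule_ge0 ?tl_ge0// lee_fin rnorm_ge0.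
have [aF iF] := amF _ amalgam_limit.
(* The factor 2 comes from estimating real and imaginary parts of the pairing separately. *)
have bound A : ((rnorm (pairing F0 phi - pairing (s A) phi : R[i]^o))%:E <= 2%:E * (t%:E * e_ A))%E.
  have [aA iA] := amF _ (amalgam_expansion A).
  have PA : pairing (s A) phi = cint mu setT (fun x => inner (rs A x) (phi x)).
    by apply: (pairing_cint aA) => //; apply: filterS (sr A) => x ->.
  have PF : pairing F0 phi = cint mu setT (fun x => inner (F0 x) (phi x)).
    by apply: (pairing_cint aF) => //; exact: aeW.
  have cA := cintegrable_le measurableT (aplim_cmeas aA) iA.
  have cF := cintegrable_le measurableT (aplim_cmeas aF) iF.
  have D : pairing F0 phi - pairing (s A) phi =
      cint mu setT (fun x => inner (F0 x) (phi x) + (-1) * inner (rs A x) (phi x)).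
    by rewrite cintD//; [rewrite cintZ// mulN1r PA PF|exact: cintegrableZ].
  have zE x : inner (F0 x) (phi x) + (-1) * inner (rs A x) (phi x) = inner (F0 x - rs A x) (phi x).
    by rewrite mulN1r innerBl.
  have le1 : (\int[mu]_x (rnorm (inner (F0 x) (phi x) + (-1) * inner (rs A x) (phi x) : R[i]^o))%:E
      <= t%:E * e_ A)%E.
    have -> : (t%:E * e_ A = \int[mu]_x (t%:E * (tl (C ^~ x) A * (rnorm (phi x))%:E)))%E.
      rewrite /e_ ge0_integralZl//.
      + by apply: emeasurable_funM => //; exact: measurable_tl.
      + by move=> x _; rewrite mule_ge0 ?tl_ge0// lee_fin rnorm_ge0.
    apply: ge0_ae_le_integral => [x|x|]; first by rewrite lee_fin rnorm_ge0.
      by rewrite mule_ge0 ?lee_fin// mule_ge0 ?tl_ge0// lee_fin rnorm_ge0.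
    apply: filterS Tfin => x fin; rewrite zE muleA.
    apply: (@le_trans _ _ ((rnorm (F0 x - rs A x))%:E * (rnorm (phi x))%:E)%E).
      by rewrite -EFinM lee_fin rnorm_inner.
    apply: lee_wpmul2r; first by rewrite lee_fin rnorm_ge0.
    by rewrite rnorm_distC; exact: expansion_error.
  have fin1 : (\int[mu]_x (rnorm (inner (F0 x) (phi x) + (-1) * inner (rs A x) (phi x) : R[i]^o))%:E < +oo)%E.
    apply: le_lt_trans le1 _; apply: lte_mul_pinfty; rewrite ?lee_fin//.
    apply: le_lt_trans pT; apply: ge0_le_integral => //.
    - by move=> x _; rewrite mule_ge0 ?tl_ge0// lee_fin rnorm_ge0.
    - by apply: emeasurable_funM => //; exact: measurable_tl.
    - by apply: emeasurable_funM.
    - by move=> x _; apply: lee_wpmul2r; [rewrite lee_fin rnorm_ge0|rewrite -CT; exact: tl_le].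
  rewrite D; apply: le_trans (rnorm_cint_le measurableT _ fin1) _.
    by apply: cmeasD; [exact: aplim_cmeas|apply: cmeasM; [exact: cmeas_cst|exact: aplim_cmeas]].
  by apply: lee_wpmul2l le1; rewrite lee_fin.
apply/cvg_rnormP => e e0.
have c2 : (2%:E * (t%:E * e_ A))%E @[A --> summability.totally] --> 0%E.
  by rewrite -[0%E](mule0 2%:E) -[X in (_ * X)%E](mule0 t%:E); do 2 apply: cvgeZl => //.
have m0 A : (0 <= 2%:E * (t%:E * e_ A))%E by rewrite !mule_ge0// lee_fin.
have e2 : 0 < e / 2 by rewrite divr_gt0.
have := (ge0_cvge0P FF m0).1 c2 _ e2; apply: filterS => A hA.
have := le_trans (bound A) hA; rewrite lee_fin => hh; apply: le_lt_trans hh _.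
by rewrite ltr_pdivrMr// ltr_pMr// ltr1n.
Qed.

End expansions.

End dominated_expansions.

Section janssen_representation.
Context {R : realType} {d : nat} {H : hilbertType R}.
Local Notation Rd := 'rV[R]_d.
Local Notation Zd := 'rV[int]_d.
Local Notation mu := (lebesgue_rV d).
Variables (a b : R) (w v : Rd -> R) (g gam f : Rd -> H) (h : H) (p q : \bar R).
Hypotheses (a0 : 0 < a) (b0 : 0 < b) (ww : weight w) (ws : submultiplicative w).
Hypotheses (vw : weight v) (vm : moderate w v) (p1 : (1 <= p)%E) (q1 : (1 <= q)%E).
Variable cc : nat -> H.
Hypothesis cd : forall (z : H) (e : R), 0 < e -> exists m, rnorm (z - cc m) < e.
Hypotheses (gw : amalgam a +oo%E 1%E w g) (gamw : amalgam a +oo%E 1%E w gam).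
Hypothesis fv : amalgam a p q v f.
Hypothesis h1 : `|h| = 1.
Local Notation bn n := (b^-1 *: rV_of_int n : Rd).
Local Notation ak k := (a *: rV_of_int k : Rd).
Local Notation t := (b ^- d).

Let agam : aplim gam := amalgam_aplim cd gamw.
Let v0 x : 0 < v x. Proof. by case: vw. Qed.
Let t0 : 0 <= t. Proof. by rewrite invr_ge0 exprn_ge0// ltW. Qed.
Local Notation S := (jsum a b g gam f).
Local Notation T := (jtotal a b g gam f).
Local Notation WP := (walnut_part a b g gam f).
Local Notation SP := (synthesis_part a b g gam f).
Let WP0 : forall n x, (0 <= WP n x)%E. Proof. exact: walnut_part_ge0. Qed.
Let SP0 : forall n x, (0 <= SP n x)%E. Proof. exact: synthesis_part_ge0. Qed.
Let T0 : forall x, (0 <= T x)%E. Proof. exact: jtotal_ge0. Qed.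
Let ST : forall x, ((rnorm (S x))%:E <= T x)%E. Proof. exact: rnorm_jsum. Qed.
Let mWP : forall n, measurable_fun setT (WP n).
Proof. exact: (measurable_walnut_part b cd gw gamw fv). Qed.
Let mSP : forall n, measurable_fun setT (SP n).
Proof. exact: (measurable_synthesis_part b cd gw gamw fv). Qed.
Let NT : (amnorm a p q v T < +oo)%E.
Proof. exact: (amnorm_jtotal a0 b0 ww ws vw vm p1 q1 cd gw gamw fv). Qed.
Let ST_E : forall x, (\esum_(k in [set: Zd]) SP k x)%E = T x.
Proof. by move=> x; rewrite jtotal_synthesis. Qed.
Let mT : measurable_fun setT T.
Proof. exact: (measurable_esum WP0 mWP). Qed.
Let aS : aplim S. Proof. exact: (aplim_jsum b cd gw gamw fv). Qed.

Local Notation F0 := (fun x => t%:C *: S x).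
Local Notation Sf := (frame_op a b p q v g gam h f).
Local Notation P k := (periodization b^-1 (window_inner a g f k)).
Local Notation r := (fun k x => (P k x : R[i]) *: gam (x - ak k)).
Local Notation rs := (fun (A : {fset Zd}) x => t%:C *: summability.partial_sum (r ^~ x) A).
Local Notation series := (fun (A : {fset Zd}) (x : Rd) => summability.partial_sum
  (fun k => inner (fourier_fun b^-1 p (analysis_op a b g h f k) x) h *: translate (ak k) gam x) A).

Let ar k : aplim (r k).
Proof.
apply: aplimZ; first exact: (aplim_P b cd gw fv k).
exact: (aplim_shift (- ak k) agam).
Qed.

Lemma synthesis_series A : {ae mu, forall x, series A x = rs A x}.
Proof.
have := ae_forall_count (synthesis_multiplier a0 b0 ww ws vw vm p1 q1 cd gw fv h1).
apply: filterS => x hx; rewrite !partial_sumE scaler_sumr; apply: eq_bigr => k _.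
by rewrite hx scalerA.
Qed.

(** The frame operator is a chosen limit. The explicit function [t S] shows that a limit exists, so
    the choice is genuine, and uniqueness of limits in the relevant topology identifies the two
    almost everywhere. *)
Lemma frame_op_janssen : amalgam a p q v Sf /\ {ae mu, forall x, F0 x = Sf x}.
Proof.
have hr x : (T x < +oo)%E -> has_tsum (SP ^~ x) (r ^~ x) (S x) by exact: jsum_synthesis.
have rA A : aplim (rs A) := aplim_expansion t ar A.
have aF0 : amalgam a p q v F0 := amalgam_limit a0 t0 v0 p1 q1 aS mT T0 NT ST.
case pqE : ((p == +oo%E) || (q == +oo%E)).
  have wk := expansion_weak_cvg a0 t0 v0 p1 q1 cd aS mT T0 NT ST SP0 mSP ST_E hr ar synthesis_series.
  have wS : amalgam_weak_cvg a p q v series Sf.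
    have : exists F, amalgam_weak_cvg a p q v series F by exists F0.
    move=> /(xgetPex (fun=> 0)); congr (amalgam_weak_cvg a p q v series _).
    by rewrite /frame_op /synthesis_op pqE.
  split; first by case: wS.
  apply: (weak_limit_unique a0 cd p1 q1 v0 aF0); first by case: wS.
  move=> phi aphi; have FF := @summability.totally_filter Zd.
  have c1 := wk.2 phi aphi; have c2 := wS.2 phi aphi.
  exact: (cvg_unique (@norm_hausdorff _ _) c1 c2).
move/negbT : pqE; rewrite negb_or => /andP[pF qF].
have NC : (amnorm a p q v (fun x => \esum_(k in [set: Zd]) SP k x)%E < +oo)%E.
  by rewrite (_ : (fun x => _) = T); [exact: NT|apply/funext; exact: ST_E].
have c1 : amalgam_cvg a p q v rs F0.
  apply: (expansion_cvg a0 t0 v0 p1 q1 aS mT T0 NT ST SP0 mSP hr).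
  exact: (amnorm_tl_cvg a0 p1 q1 v0 SP0 mSP NC pF qF).
have sr A : {ae mu, forall x, rs A x = series A x} by apply: filterS (synthesis_series A) => x ->.
have ae0 (F : Rd -> H) : {ae mu, forall x, F x = F x} by exact: aeW.
have cS : amalgam_cvg a p q v series Sf.
  have : exists F, amalgam_cvg a p q v series F.
    by exists F0; exact: (amalgam_cvg_ae a0 p1 sr (ae0 F0) aF0 c1).
  move=> /(xgetPex (fun=> 0)); congr (amalgam_cvg a p q v series _).
  by rewrite /frame_op /synthesis_op (negbTE pF) (negbTE qF).
split; first by case: cS.
apply: (amalgam_cvg_unique a0 p1 q1 v0 cd rA c1).
by apply: (amalgam_cvg_ae a0 p1 synthesis_series (ae0 Sf) _ cS); case: cS.
Qed.

(** Convergence is in norm even when an exponent is infinite: the norms of the Walnut majorants are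
    summable over [n], so the norm of a tail is bounded by a tail of norms. The synthesis series has
    no such bound and needs the weak topology there. *)
Lemma walnut_representation : amalgam_cvg a p q v
  (fun A x => t%:C *: summability.partial_sum (fun n =>
    apply_op (walnut_coef a b g gam n) (translate (bn n) f) x) A) Sf.
Proof.
have [aSf F0Sf] := frame_op_janssen.
have hr x : (T x < +oo)%E ->
    has_tsum (WP ^~ x) (fun n => apply_op (walnut_coef a b g gam n) (translate (bn n) f) x) (S x).
  exact: jsum_walnut.
have ae0 (F : Rd -> H) : {ae mu, forall x, F x = F x} by exact: aeW.
apply: (amalgam_cvg_ae a0 p1 (fun A => ae0 _) F0Sf aSf).
apply: (expansion_cvg a0 t0 v0 p1 q1 aS mT T0 NT ST WP0 mWP hr).
have FF := @summability.totally_filter Zd.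
have N0 n : (0 <= amnorm a p q v (WP n))%E by exact: (amnorm_ge0 a p q1 v0).
have tc := tl_cvg N0 (walnut_parts a0 b0 ww ws vw vm p1 q1 cd gw gamw fv).
have m0 A : (0 <= amnorm a p q v (fun x => tl (WP ^~ x) A))%E by exact: (amnorm_ge0 a p q1 v0).
apply/(ge0_cvge0P FF m0) => e e0.
have n0 A : (0 <= tl (fun n => amnorm a p q v (WP n)) A)%E by exact: tl_ge0.
have := (ge0_cvge0P FF n0).1 tc e e0; apply: filterS => A; apply: le_trans.
have i0 i x : (0 <= (if i \in A then 0%E else WP i x))%E by case: ifP.
apply: (le_trans (amnorm_esum a0 p1 q1 v0 i0 _)) => [i|].
  by case: (boolP (i \in A)) => _; [exact: measurable_cst|exact: mWP].
apply: le_esumT => i; case: (boolP (i \in A)) => // _.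
by rewrite (amnorm0 a0 p1 q1 v0).
Qed.

Lemma fourier_L2_sum_walnut n : {ae mu, forall x,
  fourier_L2_sum a (fun l => op_bracket gam (modulate (a^-1 *: rV_of_int l) (translate (bn n) g))) x =
  (a ^+ d)%:C *: walnut_coef a b g gam n x}.
Proof.
set c := (fun l : Zd => _).
(* The periodization is taken instead of [G_n] because the choice asks for periodicity at every
   point. The factor [a^d] restores the normalization that the bare brackets lack. *)
pose W x := (a ^+ d)%:C *: periodization a (walnut_kernel b g gam n) x.
have aP : aplim (periodization a (walnut_kernel b g gam n)).
  apply: (aplim_periodization a (@cmpltB R H)); apply: aplim_rank_one => //.
  exact: (aplim_shift (- bn n) (amalgam_aplim cd gw)).
have W1 : Defs.periodic a W.
  by move=> x k; rewrite /W (periodization_periodic a (@cmpltB R H)).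
have W2 : fourier_series_L2 a c W.
  have ad0 : 0 <= a ^+ d by rewrite exprn_ge0// ltW.
  have := fourier_series_L2Z a0 ad0 aP (fourier_series_periodization a0 b0 ww ws cd gw gamw n).
  congr (fourier_series_L2 a _ W); apply/funext => l; rewrite scalerA -rmorphM/= mulfV ?scale1r//.
  by rewrite expf_neq0// gt_eqF.
have [L1 L2] : Defs.periodic a (fourier_L2_sum a c) /\ fourier_series_L2 a c (fourier_L2_sum a c).
  by apply: (@xgetPex _ (fun=> 0) [set F | Defs.periodic a F /\ fourier_series_L2 a c F]); exists W.
apply: filterS2 (fourier_L2_unique a0 L1 W1 L2 W2) (walnut_coef_ae a0 b0 ww ws gw gamw n) => x -> ->.
by [].
Qed.

Lemma janssen : amalgam_cvg a p q v
  (fun A x => ((a * b) ^- d)%:C *: summability.partial_sum (fun n =>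
    apply_op (fourier_L2_sum a (fun l => op_bracket gam (modulate (a^-1 *: rV_of_int l) (translate (bn n) g))))
      (translate (bn n) f) x) A) Sf.
Proof.
have [aSf _] := frame_op_janssen.
have ae0 : {ae mu, forall x, Sf x = Sf x} by exact: aeW.
apply: (amalgam_cvg_ae a0 p1 _ ae0 aSf walnut_representation) => A.
have := ae_forall_count fourier_L2_sum_walnut; apply: filterS => x hx.
rewrite !partial_sumE !scaler_sumr; apply: eq_bigr => n _.
rewrite /apply_op hx op_scaleE scalerA -rmorphM/=; congr (_%:C *: _).
by rewrite exprMn invfM mulrAC mulVf ?mul1r// expf_neq0// gt_eqF.
Qed.

End janssen_representation.
Theorem mainTheorem2 (R : realType) (d : nat) (H : hilbertType R)
    (alpha beta : R) (p q : \bar R) (w v : 'rV[R]_d -> R)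
    (g gamma : 'rV[R]_d -> H)
    (d_gt0 : (0 < d)%N)
    (H_separable : exists2 S : set H, countable S & dense S)
    (alpha_gt0 : 0 < alpha) (beta_gt0 : 0 < beta)
    (p_ge1 : (1 <= p)%E) (q_ge1 : (1 <= q)%E)
    (w_weight : weight w) (w_submult : submultiplicative w)
    (v_weight : weight v) (v_moderate : moderate w v)
    (g_amalgam : amalgam alpha +oo%E 1%E w g)
    (gamma_amalgam : amalgam alpha +oo%E 1%E w gamma) :
  let G := walnut_coef alpha beta g gamma in
  let shifted_g (l n : 'rV[int]_d) :=
    modulate (alpha^-1 *: rV_of_int l)
      (translate (beta^-1 *: rV_of_int n) g) in
  let c n l := op_bracket gamma (shifted_g l n) in
  let Sf h f := frame_op alpha beta p q v g gamma h f in
  [/\ forall n l, fourier_coef alpha (G n) l = (alpha ^- d)%:C *: c n l,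
      forall n, fourier_series_L2 alpha (fun l => (alpha ^- d)%:C *: c n l)
        (G n)
    & forall (h : H) (f : 'rV[R]_d -> H), `|h| = 1 ->
      amalgam alpha p q v f ->
      amalgam_cvg alpha p q v
        (fun A x => (beta ^- d)%:C *: summability.partial_sum (fun n =>
           apply_op (G n) (translate (beta^-1 *: rV_of_int n) f) x) A)
        (Sf h f) /\
      amalgam_cvg alpha p q v
        (fun A x => ((alpha * beta) ^- d)%:C *: summability.partial_sum (fun n =>
           apply_op (fourier_L2_sum alpha (c n))
             (translate (beta^-1 *: rV_of_int n) f) x) A)
        (Sf h f)].
Proof.
move=> G shifted_g c Sf.
have [cc cd] := dense_seq H_separable.
split=> [n l|n|h f h1 fv].
- exact: (fourier_coef_walnut alpha_gt0 beta_gt0 w_weight w_submult cd g_amalgam gamma_amalgam).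
- exact: (fourier_series_walnut alpha_gt0 beta_gt0 w_weight w_submult cd g_amalgam gamma_amalgam).
- split.
  + exact: (walnut_representation alpha_gt0 beta_gt0 w_weight w_submult v_weight v_moderate p_ge1 q_ge1
      cd g_amalgam gamma_amalgam fv h1).
  + exact: (janssen alpha_gt0 beta_gt0 w_weight w_submult v_weight v_moderate p_ge1 q_ge1
      cd g_amalgam gamma_amalgam fv h1).
Qed.
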